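(* Let $\mathcal X_N^*=\max_{z\in V_N}\mathcal X_z^N$ and $\mathcal Y_N^*=\max_{z\in V_N}\mathcal Y_z^N$ be the maxima of the Gaussian free field and of the torus Gaussian free field on $V_N$. With $c_1=2\sqrt{2/\pi}\,\log2$ and $c_2=(3/4)\sqrt{2/\pi}$, $$E\mathcal X_{2^n}^*\ge c_1n-c_2\log n+O(1),\qquad E\mathcal Y_{2^n}^*\ge c_1n-c_2\log n+O(1),$$ that is, there is a constant $C$ such that both expectations are at least $c_1n-c_2\log n-C$ for all integers $n\ge1$.
   Context: For an integer $N\ge1$, $V_N=([0,N-1]\cap\mathbb Z)^2$, $V_N^o=((0,N-1)\cap\mathbb Z)^2$ and $\partial V_N=V_N\setminus V_N^o$. Let $\{w_m\}_{m\ge0}$ be simple random walk on $\mathbb Z^2$, with $E^x$ the expectation for the walk started at $x$. GFF: let $\tau=\min\{m\ge 0: w_m\in\partial V_N\}$ and $G_N(x,y)=E^x\big(\sum_{m=0}^{\tau-1}\mathbf 1_{\{w_m=y\}}\big)$ for $x,y\in V_N$ (so $G_N$ vanishes if $x$ or $y$ is in $\partial V_N$). The Gaussian free field $\{\mathcal X_z^N\}_{z\in V_N}$ is the zero-mean Gaussian field with covariance $G_N$. Torus GFF: write $x\sim_N y$ if $x-y\in(N\mathbb Z)^2$. Let $\tau'$ be an exponential random variable of parameter $1/N^2$ (mean $N^2$) independent of the walk, and $\bar G_N(x,y)=E^x\big(\sum_{0\le m\le\tau'}\mathbf 1_{\{w_m\sim_N y\}}\big)$ for $x,y\in V_N$.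 The torus Gaussian free field (TGFF) $\{\mathcal Y_z^N\}_{z\in V_N}$ is the zero-mean Gaussian field with covariance $\bar G_N$. $\log$ is the natural logarithm. *)

(* Defs.v *)
From HB Require Import structures.
From mathcomp Require Import all_boot all_order all_algebra.
From mathcomp Require Import all_classical all_reals all_analysis.
From mathcomp Require Import zify.

Set Implicit Arguments.
Unset Strict Implicit.
Unset Printing Implicit Defensive.

Import Order.TTheory GRing.Theory Num.Theory.
Import numFieldNormedType.Exports.

Local Open Scope classical_set_scope.
Local Open Scope ring_scope.

Definition box (N : nat) : set (int * int) :=
  [set z | (0 <= z.1 <= N%:Z - 1) && (0 <= z.2 <= N%:Z - 1)].

Definition box_interior (N : nat) : set (int * int) :=
  [set z | (0 < z.1 < N%:Z - 1) && (0 < z.2 < N%:Z - 1)].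

Definition box_boundary (N : nat) : set (int * int) :=
  box N `\` box_interior N.

(* Fields on [box N] are indexed by the finite type 'I_N * 'I_N, which [site]
   maps bijectively onto [box N]. *)
Definition site (N : nat) (z : 'I_N * 'I_N) : int * int :=
  ((z.1 : nat)%:Z, (z.2 : nat)%:Z).

Lemma range_site N : range (@site N) = box N.
Proof.
apply/seteqP; split=> [_ [[i j] _ <-]|[x y]] /=.
  by rewrite /box /=; have := ltn_ord i; have := ltn_ord j; lia.
rewrite /box /= => /andP[/andP[x0 xN] /andP[y0 yN]].
have hx : (`|x| < N)%N by lia.
have hy : (`|y| < N)%N by lia.
exists (Ordinal hx, Ordinal hy) => //; rewrite /site /=.
by congr pair; lia.
Qed.

Lemma site_inj N : injective (@site N).
Proof. by move=> [i j] [k l] [/val_inj -> /val_inj ->]. Qed.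

Definition torus_eq (N : nat) (x y : int * int) : bool :=
  (N%:Z %| x.1 - y.1)%Z && (N%:Z %| x.2 - y.2)%Z.

Definition srw_step (R : realType) (x y : int * int) : R :=
  if `|x.1 - y.1| + `|x.2 - y.2| == 1 then 4^-1 else 0.

Section walk.
Context (R : realType) (d : measure_display) (W : measurableType d).
Implicit Types (w : nat -> W -> int * int) (P : probability W R).

Definition walk_path w (m : nat) (p : nat -> int * int) : set W :=
  [set u | forall i, (i <= m)%N -> w i u = p i].

(* Under the law [P], the process [w] is simple random walk started at [x]. *)
Definition is_srw P w (x : int * int) : Prop :=
  (forall m y, measurable (w m @^-1` [set y])) /\
  (forall m p, P (walk_path w m p) =
     ((p 0%N == x)%:R * \prod_(i < m) srw_step R (p i) (p i.+1))%:E).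

(* [t] is exponential of parameter 1/N^2 and independent of the walk; the
   events [walk_path w m p], with the empty set, form a pi-system generating
   the sigma-algebra of the walk. *)
Definition is_exp_clock P w (N : nat) (t : {mfun W >-> R}) : Prop :=
  (forall B : set R, measurable B ->
     P (t @^-1` B) = exponential_prob ((N ^ 2)%:R^-1) B) /\
  (forall (B : set R) m p, measurable B ->
     P (t @^-1` B `&` walk_path w m p) =
     (P (t @^-1` B) * P (walk_path w m p))%E).

(* +oo when the walk never reaches the boundary. *)
Definition hitting_time w (N : nat) (u : W) : \bar R :=
  ereal_inf [set m%:R%:E | m in [set m | w m u \in box_boundary N]].

(* In both definitions below, [Pw x] is the law of the walk started at [x]. *)
Definition green (Pw : int * int -> probability W R) w (N : nat)
    (x y : int * int) : \bar R :=
  (\int[Pw x]_u \sum_(m <oo | m%:R%:E < hitting_time w N u)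
     (\1_[set y] (w m u))%:E)%E.

Definition torus_green (Pw : int * int -> probability W R) w
    (t : {mfun W >-> R}) (N : nat) (x y : int * int) : \bar R :=
  (\int[Pw x]_u \sum_(m <oo | (m%:R <= t u)%R)
     (\1_[set v | torus_eq N v y] (w m u))%:E)%E.

End walk.

Section gaussian.
Context (R : realType) (d : measure_display) (T : measurableType d).
Variable P : probability T R.

(* A possibly degenerate normal law: [normal_prob m 0] is not the Dirac mass
   at [m] in the library. *)
Definition gaussian_law (X : T -> R) : Prop :=
  exists m s : R, forall B : set R, measurable B ->
    P (X @^-1` B) = if s == 0 then \d_m B else normal_prob m s B.

Definition centered_gaussian_field (I : finType) (K : I -> I -> \bar R)
    (X : I -> {RV P >-> R}) : Prop :=
  [/\ forall a : I -> R, gaussian_law (fun u => \sum_(i : I) a i * X i u),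
      forall i, ('E_P[X i] = 0)%E
    & forall i j, covariance P (X i) (X j) = K i j].

Definition field_max (I : finType) (X : I -> {RV P >-> R}) (u : T) : R :=
  sup (range (fun i => X i u)).

Lemma field_max_attained (I : finType) (X : I -> {RV P >-> R}) (i0 : I) u :
  exists2 i, field_max X u = X i u & forall j, X j u <= X i u.
Proof.
have [i _ hi] := @arg_maxP _ R I i0 predT (fun i => X i u) isT.
exists i => [|j]; last exact: hi.
apply/eqP; rewrite eq_le; apply/andP; split.
  by apply: ge_sup => [|_ [j _ <-]]; [exists (X i u), i | exact: hi].
apply: ub_le_sup; last by exists i.
by exists (X i u) => _ [j _ <-]; exact: hi.
Qed.

End gaussian.

Definition is_gff (R : realType) (d d' : measure_display)
    (W : measurableType d) (T : measurableType d')
    (Pw : int * int -> probability W R) (w : nat -> W -> int * int) (N : nat)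
    (P : probability T R) (X : 'I_N * 'I_N -> {RV P >-> R}) : Prop :=
  centered_gaussian_field (fun a b => green Pw w N (site a) (site b)) X.

Definition is_tgff (R : realType) (d d' : measure_display)
    (W : measurableType d) (T : measurableType d')
    (Pw : int * int -> probability W R) (w : nat -> W -> int * int)
    (t : {mfun W >-> R}) (N : nat)
    (P : probability T R) (Y : 'I_N * 'I_N -> {RV P >-> R}) : Prop :=
  centered_gaussian_field
    (fun a b => torus_green Pw w t N (site a) (site b)) Y.

Definition c1 (R : realType) : R := 2 * Num.sqrt (2 / pi) * ln 2.
Definition c2 (R : realType) : R := 3 / 4 * Num.sqrt (2 / pi).

(* Main.v *)
Require Import Defs.
From HB Require Import structures.
From mathcomp Require Import all_boot all_order all_algebra.
From mathcomp Require Import all_classical all_reals all_analysis.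
From mathcomp Require Import measurable_realfun zify ring lra.
Set Implicit Arguments.
Unset Strict Implicit.
Unset Printing Implicit Defensive.
Import Order.TTheory GRing.Theory Num.Theory.
Import numFieldNormedType.Exports.
Local Open Scope classical_set_scope.
Local Open Scope ring_scope.

(** For a finite box [D] let [G_D(x, .)] be the Green function of the walk killed
    on leaving [D] (and, for the torus field, killed at rate [1 - a] with
    [a = exp(- 1 / N^2)]). Since the covariance inverts the Laplacian inside the
    box, the functional [u_D(x)] of the field whose coefficients are the Laplacian
    of [G_D(x, .)] has variance [G_D(x, x)], and for disjoint [D] these functionals
    are independent. This treats both fields in the same way and needs no
    comparison inequality.

    In a box [D] of side [2^J] let [B_j] be the box of radius [2^(j-1)] around [x],
    [B_J = D], and [g_j = G_(B_j)(x, x) = (2 log 2 / pi) j + O(1)]. The increments of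
    [j |-> u_(B_j)(x)] are independent, so
    [y_j = A + lam (g_J - g_j) - (u_D(x) - u_(B_j)(x))] is a Brownian motion with
    drift sampled at the times [g_j]. Instead of a hard barrier, the path is weighted
    by the probabilities that Brownian bridges interpolating it stay positive: by the
    reflection principle these weights compose as a semigroup, so moments are explicit
    Gaussian integrals. Positivity at the end forces [u_D(x) >= lam g_J - O(1)], the
    slope [lam] with [lam^2 g_J / 2 = J log 4 - (3/2) log J] makes the first moment
    of order [4^(-J)], and for two points at distance about [2^j] the second moment is
    bounded by decoupling the scales below [j] from those above [j + 3]. The
    Paley-Zygmund inequality gives [P(max u_D >= c1 J - c2 log J - C) >= delta].

    The boxes [2^s < i, j < 2^(s+1)] are disjoint, so these events are independent for
    different [s]; the largest [s] for which the event holds is [n - O(1)] in mean.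
    At the maximiser of that box, the field minus [u_D] is independent of the choice
    made and centred, so the expected value of the field there is at least
    [c1 n - c2 log n - O(1)]. *)

(** * Potential theory on the square lattice *)

(** A hard barrier at the discrete scales would leave a walk with unequal steps and no closed
    formulas; with the bridge weights it is killed Brownian motion seen at the times [g_j], and only
    durations matter. The decay [t ^ (-3/2)] of its kernel is the source of [c2]: the slope is
    lowered just enough for the order of [4 ^ J] points to compensate it. Expanding [lam * g_J =
    sqrt (2 * g_J * (J log 4 - (3/2) log J))] then gives exactly [c1] and [c2], provided that [g_J]
    is known up to [O(1)] with the sharp constant, which Wallis' integrals supply. Killing at rate
    [1 - a] with [(1 - a) 4 ^ n <= 1] changes it by [O(1)] only. The hypotheses describe single
    linear combinations of the field, so independence must be derived: averaging cosines against
    [exp (- s)] yields [1 / (1 + x ^ 2)], whose integrals are arctangents and approximate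
    indicators, so cosines of linear combinations determine joint laws. Finally, the second moment
    gives a positive probability and not an expectation; hence a fresh box at every scale, where a
    failure costs only one scale. *)

Section Potential.
Variable R : realType.
Implicit Types (f v e : int * int -> R) (a : R) (x y : int * int).

Definition avg f x : R :=
  4^-1 * (f (x.1 + 1, x.2) + f (x.1 - 1, x.2) + f (x.1, x.2 + 1) + f (x.1, x.2 - 1)).

Definition lap a f x : R := f x - a * avg f x.

Definition kron x y : R := (x == y)%:R.

Definition nbr x y : bool :=
  [|| y == (x.1 + 1, x.2), y == (x.1 - 1, x.2), y == (x.1, x.2 + 1) | y == (x.1, x.2 - 1)].

(** At a negative minimum, superharmonicity forces the neighbours down to the minimum. Killing acts
    in the same direction, since [m < 0] gives [m <= a * m]. *)
Lemma avg_min_aux a (m p q r s : R) : 0 < a -> a <= 1 -> m < 0 ->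
  m <= p -> m <= q -> m <= r -> m <= s ->
  0 <= m - a * (4^-1 * (p + q + r + s)) -> p = m.
Proof.
move=> a0 a1 m0 mp mq mr ms h; apply/eqP; rewrite eq_le mp andbT leNgt.
apply/negP => pm.
have h6 : m < 4^-1 * (p + q + r + s) by lra.
have h7 : a * m < a * (4^-1 * (p + q + r + s)) by rewrite ltr_pM2l.
have : m <= a * m by rewrite ler_nMl.
lra.
Qed.

(** Among the points of [D] where a negative minimum is attained, take a rightmost one. Its right
    neighbour has the same value, hence lies in [D] because [v] is nonnegative on the outer
    boundary, and this contradicts the choice. *)
Lemma max_principle a (D : seq (int * int)) v : 0 < a -> a <= 1 ->
  (forall x, x \in D -> 0 <= lap a v x) ->
  (forall x y, x \in D -> nbr x y -> y \notin D -> 0 <= v y) ->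
  forall x, x \in D -> 0 <= v x.
Proof.
move=> a0 a1 hD hN x0 x0D; rewrite leNgt; apply/negP => vx0.
pose F := seq_sub D.
pose x0' : F := SeqSub x0D.
have [x1 _ hx1] := @arg_minP _ R F x0' predT (fun z => v (val z)) isT.
pose mu := v (val x1).
have mu0 : mu < 0 by apply: le_lt_trans vx0; exact: (hx1 x0').
have [x2 /= /eqP hx2 mx2] := @arg_maxP _ int F x1 (fun z : F => v (val z) == mu)
  (fun z : F => (val z).1) (eqxx _).
have x2D : val x2 \in D by exact: valP.
have ge_mu y : nbr (val x2) y -> mu <= v y.
  move=> ny; have [yD|yD] := boolP (y \in D).
    by have := hx1 (SeqSub yD) isT.
  by apply: le_trans (ltW mu0) _; exact: (hN (val x2)).
have h1 := ge_mu ((val x2).1 + 1, (val x2).2).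
have h2 := ge_mu ((val x2).1 - 1, (val x2).2).
have h3 := ge_mu ((val x2).1, (val x2).2 + 1).
have h4 := ge_mu ((val x2).1, (val x2).2 - 1).
rewrite /nbr !eqxx ?orbT /= in h1 h2 h3 h4.
move: (h1 isT) (h2 isT) (h3 isT) (h4 isT) => {}h1 {}h2 {}h3 {}h4.
have := hD _ x2D; rewrite /lap /avg hx2 => hl.
have : v ((val x2).1 + 1, (val x2).2) = mu.
  exact: (avg_min_aux a0 a1 mu0 h1 h2 h3 h4 hl).
move=> hmu.
have yD : ((val x2).1 + 1, (val x2).2) \in D.
  apply/negPn/negP => /(hN (val x2)) => /(_ x2D).
  by rewrite /nbr eqxx => /(_ isT); rewrite hmu leNgt mu0.
have := mx2 (SeqSub yD); by rewrite /= hmu eqxx => /(_ isT); rewrite gerDl.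
Qed.

Lemma avgD f h x : avg (fun y => f y + h y) x = avg f x + avg h x.
Proof. by rewrite /avg; ring. Qed.
Lemma avgZ c f x : avg (fun y => c * f y) x = c * avg f x.
Proof. by rewrite /avg; ring. Qed.
Lemma avgB f h x : avg (fun y => f y - h y) x = avg f x - avg h x.
Proof. by rewrite /avg; ring. Qed.
Lemma avg_cst c x : avg (fun=> c) x = c.
Proof. by rewrite /avg; field. Qed.
Lemma lapD a f h x : lap a (fun y => f y + h y) x = lap a f x + lap a h x.
Proof. by rewrite /lap avgD; ring. Qed.
Lemma lapZ a c f x : lap a (fun y => c * f y) x = c * lap a f x.
Proof. by rewrite /lap avgZ; ring. Qed.
Lemma lapB a f h x : lap a (fun y => f y - h y) x = lap a f x - lap a h x.
Proof. by rewrite /lap avgB; ring. Qed.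
Lemma lap_cst a c x : lap a (fun=> c) x = (1 - a) * c.
Proof. by rewrite /lap avg_cst; ring. Qed.
Lemma lap_sum a (I : Type) (s : seq I) (F : I -> int * int -> R) x :
  lap a (fun y => \sum_(i <- s) F i y) x = \sum_(i <- s) lap a (F i) x.
Proof.
elim: s => [|i s IH].
  rewrite big_nil -[RHS](mulr0 (1 - a)) -(lap_cst a 0 x); congr lap.
  by apply/funext => y; rewrite big_nil.
rewrite big_cons -IH -lapD; congr lap.
by apply/funext => y; rewrite big_cons.
Qed.

(* [e] is the Green function [G_D(x, .)] of the walk killed at rate [1 - a]
   and on leaving [D]. *)
Definition is_green a (D : seq (int * int)) x e : Prop :=
  (forall y, y \notin D -> e y = 0) /\
  (forall y, y \in D -> lap a e y = kron x y).

(** The Dirichlet problem on [D] is a square linear system. The maximum principle, applied to a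
    kernel vector and to its opposite, makes it injective and hence invertible. *)
Lemma green_exists a (D : seq (int * int)) x : 0 < a -> a <= 1 ->
  exists e, is_green a D x e.
Proof.
move=> a0 a1.
pose s := undup D.
pose n := size s.
pose pt (i : 'I_n) : int * int := nth (0, 0) s i.
have ptD i : pt i \in D by rewrite -mem_undup mem_nth.
have ptI i j : (pt i == pt j) = (i == j).
  by rewrite /pt nth_uniq // undup_uniq.
pose M : 'M[R]_n := \matrix_(i, j) lap a (fun y => kron (pt j) y) (pt i).
pose fe (u : 'cV[R]_n) y : R := \sum_(j < n) u j ord0 * kron (pt j) y.
have fe_pt u i : fe u (pt i) = u i ord0.
  rewrite /fe (bigD1 i) //= /kron eqxx mulr1 big1 ?addr0 // => j ji.
  by rewrite ptI (negbTE ji) mulr0.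
have fe_out u y : y \notin D -> fe u y = 0.
  move=> yD; rewrite /fe big1 // => j _; rewrite /kron.
  case: eqP => [E|]; last by rewrite mulr0.
  by move: yD; rewrite -E ptD.
have lap_fe u i : lap a (fe u) (pt i) = (M *m u) i ord0.
  rewrite /fe lap_sum mxE; apply: eq_bigr => j _.
  by rewrite lapZ mxE mulrC.
have inD y : y \in D -> exists i, y = pt i.
  rewrite -mem_undup -/s => ys.
  have h : (index y s < n)%N by rewrite index_mem.
  by exists (Ordinal h); rewrite /pt /= nth_index.
have ker0 (u : 'cV[R]_n) : M *m u = 0 -> u = 0.
  have pos (w : 'cV[R]_n) : M *m w = 0 -> forall i, 0 <= w i ord0.
    move=> Mw i; rewrite -fe_pt; apply: (@max_principle a D (fe w)) => //.
      by move=> z /inD [j ->]; rewrite lap_fe Mw mxE.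
    by move=> z y _ _ /fe_out ->.
  move=> Mu; apply/matrixP => i j; rewrite ord1 mxE; apply/eqP.
  rewrite eq_le (pos _ Mu) andbT -oppr_ge0.
  have := pos (- u) _ i; rewrite mxE; apply.
  by rewrite mulmxN Mu oppr0.
have Mu : M \in unitmx.
  rewrite -unitmx_tr -row_free_unit -kermx_eq0.
  apply/eqP/row_matrixP => i; rewrite row0.
  apply: trmx_inj; rewrite trmx0; apply: ker0.
  have /(congr1 trmx) : row i (kermx M^T) *m M^T = 0.
    by rewrite -row_mul mulmx_ker row0.
  by rewrite trmx_mul trmxK trmx0.
exists (fe (invmx M *m (\col_i kron x (pt i)))); split; first exact: fe_out.
by move=> y /inD [i ->]; rewrite lap_fe mulmxA mulmxV // mul1mx mxE.
Qed.

(** The difference [e' - e] is harmonic in [D] and equals [e' >= 0] outside it. *)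
Lemma green_sub a D x e D' e' : 0 < a -> a <= 1 ->
  is_green a D x e -> is_green a D' x e' -> {subset D <= D'} ->
  forall y, 0 <= e y <= e' y.
Proof.
move=> a0 a1 [e0 eD] [e0' eD'] DD'.
have pos (D1 : seq (int * int)) e1 : (forall y, y \notin D1 -> e1 y = 0) ->
    (forall y, y \in D1 -> lap a e1 y = kron x y) -> forall y, 0 <= e1 y.
  move=> h1 h2 y; have [yD|/h1 -> //] := boolP (y \in D1).
  apply: (@max_principle a D1 e1) => //.
    by move=> z /h2 ->; rewrite /kron ler0n.
  by move=> z t _ _ /h1 ->.
move=> y; rewrite (pos D) //=.
have [yD|/e0 ->] := boolP (y \in D); last exact: (pos D').
rewrite -subr_ge0; apply: (@max_principle a D (fun y => e' y - e y)) => //.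
  by move=> z zD; rewrite lapB eD // eD' ?subrr // DD'.
by move=> z t _ _ /e0 ->; rewrite subr0 (pos D').
Qed.

Lemma green_ge0 a D x e : 0 < a -> a <= 1 -> is_green a D x e ->
  forall y, 0 <= e y.
Proof. by move=> a0 a1 h y; have /andP[] := green_sub a0 a1 h h (fun _ => id) y. Qed.

Lemma green_le a D x e v : 0 < a -> a <= 1 -> is_green a D x e ->
  (forall y, y \in D -> kron x y <= lap a v y) ->
  (forall z y, z \in D -> nbr z y -> y \notin D -> 0 <= v y) ->
  forall y, y \in D -> e y <= v y.
Proof.
move=> a0 a1 [e0 eD] hv hN y yD; rewrite -subr_ge0.
apply: (@max_principle a D (fun y => v y - e y)) => //.
  by move=> z zD; rewrite lapB eD // subr_ge0 hv.
by move=> z t zD zt tD; rewrite e0 // subr0; exact: (hN z).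
Qed.

Lemma green_ge a D x e v : 0 < a -> a <= 1 -> is_green a D x e ->
  (forall y, y \in D -> lap a v y <= kron x y) ->
  (forall z y, z \in D -> nbr z y -> y \notin D -> v y <= 0) ->
  forall y, y \in D -> v y <= e y.
Proof.
move=> a0 a1 [e0 eD] hv hN y yD; rewrite -subr_ge0.
apply: (@max_principle a D (fun y => e y - v y)) => //.
  by move=> z zD; rewrite lapB eD // subr_ge0 hv.
by move=> z t zD zt tD; rewrite e0 // sub0r oppr_ge0; exact: (hN z).
Qed.

End Potential.

(** * Heat kernel of the planar walk in rotated coordinates *)

Section HeatKernel.
Variable R : realType.

(** The law at time [m] of the one-dimensional simple random walk. In the coordinates [x + y] and
    [x - y] the planar walk becomes two independent copies of it, which explains the product in
    [hk]. *)
Fixpoint bet (m : nat) (j : int) : R :=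
  if m is k.+1 then 2^-1 * (bet k (j - 1) + bet k (j + 1)) else (j == 0)%:R.

Lemma bet_ge0 m j : 0 <= bet m j.
Proof. by elim: m j => [|m IH] j //=; rewrite mulr_ge0 ?invr_ge0 // addr_ge0. Qed.

Lemma betN m j : bet m (- j) = bet m j.
Proof.
elim: m j => [|m IH] j /=; first by rewrite oppr_eq0.
rewrite -[- j - 1]opprD IH addrC; congr (_ * (_ + _)).
by rewrite -[LHS]IH opprD opprK.
Qed.

(** Unimodality along a parity class. The induction looks at [j - 1], hence the range from [-1],
    where symmetry gives equality. *)
Lemma bet_mono m j : -1 <= j -> bet m (j + 2) <= bet m j.
Proof.
elim: m j => [|m IH] j hj /=.
  by have /negPf -> : j + 2 != 0 by lia.
rewrite ler_pM2l ?invr_gt0 //.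
have -> : j + 2 - 1 = j + 1 by lia.
have -> : j + 2 + 1 = j + 1 + 2 by lia.
have [-> | j0] := eqVneq j (-1).
  have -> : bet m (-1 - 1) = bet m (0 + 2) by rewrite -betN; congr bet.
  by rewrite addNr addrC.
rewrite [leRHS]addrC lerD2l.
apply: le_trans (_ : bet m (j + 1) <= _); first by apply: IH; lia.
have := IH (j - 1); rewrite (_ : j - 1 + 2 = j + 1); last by lia.
by apply; lia.
Qed.

Lemma bet_parity m i : bet m (2 * i + m%:Z + 1) = 0.
Proof.
elim: m i => [|m IH] i /=.
  by have /negPf -> : 2 * i + 0 + 1 != 0 by lia.
have -> : 2 * i + m.+1%:Z + 1 - 1 = 2 * i + m%:Z + 1 by lia.
have -> : 2 * i + m.+1%:Z + 1 + 1 = 2 * (i + 1) + m%:Z + 1 by lia.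
by rewrite !IH addr0 mulr0.
Qed.

Lemma bet_out m j : m%:Z < j -> bet m j = 0.
Proof.
elim: m j => [|m IH] j hj /=; first by have /negPf -> : j != 0 by lia.
by rewrite !IH ?addr0 ?mulr0 //; lia.
Qed.

Lemma bet_bin m i : bet m (m%:Z - (2 * i)%:Z) = 'C(m, i)%:R / 2 ^+ m.
Proof.
elim: m i => [|m IH] i /=.
  case: i => [|i]; first by rewrite bin0 eqxx expr0 divr1.
  have /negPf -> : 0%:Z - (2 * i.+1)%:Z != 0 by lia.
  by rewrite bin0n mul0r.
have -> : m.+1%:Z - (2 * i)%:Z - 1 = m%:Z - (2 * i)%:Z by lia.
rewrite IH; case: i => [|i].
  rewrite bet_out; last by lia.
  by rewrite !bin0 addr0 exprS; field.
have -> : m.+1%:Z - (2 * i.+1)%:Z + 1 = m%:Z - (2 * i)%:Z by lia.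
rewrite IH binS natrD exprS.
by field.
Qed.

(** Return probability at time [2 k]. The planar walk returns with the square of it, so the sums of
    [ctr ^ 2] govern the growth of the Green function. *)
Definition ctr (k : nat) : R := bet (2 * k) 0.

Lemma ctr_ge0 k : 0 <= ctr k. Proof. exact: bet_ge0. Qed.

Lemma ctrE k : ctr k = 'C(2 * k, k)%:R / 2 ^+ (2 * k).
Proof. by rewrite -bet_bin /ctr subrr. Qed.

Lemma ctr0 : ctr 0 = 1. Proof. by rewrite ctrE muln0 bin0 expr0 divr1. Qed.

Lemma ctrS k : ctr k.+1 * (2 * k%:R + 2) = ctr k * (2 * k%:R + 1).
Proof.
rewrite !ctrE (_ : (2 * k.+1 = (2 * k).+2)%N); last by lia.
have h1 := mul_bin_diag (2 * k).+2 k; have h2 := mul_bin_down (2 * k).+1 k.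
rewrite /= in h1 h2; rewrite (_ : ((2 * k).+1 - k = k.+1)%N) in h2; last by lia.
have h3 : ('C((2 * k).+2, k.+1) * k.+1 = 2 * (2 * k).+1 * 'C(2 * k, k))%N.
  apply/eqP; rewrite -(eqn_pmul2l (_ : 0 < k.+1)%N) //; apply/eqP.
  nia.
have h4 : ('C((2 * k).+2, k.+1)%:R : R) * (k%:R + 1) = 2 * (2 * k%:R + 1) * 'C(2 * k, k)%:R.
  by rewrite -(natrD _ k 1) addn1 -natrM h3 !natrM -(addn1 (2 * k)) natrD natrM.
rewrite !exprS; set B := 'C(_, _)%:R in h4 *; set B' := 'C(_, _)%:R in h4 *.
have e0 : (2 : R) ^+ (2 * k) != 0 by rewrite expf_neq0.
have -> : B / (2 * (2 * 2 ^+ (2 * k))) * (2 * k%:R + 2) =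
   B * (k%:R + 1) / (2 * 2 ^+ (2 * k)) by field.
by rewrite h4; field.
Qed.

(** The sequence [ctr k ^ 2 * (2 k + 1)] is nonincreasing, because
    [(2 k + 1) (2 k + 3) <= (2 k + 2) ^ 2]. *)
Lemma ctr_bound k : ctr k ^+ 2 * (2 * k%:R + 1) <= 1.
Proof.
elim: k => [|k IH]; first by rewrite ctr0; lra.
have hS := ctrS k; rewrite -addn1 natrD in hS *; rewrite addn1 in hS *.
set x := ctr k.+1 in hS *; set y := ctr k in hS IH *.
have k0 : 0 <= k%:R :> R by [].
have p0 : 0 < 2 * k%:R + 2 :> R by lra.
have -> : x = y * (2 * k%:R + 1) / (2 * k%:R + 2).
  by rewrite -hS mulfK // gt_eqF.
apply: le_trans IH.
rewrite (_ : _ * _ = y ^+ 2 * ((2 * k%:R + 1) ^+ 2 * (2 * k%:R + 3) / (2 * k%:R + 2) ^+ 2)); last first.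
  by rewrite expr_div_n exprMn; field; rewrite gt_eqF.
rewrite ler_wpM2l ?sqr_ge0 // ler_pdivrMr ?exprn_gt0 //; nra.
Qed.

Lemma bet0_neq j : j != 0 -> bet 0 j = 0.
Proof. by move=> /negPf /= ->. Qed.

Lemma bet_sum m (j : nat) : \sum_(i < j.+1) bet m (j%:Z - (2 * i)%:Z) <= 1.
Proof.
elim: m j => [|m IH] j.
  case: (boolP [exists i : 'I_j.+1, j == (2 * i)%N]) => [e|h].
    move/existsP : e => [i0 /eqP ji]; rewrite (bigD1 i0) //= big1.
      by rewrite addr0; case: (_ == _); rewrite ?ler01.
    move=> i ii; apply: bet0_neq.
    by apply: contra ii => /eqP h; apply/eqP/val_inj => /=; lia.
  rewrite big1 // => i _; apply: bet0_neq.
  by move/existsPn : h => /(_ i) h; apply: contra h => /eqP h; apply/eqP; lia.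
apply: le_trans (IH j.+1) => /=.
rewrite -mulr_sumr big_split /=.
set A := \sum_(i < j.+1) _; set B := \sum_(i < j.+1) _; set C := \sum_(i < j.+2) _.
have hB : B <= C.
  rewrite /C big_ord_recr /=; apply: ler_wpDr; first exact: bet_ge0.
  by rewrite le_eqVlt; apply/orP; left; apply/eqP/eq_bigr => i _; congr bet; lia.
have hA : A <= C.
  rewrite /C big_ord_recl /=; apply: ler_wpDl; first exact: bet_ge0.
  rewrite le_eqVlt; apply/orP; left; apply/eqP/eq_bigr => i _; congr bet.
  by rewrite /bump /=; lia.
lra.
Qed.

(** By unimodality and symmetry [bet m j] is the least of the [j + 1] values at
    [j, j - 2, ..., - j], whose sum is at most 1. *)
Lemma bet_far m (j : nat) : bet m j%:Z * (j%:R + 1) <= 1.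
Proof.
have dec i : (2 * i <= j.+1)%N -> bet m j%:Z <= bet m (j%:Z - (2 * i)%:Z).
  elim: i => [|i IH] hi; first by rewrite subr0.
  apply: le_trans (IH _) _; first by lia.
  rewrite (_ : j%:Z - (2 * i)%:Z = (j%:Z - (2 * i.+1)%:Z) + 2); last by lia.
  by apply: bet_mono; lia.
apply: le_trans (bet_sum m j).
rewrite -(natrD _ j 1) addn1 -{1}(card_ord j.+1) mulr_natr -sumr_const.
apply: ler_sum => i _.
have [h|h] := leqP (2 * i) j.+1; first exact: dec.
rewrite -[leRHS]betN (_ : - _ = j%:Z - (2 * (j - i))%:Z); last first.
  by have := ltn_ord i; lia.
by apply: dec; have := ltn_ord i; lia.
Qed.

Lemma bet_le_ctr m j : bet m j <= ctr m./2.
Proof.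
have ev k i : bet (2 * k) i <= ctr k.
  wlog i0 : i / 0 <= i.
    move=> H; have [|i0] := leP 0 i; first exact: H.
    by rewrite -betN; apply: H; lia.
  have [n ->] : exists n : nat, i = n%:Z by exists `|i|%N; lia.
  have [h|h] := boolP (odd n).
    rewrite (_ : n%:Z = 2 * (n./2%:Z - k%:Z) + (2 * k)%:Z + 1); last by lia.
    by rewrite bet_parity ctr_ge0.
  rewrite (_ : n = (2 * n./2)%N); last by lia.
  elim: n./2 => [|q IH]; first by rewrite muln0.
  apply: le_trans IH; rewrite (_ : (2 * q.+1)%:Z = (2 * q)%:Z + 2); last by lia.
  by apply: bet_mono; lia.
have [h|h] := boolP (odd m); last first.
  by rewrite {1}(_ : m = (2 * m./2)%N); [exact: ev | lia].
rewrite {1}(_ : m = (2 * m./2).+1) /=; last by lia.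
have := ev m./2 (j - 1); have := ev m./2 (j + 1); lra.
Qed.

Definition hk (x0 : int * int) (m : nat) (y : int * int) : R :=
  bet m (y.1 - x0.1 + (y.2 - x0.2)) * bet m (y.1 - x0.1 - (y.2 - x0.2)).

Lemma hk_ge0 x0 m y : 0 <= hk x0 m y. Proof. by rewrite mulr_ge0 ?bet_ge0. Qed.

Lemma hk0 x0 y : hk x0 0 y = kron R x0 y.
Proof.
rewrite /hk /= /kron -natrM mulnb; congr (nat_of_bool _)%:R.
case: x0 y => [p q] [r s] /=; rewrite xpair_eqE; lia.
Qed.

Lemma avg_hk x0 m y : avg (hk x0 m) y = hk x0 m.+1 y.
Proof.
rewrite /avg /hk /=.
set s := y.1 - x0.1; set t := y.2 - x0.2.
rewrite [y.1 + 1 - x0.1](_ : _ = s + 1); last by rewrite /s; lia.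
rewrite [y.1 - 1 - x0.1](_ : _ = s - 1); last by rewrite /s; lia.
rewrite [y.2 + 1 - x0.2](_ : _ = t + 1); last by rewrite /t; lia.
rewrite [y.2 - 1 - x0.2](_ : _ = t - 1); last by rewrite /t; lia.
rewrite [s + 1 + t](_ : _ = s + t + 1); last by lia.
rewrite [s - 1 + t](_ : _ = s + t - 1); last by lia.
rewrite [s + 1 - t](_ : _ = s - t + 1); last by lia.
rewrite [s - 1 - t](_ : _ = s - t - 1); last by lia.
rewrite [s + (t + 1)](_ : _ = s + t + 1); last by lia.
rewrite [s + (t - 1)](_ : _ = s + t - 1); last by lia.
rewrite [s - (t + 1)](_ : _ = s - t - 1); last by lia.
rewrite [s - (t - 1)](_ : _ = s - t + 1); last by lia.
by field.
Qed.

Lemma hk_le_ctr x0 m y : hk x0 m y <= ctr m./2 ^+ 2.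
Proof. by rewrite expr2 ler_pM ?bet_ge0 ?bet_le_ctr. Qed.

Lemma ctr_half m : m%:R * ctr m./2 ^+ 2 <= 1.
Proof.
apply: le_trans (ctr_bound m./2); rewrite mulrC ler_wpM2l ?sqr_ge0 //.
by rewrite -(natrM _ 2) -(natrD _ _ 1) ler_nat; lia.
Qed.

Lemma hk_le_inv x0 m y : m%:R * hk x0 m y <= 1.
Proof. by apply: le_trans (ctr_half m); rewrite ler_wpM2l ?hk_le_ctr. Qed.

(** Outside the ball one of the rotated coordinates is at least [r] in absolute value, so one factor
    is at most [1 / (r + 1)]; the other is bounded by the central value. *)
Lemma hk_far x0 m y (r : nat) : ~~ ((`|y.1 - x0.1| < r)%N && (`|y.2 - x0.2| < r)%N) ->
  hk x0 m y * (r%:R + 1) <= ctr m./2.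
Proof.
move=> h.
have far j : (r <= `|j|)%N -> bet m j * (r%:R + 1) <= 1.
  move=> hj; apply: le_trans (bet_far m `|j|).
  have -> : bet m `|j|%:Z = bet m j.
    have [j0|j0] := leP 0 j; first by congr bet; lia.
    by rewrite -[RHS]betN; congr bet; lia.
  by rewrite ler_wpM2l ?bet_ge0 // lerD2r ler_nat.
rewrite /hk; set s := _ + _; set t := _ - (_ - _).
have : (r <= `|s|)%N || (r <= `|t|)%N.
  rewrite /s /t; move: h; lia.
case/orP => [/far|/far] hf.
  rewrite -mulrAC; rewrite -[leRHS]mul1r ler_pM ?bet_le_ctr ?bet_ge0 //.
  by rewrite mulr_ge0 ?bet_ge0 // addr_ge0.
rewrite -mulrA -[leRHS]mulr1 ler_pM ?bet_le_ctr ?bet_ge0 //.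
by rewrite mulr_ge0 ?bet_ge0 // addr_ge0.
Qed.

(** The bound of order [m ^ (-1/2)] on [ctr] is put into telescoping form. *)
Lemma ctr_half_sqrt m : ctr m./2 <= 3 * (Num.sqrt m.+1%:R - Num.sqrt m%:R).
Proof.
set s := Num.sqrt m.+1%:R; set t := Num.sqrt m%:R.
have s0 : 0 < s by rewrite sqrtr_gt0.
have t0 : 0 <= t by rewrite sqrtr_ge0.
have s2 : s ^+ 2 = m%:R + 1 by rewrite sqr_sqrtr // -addn1 natrD.
have t2 : t ^+ 2 = m%:R by rewrite sqr_sqrtr.
have ts : t <= s by rewrite ler_sqrt // ler_nat.
set c := ctr m./2; have c0 : 0 <= c by exact: ctr_ge0.
have hc : c ^+ 2 * (m%:R + 1) <= 2.
  apply: le_trans (_ : c ^+ 2 * (2 * (2 * m./2%:R + 1)) <= _).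
    rewrite ler_wpM2l ?sqr_ge0 //.
    have : (m + 1 <= 2 * (2 * m./2 + 1))%N by lia.
    by rewrite -(ler_nat R) !(natrD, natrM).
  by have := ctr_bound m./2; rewrite -/c => h; lra.
rewrite -s2 -exprMn in hc.
have cs : c * s <= 3 / 2.
  rewrite leNgt; apply/negP => h; nra.
have h1 : (s - t) * (s + t) = 1 by rewrite -subr_sqr s2 t2; ring.
have h2 : (s - t) * (s + t) <= (s - t) * (2 * s) by rewrite ler_wpM2l //; lra.
rewrite h1 in h2; rewrite -(ler_pM2r s0); lra.
Qed.

Lemma ctr_half_sum M : \sum_(m < M) ctr m./2 <= 3 * Num.sqrt M%:R.
Proof.
elim: M => [|M IH]; first by rewrite big_ord0 mulr_ge0 ?sqrtr_ge0.
rewrite big_ord_recr /=; have := ctr_half_sqrt M; lra.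
Qed.

(** Up to time [r ^ 2] the sum of the [ctr] is of order [r], which cancels the factor [1 / (r + 1)]
    of [hk_far]: a point at distance [r] receives boundedly many visits in that time. *)
Lemma hk_far_sum x0 y (r : nat) : ~~ ((`|y.1 - x0.1| < r)%N && (`|y.2 - x0.2| < r)%N) ->
  \sum_(m < r ^ 2) hk x0 m y <= 3.
Proof.
move=> h; have r0 : 0 < r%:R + 1 :> R by rewrite ltr_wpDl.
rewrite -(ler_pM2r r0) mulr_suml.
apply: le_trans (_ : \sum_(m < r ^ 2) ctr m./2 <= _).
  by apply: ler_sum => m _; exact: hk_far.
apply: le_trans (ctr_half_sum _) _.
rewrite natrX sqrtr_sqr ger0_norm // ler_pM2l //; lra.
Qed.

End HeatKernel.

(** * Wallis' integrals and the sharp constant in the return probabilities *)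

Section Wallis.
Variable R : realType.
Notation mu := (@lebesgue_measure R).

Definition wal (n : nat) : R := \int[mu]_(x in `[0, pi / 2]) (sin x) ^+ n.

Lemma cont_integrable (f : R -> R) (a b : R) : continuous f ->
  mu.-integrable `[a, b] (EFin \o f).
Proof.
move=> cf; apply: continuous_compact_integrable; first exact: segment_compact.
exact: continuous_subspaceT.
Qed.

Lemma cont_sinX n : continuous (fun x : R => sin x ^+ n).
Proof. by move=> x; apply: (@continuous_comp _ _ _ sin (fun y : R => y ^+ n)); [exact: continuous_sin|exact: exprn_continuous]. Qed.

Lemma integrable_sinX n : mu.-integrable `[0, pi / 2] (EFin \o (fun x : R => sin x ^+ n)).
Proof. exact/cont_integrable/cont_sinX. Qed.

Lemma Rint_FTC2 (f F : R -> R) (a b : R) : a < b -> continuous f ->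
  (forall x : R, is_derive x (1 : R) F (f x)) ->
  \int[mu]_(x in `[a, b]) f x = F b - F a.
Proof.
move=> ab cf dF; rewrite /Rintegral (continuous_FTC2 ab _ _ (F := F)) //.
- exact: continuous_subspaceT.
- have cF : continuous F.
    by move=> x; apply/differentiable_continuous/derivable1_diffP; have dFx := dF x; exact: ex_derive.
  split; first by move=> x _; have dFx := dF x; exact: ex_derive.
  + by apply: cvg_at_right_filter; exact: cF.
  + by apply: cvg_at_left_filter; exact: cF.
- by move=> x _; rewrite derive1E; have dFx := dF x; exact: derive_val.
Qed.

Lemma wal0 : wal 0 = pi / 2.
Proof.
have dF (x : R) : is_derive x (1 : R) id (sin x ^+ 0).
  by rewrite expr0; exact: is_derive_id.
rewrite /wal (Rint_FTC2 _ _ dF) ?subr0 //; first by rewrite divr_gt0 // pi_gt0.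
exact: cont_sinX.
Qed.

Lemma wal1 : wal 1 = 1.
Proof.
have dF (x : R) : is_derive x (1 : R) (fun x => - cos x) (sin x ^+ 1).
  by apply: is_derive_eq; rewrite expr1 opprK.
rewrite /wal (Rint_FTC2 _ _ dF); first by rewrite cos_pihalf cos0; lra.
  by rewrite divr_gt0 // pi_gt0.
exact: cont_sinX.
Qed.

(** Integration by parts, packaged as the primitive [- cos x * sin x ^ (n + 1)], which vanishes at
    both ends. *)
Lemma walS n : (n.+2)%:R * wal n.+2 = (n.+1)%:R * wal n.
Proof.
apply/eqP; rewrite -subr_eq0; apply/eqP.
rewrite /wal -!RintegralZl ?integrable_sinX //= -RintegralB //; last 2 first.
- by apply: (cont_integrable (f := fun x => n.+2%:R * sin x ^+ n.+2)) => x; apply: cvgM; [exact: cvg_cst|exact: cont_sinX].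
- by apply: (cont_integrable (f := fun x => n.+1%:R * sin x ^+ n)) => x; apply: cvgM; [exact: cvg_cst|exact: cont_sinX].
have dF (x : R) : is_derive x (1 : R) (fun x => - cos x * sin x ^+ n.+1)
    (n.+2%:R * sin x ^+ n.+2 - n.+1%:R * sin x ^+ n).
  have -> : (fun x => - cos x * sin x ^+ n.+1) = (- cos) * (sin ^+ n.+1) :> (R -> R).
    by apply/funext => y; rewrite !fctE.
  apply: is_derive_eq.
  rewrite !fctE /GRing.scale /=.
  have := cos2Dsin2 x; set s := sin x; set c := cos x => h.
  have cE : c ^+ 2 = 1 - s ^+ 2 by rewrite -h; ring.
  rewrite !exprS -(addn1 n.+1) -(addn1 n) !natrD.
  apply: etrans (_ : s ^+ 2 * s ^+ n - c ^+ 2 * (n%:R + 1) * s ^+ n = _); first ring.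
  by rewrite cE; ring.
rewrite (Rint_FTC2 _ _ dF).
- by rewrite cos_pihalf sin0 expr0n /=; ring.
- by rewrite divr_gt0 // pi_gt0.
- by move=> x; apply: cvgB; (apply: cvgM; [exact: cvg_cst|exact: cont_sinX]).
Qed.

Lemma wal_mono n : wal n.+1 <= wal n.
Proof.
rewrite /wal le_Rintegral ?integrable_sinX // => x /=.
rewrite in_itv /= => /andP[x0 x1].
have s0 : 0 <= sin x by apply: sin_ge0_pi; rewrite x0 /=; have := @pi_ge0 R; lra.
by rewrite exprS ler_piMl ?exprn_ge0 // sin_le1.
Qed.

Lemma wal_even k : wal (2 * k) = pi / 2 * ctr R k.
Proof.
elim: k => [|k IH]; first by rewrite wal0 ctr0 mulr1.
have h1 := walS (2 * k); rewrite IH in h1.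
have h2 := ctrS R k.
rewrite (_ : (2 * k.+1 = (2 * k).+2)%N); last by lia.
have e2 : (2 * k).+2%:R = 2 * k%:R + 2 :> R by rewrite -addn2 natrD natrM.
have e1 : (2 * k).+1%:R = 2 * k%:R + 1 :> R by rewrite -addn1 natrD natrM.
rewrite e1 e2 in h1.
have k0 : 2 * k%:R + 2 != 0 :> R by rewrite gt_eqF // ltr_wpDl // mulr_ge0.
apply: (mulfI k0); rewrite h1.
have -> : (2 * k%:R + 1) * (pi / 2 * ctr R k) = pi / 2 * (ctr R k * (2 * k%:R + 1)) by ring.
by rewrite -h2; ring.
Qed.

Lemma wal_odd k : wal (2 * k).+1 * ((2 * k%:R + 1) * ctr R k) = 1.
Proof.
elim: k => [|k IH]; first by rewrite wal1 ctr0; ring.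
have h1 := walS (2 * k).+1.
have h2 := ctrS R k.
rewrite (_ : (2 * k.+1 = (2 * k).+2)%N); last by lia.
have e2 : (2 * k).+2%:R = 2 * k%:R + 2 :> R by rewrite -addn2 natrD natrM.
have e3 : (2 * k).+3%:R = 2 * k%:R + 3 :> R by rewrite -addn3 natrD natrM.
rewrite e2 e3 in h1.
have k0 : 2 * k%:R + 2 != 0 :> R by rewrite gt_eqF // ltr_wpDl // mulr_ge0.
apply: (mulfI k0); rewrite mulr1 -[in LHS](addn1 k) natrD addn1.
set w := wal _ in h1 *; set w' := wal _ in h1 IH; set c := ctr _ _ in h2 *; set c' := ctr _ _ in h2 IH *.
have -> : (2 * k%:R + 2) * (w * ((2 * (k%:R + 1) + 1) * c)) = ((2 * k%:R + 3) * w) * (c * (2 * k%:R + 2)) by ring.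
rewrite h1 h2; apply: etrans (_ : (2 * k%:R + 2) * (w' * ((2 * k%:R + 1) * c')) = _); first ring.
by rewrite IH mulr1.
Qed.

Lemma ctr_pos k : 0 < ctr R k.
Proof.
rewrite lt_neqAle ctr_ge0 andbT; apply/eqP => h.
by have := wal_odd k; rewrite -h !mulr0 => /eqP; rewrite eq_sym oner_eq0.
Qed.

(** Wallis' inequality [wal (2 k + 1) <= wal (2 k)], with both integrals expressed through [ctr k];
    the comparison with the next even integral gives the matching upper bound. The exact factor [pi]
    is what fixes [c1]. *)
Lemma ctr_lower k : 2 <= pi * (2 * k%:R + 1) * ctr R k ^+ 2.
Proof.
have := wal_mono (2 * k); rewrite wal_even => h.
have k0 : 0 < 2 * k%:R + 1 :> R by rewrite ltr_wpDl // mulr_ge0.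
have c0 := ctr_pos k.
have : wal (2 * k).+1 * ((2 * k%:R + 1) * ctr R k) <= pi / 2 * ctr R k * ((2 * k%:R + 1) * ctr R k).
  by rewrite ler_wpM2r // mulr_ge0 // ltW.
rewrite wal_odd expr2; lra.
Qed.

Lemma ctr_upper k : pi * k.+1%:R * ctr R k.+1 ^+ 2 <= 1.
Proof.
have := wal_mono (2 * k).+1; rewrite (_ : ((2 * k).+2 = 2 * k.+1)%N); last by lia.
rewrite wal_even => h.
have k0 : 0 < 2 * k%:R + 1 :> R by rewrite ltr_wpDl // mulr_ge0.
have c0 := ctr_pos k.
have : pi / 2 * ctr R k.+1 * ((2 * k%:R + 1) * ctr R k) <= wal (2 * k).+1 * ((2 * k%:R + 1) * ctr R k).
  by rewrite ler_wpM2r // mulr_ge0 // ltW.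
rewrite wal_odd [_ * ctr R k]mulrC -ctrS expr2 -(addn1 k) natrD addn1; lra.
Qed.

Lemma ln_succ (k : nat) : ln (k.+2%:R : R) - ln k.+1%:R <= k.+1%:R^-1.
Proof.
rewrite -ln_div ?posrE // (_ : k.+2%:R / _ = 1 + k.+1%:R^-1); last first.
  by rewrite -(addn1 k.+1) natrD mulrDl divff // div1r.
by apply: le_ln1Dx; apply: lt_trans (_ : 0 < _); rewrite ?invr_gt0 ?ltrN10.
Qed.

Lemma ln_succ_ge (k : nat) : (k.+2%:R)^-1 <= ln (k.+2%:R : R) - ln k.+1%:R.
Proof.
rewrite -lerN2 opprB -ln_div ?posrE // (_ : k.+1%:R / _ = 1 + (- (k.+2%:R^-1))); last first.
  have k0 : k.+2%:R != 0 :> R by [].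
  by apply: (mulIf k0); rewrite mulfVK // mulrBl mul1r mulVf // -[in RHS](addn1 k.+1) natrD addrK.
by apply: le_ln1Dx; rewrite ltrN2 invf_lt1 // ltr1n.
Qed.

Lemma ctr_sum_upper K : pi * \sum_(k < K.+2) ctr R k ^+ 2 <= pi + 1 + ln K.+1%:R.
Proof.
elim: K => [|K IH].
  rewrite big_ord_recr big_ord1 /= ctr0 expr1n mulrDr mulr1 ln1 addr0 lerD2l.
  by have := ctr_upper 0; rewrite mulr1.
rewrite big_ord_recr /= mulrDr.
have h1 := ctr_upper K.+1; have h2 := ln_succ_ge K.
have h3 : pi * ctr R K.+2 ^+ 2 <= K.+2%:R^-1.
  by rewrite -(ler_pM2l (_ : 0 < K.+2%:R)) // divff // mulrCA mulrA.
by apply: le_trans (lerD IH h3) _; rewrite -addrA lerD2l -lerBrDl.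
Qed.

Lemma ctr_sum_lower K : ln K.+1%:R <= pi * \sum_(k < K) ctr R k ^+ 2.
Proof.
elim: K => [|K IH]; first by rewrite big_ord0 mulr0 ln1.
rewrite big_ord_recr /= mulrDr.
have h1 := ctr_lower K; have h2 := ln_succ K.
have h3 : K.+1%:R^-1 <= pi * ctr R K ^+ 2.
  rewrite -(ler_pM2l (_ : 0 < K.+1%:R :> R)) // divff // -(addn1 K) natrD.
  have : 0 <= pi * ctr R K ^+ 2 by rewrite mulr_ge0 ?pi_ge0 ?sqr_ge0.
  nra.
by apply: le_trans (lerD IH h3); rewrite -lerBlDl.
Qed.

End Wallis.

Definition rect (lo : int * int) (n : nat) : seq (int * int) :=
  [seq (lo.1 + i%:Z, lo.2 + j%:Z) | i <- iota 0 n, j <- iota 0 n].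

Lemma mem_rect lo n (y : int * int) : (y \in rect lo n) =
  [&& lo.1 <= y.1, y.1 < lo.1 + n%:Z, lo.2 <= y.2 & y.2 < lo.2 + n%:Z].
Proof.
apply/allpairsP/idP => [[[i j] [/=]]|/and4P[h1 h2 h3 h4]].
  by rewrite !mem_iota => hi hj -> /=; lia.
exists (`|y.1 - lo.1|%N, `|y.2 - lo.2|%N) => /=; rewrite !mem_iota.
split; [lia|lia|]; case: y h1 h2 h3 h4 => a b /= *; congr pair; lia.
Qed.

Definition ball2 (x : int * int) (r : nat) : seq (int * int) :=
  rect (x.1 - r%:Z + 1, x.2 - r%:Z + 1) (2 * r).-1.

Lemma mem_ball2 x r (y : int * int) :
  (y \in ball2 x r) = (`|y.1 - x.1| < r)%N && (`|y.2 - x.2| < r)%N.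
Proof. by rewrite mem_rect /=; case: r => [|r]; lia. Qed.

(** * Green functions of balls up to a bounded error *)

Section BallGreen.
Variable R : realType.
Implicit Types (a : R) (x y : int * int).

(** Its average exceeds its value by exactly 1, so a multiple of it absorbs a constant error in a
    Laplacian. *)
Definition sqd x0 y : R := (y.1 - x0.1)%:~R ^+ 2 + (y.2 - x0.2)%:~R ^+ 2.

Lemma avg_sqd x0 y : avg (sqd x0) y = sqd x0 y + 1.
Proof.
rewrite /avg /sqd /=.
rewrite [y.1 + 1 - x0.1]addrAC [y.1 - 1 - x0.1]addrAC [y.2 + 1 - x0.2]addrAC [y.2 - 1 - x0.2]addrAC.
by rewrite !rmorphD !rmorphN /=; field.
Qed.

Lemma sqd_le x0 y (r : nat) : (`|y.1 - x0.1| <= r)%N -> (`|y.2 - x0.2| <= r)%N ->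
  sqd x0 y <= 2 * r%:R ^+ 2.
Proof.
have h (j : int) : (`|j| <= r)%N -> j%:~R ^+ 2 <= r%:R ^+ 2 :> R.
  move=> hj; rewrite -[leLHS]real_normK ?num_real // ler_pXn2r ?nnegrE //.
  by rewrite -intr_norm -[r%:R]/(r%:Z%:~R) ler_int; lia.
by move=> /h h1 /h h2; rewrite /sqd; lra.
Qed.

Definition diag_hk (M : nat) : R := \sum_(m < M) hk R (0, 0) m (0, 0).

Lemma hk_diag x0 m : hk R x0 m x0 = hk R (0, 0) m (0, 0).
Proof. by rewrite /hk !subrr. Qed.

Lemma sum_telescope (f F : nat -> R) M : (forall m, F m = f m - f m.+1) ->
  \sum_(m < M) F m = f 0%N - f M.
Proof.
move=> h; elim: M => [|M IH]; first by rewrite big_ord0 subrr.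
by rewrite big_ord_recr /= IH h addrA subrK.
Qed.

Lemma avg_ge0 (v : int * int -> R) y : (forall y', nbr y y' -> 0 <= v y') -> 0 <= avg v y.
Proof.
move=> N; rewrite /avg mulr_ge0 ?invr_ge0 // !addr_ge0 //;
by apply: N; rewrite /nbr !eqxx ?orbT.
Qed.

Lemma nbr_ball x0 r z y : z \in ball2 x0 r -> nbr z y ->
  (`|y.1 - x0.1| <= r)%N && (`|y.2 - x0.2| <= r)%N.
Proof.
rewrite mem_ball2 => hz /or4P[] /eqP -> /=; lia.
Qed.

(** A supersolution is built from the expected visits up to time [r ^ 2]: their Laplacian misses the
    Kronecker symbol by [hk (r ^ 2) <= r ^ (-2)], which the quadratic term, nonnegative on the
    neighbours of the ball, restores at the price of 2. *)
Lemma green_ball_upper a x0 (r : nat) e : 0 < a -> a <= 1 -> (0 < r)%N ->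
  is_green a (ball2 x0 r) x0 e -> e x0 <= diag_hk (r ^ 2) + 2.
Proof.
move=> a0 a1 r0 he.
have rp : 0 < r%:R ^+ 2 :> R by rewrite exprn_gt0 // ltr0n.
pose v y := \sum_(m < r ^ 2) hk R x0 m y + r%:R ^- 2 * (2 * r%:R ^+ 2 - sqd x0 y).
have v0 y : (`|y.1 - x0.1| <= r)%N && (`|y.2 - x0.2| <= r)%N -> 0 <= v y.
  move=> /andP[h1 h2]; apply: addr_ge0.
    by apply: sumr_ge0 => m _; exact: hk_ge0.
  by rewrite mulr_ge0 ?invr_ge0 ?(ltW rp) // subr_ge0 sqd_le.
have x0B : x0 \in ball2 x0 r by rewrite mem_ball2 !subrr /= r0.
have -> : diag_hk (r ^ 2) + 2 = v x0.
  rewrite /v /sqd !subrr expr0n /= addr0 subr0 mulrCA mulVf ?gt_eqF // mulr1.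
  by congr (_ + _); apply: eq_bigr => m _; rewrite hk_diag.
apply: (green_le a0 a1 he) => // [y yB|z y zB zy _]; last first.
  exact/v0/(nbr_ball zB zy).
have avg0 : 0 <= avg v y by apply: avg_ge0 => y' h; exact/v0/(nbr_ball yB h).
have : kron R x0 y <= lap 1 v y.
  rewrite /v lapD lap_sum lapZ lapB lap_cst subrr mul0r sub0r.
  rewrite (_ : lap 1 (sqd x0) y = -1) ?opprK ?mulr1; last by rewrite /lap avg_sqd; ring.
  have -> : \sum_(m < r ^ 2) lap 1 (hk R x0 m) y = hk R x0 0 y - hk R x0 (r ^ 2) y.
    apply: (@sum_telescope (fun m => hk R x0 m y) (fun m => lap 1 (hk R x0 m) y)) => m.
    by rewrite /lap mul1r avg_hk.
  rewrite hk0 -addrA lerDl addrC subr_ge0.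
  rewrite -(ler_pM2l rp) divff ?gt_eqF //.
  by have := hk_le_inv R x0 (r ^ 2) y; rewrite natrX.
move=> h; apply: le_trans h _; rewrite /lap lerD2l lerN2 mul1r.
by rewrite ler_piMl.
Qed.

Lemma bernoulli a m : 0 <= a -> a <= 1 -> 1 - m%:R * (1 - a) <= a ^+ m.
Proof.
move=> a0 a1; elim: m => [|m IH]; first by rewrite mul0r subr0.
have h : 0 <= a ^+ m <= 1 by rewrite exprn_ge0 // exprn_ile1.
have m0 : 0 <= m%:R :> R by [].
rewrite exprS -addn1 natrD; nra.
Qed.

(** The subsolution is the discounted number of visits up to time [r ^ 2], lowered by the bound 3 on
    the visits outside the ball. By Bernoulli's inequality the discount loses at most
    [(1 - a) * m * hk m <= r ^ (-2)] at time [m], hence 1 in all, so [4 = 3 + 1]. *)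
Lemma green_ball_lower a x0 (r : nat) e : 0 < a -> a <= 1 -> (0 < r)%N ->
  (1 - a) * r%:R ^+ 2 <= 1 ->
  is_green a (ball2 x0 r) x0 e -> diag_hk (r ^ 2) - 4 <= e x0.
Proof.
move=> a0 a1 r0 har he.
have rp : 0 < r%:R ^+ 2 :> R by rewrite exprn_gt0 // ltr0n.
pose v y := \sum_(m < r ^ 2) a ^+ m * hk R x0 m y - 3.
have x0B : x0 \in ball2 x0 r by rewrite mem_ball2 !subrr /= r0.
have ale1 m : 0 <= a ^+ m <= 1 by rewrite exprn_ge0 ?exprn_ile1 // ltW.
apply: le_trans (_ : v x0 <= _).
  have : diag_hk (r ^ 2) - 1 <= \sum_(m < r ^ 2) a ^+ m * hk R x0 m x0; last by rewrite /v; lra.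
  rewrite lerBlDr.
  have -> : 1 = \sum_(m < r ^ 2) (r%:R ^- 2) :> R.
    by rewrite sumr_const card_ord -[RHS]mulr_natl natrX divff // gt_eqF.
  rewrite -big_split /=; apply: ler_sum => m _.
  rewrite hk_diag; set h := hk _ _ _ _.
  have h0 : 0 <= h by exact: hk_ge0.
  have hm : m%:R * h <= 1 by exact: hk_le_inv.
  have := bernoulli m (ltW a0) a1.
  have hr : (1 - a) <= r%:R ^- 2.
    by rewrite -(ler_pM2r rp) mulVf // gt_eqF.
  have : (1 - a) * (m%:R * h) <= r%:R ^- 2.
    apply: le_trans hr; rewrite -[leRHS]mulr1 ler_wpM2l // subr_ge0 //.
  nra.
apply: (green_ge a0 a1 he) => // [y yB|z y zB zy yB]; last first.
  rewrite /v subr_le0; apply: le_trans (hk_far_sum R (r := r) (x0 := x0) (y := y) _); last first.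
    by rewrite -mem_ball2.
  apply: ler_sum => m _; rewrite ler_piMl ?hk_ge0 //.
  by have /andP[] := ale1 m.
rewrite /v lapB lap_sum lap_cst.
have -> : \sum_(m < r ^ 2) lap a (fun y => a ^+ m * hk R x0 m y) y =
    hk R x0 0 y - a ^+ (r ^ 2) * hk R x0 (r ^ 2) y.
  apply: etrans (_ : a ^+ 0 * hk R x0 0 y - _ = _); last by rewrite mul1r.
  apply: (@sum_telescope (fun m => a ^+ m * hk R x0 m y)
    (fun m => lap a (fun y0 => a ^+ m * hk R x0 m y0) y)) => m.
  by rewrite /lap avgZ avg_hk exprS; ring.
rewrite hk0.
have : 0 <= a ^+ (r ^ 2) * hk R x0 (r ^ 2) y.
  by rewrite mulr_ge0 ?hk_ge0 // exprn_ge0 // ltW.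
nra.
Qed.

Lemma diag_hk_ctr K : diag_hk (2 * K) = \sum_(k < K) ctr R k ^+ 2.
Proof.
elim: K => [|K IH]; first by rewrite /diag_hk muln0 !big_ord0.
rewrite /diag_hk (_ : (2 * K.+1 = (2 * K).+2)%N); last by lia.
rewrite !big_ord_recr /= -/(diag_hk (2 * K)) IH -addrA; congr (_ + _).
have -> : hk R (0, 0) (2 * K).+1 (0, 0) = 0.
  have -> : hk R (0, 0) (2 * K).+1 (0, 0) = bet R (2 * K).+1 0 * bet R (2 * K).+1 0 by [].
  have := bet_parity R (2 * K).+1 (- (K.+1)%:Z).
  rewrite (_ : 2 * - K.+1%:Z + (2 * K).+1%:Z + 1 = 0) ?mulr0 ?mul0r; last by lia.
  by move=> ->; rewrite mul0r.
by rewrite addr0 expr2.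
Qed.

(** Increase of the Green function when the radius doubles: over [4 ^ l] steps, [pi] times the sum
    of the [ctr ^ 2] is close to [2 * l * ln 2]. *)
Definition green_rate : R := 2 / pi * ln 2.

Lemma green_rate_gt0 : 0 < green_rate.
Proof. by rewrite mulr_gt0 ?divr_gt0 ?pi_gt0 ?ln_gt0 // ltr1n. Qed.

(* [pi >= 2] makes the constants explicit. *)
Lemma diag_hk_pow4 l : `|diag_hk (4 ^ l) - green_rate * l%:R| <= 4.
Proof.
have p2 := @pi_ge2 R.
have p0 : 0 < pi :> R by exact: pi_gt0.
case: l => [|l].
  by rewrite /diag_hk expn0 big_ord1 hk0 /kron eqxx mulr0 subr0 /= normr1; lra.
have [K hK] : exists K, (4 ^ l.+1 = 2 * K.+1)%N.
  exists (2 * 4 ^ l).-1; rewrite expnS.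
  have : (0 < 4 ^ l)%N by rewrite expn_gt0.
  lia.
rewrite hK diag_hk_ctr.
have hl : ln (K.+1%:R : R) = l.+1%:R * (2 * ln 2) - ln 2.
  have h2 : (0 : R) < 2 by [].
  have -> : K.+1%:R = 4 ^+ l.+1 / 2 :> R by rewrite -natrX hK natrM; field.
  rewrite ln_div ?posrE ?exprn_gt0 // lnXn // (_ : 4 = 2 ^+ 2 :> R); last by rewrite -natrX.
  by rewrite lnXn // -[_ *+ l.+1]mulr_natl -[_ *+ 2]mulr_natl.
have l20 : 0 < ln (2 : R) by rewrite ln_gt0 // ltr1n.
have l22 : ln (2 : R) < 2 by exact: ln_sublinear.
have := ctr_sum_lower R K.+1.
have hup : pi * \sum_(k < K.+1) ctr R k ^+ 2 <= pi + 1 + ln K.+1%:R.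
  apply: le_trans (ctr_sum_upper R K); rewrite ler_pM2l // [leRHS]big_ord_recr /=.
  by rewrite lerDl sqr_ge0.
have h2 : ln K.+1%:R <= ln (K.+2%:R : R) by rewrite ler_ln ?posrE // ler_nat.
set S := \sum_(k < K.+1) _ in hup *.
rewrite hl in h2 hup => h3.
rewrite /green_rate.
have -> : S - 2 / pi * ln 2 * l.+1%:R = (pi * S - l.+1%:R * (2 * ln 2)) / pi.
  by rewrite mulrBl [pi * S]mulrC mulfK ?gt_eqF //; ring.
rewrite normrM [`|pi^-1|]gtr0_norm ?invr_gt0 // ler_pdivrMr // ler_norml.
apply/andP; split; lra.
Qed.

Lemma green_ball_pow2 a x0 l e : 0 < a -> a <= 1 -> (1 - a) * 4 ^+ l <= 1 ->
  is_green a (ball2 x0 (2 ^ l)) x0 e -> `|e x0 - green_rate * l%:R| <= 8.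
Proof.
move=> a0 a1 ha he.
have r0 : (0 < 2 ^ l)%N by rewrite expn_gt0.
have h4 : ((2 ^ l) ^ 2 = 4 ^ l)%N by rewrite -expnM mulnC expnM.
have := green_ball_upper a0 a1 r0 he.
have := green_ball_lower a0 a1 r0 _ he.
rewrite -natrX h4 natrX => /(_ ha).
have := diag_hk_pow4 l; rewrite !ler_norml => /andP[h1 h2] h3 h5.
by apply/andP; split; lra.
Qed.

End BallGreen.

(** * Uniqueness of laws through the kernel [1 / (1 + x ^ 2)] *)

Section Cauchy.
Variable R : realType.
Notation mu := (@lebesgue_measure R).

Lemma scaleRE (a b : R) : a *: (b : R^o) = a * b.
Proof. by []. Qed.

Lemma is_derive_continuous (f df : R -> R) :
  (forall x : R, is_derive x (1 : R) f (df x)) -> continuous f.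
Proof.
move=> h x; apply/differentiable_continuous/derivable1_diffP.
by have hx := h x; exact: ex_derive.
Qed.

(** The primitive of [exp (- x) * (1 + cos (z * x))] that vanishes at infinity. *)
Definition cauchyF (z x : R) : R :=
  - expR (- x) + (1 + z ^+ 2)^-1 * (expR (- x) * (z * sin (z * x) - cos (z * x))).

Lemma sqD1_gt0 (z : R) : 0 < 1 + z ^+ 2.
Proof. by rewrite ltr_wpDr // sqr_ge0. Qed.

Lemma is_derive_cauchyF (z x : R) :
  is_derive x (1 : R) (cauchyF z) (expR (- x) * (1 + cos (z * x))).
Proof.
have dz : is_derive x (1 : R) (fun x => z * x) z.
  have := is_deriveZ z (@is_derive_id R R x 1).
  by rewrite /GRing.scale /= mulr1.
have dN : is_derive x (1 : R) (fun x => - x) (- 1).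
  exact: is_deriveNid.
have dE : is_derive x (1 : R) (fun x => expR (- x)) (expR (- x) * - 1).
  exact: (is_derive1_comp (f := expR) (g := fun x => - x)).
have dS : is_derive x (1 : R) (fun x => sin (z * x)) (cos (z * x) * z).
  exact: (is_derive1_comp (f := sin) (g := fun x => z * x)).
have dC : is_derive x (1 : R) (fun x => cos (z * x)) (- sin (z * x) * z).
  exact: (is_derive1_comp (f := cos) (g := fun x => z * x)).
have -> : cauchyF z = (- (fun x : R => expR (- x))) +
   (cst (1 + z ^+ 2)^-1 * ((fun x : R => expR (- x)) * (cst z * (fun x : R => sin (z * x)) - (fun x : R => cos (z * x))))).
  by apply/funext => y; rewrite !fctE.
have dK : is_derive x (1 : R) (cst (1 + z ^+ 2)^-1) (0 : R^o) := is_derive_cst _ _ _.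
have dz' : is_derive x (1 : R) (cst z) (0 : R^o) := is_derive_cst _ _ _.
apply: (is_derive_eq (is_deriveD (is_deriveN dE)
  (is_deriveM dK (is_deriveM dE (is_deriveB (is_deriveM dz' dS) dC))))).
rewrite !fctE !scaleRE.
have h := sqD1_gt0 z.
set s := sin _; set c := cos _; set E := expR _.
rewrite !mulr0 !addr0; rewrite (_ : _ + (1 + z ^+ 2)^-1 * _ = E + (1 + z ^+ 2)^-1 * ((1 + z ^+ 2) * E * c)).
  by rewrite -[_ * E * c]mulrA mulKf ?gt_eqF //; ring.
congr (_ + _ * _); ring.
Qed.

Lemma cauchyF_oo z : cauchyF z x @[x --> +oo] --> (0 : R).
Proof.
have h1 : (fun x : R => - expR (- x)) x @[x --> +oo] --> (0 : R).
  by rewrite -oppr0; apply: cvgN; exact: cvgr_expR.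
rewrite -[0](addr0 0); apply: cvgD; first exact: h1.
rewrite -(mulr0 (1 + z ^+ 2)^-1); apply: cvgM; first exact: cvg_cst.
pose C := `|z| + 1.
have h2 : (fun x : R => C * expR (- x)) x @[x --> +oo] --> (0 : R).
  by rewrite -(mulr0 C); apply: cvgM; [exact: cvg_cst | exact: cvgr_expR].
have h3 : (fun x : R => - (C * expR (- x))) x @[x --> +oo] --> (0 : R).
  by rewrite -oppr0; apply: cvgN; exact: h2.
apply: (squeeze_cvgr _ h3 h2).
near=> x; rewrite -ler_norml normrM ger0_norm ?expR_ge0 // mulrC.
rewrite ler_wpM2r ?expR_ge0 //.
apply: le_trans (ler_normB _ _) _; rewrite normrM lerD //.
  by rewrite ler_piMr // ler_norml sin_geN1 sin_le1.
by rewrite ler_norml cos_geN1 cos_le1.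
Unshelve. all: by end_near. Qed.

Lemma cos1_ge0 (x : R) : 0 <= 1 + cos x.
Proof. by have := cos_geN1 x; lra. Qed.

(** Laplace transform of the cosine. The summand 1 keeps the integrand nonnegative, so that
    Tonelli's theorem can exchange the integral with an expectation. *)
Lemma integral_exp_cos (z : R) :
  (\int[mu]_(x in `[0%R, +oo[) (expR (- x) * (1 + cos (z * x)))%:E =
   (1 + (1 + z ^+ 2)^-1)%:E)%E.
Proof.
have dF := is_derive_cauchyF z.
have cF := is_derive_continuous dF.
rewrite (@ge0_continuous_FTC2y R _ (cauchyF z) 0 0).
- rewrite -EFinB; congr EFin; rewrite /cauchyF mulr0 oppr0 expR0 sin0 cos0.
  by ring.
- by move=> x _; rewrite mulr_ge0 ?expR_ge0 ?cos1_ge0.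
- apply: continuous_subspaceT => x; apply: cvgM.
    by apply: (@continuous_comp _ _ _ (fun x : R => - x) expR); [exact: oppr_continuous|exact: continuous_expR].
  apply: cvgD; first exact: cvg_cst.
  by apply: (@continuous_comp _ _ _ (fun x : R => z * x) cos); [exact: mulrl_continuous|exact: continuous_cos].
- exact: cauchyF_oo.
- by move=> x _; have dx := dF x; exact: ex_derive.
- by apply: cvg_at_right_filter; exact: cF.
- by move=> x _; rewrite derive1E; have dx := dF x; exact: derive_val.
Qed.

Lemma integral_ck (k x a b c : R) : 0 < k -> a < b ->
  (\int[mu]_(y in `[a, b]) (k * (1 + (k * (x - y) - c) ^+ 2)^-1)%:E =
   (atan (k * (x - a) - c) - atan (k * (x - b) - c))%:E)%E.
Proof.
move=> k0 ab.
pose g (y : R) : R := k * (x - y) - c.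
have dg (y : R) : is_derive y (1 : R) g (- k).
  have -> : g = (cst (k * x - c)) + (cst (- k)) * (@id R).
    by apply/funext => t; rewrite !fctE /g; ring.
  have d1 : is_derive y (1 : R) (cst (k * x - c)) (0 : R^o) := is_derive_cst _ _ _.
  have d2 : is_derive y (1 : R) (cst (- k)) (0 : R^o) := is_derive_cst _ _ _.
  apply: (is_derive_eq (is_deriveD d1 (is_deriveM d2 (is_derive_id _ _)))).
  by rewrite !fctE !scaleRE; ring.
have dF (y : R) : is_derive y (1 : R) (fun y => - atan (g y)) (k * (1 + (g y) ^+ 2)^-1).
  have d1 : is_derive y (1 : R) (atan \o g) ((1 + (g y) ^+ 2)^-1 * - k).
    exact: is_derive1_comp.
  have -> : (fun y => - atan (g y)) = - (atan \o g) by apply/funext.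
  by apply: is_derive_eq; ring.
have cg := is_derive_continuous dg.
rewrite (continuous_FTC2 ab _ _ (F := fun y => - atan (g y))).
- by rewrite -EFinB opprK addrC.
- apply: continuous_subspaceT => y; apply: cvgM; first exact: cvg_cst.
  apply: (@continuous_comp _ _ _ g (fun z : R => (1 + z ^+ 2)^-1)); first exact: cg.
  apply: cvgV; first by rewrite gt_eqF // sqD1_gt0.
  by apply: cvgD; [exact: cvg_cst | exact: exprn_continuous].
- have cF := is_derive_continuous dF.
  split; first by move=> y _; have dy := dF y; exact: ex_derive.
  + by apply: cvg_at_right_filter; exact: cF.
  + by apply: cvg_at_left_filter; exact: cF.
- by move=> y _; rewrite derive1E; have dy := dF y; exact: derive_val.
Qed.

(** The factor [n ^ 2] sharpens the step, and the shift by [n] decides the case [c = 0], so that the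
    limiting intervals are open on the left and closed on the right. *)
Lemma cvg_atan_step (c : R) :
  (fun n : nat => atan (n.+1%:R ^+ 2 * c - n.+1%:R)) @ \oo -->
  (if 0 < c then pi / 2 else - (pi / 2) : R).
Proof.
have cy : (fun n : nat => (n.+1%:R : R)) @ \oo --> +oo.
  by have := @cvgr_idn R; rewrite -(cvg_shiftS (fun n : nat => n%:R : R)).
have [c0|c0] := ltP 0 c.
  apply: (@cvg_comp _ _ _ (fun n : nat => n.+1%:R ^+ 2 * c - n.+1%:R) (@atan R) _ (+oo)); last exact: cvgy_atan.
  apply/cvgryPge => A.
  near=> n.
  have h1 : (c^-1 * (`|A| + 1)) <= n.+1%:R.
    by near: n; move/cvgryPge : cy; apply.
  have h2 : 1 <= n.+1%:R :> R by rewrite ler1n.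
  have h3 : `|A| + 1 <= n.+1%:R * c by rewrite -ler_pdivrMr // mulrC.
  have : n.+1%:R * (`|A| + 1) <= n.+1%:R * (n.+1%:R * c) by rewrite ler_wpM2l.
  have := ler_norm A; have := normr_ge0 A; nra.
apply: (@cvg_comp _ _ _ (fun n : nat => n.+1%:R ^+ 2 * c - n.+1%:R) (@atan R) _ (-oo)); last first.
  apply: (@cvg_trans _ ((fun x => - atan (- x)) @ -oo)).
    by apply: near_eq_cvg; near=> x; rewrite atanN opprK.
  apply: cvgN; apply/cvgNy_compNP => /=; under eq_fun do rewrite opprK.
  exact: cvgy_atan.
apply/cvgrNyPle => A; near=> n.
have h1 : `|A| <= n.+1%:R by near: n; move/cvgryPge : cy; apply.
have h2 : n.+1%:R ^+ 2 * c <= 0 by rewrite mulr_ge0_le0 // sqr_ge0.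
have := ler_norm (- A); rewrite normrN; lra.
Unshelve. all: by end_near. Qed.

End Cauchy.

(** * Weighted expectations and uniqueness in one dimension *)

Section OneDim.
Variable R : realType.
Notation mu := (@lebesgue_measure R).

Section weighted.
Context d (T : measurableType d) (P : probability T R).
Variables (w X : T -> R) (C : R).
Hypotheses (mw : measurable_fun setT w) (mX : measurable_fun setT X).
Hypotheses (w0 : forall t, 0 <= w t) (wC : forall t, w t <= C).

(** The weight [w] will carry the conditions on the other coordinates when the coordinates of a
    vector are treated one at a time. *)
Definition wE (f : R -> R) : \bar R := (\int[P]_t (w t * f (X t))%:E)%E.

Lemma mwf (f : R -> R) : measurable_fun setT f ->
  measurable_fun setT (fun t => @EFin R (w t * f (X t))).
Proof.
by move=> mf; apply/measurable_EFinP; apply: measurable_funM => //; exact: measurableT_comp.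
Qed.

Lemma wE_fin (f : R -> R) (M : R) : measurable_fun setT f -> (forall x, 0 <= f x <= M) -> wE f \is a fin_num.
Proof.
move=> mf fM; rewrite ge0_fin_numE; last first.
  by apply: integral_ge0 => t _; rewrite lee_fin mulr_ge0 //; case/andP: (fM (X t)).
apply: (@le_lt_trans _ _ (\int[P]_t (C * M)%:E)%E); last first.
  by rewrite integral_cst //= probability_setT mule1 ltry.
apply: ge0_le_integral => //.
- by move=> t _; rewrite lee_fin mulr_ge0 //; case/andP: (fM (X t)).
- exact: mwf.
- move=> t _; rewrite lee_fin; have /andP[a b] := fM (X t).
  by rewrite ler_pM.
Qed.

Lemma wED (f g : R -> R) : measurable_fun setT f -> measurable_fun setT g ->
  (forall x, 0 <= f x) -> (forall x, 0 <= g x) ->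
  wE (fun x => f x + g x) = (wE f + wE g)%E.
Proof.
move=> mf mg f0 g0; rewrite /wE -ge0_integralD //.
- by apply: eq_integral => t _; rewrite -EFinD mulrDr.
- by move=> t _; rewrite lee_fin mulr_ge0.
- exact: mwf.
- by move=> t _; rewrite lee_fin mulr_ge0.
- exact: mwf.
Qed.

Lemma wEZ (c : R) (f : R -> R) : measurable_fun setT f -> 0 <= c -> (forall x, 0 <= f x) ->
  wE (fun x => c * f x) = (c%:E * wE f)%E.
Proof.
move=> mf c0 f0; rewrite /wE -ge0_integralZl_EFin //.
- by apply: eq_integral => t _; rewrite -EFinM mulrCA.
- by move=> t _; rewrite lee_fin mulr_ge0.
- exact: mwf.
Qed.

Lemma wE_tonelli (D : set R) (f : R -> R -> R) (g : R -> R) :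
  measurable D -> measurable_fun setT (fun z : R * R => f z.1 z.2) ->
  (forall y x, 0 <= f y x) ->
  (forall x, (\int[mu]_(y in D) (f y x)%:E = (g x)%:E)%E) ->
  wE g = (\int[mu]_(y in D) wE (f y))%E.
Proof.
move=> mD mf f0 hg.
have mf2 y : measurable_fun setT (f y).
  by apply: (measurableT_comp mf (g := fun x => (y, x))); exact: measurable_pair1.
rewrite /wE.
transitivity (\int[P]_t \int[mu]_y ((w t * f y (X t))%:E * (\1_D y)%:E))%E.
  apply: eq_integral => t _.
  rewrite EFinM -hg -ge0_integralZl //.
  - rewrite integral_mkcond; apply: eq_integral => y _; rewrite patchE indicE.
    by case: (y \in D); rewrite ?mule1 ?mule0 // EFinM.
  - apply/measurable_EFinP/measurable_funTS.
    by apply: (measurableT_comp mf (g := fun y => (y, X t))); exact: measurable_pair2.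
  - by move=> y _; rewrite lee_fin.
  - by rewrite lee_fin.
rewrite (@fubini_tonelli _ _ _ _ _ P mu (fun z => ((w z.1 * f z.2 (X z.1))%:E * (\1_D z.2)%:E)%E)) /=.
- rewrite [RHS]integral_mkcond; apply: eq_integral => y _; rewrite patchE.
  case: ifPn => yD.
    by apply: eq_integral => t _; rewrite indicE yD mule1.
  apply: integral0_eq => t _; by rewrite indicE (negbTE yD) mule0.
- apply: emeasurable_funM; apply/measurable_EFinP.
    apply: measurable_funM; first exact: measurableT_comp.
    apply: (measurableT_comp mf (g := fun z : T * R => (z.2, X z.1))).
    apply: measurable_fun_pair => //; exact: measurableT_comp.
  have m1 : measurable_fun setT (\1_D : measurableTypeR R -> R) by exact: measurable_indic.
  exact: (measurableT_comp m1 measurable_snd).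
- by move=> z; rewrite mule_ge0 // lee_fin mulr_ge0.
Qed.

End weighted.

End OneDim.

Lemma addeI_fin (R : realType) (x y z : \bar R) : x \is a fin_num ->
  (x + y = x + z)%E -> y = z.
Proof. by move=> fx /(congr1 (fun u => u - x)%E); rewrite ![(x + _)%E]addeC !addeK. Qed.

Section TwoWorlds.
Variable R : realType.
Notation mu := (@lebesgue_measure R).
Context d1 (T1 : measurableType d1) (P1 : probability T1 R).
Context d2 (T2 : measurableType d2) (P2 : probability T2 R).

Section unique1.
Variables (w1 X1 : T1 -> R) (w2 X2 : T2 -> R) (C : R).
Hypotheses (mw1 : measurable_fun setT w1) (mX1 : measurable_fun setT X1).
Hypotheses (mw2 : measurable_fun setT w2) (mX2 : measurable_fun setT X2).
Hypotheses (w10 : forall t, 0 <= w1 t) (w1C : forall t, w1 t <= C).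
Hypotheses (w20 : forall t, 0 <= w2 t) (w2C : forall t, w2 t <= C).

Local Notation E1 := (wE P1 w1 X1).
Local Notation E2 := (wE P2 w2 X2).

Hypothesis Ecos : forall al s : R,
  E1 (fun x => 1 + cos (al * x + s)) = E2 (fun x => 1 + cos (al * x + s)).

Lemma mcos_lin (al s : R) : measurable_fun setT (fun x : R => 1 + cos (al * x + s)).
Proof.
apply: continuous_measurable_fun => x; apply: cvgD; first exact: cvg_cst.
apply: (@continuous_comp _ _ _ (fun x : R => al * x + s) cos); last exact: continuous_cos.
by apply: cvgD; [exact: mulrl_continuous|exact: cvg_cst].
Qed.

Lemma wE_1 : E1 (cst 1) = E2 (cst 1).
Proof.
have h := Ecos 0 0.
have e : (fun x : R => 1 + cos (0 * x + 0)) = (fun x => 2 * (cst 1 x)).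
  by apply/funext => x; rewrite mul0r addr0 cos0 /cst; ring.
rewrite e !wEZ // in h.
have f1 : E1 (cst 1) \is a fin_num.
  by apply: (@wE_fin R _ _ P1 w1 X1 C mw1 mX1 w10 w1C _ 1) => // x; rewrite ler01 lexx.
have f2 : E2 (cst 1) \is a fin_num.
  by apply: (@wE_fin R _ _ P2 w2 X2 C mw2 mX2 w20 w2C _ 1) => // x; rewrite ler01 lexx.
move: h; rewrite -(fineK f1) -(fineK f2) -!EFinM => -[] /mulfI h.
by congr EFin; apply: h.
Qed.

Lemma mK_lin (k c : R) : measurable_fun setT (fun x : R => (1 + (k * x + c) ^+ 2)^-1).
Proof.
apply: continuous_measurable_fun => x.
apply: cvgV; first by rewrite gt_eqF // sqD1_gt0.
apply: cvgD; first exact: cvg_cst.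
apply: (@continuous_comp _ _ _ (fun x : R => k * x + c) (fun y : R => y ^+ 2)); last exact: exprn_continuous.
by apply: cvgD; [exact: mulrl_continuous|exact: cvg_cst].
Qed.

Lemma K_ge0 (z : R) : 0 <= (1 + z ^+ 2)^-1 <= 1.
Proof.
have := sqD1_gt0 z => h; rewrite invr_ge0 ltW //= invf_le1 // lerDl sqr_ge0 //.
Qed.

Lemma m2_cos (k c : R) : measurable_fun setT
  (fun z : R * R => expR (- z.1) * (1 + cos (z.1 * (k * z.2 + c)))).
Proof.
apply: measurable_funM.
  apply: (@measurableT_comp _ _ _ _ _ _ expR _ (fun z : R * R => - z.1)) => //.
  exact: (measurableT_comp (continuous_measurable_fun (@oppr_continuous _ R^o)) measurable_fst).
apply: measurable_funD => //; apply: (measurableT_comp (continuous_measurable_fun (@continuous_cos R))).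
by apply: measurable_funM => //; apply: measurable_funD => //; apply: measurable_funM.
Qed.

(** Averaging the hypothesis on cosines over the frequency against [exp (- xi)] produces the kernel
    [1 / (1 + x ^ 2)]. *)
Lemma wE_K (k c : R) : E1 (fun x => (1 + (k * x + c) ^+ 2)^-1) =
  E2 (fun x => (1 + (k * x + c) ^+ 2)^-1).
Proof.
pose f (xi x : R) : R := expR (- xi) * (1 + cos (xi * (k * x + c))).
have hf x : (\int[mu]_(y in `[0%R, +oo[) (f y x)%:E = (1 + (1 + (k * x + c) ^+ 2)^-1)%:E)%E.
  rewrite -integral_exp_cos; apply: eq_integral => y _.
  by rewrite /f [y * _]mulrC.
have f0 y x : 0 <= f y x by rewrite mulr_ge0 ?expR_ge0 ?cos1_ge0.
have mI : measurable (`[0%R, +oo[%classic : set R) by [].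
have ef xi : f xi = (fun x => expR (- xi) * (1 + cos (xi * k * x + xi * c))).
  by apply/funext => x; rewrite /f; congr (_ * (1 + cos _)); ring.
have h : E1 (fun x => 1 + (1 + (k * x + c) ^+ 2)^-1) = E2 (fun x => 1 + (1 + (k * x + c) ^+ 2)^-1).
  rewrite (wE_tonelli _ mw1 mX1 w10 mI (m2_cos k c) f0 hf).
  rewrite (wE_tonelli _ mw2 mX2 w20 mI (m2_cos k c) f0 hf).
  apply: eq_integral => xi _; rewrite ef.
  rewrite !wEZ ?expR_ge0 //; try exact: mcos_lin; try by move=> x; exact: cos1_ge0.
  by rewrite Ecos.
rewrite !wED // in h; try exact: mK_lin; try by move=> x; have /andP[] := K_ge0 (k * x + c).
rewrite wE_1 in h.
have f2 : E2 (cst 1) \is a fin_num.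
  by apply: (@wE_fin R _ _ P2 w2 X2 C mw2 mX2 w20 w2C _ 1) => // x; rewrite ler01 lexx.
exact: (addeI_fin f2).
Qed.

(** Integrating the kernel over a shift gives differences of arctangents, the smooth steps that tend
    to indicators of intervals. *)
Lemma wE_atan (k a b c : R) : 0 < k -> a < b ->
  E1 (fun x => atan (k * (x - a) - c) - atan (k * (x - b) - c)) =
  E2 (fun x => atan (k * (x - a) - c) - atan (k * (x - b) - c)).
Proof.
move=> k0 ab.
pose f (y x : R) : R := k * (1 + (k * (x - y) - c) ^+ 2)^-1.
have hf x := integral_ck x c k0 ab.
have f0 y x : 0 <= f y x.
  by rewrite mulr_ge0 ?(ltW k0) //; case/andP: (K_ge0 (k * (x - y) - c)).
have mI : measurable (`[a, b]%classic : set R) by [].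
have mf : measurable_fun setT (fun z : R * R => f z.1 z.2).
  apply: measurable_funM => //.
  apply: (measurableT_comp (f := fun y : R => (1 + y ^+ 2)^-1)).
    by have := mK_lin 1 0; under eq_fun do rewrite mul1r addr0.
  apply: measurable_funB => //; apply: measurable_funM => //.
  exact: measurable_funB.
rewrite (wE_tonelli _ mw1 mX1 w10 mI mf f0 hf).
rewrite (wE_tonelli _ mw2 mX2 w20 mI mf f0 hf).
apply: eq_integral => y _; rewrite /f.
have -> : (fun x : R => k * (1 + (k * (x - y) - c) ^+ 2)^-1) =
    (fun x : R => k * (1 + (k * x + (- (k * y) - c)) ^+ 2)^-1).
  by apply/funext => x; congr (_ * (1 + _ ^+ 2)^-1); ring.
rewrite !wEZ ?(ltW k0) //; try exact: mK_lin; try by move=> x; have /andP[] := K_ge0 (k * x + (- (k * y) - c)).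
by rewrite wE_K.
Qed.

End unique1.
End TwoWorlds.

Section Limit.
Variable R : realType.
Context d (T : measurableType d) (P : probability T R).
Variables (w X : T -> R) (C : R).
Hypotheses (mw : measurable_fun setT w) (mX : measurable_fun setT X).
Hypotheses (w0 : forall t, 0 <= w t) (wC : forall t, w t <= C).

Lemma wE_step (a b : R) : a < b ->
  (fun n : nat => wE P w X (fun x => atan (n.+1%:R ^+ 2 * (x - a) - n.+1%:R) -
     atan (n.+1%:R ^+ 2 * (x - b) - n.+1%:R))) @ \oo -->
  wE P w X (fun x => pi * \1_(`]a, b]%classic) x).
Proof.
move=> ab; rewrite /wE.
have C0 : 0 <= C.
  have [[t _]|h] := pselect (exists t : T, True).
    exact: le_trans (w0 t) (wC t).
  exfalso; have := @probability_setT _ _ _ P.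
  rewrite (_ : setT = set0); last by apply/seteqP; split => // t _; apply: h; exists t.
  by rewrite measure0 => /eqP; rewrite eq_sym onee_eq0.
have matan n (c : R) : measurable_fun setT (fun t => atan (n.+1%:R ^+ 2 * (X t - c) - n.+1%:R) : R).
  apply: (measurableT_comp (f := fun y : R => atan y)).
    by apply: continuous_measurable_fun; exact: continuous_atan.
  apply: measurable_funB => //; apply: measurable_funM => //.
  exact: measurable_funB.
pose f_ n t : \bar R := (w t * (atan (n.+1%:R ^+ 2 * (X t - a) - n.+1%:R) -
     atan (n.+1%:R ^+ 2 * (X t - b) - n.+1%:R)))%:E.
pose f t : \bar R := (w t * (pi * \1_(`]a, b]%classic) (X t)))%:E.
have mf : measurable_fun setT f.
  apply/measurable_EFinP; apply: measurable_funM => //; apply: measurable_funM => //.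
  have m1 : measurable_fun setT (\1_(`]a, b]%classic) : R -> R) by exact: measurable_indic.
  exact: (measurableT_comp m1 mX).
have mf_ n : measurable_fun setT (f_ n).
  by apply/measurable_EFinP; apply: measurable_funM => //; apply: measurable_funB.
have [] := @dominated_convergence _ _ _ P setT measurableT f_ f (cst (C * pi)%:E) mf_ mf.
- apply: aeW => t _; apply: cvg_EFin; first by near=> n.
  rewrite /f_ /=; apply: cvgM; first exact: cvg_cst.
  rewrite (_ : pi * _ = (if 0 < X t - a then pi / 2 else - (pi / 2)) -
     (if 0 < X t - b then pi / 2 else - (pi / 2))).
    by apply: cvgB; exact: cvg_atan_step.
  rewrite !subr_gt0 indicE; case: (ltP a (X t)) => h1; case: (ltP b (X t)) => h2.
  + rewrite subrr memNset ?mulr0 //= in_itv /= h1 /=; apply/negP; by rewrite -ltNge.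
  + rewrite mem_set ?mulr1; first by lra.
    by rewrite /= in_itv /= h1.
  + by have := lt_trans (lt_le_trans h2 h1) ab; rewrite ltxx.
  + rewrite subrr memNset ?mulr0 //= in_itv /=; apply/negP; by rewrite ltNge h1.
- apply/integrableP; split => //.
  by rewrite integral_cst //= probability_setT mule1 ltry.
- apply: aeW => t n _; rewrite lee_fin normrM (ger0_norm (w0 t)).
  rewrite ler_pM //.
  set u := _ * (X t - a) - _; set v := _ * (X t - b) - _.
  have := @atan_gtNpi2 R u; have := @atan_ltpi2 R u.
  have := @atan_gtNpi2 R v; have := @atan_ltpi2 R v.
  by rewrite ler_norml => *; lra.
by move=> _ _; exact.
Unshelve. all: by end_near. Qed.

End Limit.

Section TwoWorlds2.
Variable R : realType.
Context d1 (T1 : measurableType d1) (P1 : probability T1 R).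
Context d2 (T2 : measurableType d2) (P2 : probability T2 R).

Section unique1.
Variables (w1 X1 : T1 -> R) (w2 X2 : T2 -> R) (C : R).
Hypotheses (mw1 : measurable_fun setT w1) (mX1 : measurable_fun setT X1).
Hypotheses (mw2 : measurable_fun setT w2) (mX2 : measurable_fun setT X2).
Hypotheses (w10 : forall t, 0 <= w1 t) (w1C : forall t, w1 t <= C).
Hypotheses (w20 : forall t, 0 <= w2 t) (w2C : forall t, w2 t <= C).

Local Notation E1 := (wE P1 w1 X1).
Local Notation E2 := (wE P2 w2 X2).

Hypothesis Ecos : forall al s : R,
  E1 (fun x => 1 + cos (al * x + s)) = E2 (fun x => 1 + cos (al * x + s)).

Lemma wE_itv (a b : R) : E1 (\1_(`]a, b]%classic)) = E2 (\1_(`]a, b]%classic)).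
Proof.
have [ab|ba] := ltP a b; last first.
  have -> : `]a, b]%classic = set0 :> set R.
    by apply/seteqP; split => // x /=; rewrite in_itv /= => /andP[h1 h2]; have := lt_le_trans h1 (le_trans h2 ba); rewrite ltxx.
  rewrite /wE; transitivity (0 : \bar R)%E; [|symmetry];
   by apply: integral0_eq => t _; rewrite indic0 mulr0.
have h1 := wE_step mw1 mX1 w10 w1C ab.
have h2 := wE_step mw2 mX2 w20 w2C ab.
have h : E1 (fun x => pi * \1_(`]a, b]%classic) x) = E2 (fun x => pi * \1_(`]a, b]%classic) x).
  apply: (cvg_unique (@ereal_hausdorff R) (h1 P1)).
  rewrite /= [X in X @ \oo](_ : _ = (fun n : nat => E2 (fun x =>
    atan (n.+1%:R ^+ 2 * (x - a) - n.+1%:R) - atan (n.+1%:R ^+ 2 * (x - b) - n.+1%:R)))).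
    exact: h2.
  apply/funext => n; apply: (wE_atan mw1 mX1 mw2 mX2 w10 w1C w20 w2C Ecos _ _ ab).
  by rewrite exprn_gt0.
rewrite !wEZ ?pi_ge0 // in h.
have f1 : E1 (\1_(`]a, b]%classic)) \is a fin_num.
  by apply: (@wE_fin R _ _ P1 w1 X1 C mw1 mX1 w10 w1C _ 1) => // x; rewrite indicE; case: (_ \in _); rewrite ?lexx ?ler01.
have f2 : E2 (\1_(`]a, b]%classic)) \is a fin_num.
  by apply: (@wE_fin R _ _ P2 w2 X2 C mw2 mX2 w20 w2C _ 1) => // x; rewrite indicE; case: (_ \in _); rewrite ?lexx ?ler01.
move: h; rewrite -(fineK f1) -(fineK f2) -!EFinM => -[] /mulfI h.
by congr EFin; apply: h; rewrite gt_eqF // pi_gt0.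
Qed.

Lemma wE_borel (B : set R) : measurable B -> E1 (\1_B) = E2 (\1_B).
Proof.
move=> mB.
have fin1 (A : set R) : measurable A -> E1 (\1_A) \is a fin_num.
  by move=> mA; apply: (@wE_fin R _ _ P1 w1 X1 C mw1 mX1 w10 w1C _ 1) => // x; rewrite indicE; case: (_ \in _); rewrite ?lexx ?ler01.
have fin2 (A : set R) : measurable A -> E2 (\1_A) \is a fin_num.
  by move=> mA; apply: (@wE_fin R _ _ P2 w2 X2 C mw2 mX2 w20 w2C _ 1) => // x; rewrite indicE; case: (_ \in _); rewrite ?lexx ?ler01.
have one : E1 (\1_setT) = E2 (\1_setT).
  have := wE_1 mw1 mX1 mw2 mX2 w10 w1C w20 w2C Ecos.
  by rewrite (_ : \1_setT = cst 1) // ; apply/funext => x; rewrite indicT.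
have add d (T : measurableType d) (P : probability T R) (w X : T -> R) (A : set R) :
    measurable_fun setT w -> measurable_fun setT X -> (forall t, 0 <= w t) ->
    measurable A -> wE P w X (\1_setT) = (wE P w X (\1_A) + wE P w X (\1_(~` A)))%E.
  move=> mw mX w0 mA; rewrite -wED //; last exact: measurable_indic (measurableC mA).
  by congr wE; apply/funext => x; rewrite indicT !indicE in_setC; case: (x \in A); rewrite ?addr0 ?add0r.
apply: (@dynkin_induction _ (measurableTypeR R) (@ocitv R) (fun B => E1 (\1_B) = E2 (\1_B))) => //.
- exact: ocitvI.
- by move=> _ [[a b] _ <-]; exact: wE_itv.
- move=> A mA hA.
  have := one; rewrite (add _ _ _ _ _ A) // (add _ _ P2 _ _ A) // hA.
  exact: (addeI_fin (fin2 _ mA)).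
- move=> F mF tF hF.
  have ser d (T : measurableType d) (P : probability T R) (w X : T -> R) :
    measurable_fun setT w -> measurable_fun setT X -> (forall t, 0 <= w t) ->
     wE P w X (\1_(\bigcup_k F k)) = (\sum_(k <oo) wE P w X (\1_(F k)))%E.
    move=> mw mX w0; rewrite /wE -integral_nneseries //.
    + apply: eq_integral => t _; rewrite EFinM.
      rewrite indic_bigcup // -nneseriesZl; last by move=> k _; rewrite lee_fin.
      by apply: eq_eseriesr => k _; rewrite EFinM.
    + move=> n; apply/measurable_EFinP; apply: measurable_funM => //.
      have m1 : measurable_fun setT (\1_(F n) : measurableTypeR R -> R).
        exact: (measurable_indic (mF n)).
      exact: (measurableT_comp m1 mX).
    + by move=> n t _; rewrite lee_fin mulr_ge0.
  by rewrite ser // ser //; apply: eq_eseriesr => k _; exact: hF.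
Qed.

End unique1.
End TwoWorlds2.

(** * Gaussian processes *)

Section Density.
Local Open Scope ereal_scope.
Context d (X : measurableType d) (R : realType).
Variables (mu nu : {measure set X -> \bar R}) (g : X -> \bar R).
Hypotheses (mg : measurable_fun setT g) (g0 : forall x, 0 <= g x).
Hypothesis gfin : forall x, g x \is a fin_num.
Hypothesis nuE : forall A, measurable A -> nu A = \int[mu]_(x in A) g x.
Import HBNNSimple.

Lemma integral_density_nnsfun (h : {nnsfun X >-> R}) :
  \int[nu]_x (h x)%:E = \int[mu]_x ((h x)%:E * g x).
Proof.
under [LHS]eq_integral do rewrite fimfunE -fsumEFin//.
rewrite [LHS]ge0_integral_fsum//; last 2 first.
  - by move=> r; exact/measurable_EFinP/measurableT_comp.
  - by move=> n x _; rewrite EFinM nnfun_muleindic_ge0.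
under [RHS]eq_integral.
  move=> x xD; rewrite fimfunE -fsumEFin// ge0_mule_fsuml; last first.
    by move=> r; rewrite EFinM nnfun_muleindic_ge0.
  over.
rewrite [RHS]ge0_integral_fsum//; last 2 first.
  - move=> r; apply: emeasurable_funM => //; exact/measurable_EFinP/measurableT_comp.
  - by move=> n x _; rewrite mule_ge0 // EFinM nnfun_muleindic_ge0.
apply: eq_fsbigr => r _.
under eq_integral do rewrite EFinM.
rewrite integralZl_indic_nnsfun // integral_indic // setIT nuE //.
under [RHS]eq_integral do rewrite EFinM -muleA.
have [r0|r0] := leP 0%R r.
  rewrite [RHS]ge0_integralZl_EFin //; last 2 first.
  - by move=> x _; rewrite mule_ge0 // lee_fin.
  - apply: emeasurable_funM => //; exact/measurable_EFinP.
  congr (_ * _); rewrite integral_mkcond; apply: eq_integral => x _.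
  by rewrite patchE indicE; case: (x \in _); rewrite ?mul1e ?mul0e.
rewrite preimage_nnfun0 // integral_set0 mule0; symmetry; apply: integral0_eq => x _.
by rewrite indic0 mul0e mule0.
Qed.

Lemma ge0_integral_density (h : X -> \bar R) : measurable_fun setT h -> (forall x, 0 <= h x) ->
  \int[nu]_x h x = \int[mu]_x (h x * g x).
Proof.
move=> mh h0.
pose h_ := nnsfun_approx measurableT mh.
transitivity (limn (fun n => \int[nu]_x (h_ n x)%:E)).
  rewrite -monotone_convergence//=.
  - apply: eq_integral => x _; apply/esym/cvg_lim => //=.
    exact: cvg_nnsfun_approx.
  - by move=> n; exact/measurable_EFinP/measurable_funTS.
  - by move=> n x _; rewrite lee_fin.
  - by move=> x _ m n mn; rewrite lee_fin; exact/lefP/nd_nnsfun_approx.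
transitivity (limn (fun n => \int[mu]_x ((h_ n x)%:E * g x))).
  by apply: congr_lim; apply/funext => n; exact: integral_density_nnsfun.
rewrite -monotone_convergence//=.
- apply: eq_integral => x _; apply/cvg_lim => //=.
  apply: cvgeZr; first exact: gfin.
  exact: cvg_nnsfun_approx.
- move=> n; apply: emeasurable_funM => //; exact/measurable_EFinP/measurable_funTS.
- by move=> n x _; rewrite mule_ge0 // lee_fin.
- move=> x _ m n mn; rewrite lee_wpmul2r // lee_fin; exact/lefP/nd_nnsfun_approx.
Qed.

End Density.

Section LebesgueSymmetry.
Variable R : realType.
Notation mu := (@lebesgue_measure R).

Definition refl (c x : R) : R := c - x.

Lemma mrefl (c : R) : measurable_fun setT (refl c : measurableTypeR R -> measurableTypeR R).
Proof. exact: measurable_funB. Qed.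

Lemma lebesgue_refl (c : R) (A : set R) : measurable A -> mu (refl c @^-1` A) = mu A.
Proof.
move=> mA.
have m1 := mrefl c.
pose phi : {mfun measurableTypeR R >-> measurableTypeR R} :=
  HB.pack (refl c : measurableTypeR R -> measurableTypeR R) (isMeasurableFun.Build _ _ _ _ _ m1).
symmetry; apply: (@lebesgue_measure_unique R (pushforward mu phi)) => //.
move=> _ [[a b] _ <-] /=; rewrite /pushforward.
have -> : refl c @^-1` `]a, b]%classic = `[c - b, c - a[%classic.
  by apply/seteqP; split => x /=; rewrite !in_itv /= /refl => /andP[h1 h2]; apply/andP; split; lra.
rewrite !lebesgue_measure_itv /= !lte_fin ltrD2l ltrN2.
case: ifP => // _; rewrite -!EFinB; congr EFin; lra.
Qed.

Lemma integral_refl (c : R) (f : R -> \bar R) : measurable_fun setT f -> (forall x, (0 <= f x)%E) ->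
  (\int[mu]_x f (c - x)%R = \int[mu]_x f x)%E.
Proof.
move=> mf f0.
have m1 := mrefl c.
pose phi : {mfun measurableTypeR R >-> measurableTypeR R} :=
  HB.pack (refl c : measurableTypeR R -> measurableTypeR R) (isMeasurableFun.Build _ _ _ _ _ m1).
have := @ge0_integral_pushforward _ _ _ _ R phi m1 mu setT f measurableT mf.
rewrite preimage_setT => <- //.
apply: eq_measure_integral => A mA _; rewrite /= /pushforward; exact: lebesgue_refl.
Qed.

(** A translation is the composition of two reflections, so the invariance under reflections
    suffices. *)
Lemma integral_shift (c : R) (f : R -> \bar R) : measurable_fun setT f -> (forall x, (0 <= f x)%E) ->
  (\int[mu]_x f (x + c)%R = \int[mu]_x f x)%E.
Proof.
move=> mf f0; rewrite -(integral_refl c mf f0) -(@integral_refl 0 (fun x => f (c - x))) //.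
  by apply: eq_integral => x _; rewrite sub0r opprK addrC.
by apply: (measurableT_comp mf); exact: mrefl.
Qed.

End LebesgueSymmetry.

Section Gauss.
Variable R : realType.
Notation mu := (@lebesgue_measure R).

Definition gauss_pdf (v x : R) : R := (Num.sqrt (2 * pi * v))^-1 * expR (- (x ^+ 2) / (2 * v)).

(* locked: unification must not unfold the test [v == 0] *)
Fact gauss_key : unit. Proof. exact: tt. Qed.
Definition gauss (v : R) : probability (measurableTypeR R) R :=
  locked_with gauss_key (if v == 0 then (@dirac _ (measurableTypeR R) 0 R : probability (measurableTypeR R) R)
  else normal_prob 0 (Num.sqrt v)).

Lemma gauss_pdf_ge0 v x : 0 <= gauss_pdf v x.
Proof. by rewrite mulr_ge0 ?expR_ge0 // invr_ge0 sqrtr_ge0. Qed.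

Lemma pgN v x : gauss_pdf v (- x) = gauss_pdf v x.
Proof. by rewrite /gauss_pdf sqrrN. Qed.

Lemma pgE (v m x : R) : 0 < v -> normal_pdf m (Num.sqrt v) x = gauss_pdf v (x - m).
Proof.
move=> v0; rewrite normal_pdfE ?gt_eqF ?sqrtr_gt0 // /normal_peak /normal_fun sqr_sqrtr ?ltW //.
congr ((Num.sqrt _)^-1 * expR (_ / _)); first by rewrite -mulr_natl; ring.
by rewrite -mulr_natl.
Qed.

Lemma continuous_gauss_pdf v : continuous (gauss_pdf v).
Proof.
move=> x; apply: cvgM; first exact: cvg_cst.
apply: (@continuous_comp _ _ _ (fun x : R => - x ^+ 2 / (2 * v)) expR); last exact: continuous_expR.
apply: cvgM; last exact: cvg_cst.
by apply: cvgN; exact: exprn_continuous.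
Qed.

Lemma measurable_gauss_pdf v : measurable_fun setT (gauss_pdf v).
Proof. apply: continuous_measurable_fun; exact: continuous_gauss_pdf. Qed.

Lemma integral_gauss_pdf v m : 0 < v -> (\int[mu]_x (gauss_pdf v (x - m))%:E = 1)%E.
Proof.
move=> v0; rewrite -(integral_normal_pdf m (Num.sqrt v)).
by apply: eq_integral => x _; rewrite pgE.
Qed.

Lemma integral_gauss v (h : R -> \bar R) : 0 < v -> measurable_fun setT h ->
  (forall x, (0 <= h x)%E) -> (\int[gauss v]_x h x = \int[mu]_x (h x * (gauss_pdf v x)%:E))%E.
Proof.
move=> v0 mh h0.
apply: (@ge0_integral_density _ (measurableTypeR R) R mu (gauss v) (fun x => (gauss_pdf v x)%:E)) => //.
- by apply/measurable_EFinP; exact: measurable_gauss_pdf.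
- by move=> x; rewrite lee_fin gauss_pdf_ge0.
- move=> A mA; rewrite /gauss unlock gt_eqF //= /normal_prob.
  by apply: eq_integral => x _; rewrite pgE // subr0.
Qed.

Lemma integral_gauss0 (h : R -> \bar R) : measurable_fun setT h ->
  (forall x, (0 <= h x)%E) -> (\int[gauss 0]_x h x = h 0%R)%E.
Proof.
move=> mh h0; rewrite /gauss unlock eqxx /=.
by rewrite integral_dirac // diracT mul1e.
Qed.

(* completing the square *)
Lemma gauss_pdf_conv_pt s t x y z : 0 < s -> 0 < t ->
  gauss_pdf s (x - z) * gauss_pdf t (z - y) = gauss_pdf (s + t) (x - y) * gauss_pdf (s * t / (s + t)) (z - (t * x + s * y) / (s + t)).
Proof.
move=> s0 t0; have st0 : 0 < s + t by rewrite addr_gt0.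
have p0 := @pi_gt0 R.
have sq : Num.sqrt (2 * pi * s) * Num.sqrt (2 * pi * t) =
   Num.sqrt (2 * pi * (s + t)) * Num.sqrt (2 * pi * (s * t / (s + t))).
  rewrite -!sqrtrM ?mulr_ge0 ?ltW // ?addr_gt0 //; congr Num.sqrt.
  by field; rewrite gt_eqF.
rewrite /gauss_pdf mulrACA -expRD -invfM sq [RHS]mulrACA -expRD -invfM; congr (_ * expR _).
by field; rewrite !gt_eqF.
Qed.

Lemma gauss_pdf_conv s t x y : 0 < s -> 0 < t ->
  (\int[mu]_z (gauss_pdf s (x - z) * gauss_pdf t (z - y))%:E = (gauss_pdf (s + t) (x - y))%:E)%E.
Proof.
move=> s0 t0; have st0 : 0 < s + t by rewrite addr_gt0.
under eq_integral do rewrite gauss_pdf_conv_pt // EFinM.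
rewrite ge0_integralZl_EFin ?gauss_pdf_ge0 //.
- by rewrite integral_gauss_pdf ?mule1 // divr_gt0 // mulr_gt0.
- by move=> z _; rewrite lee_fin gauss_pdf_ge0.
- apply/measurable_EFinP; apply: (measurableT_comp (measurable_gauss_pdf _)).
  exact: measurable_funB.
Qed.

Lemma gauss_conv s t (h : R -> \bar R) : 0 <= s -> 0 <= t -> measurable_fun setT h ->
  (forall x, (0 <= h x)%E) ->
  (\int[gauss s]_x \int[gauss t]_y h (x + y)%R = \int[gauss (s + t)]_z h z)%E.
Proof.
move=> s0 t0 mh h0.
have mhx x : measurable_fun setT (fun y : R => h (x + y)).
  by apply: (measurableT_comp mh); apply: measurable_funD.
have mh2 : measurable_fun setT (fun z : R * R => h (z.1 + z.2)).
  by apply: (measurableT_comp mh); apply: measurable_funD.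
pose H (x : R) : \bar R := (\int[gauss t]_y h (x + y)%R)%E.
have H0 x : (0 <= H x)%E by apply: integral_ge0 => y _; exact: h0.
have mH : measurable_fun setT H.
  by apply: (measurable_fun_fubini_tonelli_F (m2 := gauss t) (fun z : R * R => h (z.1 + z.2)%R)) => // z; exact: h0.
(* A vanishing variance means the Dirac mass at 0, which has no density, so it is split off. *)
have [->|s_neq0] := eqVneq s 0.
  transitivity (H 0); first exact: (integral_gauss0 mH H0).
  have -> : 0 + t = t by rewrite add0r.
  by apply: eq_integral => y _; congr h; rewrite add0r.
have sp : 0 < s by rewrite lt_neqAle eq_sym s_neq0.
have [->|t_neq0] := eqVneq t 0.
  rewrite addr0; apply: eq_integral => x _; rewrite integral_gauss0 // addr0 //.
have tp : 0 < t by rewrite lt_neqAle eq_sym t_neq0.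
apply: (etrans (integral_gauss sp mH H0)).
rewrite (integral_gauss (addr_gt0 sp tp) mh h0).
transitivity (\int[mu]_x \int[mu]_z (h z * (gauss_pdf t (z - x))%:E * (gauss_pdf s x)%:E))%E.
  apply: eq_integral => x _.
  rewrite /H (integral_gauss tp (mhx x)) // -(integral_shift (- x)).
  - rewrite -ge0_integralZr //.
    + by apply: eq_integral => z _; rewrite addrC subrK.
    + apply: emeasurable_funM.
        by apply: (measurableT_comp mh); apply: measurable_funD => //; apply: measurable_funD.
      by apply/measurable_EFinP/(measurableT_comp (measurable_gauss_pdf _)); apply: measurable_funD.
    + by move=> z _; rewrite mule_ge0 // lee_fin gauss_pdf_ge0.
    + by rewrite lee_fin gauss_pdf_ge0.
  - by apply: emeasurable_funM => //; apply/measurable_EFinP; exact: measurable_gauss_pdf.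
  - by move=> y; rewrite mule_ge0 // lee_fin gauss_pdf_ge0.
rewrite (@fubini_tonelli _ _ _ _ _ mu mu (fun w => (h w.2 * (gauss_pdf t (w.2 - w.1))%:E * (gauss_pdf s w.1)%:E)%E)) /=.
- apply: eq_integral => z _.
  have := gauss_pdf_conv z 0 tp sp; rewrite subr0 [t + s]addrC => <-.
  rewrite -ge0_integralZl //.
  + apply: eq_integral => x _; rewrite [(x - 0)%R]subr0 [in RHS]EFinM [in RHS]muleA; reflexivity.
  + apply/measurable_EFinP; apply: measurable_funM; apply: (measurableT_comp (measurable_gauss_pdf _)).
      exact: measurable_funB.
    exact: measurable_funB.
  + by move=> x _; rewrite lee_fin mulr_ge0 ?gauss_pdf_ge0.
- apply: emeasurable_funM; first apply: emeasurable_funM.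
  + exact: (measurableT_comp mh measurable_snd).
  + apply/measurable_EFinP; apply: (measurableT_comp (measurable_gauss_pdf _)).
    exact: measurable_funB.
  + by apply/measurable_EFinP; exact: (measurableT_comp (measurable_gauss_pdf _) measurable_fst).
- by move=> w; rewrite !mule_ge0 // lee_fin gauss_pdf_ge0.
Qed.

Lemma integral_gauss_exp v (a : R) : 0 <= v ->
  (\int[gauss v]_x (expR (a * x))%:E = (expR (a ^+ 2 * v / 2))%:E)%E.
Proof.
move=> v0.
have me : measurable_fun setT (fun x : R => (expR (a * x))%:E).
  apply/measurable_EFinP; apply: (measurableT_comp (@measurable_expR R)).
  exact: measurable_funM.
have [->|vn] := eqVneq v 0.
  by rewrite integral_gauss0 //; rewrite ?mulr0 ?mul0r // => x; rewrite lee_fin expR_ge0.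
have vp : 0 < v by rewrite lt_neqAle eq_sym vn.
rewrite integral_gauss //.
transitivity (\int[mu]_x ((expR (a ^+ 2 * v / 2))%:E * (gauss_pdf v (x - a * v))%:E))%E.
  apply: eq_integral => x _; rewrite -!EFinM; congr EFin.
  rewrite /gauss_pdf mulrCA [RHS]mulrCA -!expRD; congr (_ * expR _).
  by field; rewrite gt_eqF.
rewrite ge0_integralZl_EFin ?expR_ge0 ?integral_gauss_pdf ?mule1 //.
- by move=> x _; rewrite lee_fin gauss_pdf_ge0.
- apply/measurable_EFinP; apply: (measurableT_comp (measurable_gauss_pdf _)); exact: measurable_funB.
Qed.

End Gauss.

(** * Finite-dimensional laws from cosines of linear combinations *)

Section OneWorld.
Variable R : realType.
Context d (T : measurableType d) (P : probability T R).
Variables (X : nat -> T -> R) (n : nat).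
Hypothesis mX : forall i, measurable_fun setT (X i).
Implicit Types (B : nat -> set R) (a : nat -> R) (s : R).

Definition boxind B j t : R := \prod_(i < j) \1_(B i) (X i t).

(** Interpolates between cosines and indicators: the first [j] coordinates are confined to sets, the
    others enter through a cosine, kept nonnegative by the summand 1. *)
Definition boxcos B j a s : \bar R :=
  (\int[P]_t (boxind B j t * (1 + cos (s + \sum_(j <= i < n) a i * X i t)))%:E)%E.

Lemma boxind_ge0 B j t : 0 <= boxind B j t.
Proof. by apply: prodr_ge0 => i _; rewrite indicE. Qed.

Lemma boxind_le1 B j t : boxind B j t <= 1.
Proof.
elim: j => [|j IH]; rewrite /boxind ?big_ord0 // big_ord_recr /= -/(boxind B j t).
rewrite -[leRHS]mulr1 ler_pM ?boxind_ge0 // indicE ?ler0n //.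
Qed.

Lemma mboxind B j : (forall i, measurable (B i)) -> measurable_fun setT (boxind B j).
Proof.
move=> mB; elim: j => [|j IH].
  by rewrite /boxind; under eq_fun do rewrite big_ord0; exact: measurable_cst.
rewrite /boxind; under eq_fun do rewrite big_ord_recr /=.
apply: measurable_funM; first exact: IH.
have m1 : measurable_fun setT (\1_(B j) : measurableTypeR R -> R).
  exact: (measurable_indic (mB j)).
exact: (measurableT_comp m1 (mX j)).
Qed.

Lemma mcos1 (f : T -> R) : measurable_fun setT f -> measurable_fun setT (fun t => 1 + cos (f t)).
Proof.
move=> mf; apply: measurable_funD => //.
exact: (measurableT_comp (continuous_measurable_fun (@continuous_cos R))).
Qed.

Lemma mlincomb a s j : measurable_fun setT (fun t => s + \sum_(j <= i < n) a i * X i t).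
Proof.
apply: measurable_funD => //; apply: measurable_sum => i.
exact: measurable_funM.
Qed.

Lemma boxcos_fin B j a s : (forall i, measurable (B i)) -> boxcos B j a s \is a fin_num.
Proof.
move=> mB; rewrite ge0_fin_numE; last first.
  by apply: integral_ge0 => t _; rewrite lee_fin mulr_ge0 ?boxind_ge0 ?cos1_ge0.
apply: (@le_lt_trans _ _ (\int[P]_t (2 : R)%:E)%E); last first.
  by rewrite integral_cst //= probability_setT mule1 ltry.
apply: ge0_le_integral => //.
- by move=> t _; rewrite lee_fin mulr_ge0 ?boxind_ge0 ?cos1_ge0.
- apply/measurable_EFinP; apply: measurable_funM; first exact: mboxind.
  exact/mcos1/mlincomb.
- move=> t _; rewrite lee_fin -[leRHS]mul1r ler_pM ?boxind_ge0 ?cos1_ge0 ?boxind_le1 //.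
  by have := cos_le1 (s + \sum_(j <= i < n) a i * X i t); lra.
Qed.

Lemma boxcosS B j a s :
  boxcos B j.+1 a s =
  wE P (fun t => boxind B j t * (1 + cos (s + \sum_(j.+1 <= i < n) a i * X i t))) (X j) (\1_(B j)).
Proof.
rewrite /boxcos /wE; apply: eq_integral => t _; congr EFin.
by rewrite /boxind big_ord_recr /= mulrAC.
Qed.

Definition upd a j (x : R) : nat -> R := fun i => if i == j then x else a i.

Lemma sum_upd a j x t : (j < n)%N ->
  \sum_(j <= i < n) upd a j x i * X i t = x * X j t + \sum_(j.+1 <= i < n) a i * X i t.
Proof.
move=> jn; rewrite big_ltn // /upd eqxx; congr (_ + _).
by apply: eq_big_nat => i /andP[ji _]; rewrite gtn_eqF.
Qed.

(** The product formula for two cosines, written with the nonnegative functions [1 + cos] only; the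
    second term on the left, twice the mass of the box, balances the constants. *)
Lemma boxcos_split B j a s al sg : (j < n)%N -> (forall i, measurable (B i)) ->
  (wE P (fun t => boxind B j t * (1 + cos (s + \sum_(j.+1 <= i < n) a i * X i t)))%R (X j)
     (fun x => 1 + cos (al * x + sg))%R + boxcos B j (fun=> 0%R) 0%R =
  (boxcos B j (upd a j 0%R) s + boxcos B j (upd (fun=> 0%R) j al) sg) +
  ((2^-1)%:E * boxcos B j (upd a j al) (s + sg)%R + (2^-1)%:E * boxcos B j (upd a j (- al)%R) (s - sg)%R))%E.
Proof.
move=> jn mB.
have mI a' s' : measurable_fun setT (fun t => (boxind B j t * (1 + cos (s' + \sum_(j <= i < n) a' i * X i t)))%:E).
  apply/measurable_EFinP; apply: measurable_funM; first exact: mboxind.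
  exact/mcos1/mlincomb.
have I0 a' s' t : (0 <= (boxind B j t * (1 + cos (s' + \sum_(j <= i < n) a' i * X i t)))%:E)%E.
  by rewrite lee_fin mulr_ge0 ?boxind_ge0 ?cos1_ge0.
have mw : measurable_fun setT (fun t => ((boxind B j t * (1 + cos (s + \sum_(j.+1 <= i < n) a i * X i t))) * (1 + cos (al * X j t + sg)))%:E).
  apply/measurable_EFinP; apply: measurable_funM; first apply: measurable_funM.
  - exact: mboxind.
  - exact/mcos1/mlincomb.
  - by apply: mcos1; apply: measurable_funD => //; exact: measurable_funM.
rewrite /wE /boxcos -!ge0_integralZl_EFin //; try by rewrite invr_ge0.
have mZ a' s' : measurable_fun setT (fun t => ((2^-1)%:E * (boxind B j t * (1 + cos (s' + \sum_(j <= i < n) a' i * X i t)))%:E)%E).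
  exact: emeasurable_funM.
have Z0 a' s' t : (0 <= (2^-1)%:E * (boxind B j t * (1 + cos (s' + \sum_(j <= i < n) a' i * X i t)))%:E)%E.
  by rewrite mule_ge0 // lee_fin invr_ge0.
rewrite -!ge0_integralD //; last 5 first.
- by move=> t _; rewrite adde_ge0.
- exact: emeasurable_funD.
- by move=> t _; rewrite adde_ge0.
- exact: emeasurable_funD.
- by move=> t _; rewrite lee_fin !mulr_ge0 ?boxind_ge0 ?cos1_ge0.
apply: eq_integral => t _.
rewrite !sum_upd // -!EFinM -!EFinD; congr EFin.
rewrite [\sum_(j <= i < n) _]big1; last by move=> i _; rewrite mul0r.
rewrite [\sum_(j.+1 <= i < n) 0 * _]big1; last by move=> i _; rewrite mul0r.
rewrite mul0r !addr0 add0r cos0.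
set u := \sum_(j.+1 <= i < n) _; set v := al * X j t; set b := boxind B j t.
have -> : s + sg + (v + u) = (s + u) + (v + sg) by ring.
have -> : s - sg + (- al * X j t + u) = (s + u) - (v + sg) by rewrite /v; ring.
have -> : sg + v = v + sg by ring.
set U := s + u; set V := v + sg.
rewrite (cosD U V) (cosB U V).
by field.
Qed.

Lemma boxind_indic B m t :
  boxind B m t = \1_[set t | forall i, (i < m)%N -> B i (X i t)] t.
Proof.
elim: m => [|m IH].
  by rewrite /boxind big_ord0 indicE mem_set.
rewrite /boxind big_ord_recr /= -/(boxind B m t) IH !indicE -natrM mulnb.
congr (nat_of_bool _)%:R; apply/andP/idP; rewrite !inE /=.
  by move=> [h hn] i; rewrite ltnS leq_eqVlt => /orP[/eqP ->|]; [|exact: h].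
by move=> h; split => [i hi|]; apply: h => //; exact: ltnW.
Qed.

End OneWorld.

Section TwoWorldsMulti.
Variable R : realType.
Context d1 (T1 : measurableType d1) (P1 : probability T1 R).
Context d2 (T2 : measurableType d2) (P2 : probability T2 R).
Variables (X1 : nat -> T1 -> R) (X2 : nat -> T2 -> R) (n : nat).
Hypothesis mX1 : forall i, measurable_fun setT (X1 i).
Hypothesis mX2 : forall i, measurable_fun setT (X2 i).
Hypothesis Hcos : forall (a : nat -> R) (s : R),
  (\int[P1]_t (1 + cos (s + \sum_(0 <= i < n) a i * X1 i t))%:E =
   \int[P2]_t (1 + cos (s + \sum_(0 <= i < n) a i * X2 i t))%:E)%E.

(** Coordinates are converted one at a time: [boxcos_split] supplies the cosine hypothesis of
    [wE_borel] for coordinate [j], with the sets before it and the cosine after it as weight. *)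
Lemma boxcos_eq j (B : nat -> set R) (a : nat -> R) s : (j <= n)%N -> (forall i, measurable (B i)) ->
  boxcos P1 X1 n B j a s = boxcos P2 X2 n B j a s.
Proof.
elim: j B a s => [|j IH] B a s jn mB.
  rewrite /boxcos /boxind; under eq_integral do rewrite big_ord0 mul1r.
  by under [RHS]eq_integral do rewrite big_ord0 mul1r; exact: Hcos.
rewrite !boxcosS.
apply: (@wE_borel R _ _ P1 _ _ P2 _ (X1 j) _ (X2 j) 2) => //.
- by apply: measurable_funM; [exact: mboxind | exact/mcos1/mlincomb].
- by apply: measurable_funM; [exact: mboxind | exact/mcos1/mlincomb].
- by move=> t; rewrite mulr_ge0 ?boxind_ge0 ?cos1_ge0.
- move=> t; rewrite -[leRHS]mul1r ler_pM ?boxind_ge0 ?cos1_ge0 ?boxind_le1 //.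
  by have := cos_le1 (s + \sum_(j.+1 <= i < n) a i * X1 i t); lra.
- by move=> t; rewrite mulr_ge0 ?boxind_ge0 ?cos1_ge0.
- move=> t; rewrite -[leRHS]mul1r ler_pM ?boxind_ge0 ?cos1_ge0 ?boxind_le1 //.
  by have := cos_le1 (s + \sum_(j.+1 <= i < n) a i * X2 i t); lra.
move=> al sg.
have h1 := boxcos_split P1 mX1 a s al sg jn mB.
have h2 := boxcos_split P2 mX2 a s al sg jn mB.
rewrite !(IH _ _ _ (ltnW jn) mB) -h2 in h1.
apply: (@addeI_fin R (boxcos P2 X2 n B j (fun=> 0) 0)).
  exact: boxcos_fin.
by rewrite addeC h1 addeC.
Qed.

Lemma boxind_eq (B : nat -> set R) : (forall i, measurable (B i)) ->
  (\int[P1]_t (boxind X1 B n t)%:E = \int[P2]_t (boxind X2 B n t)%:E)%E.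
Proof.
move=> mB; have := boxcos_eq (fun=> 0) 0 (leqnn n) mB.
rewrite /boxcos.
under eq_integral do rewrite big_geq // addr0 cos0 mulrC EFinM.
under [X in _ = X -> _]eq_integral do rewrite big_geq // addr0 cos0 mulrC EFinM.
have two0 : 0 <= 1 + 1 :> R by lra.
rewrite !ge0_integralZl_EFin //; last 4 first.
- by move=> t _; rewrite lee_fin boxind_ge0.
- by apply/measurable_EFinP; exact: mboxind.
- by move=> t _; rewrite lee_fin boxind_ge0.
- by apply/measurable_EFinP; exact: mboxind.
have fin d (T : measurableType d) (P : probability T R) (X : nat -> T -> R) :
   (forall i, measurable_fun setT (X i)) -> (\int[P]_t (boxind X B n t)%:E)%E \is a fin_num.
  move=> mX; rewrite ge0_fin_numE; last first.
    by apply: integral_ge0 => t _; rewrite lee_fin boxind_ge0.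
  apply: (@le_lt_trans _ _ (\int[P]_t (1 : R)%:E)%E); last first.
    by rewrite integral_cst //= probability_setT mule1 ltry.
  apply: ge0_le_integral => //.
  - by move=> t _; rewrite lee_fin boxind_ge0.
  - by apply/measurable_EFinP; exact: mboxind.
  - by move=> t _; rewrite lee_fin boxind_le1.
rewrite -(fineK (fin _ _ P1 _ mX1)) -(fineK (fin _ _ P2 _ mX2)) -!EFinM => -[] /mulfI h.
by congr EFin; apply: h; rewrite gt_eqF //; lra.
Qed.

End TwoWorldsMulti.

(** * Gaussian spaces: orthogonality implies independence *)

Section GaussianSpace.
Variable R : realType.
Context d (T : measurableType d) (P : probability T R).
Variables (F : lmodType R) (L : F -> T -> R) (c : F -> F -> R).

(* [L] is a centred Gaussian process, linear in its index, with covariance form [c]. *)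
Definition gaussian_space : Prop :=
  [/\ forall f, measurable_fun setT (L f),
      forall (a : R) f g t, L (a *: f + g) t = a * L f t + L g t,
      (forall (a : R) f g h, c (a *: f + g) h = a * c f h + c g h) /\ (forall f g, c f g = c g f),
      forall f, 0 <= c f f
    & forall f (h : R -> \bar R), measurable_fun setT h -> (forall x, 0 <= h x)%E ->
        (\int[P]_t h (L f t) = \int[gauss (c f f)]_x h x)%E].

Hypothesis G : gaussian_space.

Let mL f : measurable_fun setT (L f). Proof. by case: G. Qed.
Let Llin (a : R) f g t : L (a *: f + g) t = a * L f t + L g t. Proof. by case: G. Qed.
Let cZD (a : R) f g h : c (a *: f + g) h = a * c f h + c g h. Proof. by case: G => _ _ []. Qed.
Let csym f g : c f g = c g f. Proof. by case: G => _ _ []. Qed.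
Let c_ge0 f : 0 <= c f f. Proof. by case: G. Qed.
Let law f (h : R -> \bar R) : measurable_fun setT h -> (forall x, 0 <= h x)%E ->
  (\int[P]_t h (L f t) = \int[gauss (c f f)]_x h x)%E.
Proof. by case: G => _ _ _ _; apply. Qed.

Lemma gs_L0 t : L 0 t = 0.
Proof. by have := Llin 1 0 0 t; rewrite scaler0 addr0 mul1r => /eqP; rewrite -subr_eq0 opprD addNKr oppr_eq0 => /eqP. Qed.
Lemma gs_LD f g t : L (f + g) t = L f t + L g t.
Proof. by have := Llin 1 f g t; rewrite scale1r mul1r. Qed.
Lemma gs_LZ (a : R) f t : L (a *: f) t = a * L f t.
Proof. by have := Llin a f 0 t; rewrite addr0 gs_L0 addr0. Qed.
Lemma gs_LN f t : L (- f) t = - L f t.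
Proof. by rewrite -scaleN1r gs_LZ mulN1r. Qed.
Lemma gs_LB f g t : L (f - g) t = L f t - L g t.
Proof. by rewrite gs_LD gs_LN. Qed.
Lemma gs_c0 h : c 0 h = 0.
Proof. by have := cZD 1 0 0 h; rewrite scaler0 addr0 mul1r => /eqP; rewrite -subr_eq0 opprD addNKr oppr_eq0 => /eqP. Qed.
Lemma gs_cD f g h : c (f + g) h = c f h + c g h.
Proof. by have := cZD 1 f g h; rewrite scale1r mul1r. Qed.
Lemma gs_cZ (a : R) f h : c (a *: f) h = a * c f h.
Proof. by have := cZD a f 0 h; rewrite addr0 gs_c0 addr0. Qed.

Lemma gs_cB f g h : c (f - g) h = c f h - c g h.
Proof. by rewrite gs_cD -scaleN1r gs_cZ mulN1r. Qed.

Lemma gs_Lsum (I : Type) (s : seq I) (a : I -> R) (f : I -> F) t :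
  L (\sum_(i <- s) a i *: f i) t = \sum_(i <- s) a i * L (f i) t.
Proof.
elim: s => [|i s IH]; first by rewrite !big_nil gs_L0.
by rewrite !big_cons gs_LD gs_LZ IH.
Qed.

Lemma gs_c_suml (I : Type) (s : seq I) (a : I -> R) (f : I -> F) h :
  c (\sum_(i <- s) a i *: f i) h = \sum_(i <- s) a i * c (f i) h.
Proof.
elim: s => [|i s IH]; first by rewrite !big_nil gs_c0.
by rewrite !big_cons gs_cD gs_cZ IH.
Qed.

(** The sum [f + g] has variance [c f f + c g g], and the centred Gaussian law of that variance is
    the convolution of the two; on the product space the same convolution appears by Fubini. *)
Lemma gs_indep_cos f g s : c f g = 0 ->
  (\int[P]_t (1 + cos (s + L f t + L g t))%:E =
   \int[P \x P]_z (1 + cos (s + L f z.1 + L g z.2))%:E)%E.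
Proof.
move=> fg.
have mc : measurable_fun setT (fun x : R => (1 + cos (s + x))%:E).
  apply/measurable_EFinP; apply: measurable_funD => //.
  apply: (measurableT_comp (continuous_measurable_fun (@continuous_cos R))).
  exact: measurable_funD.
have c0 x : (0 <= (1 + cos (s + x))%:E)%E by rewrite lee_fin cos1_ge0.
have cE : c (f + g) (f + g) = c f f + c g g.
  by rewrite gs_cD (csym f) (csym g) !gs_cD (csym g f) fg addr0 add0r.
transitivity (\int[gauss (c f f + c g g)]_x (1 + cos (s + x))%:E)%E.
  rewrite -cE -law //; apply: eq_integral => t _.
  by rewrite gs_LD addrA.
rewrite -gauss_conv //.
pose H (x : R) : \bar R := (\int[gauss (c g g)]_y (1 + cos (s + (x + y)))%:E)%E.
have H0 x : (0 <= H x)%E by apply: integral_ge0 => y _; exact: c0.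
have mH : measurable_fun setT H.
  apply: (measurable_fun_fubini_tonelli_F (m2 := gauss (c g g)) (fun z : R * R => (1 + cos (s + (z.1 + z.2)))%:E)) => [|z].
    by apply: (measurableT_comp mc (g := fun z : R * R => z.1 + z.2)); exact: measurable_funD.
  exact: c0.
transitivity (\int[P]_t H (L f t))%E; first by rewrite law.
rewrite (fubini_tonelli1 (m1 := P) (m2 := P) (fun z : T * T => (1 + cos (s + L f z.1 + L g z.2))%:E)); last 2 first.
- rewrite (_ : (fun z => _) = (fun z : T * T => (1 + cos (s + (L f z.1 + L g z.2)))%:E)); last first.
    by apply/funext => z; rewrite addrA.
  apply: (measurableT_comp mc (g := fun z : T * T => L f z.1 + L g z.2)).
  apply: measurable_funD; [exact: (measurableT_comp (mL f) measurable_fst)|exact: (measurableT_comp (mL g) measurable_snd)].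
- by move=> z; rewrite lee_fin cos1_ge0.
apply: eq_integral => t _; rewrite /H /fubini_F /=.
rewrite -(@law g (fun y => (1 + cos (s + (L f t + y)))%:E)) //.
  by apply: eq_integral => u _; rewrite addrA.
by apply: (measurableT_comp mc (g := fun y : R => L f t + y)); exact: measurable_funD.
Qed.

(** The cylinder events of the functionals in [S], a pi-system generating their sigma-algebra. *)
Definition rects (S : set F) : set (set T) :=
  [set A | exists n (f : nat -> F) (B : nat -> set R),
     [/\ forall i, S (f i), forall i, measurable (B i) &
        A = [set t | forall i, (i < n)%N -> B i (L (f i) t)]]].

Lemma rects_measurable S : rects S `<=` measurable.
Proof.
move=> _ [n [f [B [_ mB ->]]]].
rewrite (_ : [set t | _] = \bigcap_(i < n) (L (f i) @^-1` B i)).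
  apply: bigcap_measurableType => i _; rewrite -[X in measurable X]setTI.
  exact: (mL (f i) measurableT (mB i)).
by apply/seteqP; split => t /= h i; exact: h.
Qed.

Lemma rects_setI S : setI_closed (rects S).
Proof.
move=> _ _ [n [f [B [Sf mB ->]]]] [m [g [C [Sg mC ->]]]].
exists (n + m)%N, (fun i => if (i < n)%N then f i else g (i - n)%N),
  (fun i => if (i < n)%N then B i else C (i - n)%N); split.
- by move=> i; case: ifP.
- by move=> i; case: ifP.
apply/seteqP; split => t /=.
  by move=> [h1 h2] i hi; case: ltnP => hn; [exact: h1 | apply: h2; lia].
move=> h; split => i hi.
  by have := h i; rewrite hi => h'; apply: h'; lia.
have := h (n + i)%N; have -> : (n + i < n)%N = false by lia.
by rewrite addKn => h'; apply: h'; lia.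
Qed.

Lemma rects_setT S f : S f -> rects S setT.
Proof.
move=> Sf; exists 0%N, (fun=> f), (fun=> setT); split => //.
by apply/seteqP; split.
Qed.

(** Reading the functionals of [S2] on an independent copy of the space does not change the cosines
    of linear combinations, so [boxind_eq] compares [P] with [P \x P] on boxes. *)
Lemma rects_indep (S1 S2 : set F) A1 A2 : (forall f g, S1 f -> S2 g -> c f g = 0) ->
  rects S1 A1 -> rects S2 A2 -> P (A1 `&` A2) = (P A1 * P A2)%E.
Proof.
move=> S12 rA1 rA2.
have mA1 := rects_measurable rA1; have mA2 := rects_measurable rA2.
move: rA1 rA2 => [n [f [B [Sf mB A1E]]]] [m [g [C [Sg mC A2E]]]].
pose X1 i t := if (i < n)%N then L (f i) t else L (g (i - n)%N) t.
pose X2 i (z : T * T) := if (i < n)%N then L (f i) z.1 else L (g (i - n)%N) z.2.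
pose D i := if (i < n)%N then B i else C (i - n)%N.
have mX1 i : measurable_fun setT (X1 i) by rewrite /X1; case: (i < n)%N.
have mX2 i : measurable_fun setT (X2 i).
  rewrite /X2; case: (i < n)%N; [exact: (measurableT_comp (mL _) measurable_fst)|exact: (measurableT_comp (mL _) measurable_snd)].
have mD i : measurable (D i) by rewrite /D; case: ifP.
have split_sum (a : nat -> R) (x y : nat -> R) :
   \sum_(0 <= i < n + m) a i * (if (i < n)%N then x i else y (i - n)%N) =
   \sum_(0 <= i < n) a i * x i + \sum_(0 <= i < m) a (n + i)%N * y i.
  rewrite (big_cat_nat _ (n := n)) //=; last by rewrite leq_addr.
  congr (_ + _); first by apply: eq_big_nat => i /andP[_ ->].
  rewrite -[X in \sum_(X <= _ < _) _]add0n big_addn addKn; apply: eq_bigr => i _.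
  by rewrite ltnNge addnC leq_addr /= addKn.
have := @boxind_eq R _ T P _ _ (P \x P)%E X1 X2 (n + m) mX1 mX2 _ D mD.
have E1 t : (forall i, (i < n + m)%N -> D i (X1 i t)) <-> A1 t /\ A2 t.
  rewrite A1E A2E /D /X1 /=; split.
    move=> h; split => i hi.
      by have := h i; rewrite hi => h'; apply: h'; lia.
    have := h (n + i)%N; have -> : (n + i < n)%N = false by lia.
    by rewrite addKn => h'; apply: h'; lia.
  by move=> [h1 h2] i hi; case: ltnP => hn; [exact: h1 | apply: h2; lia].
have E2 z : (forall i, (i < n + m)%N -> D i (X2 i z)) <-> A1 z.1 /\ A2 z.2.
  rewrite A1E A2E /D /X2 /=; split.
    move=> h; split => i hi.
      by have := h i; rewrite hi => h'; apply: h'; lia.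
    have := h (n + i)%N; have -> : (n + i < n)%N = false by lia.
    by rewrite addKn => h'; apply: h'; lia.
  by move=> [h1 h2] i hi; case: ltnP => hn; [exact: h1 | apply: h2; lia].
have -> : (\int[P]_t (boxind X1 D (n + m) t)%:E)%E = P (A1 `&` A2).
  under eq_integral do rewrite boxind_indic.
  rewrite (_ : [set t | _] = A1 `&` A2); last by apply/seteqP; split => t /= /E1.
  by rewrite integral_indic ?setIT //; exact: measurableI.
have -> : (\int[P \x P]_z (boxind X2 D (n + m) z)%:E)%E = (P A1 * P A2)%E.
  under eq_integral do rewrite boxind_indic.
  rewrite (_ : [set t | _] = A1 `*` A2); last by apply/seteqP; split => t /= /E2.
  have mAA : measurable (A1 `*` A2) by exact: measurableX.
  rewrite (integral_indic (P \x P)%E measurableT mAA) setIT.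
  exact: product_measure1E.
apply => a s.
pose f' := \sum_(0 <= i < n) a i *: f i.
pose g' := \sum_(0 <= i < m) a (n + i)%N *: g i.
have fg : c f' g' = 0.
  rewrite gs_c_suml big1 // => i _; rewrite csym gs_c_suml big1 ?mulr0 // => j _.
  by rewrite csym S12 ?mulr0.
transitivity (\int[P]_t (1 + cos (s + L f' t + L g' t))%:E)%E.
  apply: eq_integral => t _; rewrite /X1 (split_sum a (fun i => L (f i) t) (fun i => L (g i) t)).
  by rewrite /f' /g' !gs_Lsum addrA.
rewrite gs_indep_cos //; apply: eq_integral => z _.
rewrite /X2 (split_sum a (fun i => L (f i) z.1) (fun i => L (g i) z.2)).
by rewrite /f' /g' !gs_Lsum addrA.
Qed.

(** Uniqueness of measures on a pi-system is applied once for each family: for a fixed event [A'],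
    the restriction of [P] to [A'] and [P] scaled by [P A'] agree on cylinder events. *)
Lemma gs_indep (S1 S2 : set F) A1 A2 : S1 0 -> S2 0 ->
  (forall f g, S1 f -> S2 g -> c f g = 0) ->
  <<s rects S1 >> A1 -> <<s rects S2 >> A2 -> P (A1 `&` A2) = (P A1 * P A2)%E.
Proof.
move=> S10 S20 S12.
have ext (S : set F) A' : S 0 -> measurable A' ->
    (forall A, rects S A -> P (A `&` A') = (P A' * P A)%E) ->
    forall A, <<s rects S >> A -> P (A `&` A') = (P A' * P A)%E.
  move=> S0 mA' h A sA.
  have fA' := fin_num_measure P A' mA'.
  pose r : {nonneg R} := NngNum (fine_ge0 (measure_ge0 P A')).
  have rE B : mscale r P B = (P A' * P B)%E by rewrite /mscale /= fineK.
  rewrite -rE -[LHS]/(mrestr P mA' A).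
  apply: (@g_sigma_algebra_measure_unique _ R T (rects S) (@rects_measurable S)
    (fun=> setT) (fun=> rects_setT S0) _ (mrestr P mA') (mscale r P) (@rects_setI S)) => //.
  - by rewrite bigcup_const //; exists 0%N.
  - by move=> B rB; apply: etrans (esym (rE B)); exact: h.
  - move=> k; rewrite [X in (X < _)%E](_ : _ = P A') ?ltey_eq ?fA' //.
    by rewrite /= /mrestr setTI.
have sm S B : <<s rects S >> B -> measurable B.
  by apply: smallest_sub; [exact: sigma_algebra_measurable | exact: rects_measurable].
move=> sA1 sA2.
rewrite setIC.
apply: (ext S2 A1 S20 (sm _ _ sA1) _ _ sA2) => B rB.
rewrite setIC [RHS]muleC.
apply: etrans (ext S1 B S10 (rects_measurable rB) _ _ sA1) _ => // C rC.
by rewrite (rects_indep S12) // muleC.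
Qed.

Definition mapid (S : set F) : T -> g_sigma_algebraType (rects S) := id.

Lemma measurable_mapid S : measurable_fun setT (mapid S).
Proof.
move=> _ A mA; rewrite setTI /mapid preimage_id.
by move: A mA; apply: smallest_sub; [exact: sigma_algebra_measurable | exact: rects_measurable].
Qed.

(** The sigma-algebra of [S] and the functional [L e] have a product joint law, so [L e] can be
    integrated out with everything else frozen. The identity map [mapid] into [g_sigma_algebraType]
    is how measurability with respect to [S] is expressed. *)
Lemma gs_peel (S : set F) (e : F) (Phi : g_sigma_algebraType (rects S) * R -> \bar R) :
  S 0 -> (forall f, S f -> c f e = 0) ->
  measurable_fun setT Phi -> (forall z, 0 <= Phi z)%E ->
  (\int[P]_t Phi (t, L e t) = \int[P]_t \int[gauss (c e e)]_u Phi (t, u))%E.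
Proof.
move=> S0 Se mPhi Phi0.
pose G' := g_sigma_algebraType (rects S).
pose m1 : {mfun T >-> G'} := HB.pack (mapid S) (isMeasurableFun.Build _ _ _ _ _ (@measurable_mapid S)).
have mPsi : measurable_fun setT (fun t => (mapid S t, L e t) : G' * measurableTypeR R).
  by apply: measurable_fun_pair; [exact: (@measurable_mapid S)|exact: mL].
pose Psi : {mfun T >-> (G' * measurableTypeR R)%type} := HB.pack (fun t => (mapid S t, L e t) : G' * measurableTypeR R)
  (isMeasurableFun.Build _ _ _ _ _ mPsi).
have h0 := @ge0_integral_distribution _ _ T _ R P Psi Phi mPhi Phi0.
rewrite -[LHS]h0.
transitivity (\int[distribution P m1 \x gauss (c e e)]_z Phi z)%E.
  symmetry; apply: eq_measure_integral => A mA _.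
  apply: product_measure_unique => // A1 A2 mA1 mA2.
  apply: (@etrans _ _ (P (A1 `&` (L e @^-1` A2)))).
    by rewrite /distribution /= /pushforward; congr (P _); apply/seteqP; split.
  apply: (@etrans _ _ (P A1 * gauss (c e e) A2)%E) => //.
  have sA2 : <<s rects [set 0; e] >> (L e @^-1` A2).
    apply: sub_gen_smallest; exists 1%N, (fun=> e), (fun=> A2); split => //.
      by move=> i; right.
    by apply/seteqP; split => t /=; [move=> ? i _ | move=> h; exact: (h 0%N)].
  rewrite (@gs_indep S [set 0; e] A1) //; last 2 first.
  - by left.
  - by move=> f g Sf [->|->]; [rewrite csym gs_c0 | exact: Se].
  congr (_ * _)%E.
  have := @law e (fun x => (\1_A2 x : R)%:E).
  have m1A2 : measurable_fun setT (fun x : R => (\1_A2 x : R)%:E).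
    by apply/measurable_EFinP; exact: (measurable_indic mA2).
  rewrite (integral_indic (gauss (c e e)) measurableT mA2) setIT => <- //.
  have mLA : measurable (L e @^-1` A2).
    by rewrite -[X in measurable X]setTI; exact: (mL e measurableT mA2).
  by rewrite (integral_indic P measurableT mLA) setIT.
rewrite fubini_tonelli1 // /fubini_F.
rewrite ge0_integral_distribution //.
  exact: measurable_fun_fubini_tonelli_F.
by move=> x; exact: integral_ge0.
Qed.

End GaussianSpace.

(** * Paths weighted to stay positive *)

Section Kernel.
Variable R : realType.
Notation mu := (@lebesgue_measure R).
Implicit Types (lam s t y v : R).

Definition pos (x : R) : R := (0 < x)%R%:R.

Lemma pos_ge0 x : 0 <= pos x. Proof. by rewrite /pos ler0n. Qed.
Lemma pos_idem x : pos x * pos x = pos x.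
Proof. by rewrite /pos -natrM mulnb andbb. Qed.
Lemma posT x : 0 < x -> pos x = 1. Proof. by rewrite /pos => ->. Qed.
Lemma posF x : x <= 0 -> pos x = 0. Proof. by rewrite /pos ltNge => ->. Qed.

Lemma measurable_pos : measurable_fun setT pos.
Proof.
rewrite (_ : pos = \1_[set x : R | 0 < x]); last first.
  by apply/funext => x; rewrite indicE /pos; congr (nat_of_bool _)%:R; apply/idP/idP; rewrite inE.
apply: measurable_indic; rewrite (_ : [set x | _] = `]0, +oo[%classic) //.
by apply/seteqP; split => x /=; rewrite in_itv /= andbT.
Qed.

(* One minus the probability that a Brownian bridge of duration [t] from [y] to
   [z] hits the negative half-line. *)
Definition bridge_weight t y z : R := pos y * pos z * (1 - expR (- (2 * y * z / t))).

(* Heat kernel of Brownian motion killed at [0], by reflection. *)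
Definition reflected_pg t y z : R := gauss_pdf t (y - z) - gauss_pdf t (y + z).

(** The exponential is the Cameron-Martin density for the drift [lam]: this is the transition
    density of Brownian motion with that drift, killed at 0. *)
Definition barrier_kernel lam t y z : R :=
  pos y * pos z * expR (lam * (z - y) - lam ^+ 2 * t / 2) * reflected_pg t y z.

Lemma reflected_pgE t y z : 0 < t -> reflected_pg t y z = gauss_pdf t (y - z) * (1 - expR (- (2 * y * z / t))).
Proof.
move=> t0; rewrite /reflected_pg mulrBr mulr1; congr (_ - _).
rewrite /gauss_pdf -[RHS]mulrA -expRD; congr (_ * expR _).
by field; rewrite gt_eqF.
Qed.

Lemma one_sub_exp_bounds t y (z : R) : 0 < t -> 0 < y -> 0 < z ->
  0 <= 1 - expR (- (2 * y * z / t)) <= 2 * y * z / t.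
Proof.
move=> t0 y0 z0; have h : 0 <= 2 * y * z / t by rewrite divr_ge0 ?mulr_ge0 // ltW.
have := expR_ge1Dx (- (2 * y * z / t)).
have : expR (- (2 * y * z / t)) <= 1 by rewrite -[leRHS]expR0 ler_expR oppr_le0.
by lra.
Qed.

Lemma bridge_weight_ge0 t y z : 0 < t -> 0 <= bridge_weight t y z.
Proof.
move=> t0; rewrite /bridge_weight.
case: (ltP 0 y) => y0; last by rewrite (posF y0) !mul0r.
case: (ltP 0 z) => z0; last by rewrite (posF z0) mulr0 mul0r.
by rewrite !posT // !mul1r; case/andP: (one_sub_exp_bounds t0 y0 z0).
Qed.

Lemma bridge_weight_le1 t y z : 0 < t -> bridge_weight t y z <= 1.
Proof.
move=> t0; rewrite /bridge_weight.
case: (ltP 0 y) => y0; last by rewrite (posF y0) !mul0r.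
case: (ltP 0 z) => z0; last by rewrite (posF z0) mulr0 mul0r.
by rewrite !posT // !mul1r; have := expR_gt0 (- (2 * y * z / t)); lra.
Qed.

Lemma reflected_pg_ge0 t y z : 0 < t -> 0 < y -> 0 < z -> 0 <= reflected_pg t y z.
Proof.
move=> t0 y0 z0; rewrite reflected_pgE //; apply: mulr_ge0; first exact: gauss_pdf_ge0.
by case/andP: (one_sub_exp_bounds t0 y0 z0).
Qed.

Lemma barrier_kernel_ge0 lam t y z : 0 < t -> 0 <= barrier_kernel lam t y z.
Proof.
move=> t0; rewrite /barrier_kernel.
case: (ltP 0 y) => y0; last by rewrite (posF y0) !mul0r.
case: (ltP 0 z) => z0; last by rewrite (posF z0) mulr0 !mul0r.
by rewrite !posT // !mul1r mulr_ge0 ?expR_ge0 ?reflected_pg_ge0.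
Qed.

Lemma mpg2 t (f : R * R -> R) : measurable_fun setT f -> measurable_fun setT (fun z => gauss_pdf t (f z)).
Proof. by move=> mf; exact: (measurableT_comp (@measurable_gauss_pdf R t) mf). Qed.

Lemma mpos2 d (T : measurableType d) (f : T -> R) : measurable_fun setT f -> measurable_fun setT (fun z => pos (f z)).
Proof. by move=> mf; exact: (measurableT_comp measurable_pos mf). Qed.

Lemma mexp2 d (T : measurableType d) (f : T -> R) : measurable_fun setT f -> measurable_fun setT (fun z => expR (f z)).
Proof. by move=> mf; exact: (measurableT_comp (@measurable_expR R) mf). Qed.

Lemma measurable_barrier_kernel lam t : measurable_fun setT (fun z : R * R => barrier_kernel lam t z.1 z.2).
Proof.
have m1 : measurable_fun setT (fun z : R * R => z.1) := measurable_fst.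
have m2 : measurable_fun setT (fun z : R * R => z.2) := measurable_snd.
rewrite /barrier_kernel; apply: measurable_funM; first apply: measurable_funM; first apply: measurable_funM.
- exact: mpos2.
- exact: mpos2.
- by apply: mexp2; apply: measurable_funB => //; apply: measurable_funM => //; exact: measurable_funB.
- by apply: measurable_funB; apply: mpg2; [exact: measurable_funB|exact: measurable_funD].
Qed.

Lemma measurable_bridge_weight d (T : measurableType d) t (f g : T -> R) :
  measurable_fun setT f -> measurable_fun setT g -> measurable_fun setT (fun z => bridge_weight t (f z) (g z)).
Proof.
move=> mf mg; rewrite /bridge_weight; apply: measurable_funM; first apply: measurable_funM.
- exact: mpos2.
- exact: mpos2.
- apply: measurable_funB => //; apply: mexp2.
  rewrite (_ : (fun x => _) = (fun x => (- (2 / t)) * (f x * g x))); last by apply/funext => x; ring.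
  by apply: measurable_funM => //; exact: measurable_funM.
Qed.

Definition barrier_op lam t (f : R -> \bar R) y : \bar R := (\int[mu]_z ((barrier_kernel lam t y z)%:E * f z))%E.

Lemma measurable_kk2 lam t y : measurable_fun setT (fun z => barrier_kernel lam t y z).
Proof.
have mp : measurable_fun setT (fun z : R => (y, z)) by apply: measurable_fun_pair.
exact: (measurableT_comp (measurable_barrier_kernel lam t) mp).
Qed.

Lemma measurable_kkf lam t (f : R -> \bar R) : measurable_fun setT f ->
  measurable_fun setT (fun z : R * R => ((barrier_kernel lam t z.1 z.2)%:E * f z.2)%E).
Proof.
move=> mf; apply: emeasurable_funM; first by apply/measurable_EFinP; exact: measurable_barrier_kernel.
exact: (measurableT_comp mf measurable_snd).
Qed.

Lemma barrier_op_ge0 lam t (f : R -> \bar R) y : 0 < t -> (forall x, 0 <= f x)%E -> (0 <= barrier_op lam t f y)%E.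
Proof. by move=> t0 f0; apply: integral_ge0 => z _; rewrite mule_ge0 ?lee_fin ?barrier_kernel_ge0. Qed.

Lemma measurable_barrier_op lam t (f : R -> \bar R) : 0 < t -> measurable_fun setT f -> (forall x, 0 <= f x)%E ->
  measurable_fun setT (barrier_op lam t f).
Proof.
move=> t0 mf f0.
apply: (measurable_fun_fubini_tonelli_F (m2 := mu) (fun z : R * R => ((barrier_kernel lam t z.1 z.2)%:E * f z.2)%E)).
  exact: measurable_kkf.
by move=> z; rewrite mule_ge0 ?lee_fin ?barrier_kernel_ge0.
Qed.

(** For a Gaussian increment [u] of variance [t], completing the square shows that the drift
    [lam * t] of the step produces the exponential factor of the killed kernel. *)
Lemma bridge_weight_gauss_pdf lam t y u : 0 < t ->
  bridge_weight t y (y + lam * t - u) * gauss_pdf t u = barrier_kernel lam t y (y + lam * t - u).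
Proof.
move=> t0; rewrite /barrier_kernel reflected_pgE // /bridge_weight.
have -> : gauss_pdf t u = expR (lam * (y + lam * t - u - y) - lam ^+ 2 * t / 2) * gauss_pdf t (y - (y + lam * t - u)).
  rewrite /gauss_pdf mulrCA -expRD; congr (_ * expR _).
  by field; rewrite gt_eqF.
by ring.
Qed.

Lemma barrier_kernel_mul lam s t y v x : 0 < y -> 0 < v ->
  barrier_kernel lam s y x * barrier_kernel lam t x v =
  expR (lam * (v - y) - lam ^+ 2 * (s + t) / 2) * (pos x * (reflected_pg s y x * reflected_pg t x v)).
Proof.
move=> y0 v0; rewrite /barrier_kernel (posT y0) (posT v0).
have -> : expR (lam * (v - y) - lam ^+ 2 * (s + t) / 2) =
    expR (lam * (x - y) - lam ^+ 2 * s / 2) * expR (lam * (v - x) - lam ^+ 2 * t / 2).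
  by rewrite -expRD; congr expR; field.
by rewrite -[in RHS](pos_idem x); ring.
Qed.

Lemma gauss_step lam t (f : R -> \bar R) y : 0 < t -> measurable_fun setT f -> (forall x, 0 <= f x)%E ->
  (\int[gauss t]_u ((bridge_weight t y (y + lam * t - u))%:E * f (y + lam * t - u)%R) = barrier_op lam t f y)%E.
Proof.
move=> t0 mf f0.
have mr : measurable_fun setT (fun u : R => y + lam * t - u) by exact: measurable_funB.
have mh : measurable_fun setT (fun x => ((bridge_weight t y x)%:E * f x)%E).
  apply: emeasurable_funM => //; apply/measurable_EFinP.
  exact: (@measurable_bridge_weight _ _ t (fun=> y) id).
have h0 x : (0 <= (bridge_weight t y x)%:E * f x)%E by rewrite mule_ge0 ?lee_fin ?bridge_weight_ge0.
rewrite (integral_gauss t0 (h := fun u => ((bridge_weight t y (y + lam * t - u))%:E * f (y + lam * t - u)%R)%E)) //; last first.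
  exact: (measurableT_comp mh mr).
rewrite /barrier_op -[RHS](@integral_refl R (y + lam * t) (fun u => ((barrier_kernel lam t y u)%:E * f u)%E)).
- by apply: eq_integral => u _; rewrite muleAC -EFinM bridge_weight_gauss_pdf.
- by apply: emeasurable_funM => //; apply/measurable_EFinP; exact: measurable_kk2.
- by move=> x; rewrite mule_ge0 ?lee_fin ?barrier_kernel_ge0.
Qed.

Lemma integral_pg2 s t y v : 0 < s -> 0 < t ->
  (\int[mu]_z (gauss_pdf s (y + z) * gauss_pdf t (z - v))%:E = (gauss_pdf (s + t) (y + v))%:E)%E.
Proof.
move=> s0 t0; rewrite -(pgN (s + t) (y + v)) opprD -(gauss_pdf_conv (- y) v s0 t0).
by apply: eq_integral => z _; rewrite -[in LHS]pgN opprD.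
Qed.

(** Both factors are odd in [z], so their product is even and the half line carries half of the
    integral over the line, which expands into four Gaussian convolutions. *)
Lemma integral_reflected_pg s t y v : 0 < s -> 0 < t -> 0 < y -> 0 < v ->
  (\int[mu]_z (pos z * (reflected_pg s y z * reflected_pg t z v))%:E = (reflected_pg (s + t) y v)%:E)%E.
Proof.
move=> s0 t0 y0 v0.
pose r z := reflected_pg s y z * reflected_pg t z v.
have rN z : r (- z) = r z.
  rewrite /r /reflected_pg opprK -[gauss_pdf t (- z - v)]pgN -[gauss_pdf t (- z + v)]pgN !opprD !opprK.
  by ring.
have r0 : r 0 = 0 by rewrite /r /reflected_pg subr0 addr0 subrr mul0r.
have rp z : 0 <= r z.
  have [z0|z0|<-] := ltgtP 0 z; last by rewrite r0.
    by rewrite /r mulr_ge0 ?reflected_pg_ge0.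
  by rewrite -rN /r mulr_ge0 ?reflected_pg_ge0 ?oppr_gt0.
have mq1 : measurable_fun setT (fun z => reflected_pg s y z).
  apply: measurable_funB; apply: (measurableT_comp (@measurable_gauss_pdf R s)).
    exact: measurable_funB.
  exact: measurable_funD.
have mq2 : measurable_fun setT (fun z => reflected_pg t z v).
  apply: measurable_funB; apply: (measurableT_comp (@measurable_gauss_pdf R t)).
    exact: measurable_funB.
  exact: measurable_funD.
have mr : measurable_fun setT r by exact: measurable_funM.
have mpr : measurable_fun setT (fun z => (pos z * r z)%:E).
  by apply/measurable_EFinP; apply: measurable_funM => //; exact: measurable_pos.
have mprN : measurable_fun setT (fun z : R => (pos (- z) * r z)%:E).
  by apply/measurable_EFinP; apply: measurable_funM => //; apply: mpos2; exact: measurable_funN.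
pose I := (\int[mu]_z (pos z * r z)%:E)%E.
have half : (\int[mu]_z (r z)%:E = I + I)%E.
  rewrite {2}/I -(@integral_refl R 0 (fun z => (pos z * r z)%:E)) //; last first.
    by move=> z; rewrite lee_fin mulr_ge0 ?pos_ge0.
  rewrite /I -ge0_integralD //.
  - apply: eq_integral => z _; rewrite sub0r rN -EFinD -mulrDl /pos oppr_gt0.
    by have [z0|z0|<-] := ltgtP 0 z; rewrite ?r0 ?mulr0 // ?addr0 ?add0r mul1r.
  - by move=> z _; rewrite lee_fin mulr_ge0 ?pos_ge0.
  - by move=> z _; rewrite lee_fin mulr_ge0 ?pos_ge0.
  - by under eq_fun do rewrite sub0r rN.
have mm (f g : R -> R) : measurable_fun setT f -> measurable_fun setT g ->
    measurable_fun setT (fun z => (gauss_pdf s (f z) * gauss_pdf t (g z))%:E).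
  move=> mf mg; apply/measurable_EFinP; apply: measurable_funM.
    exact: (measurableT_comp (@measurable_gauss_pdf R s) mf).
  exact: (measurableT_comp (@measurable_gauss_pdf R t) mg).
have my1 : measurable_fun setT (fun z : R => y - z) by exact: measurable_funB.
have my2 : measurable_fun setT (fun z : R => y + z) by exact: measurable_funD.
have mv1 : measurable_fun setT (fun z : R => z - v) by exact: measurable_funB.
have mv2 : measurable_fun setT (fun z : R => z + v) by exact: measurable_funD.
(* The negative terms of the product are moved to the other side, so that only nonnegative integrals
   are added. *)
have tot : (\int[mu]_z (r z)%:E + ((gauss_pdf (s + t) (y + v))%:E + (gauss_pdf (s + t) (y + v))%:E) =
    (gauss_pdf (s + t) (y - v))%:E + (gauss_pdf (s + t) (y - v))%:E)%E.
  have e1 : (\int[mu]_z (gauss_pdf s (y - z) * gauss_pdf t (z + v))%:E = (gauss_pdf (s + t) (y + v))%:E)%E.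
    by rewrite -[in RHS](opprK v) -(gauss_pdf_conv y (- v) s0 t0); apply: eq_integral => z _; rewrite opprK.
  have e2 : (\int[mu]_z (gauss_pdf s (y + z) * gauss_pdf t (z + v))%:E = (gauss_pdf (s + t) (y - v))%:E)%E.
    by rewrite -(integral_pg2 y (- v) s0 t0); apply: eq_integral => z _; rewrite opprK.
  rewrite -{1}e1 -{1}(integral_pg2 y v s0 t0) -{1}(gauss_pdf_conv y v s0 t0) -e2.
  have p0 (f g : R -> R) z : (0 <= (gauss_pdf s (f z) * gauss_pdf t (g z))%:E)%E.
    by rewrite lee_fin mulr_ge0 ?gauss_pdf_ge0.
  rewrite -(ge0_integralD mu measurableT (fun z _ => p0 _ _ z) (mm _ _ my1 mv2) (fun z _ => p0 _ _ z) (mm _ _ my2 mv1)).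
  rewrite -(ge0_integralD mu measurableT (fun z _ => p0 _ _ z) (mm _ _ my1 mv1) (fun z _ => p0 _ _ z) (mm _ _ my2 mv2)).
  rewrite -ge0_integralD //; last 4 first.
  - by move=> z _; rewrite lee_fin.
  - exact/measurable_EFinP.
  - by move=> z _; rewrite adde_ge0 ?lee_fin ?mulr_ge0 ?gauss_pdf_ge0.
  - by apply: emeasurable_funD; exact: mm.
  apply: eq_integral => z _; rewrite -!EFinD /r /reflected_pg; congr EFin; ring.
rewrite half in tot.
have I0 : (0 <= I)%E by apply: integral_ge0 => z _; rewrite lee_fin mulr_ge0 ?pos_ge0.
have aux (x : \bar R) (a b : R) : (0 <= x)%E ->
    (x + x + (a%:E + a%:E) = b%:E + b%:E)%E -> x = (b - a)%:E.
  by case: x => [x||] //= _ [] h; congr EFin; move: h; lra.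
by rewrite -/I (aux _ _ _ I0 tot) /reflected_pg.
Qed.

Lemma barrier_kernel_semigroup lam s t y v : 0 < s -> 0 < t ->
  (\int[mu]_z (barrier_kernel lam s y z * barrier_kernel lam t z v)%:E = (barrier_kernel lam (s + t) y v)%:E)%E.
Proof.
move=> s0 t0.
case: (ltP 0 y) => y0; last first.
  rewrite [in RHS]/barrier_kernel (posF y0) !mul0r; apply: integral0_eq => z _.
  by rewrite /barrier_kernel (posF y0) !mul0r.
case: (ltP 0 v) => v0; last first.
  rewrite [in RHS]/barrier_kernel (posF v0) mulr0 !mul0r; apply: integral0_eq => z _.
  by rewrite {2}/barrier_kernel (posF v0) mulr0 !mul0r mulr0.
pose c := expR (lam * (v - y) - lam ^+ 2 * (s + t) / 2).
transitivity (\int[mu]_z (c%:E * (pos z * (reflected_pg s y z * reflected_pg t z v))%:E))%E.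
  by apply: eq_integral => z _; rewrite -EFinM barrier_kernel_mul.
rewrite ge0_integralZl_EFin ?expR_ge0 //.
- by rewrite integral_reflected_pg // -EFinM /barrier_kernel !posT // !mul1r.
- move=> z _; rewrite lee_fin; case: (ltP 0 z) => z0; last by rewrite posF ?mul0r.
  by rewrite posT // mul1r mulr_ge0 ?reflected_pg_ge0.
- apply/measurable_EFinP; apply: measurable_funM; first exact: measurable_pos.
  apply: measurable_funM; apply: measurable_funB; apply: (measurableT_comp (@measurable_gauss_pdf R _));
    by [exact: measurable_funB | exact: measurable_funD].
Qed.

Lemma barrier_op_semigroup lam s t (f : R -> \bar R) y : 0 < s -> 0 < t ->
  measurable_fun setT f -> (forall x, 0 <= f x)%E ->
  barrier_op lam s (barrier_op lam t f) y = barrier_op lam (s + t) f y.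
Proof.
move=> s0 t0 mf f0.
have mky : measurable_fun setT (fun z : R * R => barrier_kernel lam s y z.1).
  exact: (measurableT_comp (measurable_kk2 lam s y) measurable_fst).
pose H (z : R * R) : \bar R := ((barrier_kernel lam s y z.1)%:E * ((barrier_kernel lam t z.1 z.2)%:E * f z.2))%E.
have mH : measurable_fun setT H.
  by apply: emeasurable_funM; [exact/measurable_EFinP | exact: measurable_kkf].
have H0 z : (0 <= H z)%E by rewrite /H !mule_ge0 ?lee_fin ?barrier_kernel_ge0.
transitivity (\int[mu]_z \int[mu]_v H (z, v))%E.
  apply: eq_integral => z _; rewrite /barrier_op -ge0_integralZl_EFin ?barrier_kernel_ge0 //.
  - by move=> v _; rewrite mule_ge0 ?lee_fin ?barrier_kernel_ge0.
  - by apply: emeasurable_funM => //; apply/measurable_EFinP; exact: measurable_kk2.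
apply: (etrans (fubini_tonelli (m1 := mu) (m2 := mu) H mH H0)).
apply: eq_integral => v _.
rewrite -barrier_kernel_semigroup // -ge0_integralZr //.
- by apply: eq_integral => z _; rewrite /H /= muleA EFinM.
- apply/measurable_EFinP; apply: measurable_funM; first exact: measurable_kk2.
  have mp : measurable_fun setT (fun z : R => (z, v)) by apply: measurable_fun_pair.
  exact: (measurableT_comp (measurable_barrier_kernel lam t) mp).
- by move=> z _; rewrite lee_fin mulr_ge0 ?barrier_kernel_ge0.
Qed.

End Kernel.

(** * Bounds on the killed kernel *)

Section KernelBounds.
Variable R : realType.
Notation mu := (@lebesgue_measure R).
Implicit Types (lam t y : R).

Definition pow32 (t : R) : R := t * Num.sqrt t.

Lemma pow32_gt0 t : 0 < t -> 0 < pow32 t.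
Proof. by move=> t0; rewrite mulr_gt0 ?sqrtr_gt0. Qed.

Lemma pow32_le s t : 0 <= s -> s <= t -> pow32 s <= pow32 t.
Proof. by move=> s0 st; rewrite ler_pM ?sqrtr_ge0 ?ler_wsqrtr. Qed.

Lemma pow32M s t : 0 <= s -> pow32 (s * t) = pow32 s * pow32 t.
Proof. by move=> s0; rewrite /pow32 sqrtrM //; ring. Qed.

(** The window for the path at scale 0. Its upper end makes the field high when the path has value 2
    at scale [J]; its lower end keeps [z] away from the barrier in the lower bound on the kernel. *)
Definition start_window (x : R) : \bar R := (\1_(`[1, 2]%classic : set R) x)%:E.

Lemma start_window_ge0 x : (0 <= start_window x)%E.
Proof. by rewrite lee_fin indicE ler0n. Qed.

Lemma start_windowE x : start_window x = (1 <= x <= 2)%R%:R%:E.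
Proof. by rewrite /start_window indicE mem_setE in_itv. Qed.

Lemma measurable_start_window : measurable_fun setT start_window.
Proof. by apply/measurable_EFinP; apply: measurable_indic. Qed.

Lemma integral_start_window : (\int[mu]_x start_window x = 1)%E.
Proof.
have m12 : measurable (`[1, 2]%classic : set R) by [].
apply: (etrans (integral_indic mu measurableT m12)).
rewrite setIT; apply: (etrans (lebesgue_measure_itv `[1, 2])).
by rewrite /= lte_fin ltr1n -EFinB; congr EFin; ring.
Qed.

Lemma pi_ge2 : 2 <= pi :> R. Proof. exact: pi_ge2. Qed.

(** The inequality [1 - exp (- x) <= x] turns the bridge factor into [2 * y * z / t]; with the
    density, of order [t ^ (-1/2)], this is the decay [t ^ (-3/2)] behind the term in [log n]. *)
Lemma barrier_kernel_le lam t y z : 0 < t ->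
  barrier_kernel lam t y z <= pos y * pos z * expR (lam * (z - y) - lam ^+ 2 * t / 2) * (2 * y * z / pow32 t).
Proof.
move=> t0; rewrite /barrier_kernel.
case: (ltP 0 y) => y0; last by rewrite (posF y0) !mul0r.
case: (ltP 0 z) => z0; last by rewrite (posF z0) mulr0 !mul0r.
rewrite !posT // !mul1r ler_wpM2l ?expR_ge0 // reflected_pgE //.
have /andP[h0 h1] := one_sub_exp_bounds t0 y0 z0.
have s0 : 0 < Num.sqrt t by rewrite sqrtr_gt0.
rewrite /pow32 invfM mulrA mulrC ler_pM ?gauss_pdf_ge0 //.
rewrite /gauss_pdf -[leRHS]mulr1 ler_pM ?invr_ge0 ?sqrtr_ge0 ?expR_ge0 //.
  rewrite lef_pV2 ?posrE ?sqrtr_gt0 ?mulr_gt0 ?pi_gt0 // ler_wsqrtr // ler_peMl ?ltW //.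
  by have := pi_ge2; lra.
rewrite -[leRHS]expR0 ler_expR mulNr oppr_le0 divr_ge0 ?sqr_ge0 //.
by rewrite mulr_ge0 // ltW.
Qed.

(** For [t >= 1] the Gaussian factor is at least [exp (- 1)] because [(2 - z) ^ 2 <= 1], and
    [1 - exp (- x) >= x / (1 + x)] at [x = 4 / t] gives [4 / (t + 4) >= (4 / 5) / t]. *)
Lemma barrier_kernel_ge lam t z : 1 <= t -> 0 <= lam -> 1 <= z <= 2 ->
  expR (- lam) * expR (- (lam ^+ 2 * t / 2)) * (expR (- 1) * (Num.sqrt (2 * pi))^-1 * (4 / 5)) / pow32 t <= barrier_kernel lam t 2 z.
Proof.
move=> t1 lam0 /andP[z1 z2]; have t0 : 0 < t by lra.
have z0 : 0 < z by lra.
rewrite /barrier_kernel !posT // !mul1r -!mulrA mulrA -expRD ler_pM //.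
- by rewrite mulr_ge0 ?expR_ge0 // mulr_ge0 ?invr_ge0 ?sqrtr_ge0 // mulr_ge0 // divr_ge0 // ltW // pow32_gt0.
- rewrite ler_expR lerD2r.
  have : 0 <= lam * (z - 1) by rewrite mulr_ge0 //; lra.
  by rewrite !mulrBr; lra.
rewrite reflected_pgE // /gauss_pdf.
have s0 : 0 < Num.sqrt t by rewrite sqrtr_gt0.
have -> : expR (- 1) * ((Num.sqrt (2 * pi))^-1 * (4 * (5^-1 / pow32 t))) =
  (Num.sqrt (2 * pi))^-1 * (Num.sqrt t)^-1 * expR (- 1) * (4 / 5 / t).
  by rewrite /pow32 invfM; ring.
rewrite -invfM -sqrtrM ?mulr_ge0 ?pi_ge0 //.
rewrite ler_pM //.
- by rewrite !divr_ge0 // ltW.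
- rewrite ler_wpM2l ?invr_ge0 ?sqrtr_ge0 // ler_expR.
  rewrite mulNr lerN2 ler_pdivrMr ?mulr_gt0 // mul1r.
  have : (2 - z) ^+ 2 <= 1 by rewrite expr_le1 //; lra.
  by lra.
- have x0 : 0 < 4 / t by rewrite divr_gt0.
  have h1 : expR (- (2 * 2 * z / t)) <= expR (- (4 / t)).
    rewrite ler_expR lerN2 ler_pM2r ?invr_gt0 //; lra.
  have h2 : 1 + 4 / t <= expR (4 / t) by exact: expR_ge1Dx.
  have h3 : expR (- (4 / t)) <= (1 + 4 / t)^-1.
    by rewrite expRN lef_pV2 ?posrE ?expR_gt0 //; lra.
  have h4 : (1 + 4 / t)^-1 = 1 - 4 / (t + 4) by field; lra.
  have h5 : 4 / 5 / t <= 4 / (t + 4).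
    by rewrite -mulrA ler_pM2l // -invfM lef_pV2 ?posrE; lra.
  by lra.
Qed.

Lemma barrier_op_start_window_le lam t y : 0 < t -> 0 <= lam ->
  (barrier_op lam t start_window y <= (4 * expR (2 * lam) / pow32 t * expR (- (lam ^+ 2 * t / 2)) *
     (pos y * y * expR (- (lam * y))))%:E)%E.
Proof.
move=> t0 lam0.
set B := (X in (_ <= X%:E)%E).
have B0 : 0 <= B.
  rewrite /B; apply: mulr_ge0.
    by rewrite !mulr_ge0 ?expR_ge0 // invr_ge0 ltW // pow32_gt0.
  case: (ltP 0 y) => y0; last by rewrite posF // !mul0r.
  by rewrite posT // mul1r mulr_ge0 ?expR_ge0 // ltW.
apply: (@le_trans _ _ (\int[mu]_z (B%:E * start_window z))%E); last first.
  rewrite ge0_integralZl_EFin //; first by rewrite integral_start_window mule1.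
  - by move=> z _; exact: start_window_ge0.
  - exact: measurable_start_window.
apply: ge0_le_integral => //.
- by move=> z _; rewrite mule_ge0 ?start_window_ge0 // lee_fin barrier_kernel_ge0.
- by apply: emeasurable_funM; [apply/measurable_EFinP; exact: measurable_kk2 | exact: measurable_start_window].
- by apply: emeasurable_funM => //; exact: measurable_start_window.
- move=> z _; rewrite start_windowE; case: (boolP (1 <= (z : R) <= 2)) => [/andP[z1 z2]|_]; last by rewrite !mule0.
  rewrite !mule1 lee_fin; apply: (le_trans (barrier_kernel_le _ _ _ t0)).
  have z0 : 0 < z by lra.
  rewrite (posT z0) mulr1 /B.
  case: (ltP 0 y) => y0; last by rewrite posF // !mul0r mulr0.
  rewrite posT // !mul1r.
  have -> : expR (lam * (z - y) - lam ^+ 2 * t / 2) = expR (lam * z) * expR (- (lam * y)) * expR (- (lam ^+ 2 * t / 2)).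
    by rewrite -!expRD; congr expR; ring.
  have h1 : expR (lam * z) <= expR (2 * lam) by rewrite ler_expR mulrC ler_wpM2r.
  have ip := pow32_gt0 t0.
  rewrite [leLHS](_ : _ = (expR (lam * z) * (2 * z)) * (expR (- (lam * y)) * expR (- (lam ^+ 2 * t / 2)) * (y / pow32 t))); last by ring.
  rewrite [leRHS](_ : _ = (expR (2 * lam) * 4) * (expR (- (lam * y)) * expR (- (lam ^+ 2 * t / 2)) * (y / pow32 t))); last by ring.
  rewrite ler_wpM2r //.
    by rewrite !mulr_ge0 ?expR_ge0 ?invr_ge0 // ltW.
  by rewrite ler_pM ?expR_ge0 //; lra.
Qed.

Lemma barrier_op_start_window_ge lam t : 1 <= t -> 0 <= lam ->
  ((expR (- lam) * expR (- (lam ^+ 2 * t / 2)) * (expR (- 1) * (Num.sqrt (2 * pi))^-1 * (4 / 5)) / pow32 t)%:E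
    <= barrier_op lam t start_window 2)%E.
Proof.
move=> t1 lam0; have t0 : 0 < t by lra.
set B := (X in (X%:E <= _)%E).
have B0 : 0 <= B.
  by rewrite /B !mulr_ge0 ?expR_ge0 ?invr_ge0 ?sqrtr_ge0 // ltW // pow32_gt0.
apply: (@le_trans _ _ (\int[mu]_z (B%:E * start_window z))%E).
  rewrite ge0_integralZl_EFin //; first by rewrite integral_start_window mule1.
  - by move=> z _; exact: start_window_ge0.
  - exact: measurable_start_window.
apply: ge0_le_integral => //.
- by move=> z _; rewrite mule_ge0 ?start_window_ge0.
- by apply: emeasurable_funM => //; exact: measurable_start_window.
- by apply: emeasurable_funM; [apply/measurable_EFinP; exact: measurable_kk2 | exact: measurable_start_window].
- move=> z _; rewrite start_windowE; case: (boolP (1 <= (z : R) <= 2)) => [z12|_]; last by rewrite !mule0.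
  by rewrite !mule1 lee_fin barrier_kernel_ge.
Qed.

Lemma measurable_exp_pos (b : R) : measurable_fun setT (fun z => (pos z * expR (- (b * z)))%:E).
Proof.
apply/measurable_EFinP; apply: measurable_funM; first exact: measurable_pos.
by apply: mexp2; apply: measurable_funN; exact: measurable_funM.
Qed.

Lemma integral_exp_pos (b : R) : 0 < b -> (\int[mu]_z (pos z * expR (- (b * z)))%:E <= (b^-1)%:E)%E.
Proof.
move=> b0.
have <- : (\int[mu]_z ((b^-1)%:E * (exponential_pdf b z)%:E) = (b^-1)%:E)%E.
  rewrite ge0_integralZl_EFin ?invr_ge0 ?(ltW b0) //.
  - by rewrite integral_exponential_pdf // mule1.
  - by move=> z _; rewrite lee_fin exponential_pdf_ge0 // ltW.
  - by apply/measurable_EFinP; exact: measurable_exponential_pdf.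
apply: ge0_le_integral => //.
- by move=> z _; rewrite lee_fin mulr_ge0 ?pos_ge0 ?expR_ge0.
- exact: measurable_exp_pos.
- apply: emeasurable_funM => //.
  by apply/measurable_EFinP; exact: measurable_exponential_pdf.
- move=> z _; rewrite -EFinM lee_fin; case: (ltP 0 z) => z0.
    rewrite posT // mul1r exponential_pdfE ?(ltW z0) //.
    by rewrite mulrA mulVf ?gt_eqF // mul1r -mulNr.
  by rewrite posF // mul0r mulr_ge0 ?invr_ge0 ?exponential_pdf_ge0 // ltW.
Qed.

Lemma lin_le_exp (b x : R) : 0 < b -> x <= expR (b * x) / b.
Proof.
move=> b0; rewrite ler_pdivlMr // mulrC.
by apply: le_trans (expR_ge1Dx _); rewrite lerDr.
Qed.

(** The weight [exp (- (3/2) lam z)] wins over the factor [exp (lam z)] of the drift and leaves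
    [exp (- lam z / 2)]; half of this exponent pays for the factor [z], the other half integrates to
    at most [4 / lam]. *)
Lemma barrier_op_exp_le lam t y : 0 < t -> 0 < lam ->
  (barrier_op lam t (fun x => (expR (- (3 / 2 * lam * x)))%:E) y <=
    (32 / lam ^+ 2 * (pos y * y * expR (- (lam * y))) * expR (- (lam ^+ 2 * t / 2)) / pow32 t)%:E)%E.
Proof.
move=> t0 lam0.
have ip := pow32_gt0 t0.
have l4 : 0 < lam / 4 by rewrite divr_gt0.
pose B := 8 / lam * (pos y * y * expR (- (lam * y))) * expR (- (lam ^+ 2 * t / 2)) / pow32 t.
have B0 : 0 <= B.
  rewrite /B; case: (ltP 0 y) => y0; last by rewrite posF // !(mul0r, mulr0).
  by rewrite posT // mul1r !mulr_ge0 ?expR_ge0 ?invr_ge0 // ltW.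
rewrite [X in (_ <= X%:E)%E](_ : _ = B * (lam / 4)^-1); last first.
  by rewrite /B; field; rewrite !gt_eqF.
rewrite EFinM; apply: (@le_trans _ _ (B%:E * \int[mu]_z (pos z * expR (- (lam / 4 * z)))%:E)%E); last first.
  by apply: lee_wpmul2l; [rewrite lee_fin | exact: integral_exp_pos].
rewrite -ge0_integralZl_EFin //; last 2 first.
- by move=> z _; rewrite lee_fin mulr_ge0 ?pos_ge0 ?expR_ge0.
- exact: measurable_exp_pos.
apply: ge0_le_integral => //.
- by move=> z _; rewrite mule_ge0 ?lee_fin ?barrier_kernel_ge0 ?expR_ge0.
- apply: emeasurable_funM; first by apply/measurable_EFinP; exact: measurable_kk2.
  by apply/measurable_EFinP; apply: mexp2; apply: measurable_funN; exact: measurable_funM.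
- by apply: emeasurable_funM => //; exact: measurable_exp_pos.
- move=> z _; rewrite -!EFinM lee_fin.
  apply: (le_trans (ler_wpM2r (expR_ge0 _) (barrier_kernel_le _ _ _ t0))).
  rewrite /B; case: (ltP 0 y) => y0; last by rewrite posF // !(mul0r, mulr0).
  case: (ltP 0 z) => z0; last by rewrite (posF z0) !(mul0r, mulr0).
  rewrite !posT // !mul1r.
  have -> : expR (lam * (z - y) - lam ^+ 2 * t / 2) = expR (lam * z) * expR (- (lam * y)) * expR (- (lam ^+ 2 * t / 2)).
    by rewrite -!expRD; congr expR; ring.
  have hz := lin_le_exp z l4.
  have e1 : expR (lam * z) * expR (- (3 / 2 * lam * z)) * expR (lam / 4 * z) = expR (- (lam / 4 * z)).
    by rewrite -!expRD; congr expR; field.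
  rewrite [leLHS](_ : _ = (expR (lam * z) * expR (- (3 / 2 * lam * z)) * z) * (expR (- (lam * y)) * expR (- (lam ^+ 2 * t / 2)) * (2 * y / pow32 t))); last by ring.
  rewrite [leRHS](_ : _ = (expR (- (lam / 4 * z)) * (4 / lam)) * (expR (- (lam * y)) * expR (- (lam ^+ 2 * t / 2)) * (2 * y / pow32 t))); last by ring.
  rewrite ler_wpM2r //.
    by rewrite !mulr_ge0 ?expR_ge0 ?invr_ge0 // ltW.
  rewrite -e1 -[leRHS]mulrA ler_wpM2l ?mulr_ge0 ?expR_ge0 //.
  by move: hz; rewrite invf_div.
Qed.

End KernelBounds.

Lemma integral_gauss_exp_affine (R : realType) (v w a b : R) : 0 <= v -> 0 <= w ->
  (\int[gauss v]_u (w * expR (b + a * u))%:E = (w * expR (b + a ^+ 2 * v / 2))%:E)%E.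
Proof.
move=> v0 w0; rewrite expRD mulrA EFinM -(integral_gauss_exp a v0).
have m1 : measurable_fun setT (fun u : R => (expR (a * u))%:E).
  by apply/measurable_EFinP; apply: mexp2; exact: measurable_funM.
have p1 (u : R) : setT u -> (0 <= (expR (a * u))%:E)%E by rewrite lee_fin expR_ge0.
have wb0 : 0 <= w * expR b by rewrite mulr_ge0 ?expR_ge0.
rewrite -(ge0_integralZl_EFin (gauss v) measurableT p1 m1 wb0).
by apply: eq_integral => u _; rewrite expRD -EFinM mulrA.
Qed.

(** * The weighted path along an increasing chain of domains *)

Section Chain.
Variable R : realType.
Context d (T : measurableType d) (P : probability T R).
Variables (F : lmodType R) (L : F -> T -> R) (c : F -> F -> R).
Hypothesis G : gaussian_space P L c.
Notation GT S := (g_sigma_algebraType (rects L S)).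

Definition smeas (S : set F) (H : T -> \bar R) : Prop :=
  measurable_fun setT (H : GT S -> \bar R).

Lemma smeas_L S f : S f -> measurable_fun setT (L f : GT S -> measurableTypeR R).
Proof.
move=> Sf _ B mB; rewrite setTI; apply: sub_gen_smallest.
exists 1%N, (fun=> f), (fun=> B); split => //.
by apply/seteqP; split => t /=; [move=> ? i _ | move=> h; exact: (h 0%N)].
Qed.

Lemma smeas_sub S S' H : S `<=` S' -> smeas S H -> smeas S' H.
Proof.
move=> SS' mH _ B mB; have := mH measurableT B mB; rewrite !setTI.
move: (_ @^-1` B) => A; apply: smallest_sub; first exact: smallest_sigma_algebra.
move=> X [n [f [E [Sf mE ->]]]]; apply: sub_gen_smallest.
by exists n, f, E; split => // i; exact: SS'.
Qed.

Lemma smeas_meas S H : smeas S H -> measurable_fun setT H.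
Proof.
move=> mH _ B mB; have := mH measurableT B mB; rewrite !setTI.
by apply: smallest_sub; [exact: sigma_algebra_measurable | exact: (rects_measurable G)].
Qed.

(* [U j] are the field values at a point relative to an increasing sequence of
   domains, [g j] their variances, and [S j] the functionals not involving
   the [j]-th domain. *)
Record chain (J : nat) (U : nat -> F) (S : nat -> set F) (g : nat -> R) : Prop := Chain {
  chain_S0 : forall j, S j 0;
  chain_Smono : forall i j, (i <= j)%N -> S j `<=` S i;
  chain_cU : forall i j, (i <= j <= J)%N -> c (U i) (U j) = g i;
  chain_SU : forall j, (j <= J)%N -> S j (U J - U j);
  chain_cS : forall j f, (j <= J)%N -> S j f -> c f (U j) = 0;
  chain_g0 : g 0%N = 0;
  chain_lt : forall j, (j < J)%N -> g j < g j.+1 }.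

Section OneChain.
Variables (J : nat) (U : nat -> F) (S : nat -> set F) (g : nat -> R).
Hypothesis ch : chain J U S g.
Variables (lam A : R).

(** The path runs downwards in [j]: it has the deterministic value [A] at [J], and each finer scale
    adds an increment independent of the coarser ones. *)
Definition profile j t : R := A + lam * (g J - g j) - (L (U J) t - L (U j) t).
Definition step_weight j t : R := bridge_weight (g j.+1 - g j) (profile j.+1 t) (profile j t).
Definition weight_prod k j t : R := \prod_(k <= i < j) step_weight i t.

Lemma chain_mono i j : (i <= j <= J)%N -> g i <= g j.
Proof.
move=> /andP[ij jJ]; elim: j ij jJ => [|j IH]; first by rewrite leqn0 => /eqP ->.
rewrite leq_eqVlt => /orP[/eqP -> //|ij] jJ.
by apply: le_trans (IH ij (ltnW jJ)) _; rewrite ltW // (chain_lt ch).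
Qed.

Lemma chain_mono_lt i j : (i < j <= J)%N -> g i < g j.
Proof.
move=> /andP[ij jJ]; apply: lt_le_trans (chain_lt ch _) _; first by exact: leq_trans jJ.
by apply: chain_mono; rewrite ij.
Qed.

Lemma profileE j t : profile j t = A + lam * (g J - g j) - L (U J - U j) t.
Proof. by rewrite /profile (gs_LB G). Qed.

Lemma profile_J t : profile J t = A.
Proof. by rewrite /profile !subrr mulr0 subr0 addr0. Qed.

Lemma profile_step k j t : profile j t = profile k t + lam * (g k - g j) - L (U k - U j) t.
Proof. by rewrite /profile (gs_LB G); ring. Qed.

Lemma profile_smeas S' j : S' (U J - U j) -> measurable_fun setT (profile j : GT S' -> R).
Proof.
move=> h; rewrite (_ : profile j = fun t => A + lam * (g J - g j) - L (U J - U j) t); last first.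
  by apply/funext => t; rewrite profileE.
by apply: measurable_funB => //; exact: smeas_L.
Qed.

Lemma step_weight_ge0 j t : (j < J)%N -> 0 <= step_weight j t.
Proof. by move=> jJ; rewrite bridge_weight_ge0 // subr_gt0 (chain_lt ch). Qed.

Lemma step_weight_le1 j t : (j < J)%N -> step_weight j t <= 1.
Proof. by move=> jJ; rewrite bridge_weight_le1 // subr_gt0 (chain_lt ch). Qed.

Lemma weight_prod_ge0 k j t : (j <= J)%N -> 0 <= weight_prod k j t.
Proof.
move=> jJ; rewrite /weight_prod big_nat prodr_ge0 // => i /andP[_ ij].
by rewrite step_weight_ge0 // (leq_trans ij).
Qed.

Lemma weight_prod_le1 k j t : (j <= J)%N -> weight_prod k j t <= 1.
Proof.
elim: j => [|j IH] jJ; first by rewrite /weight_prod big_geq.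
case: (leqP k j) => kj; last by rewrite /weight_prod big_geq.
rewrite /weight_prod big_nat_recr //= -[leRHS]mulr1 ler_pM //.
- exact: (weight_prod_ge0 k t (ltnW jJ)).
- exact: step_weight_ge0.
- exact: (IH (ltnW jJ)).
- exact: step_weight_le1.
Qed.

Lemma step_weight_smeas S' j : S' (U J - U j) -> S' (U J - U j.+1) ->
  measurable_fun setT (step_weight j : GT S' -> R).
Proof.
move=> h1 h2; exact: (measurable_bridge_weight (g j.+1 - g j) (profile_smeas h2) (profile_smeas h1)).
Qed.

Lemma weight_prod_recr k j t : (k <= j)%N -> weight_prod k j.+1 t = weight_prod k j t * step_weight j t.
Proof. by move=> kj; rewrite /weight_prod big_nat_recr. Qed.

Lemma wprod1 j t : weight_prod j j.+1 t = step_weight j t.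
Proof. by rewrite /weight_prod big_nat1. Qed.

Lemma weight_prod_smeas S' k j : (forall i, (k <= i <= j)%N -> S' (U J - U i)) ->
  measurable_fun setT (weight_prod k j : GT S' -> R).
Proof.
elim: j => [|j IH] h; first by rewrite /weight_prod; under eq_fun do rewrite big_geq //; exact: measurable_cst.
case: (leqP k j) => kj; last by rewrite /weight_prod; under eq_fun do rewrite big_geq //; exact: measurable_cst.
rewrite /weight_prod; under eq_fun do rewrite big_nat_recr //=.
apply: measurable_funM; first by apply: IH => i /andP[ki ij]; apply: h; rewrite ki ltnW.
by apply: step_weight_smeas; apply: h; rewrite ?leqnn ?leqnSn ?kj // ltnW.
Qed.

Lemma SUle i j : (i <= j <= J)%N -> S i (U J - U j).
Proof. by move=> /andP[ij jJ]; apply: (chain_Smono ch ij); exact: (chain_SU ch). Qed.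

Lemma chain_cee j k : (j <= k <= J)%N -> c (U k - U j) (U k - U j) = g k - g j.
Proof.
move=> /andP[jk kJ]; have [_ _ [_ csym] _ _] := G.
have c1 : c (U k) (U k) = g k by rewrite (chain_cU ch) // leqnn.
have c2 : c (U j) (U k) = g j by rewrite (chain_cU ch) // jk.
have c3 : c (U j) (U j) = g j by rewrite (chain_cU ch) // leqnn (leq_trans jk).
rewrite (gs_cB G) (csym (U k)) (csym (U j)) !(gs_cB G) c1 c2 c3 (csym (U k)) c2.
by ring.
Qed.

Lemma chain_orth j k f : (j <= k <= J)%N -> S k f -> c f (U k - U j) = 0.
Proof.
move=> /andP[jk kJ] Sf; have [_ _ [_ csym] _ _] := G.
rewrite csym (gs_cB G) -!(csym f).
rewrite !(chain_cS ch) ?subr0 ?(leq_trans jk) //.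
exact: (chain_Smono ch jk).
Qed.

(** The increment between the scales [j + 1] and [j] is orthogonal to [S (j + 1)], hence independent
    of [H] and of the path at [j + 1]; integrating it out turns weight and density into the killed
    kernel. *)
Lemma peel1 j H (f : R -> \bar R) : (j < J)%N -> smeas (S j.+1) H -> (forall t, 0 <= H t)%E ->
  measurable_fun setT f -> (forall x, 0 <= f x)%E ->
  (\int[P]_t (H t * ((step_weight j t)%:E * f (profile j t))) =
   \int[P]_t (H t * barrier_op lam (g j.+1 - g j) f (profile j.+1 t)))%E.
Proof.
move=> jJ mH H0 mf f0.
set tau := g j.+1 - g j.
have tau0 : 0 < tau by rewrite subr_gt0 (chain_lt ch).
pose e := U j.+1 - U j.
have jj1 : (j <= j.+1 <= J)%N by rewrite leqnSn.
have cee : c e e = tau by exact: chain_cee.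
have Se f' : S j.+1 f' -> c f' e = 0 by exact: chain_orth.
pose y1 : GT (S j.+1) -> R := profile j.+1.
have my1 : measurable_fun setT y1 by apply: profile_smeas; exact: (chain_SU ch).
pose Phi (z : GT (S j.+1) * R) : \bar R :=
  ((H : GT (S j.+1) -> \bar R) z.1 * ((bridge_weight tau (y1 z.1) (y1 z.1 + lam * tau - z.2))%:E * f (y1 z.1 + lam * tau - z.2)%R))%E.
have my1' : measurable_fun setT (fun z : GT (S j.+1) * R => y1 z.1) by exact: (measurableT_comp my1 measurable_fst).
have mz : measurable_fun setT (fun z : GT (S j.+1) * R => y1 z.1 + lam * tau - z.2).
  by apply: measurable_funB; [exact: measurable_funD | exact: measurable_snd].
have mPhi : measurable_fun setT Phi.
  apply: emeasurable_funM; first exact: (measurableT_comp mH measurable_fst).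
  apply: emeasurable_funM; first by apply/measurable_EFinP; exact: measurable_bridge_weight.
  exact: (measurableT_comp mf mz).
have Phi0 z : (0 <= Phi z)%E by rewrite /Phi !mule_ge0 // lee_fin bridge_weight_ge0.
transitivity (\int[P]_t Phi (t, L e t))%E.
  apply: eq_integral => t _; by rewrite /Phi /= /y1 /step_weight (profile_step j.+1 j).
rewrite (gs_peel G (chain_S0 ch _) Se mPhi Phi0) cee.
apply: eq_integral => t _; rewrite /Phi /=.
have mr : measurable_fun setT (fun u : R => y1 t + lam * tau - u) by exact: measurable_funB.
rewrite ge0_integralZl //.
- by rewrite gauss_step.
- apply: emeasurable_funM; last exact: (measurableT_comp mf mr).
  by apply/measurable_EFinP; exact: measurable_bridge_weight.
- by move=> u _; rewrite mule_ge0 // lee_fin bridge_weight_ge0.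
Qed.

(** Scales are integrated out from the finest up: the weight of the coarsest step is first put into
    [H], and the operators then compose by the semigroup property, so that only the total duration
    [g j - g k] remains. *)
Lemma peel k j H (f : R -> \bar R) : (k < j <= J)%N -> smeas (S j) H -> (forall t, 0 <= H t)%E ->
  measurable_fun setT f -> (forall x, 0 <= f x)%E ->
  (\int[P]_t (H t * ((weight_prod k j t)%:E * f (profile k t))) =
   \int[P]_t (H t * barrier_op lam (g j - g k) f (profile j t)))%E.
Proof.
move=> /andP[kj jJ] mH H0 mf f0.
elim: j kj jJ H mH H0 => // j IH; rewrite ltnS leq_eqVlt => /orP[/eqP <- {IH}|kj] jJ H mH H0.
  apply: etrans (peel1 jJ mH H0 mf f0).
  by apply: eq_integral => t _; rewrite wprod1.
have gkj : 0 < g j - g k by rewrite subr_gt0 chain_mono_lt // kj ltnW.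
have gj1 : 0 < g j.+1 - g j by rewrite subr_gt0 (chain_lt ch).
pose H' t := (H t * (step_weight j t)%:E)%E.
have mH' : smeas (S j) H'.
  apply: emeasurable_funM; first exact: (smeas_sub (chain_Smono ch (leqnSn j)) mH).
  apply/measurable_EFinP; apply: step_weight_smeas; apply: SUle; first by rewrite leqnn ltnW.
  by rewrite leqnSn.
have H'0 t : (0 <= H' t)%E by rewrite mule_ge0 // lee_fin step_weight_ge0.
transitivity (\int[P]_t (H' t * ((weight_prod k j t)%:E * f (profile k t))))%E.
  apply: eq_integral => t _; rewrite weight_prod_recr ?(ltnW kj) // /H' EFinM.
  by rewrite -!muleA; congr (_ * _)%E; rewrite muleCA.
apply: (etrans (IH kj (ltnW jJ) H' mH' H'0)).
have mK := measurable_barrier_op lam gkj mf f0.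
have K0 x : (0 <= barrier_op lam (g j - g k) f x)%E by exact: barrier_op_ge0.
transitivity (\int[P]_t (H t * ((step_weight j t)%:E * barrier_op lam (g j - g k) f (profile j t))))%E.
  by apply: eq_integral => t _; rewrite muleA.
apply: (etrans (peel1 jJ mH H0 mK K0)).
apply: eq_integral => t _; congr (_ * _)%E.
apply: (etrans (barrier_op_semigroup lam (profile j.+1 t) gj1 gkj mf f0)).
by rewrite addrA subrK.
Qed.

(** The conditional mean of the weights of the scales below [j] and of the window, given the path at
    [j]. At [j = 0] no time elapses and the window itself takes the place of the kernel. *)
Definition barrier_value j : R -> \bar R := if j is 0%N then @start_window R else barrier_op lam (g j) (@start_window R).

Lemma g_gt0 j : (0 < j <= J)%N -> 0 < g j.
Proof. by move=> h; rewrite -(chain_g0 ch) chain_mono_lt. Qed.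

Lemma barrier_value_ge0 j x : (j <= J)%N -> (0 <= barrier_value j x)%E.
Proof.
case: j => [|j] jJ; first exact: start_window_ge0.
by apply: barrier_op_ge0; [exact: g_gt0 | exact: start_window_ge0].
Qed.

Lemma measurable_barrier_value j : (j <= J)%N -> measurable_fun setT (barrier_value j).
Proof.
case: j => [|j] jJ; first exact: measurable_start_window.
by apply: measurable_barrier_op; [exact: g_gt0 | exact: measurable_start_window | exact: start_window_ge0].
Qed.

Lemma peel_barrier_value j H : (j <= J)%N -> smeas (S j) H -> (forall t, 0 <= H t)%E ->
  (\int[P]_t (H t * ((weight_prod 0 j t)%:E * start_window (profile 0 t))) =
   \int[P]_t (H t * barrier_value j (profile j t)))%E.
Proof.
case: j => [|j] jJ mH H0.
  by apply: eq_integral => t _; rewrite /weight_prod big_geq // mul1e.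
have kj : (0 < j.+1 <= J)%N by rewrite jJ.
have := peel kj mH H0 (@measurable_start_window R) (@start_window_ge0 R).
by rewrite (chain_g0 ch) subr0.
Qed.

Definition total_weight t : \bar R := ((weight_prod 0 J t)%:E * start_window (profile 0 t))%E.

Lemma total_weight_ge0 t : (0 <= total_weight t)%E.
Proof. by rewrite mule_ge0 ?start_window_ge0 // lee_fin weight_prod_ge0. Qed.

Lemma integral_total_weight : (\int[P]_t total_weight t = barrier_value J A)%E.
Proof.
transitivity (\int[P]_t (1 * ((weight_prod 0 J t)%:E * start_window (profile 0 t))))%E.
  by apply: eq_integral => t _; rewrite mul1e.
have m1 : smeas (S J) (fun=> 1%E) by exact: measurable_cst.
apply: (etrans (peel_barrier_value (leqnn J) m1 (fun=> lee01))).
transitivity (\int[P]_t (cst (barrier_value J A) t))%E.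
  by apply: eq_integral => t _; rewrite profile_J mul1e.
by rewrite integral_cst //= probability_setT mule1.
Qed.

(* Up to constants, the weights of the scales below [j] contribute [fine_factor j] and those
   above [k] contribute [coarse_factor k]. *)
Definition fine_factor j : R := if j is 0%N then 1 else (pow32 (g j))^-1.

Lemma barrier_value_le j x : 0 < lam -> (j <= J)%N ->
  (barrier_value j x <= (4 * expR (2 * lam) * fine_factor j * expR (- (lam ^+ 2 * g j / 2)) *
     (pos x * x * expR (- (lam * x))))%:E)%E.
Proof.
move=> lam0; case: j => [|j] jJ; last first.
  by apply: (barrier_op_start_window_le x (g_gt0 _) (ltW lam0)); rewrite jJ.
rewrite /barrier_value /fine_factor start_windowE lee_fin (chain_g0 ch) mulr0 mul0r oppr0 expR0 !mulr1.
case: (ltP 0 x) => x0; last first.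
  by rewrite posF // !mul0r mulr0 (_ : (1 <= x <= 2) = false) //; apply/negbTE/negP; lra.
rewrite posT // mul1r; case: (boolP (1 <= x <= 2)) => /= [/andP[x1 x2]|_]; last first.
  by rewrite !mulr_ge0 ?expR_ge0 // ltW.
have h : 1 <= expR (2 * lam) * expR (- (lam * x)).
  rewrite -expRD; apply: le_trans (expR_ge1Dx _).
  have : 0 <= (2 - x) * lam by apply: mulr_ge0; [lra | exact: ltW].
  by lra.
rewrite [leRHS](_ : _ = 4 * x * (expR (2 * lam) * expR (- (lam * x)))); last by ring.
rewrite -[leLHS]mulr1 ler_pM //; lra.
Qed.

(** Squaring [x * exp (- lam x)] gives [x ^ 2 * exp (- 2 lam x)]; giving up [exp (lam x / 2)] for
    the factor [x ^ 2] leaves the exponent [3/2], still larger than the exponent 1 of the drift that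
    it meets in [barrier_op_exp_le]. *)
Lemma barrier_value2_le j x : 0 < lam -> (j <= J)%N ->
  (barrier_value j x * barrier_value j x <= (256 * expR (4 * lam) / lam ^+ 2 * fine_factor j ^+ 2 * expR (- (lam ^+ 2 * g j)) *
     expR (- (3 / 2 * lam * x)))%:E)%E.
Proof.
move=> lam0 jJ; have h := barrier_value_le x lam0 jJ; have h0 := barrier_value_ge0 x jJ.
apply: (le_trans (lee_pmul h0 h0 h h)); rewrite -EFinM lee_fin.
have l4 : 0 < lam / 4 by rewrite divr_gt0.
have hx : (pos x * x * expR (- (lam * x))) ^+ 2 <= 16 / lam ^+ 2 * expR (- (3 / 2 * lam * x)).
  case: (ltP 0 x) => x0; last first.
    by rewrite posF // !mul0r expr0n /= !mulr_ge0 ?expR_ge0 // invr_ge0 sqr_ge0.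
  rewrite posT // mul1r exprMn.
  have e1 : expR (- (3 / 2 * lam * x)) = expR (lam / 4 * x) ^+ 2 * expR (- (lam * x)) ^+ 2.
    by rewrite -!expRM_natl -expRD; congr expR; field.
  rewrite e1 [leRHS]mulrA ler_wpM2r ?sqr_ge0 //.
  have := lin_le_exp x l4; rewrite invf_div => hz.
  have -> : 16 / lam ^+ 2 * expR (lam / 4 * x) ^+ 2 = (expR (lam / 4 * x) * (4 / lam)) ^+ 2.
    by field; rewrite gt_eqF.
  have r0 : 0 < expR (lam / 4 * x) * (4 / lam) by rewrite mulr_gt0 ?expR_gt0 // divr_gt0.
  by apply: lerXn2r => //; rewrite nnegrE ltW.
have e2 : expR (4 * lam) = expR (2 * lam) ^+ 2 by rewrite -expRM_natl; congr expR; ring.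
have e3 : expR (- (lam ^+ 2 * g j)) = expR (- (lam ^+ 2 * g j / 2)) ^+ 2.
  by rewrite -expRM_natl; congr expR; field.
rewrite [leLHS](_ : _ = 16 * expR (2 * lam) ^+ 2 * fine_factor j ^+ 2 * expR (- (lam ^+ 2 * g j / 2)) ^+ 2 *
   (pos x * x * expR (- (lam * x))) ^+ 2); last by ring.
rewrite [leRHS](_ : _ = 16 * expR (2 * lam) ^+ 2 * fine_factor j ^+ 2 * expR (- (lam ^+ 2 * g j / 2)) ^+ 2 *
   (16 / lam ^+ 2 * expR (- (3 / 2 * lam * x)))); last by rewrite e2 e3; field; rewrite gt_eqF.
apply: ler_wpM2l => //; apply: mulr_ge0; last exact: sqr_ge0.
by apply: mulr_ge0; last exact: sqr_ge0; apply: mulr_ge0 => //; exact: sqr_ge0.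
Qed.

Lemma mexp_profile j : (j <= J)%N -> measurable_fun setT (fun t => (expR (- (3 / 2 * lam * profile j t)))%:E).
Proof.
move=> jJ; have [mL _ _ _ _] := G.
apply/measurable_EFinP; apply: mexp2; apply: measurable_funN; apply: measurable_funM => //.
rewrite (_ : profile j = fun t => A + lam * (g J - g j) - L (U J - U j) t); last first.
  by apply/funext => t; rewrite profileE.
by apply: measurable_funB.
Qed.

Lemma measurable_profile j : (j <= J)%N -> measurable_fun setT (profile j).
Proof.
move=> jJ; have my1 := profile_smeas (chain_SU ch jJ).
by have := smeas_meas ((measurable_EFinP _ _).2 my1); move/measurable_EFinP.
Qed.

Lemma measurable_weight_prod k j : (j <= J)%N -> measurable_fun setT (weight_prod k j).
Proof.
move=> jJ; have mw1 : measurable_fun setT (weight_prod k j : GT (S 0%N) -> R).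
  by apply: weight_prod_smeas => i /andP[_ ij]; apply: SUle; rewrite (leq_trans ij).
by have /smeas_meas/measurable_EFinP := (measurable_EFinP _ _).2 mw1.
Qed.

(** The scales between [j] and [k] carry no weight. Over their duration [tau] the exponential moment
    is multiplied by [exp ((9/8 - 3/2) * lam ^ 2 * tau) <= 1]. *)
Lemma gap_le j k : (j <= k <= J)%N ->
  (\int[P]_t ((weight_prod k J t)%:E * (expR (- (3 / 2 * lam * profile j t)))%:E) <=
   \int[P]_t ((weight_prod k J t)%:E * (expR (- (3 / 2 * lam * profile k t)))%:E))%E.
Proof.
move=> jk; have /andP[_ kJ] := jk.
set tau := g k - g j; pose e := U k - U j.
have tau0 : 0 <= tau by rewrite subr_ge0 chain_mono.
have cee : c e e = tau by exact: chain_cee.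
have Se f' : S k f' -> c f' e = 0 by exact: chain_orth.
pose y1 : GT (S k) -> R := profile k.
pose w1 : GT (S k) -> R := weight_prod k J.
have my1 : measurable_fun setT y1 by apply: profile_smeas; exact: (chain_SU ch).
have mw1 : measurable_fun setT w1 by apply: weight_prod_smeas => i h; exact: SUle.
pose Phi (z : GT (S k) * R) : \bar R :=
  ((w1 z.1)%:E * (expR (- (3 / 2 * lam * (y1 z.1 + lam * tau - z.2))))%:E)%E.
have my1' : measurable_fun setT (fun z : GT (S k) * R => y1 z.1) by exact: (measurableT_comp my1 measurable_fst).
have mw1' : measurable_fun setT (fun z : GT (S k) * R => w1 z.1) by exact: (measurableT_comp mw1 measurable_fst).
have mz : measurable_fun setT (fun z : GT (S k) * R => y1 z.1 + lam * tau - z.2).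
  by apply: measurable_funB; [exact: measurable_funD | exact: measurable_snd].
have mPhi : measurable_fun setT Phi.
  apply: emeasurable_funM; first exact/measurable_EFinP.
  by apply/measurable_EFinP; apply: mexp2; apply: measurable_funN; exact: measurable_funM.
have Phi0 z : (0 <= Phi z)%E by rewrite /Phi mule_ge0 // lee_fin ?expR_ge0 // weight_prod_ge0.
rewrite [leLHS](_ : _ = \int[P]_t Phi (t, L e t))%E; last first.
  by apply: eq_integral => t _; rewrite /Phi /= /y1 /w1 (profile_step k j).
rewrite (gs_peel G (chain_S0 ch _) Se mPhi Phi0) cee.
have mwr : measurable_fun setT (weight_prod k J : T -> R).
  by have /smeas_meas/measurable_EFinP := (measurable_EFinP _ _).2 mw1.
have key t : (\int[gauss tau]_u Phi (t, u) =
    (weight_prod k J t)%:E * (expR (- (3 / 2 * lam * (profile k t + lam * tau)) + (3 / 2 * lam) ^+ 2 * tau / 2))%:E)%E.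
  rewrite -EFinM -(integral_gauss_exp_affine _ _ tau0 (weight_prod_ge0 k t (leqnn J))).
  apply: eq_integral => u _; rewrite /Phi /= -EFinM.
  have pt (Y s v : R) : - (3 / 2 * lam * (Y + lam * s - v)) = - (3 / 2 * lam * (Y + lam * s)) + 3 / 2 * lam * v by ring.
  by rewrite /y1 /w1 pt.
apply: ge0_le_integral => //.
- by move=> t _; exact: integral_ge0.
- rewrite (_ : (fun t => _) = fun t => ((weight_prod k J t)%:E * (expR (- (3 / 2 * lam * (profile k t + lam * tau)) + (3 / 2 * lam) ^+ 2 * tau / 2))%:E)%E); last exact/funext.
  apply: emeasurable_funM; first exact/measurable_EFinP.
  apply/measurable_EFinP; apply: mexp2; apply: measurable_funD => //; apply: measurable_funN.
  apply: measurable_funM => //; apply: measurable_funD => //.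
  exact: measurable_profile.
- by apply: emeasurable_funM; [exact/measurable_EFinP | exact: mexp_profile].
- move=> t _; rewrite key -!EFinM lee_fin ler_wpM2l ?weight_prod_ge0 // ler_expR.
  have : 0 <= lam ^+ 2 * tau by rewrite mulr_ge0 ?sqr_ge0.
  by rewrite !exprMn; lra.
Qed.

Definition coarse_factor k : R := if (k < J)%N then
  32 / lam ^+ 2 * A * expR (- (lam ^+ 2 * (g J - g k) / 2)) / pow32 (g J - g k) else 1.

Lemma coarse_le k : 0 < lam -> 0 < A -> (k <= J)%N ->
  (\int[P]_t ((weight_prod k J t)%:E * (expR (- (3 / 2 * lam * profile k t)))%:E) <= (coarse_factor k)%:E)%E.
Proof.
move=> lam0 A0; rewrite leq_eqVlt /coarse_factor => /orP[/eqP ->|kJ].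
  rewrite ltnn; apply: (@le_trans _ _ (\int[P]_t (cst 1 t))%E); last first.
    by rewrite integral_cst //= probability_setT mule1.
  apply: ge0_le_integral => //.
  - by move=> t _; rewrite mule_ge0 // lee_fin ?expR_ge0 // weight_prod_ge0.
  - apply: emeasurable_funM; last exact: mexp_profile.
    by apply/measurable_EFinP; rewrite /weight_prod; under eq_fun do rewrite big_geq //; exact: measurable_cst.
  - move=> t _; rewrite /weight_prod big_geq // mul1e profile_J /= lee_fin -[leRHS]expR0 ler_expR oppr_le0.
    by rewrite !mulr_ge0 // ltW.
rewrite kJ.
pose f (x : R) : \bar R := (expR (- (3 / 2 * lam * x)))%:E.
have mf : measurable_fun setT f.
  by apply/measurable_EFinP; apply: mexp2; apply: measurable_funN; exact: measurable_funM.
have f0 x : (0 <= f x)%E by rewrite lee_fin expR_ge0.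
have m1 : smeas (S J) (fun=> 1%E) by exact: measurable_cst.
have kJJ : (k < J <= J)%N by rewrite kJ leqnn.
have tau0 : 0 < g J - g k by rewrite subr_gt0 chain_mono_lt.
rewrite [leLHS](_ : _ = \int[P]_t (1 * ((weight_prod k J t)%:E * f (profile k t))))%E; last first.
  by apply: eq_integral => t _; rewrite mul1e.
rewrite (peel kJJ m1 (fun=> lee01) mf f0).
rewrite [leLHS](_ : _ = \int[P]_t (cst (barrier_op lam (g J - g k) f A) t))%E; last first.
  by apply: eq_integral => t _; rewrite profile_J mul1e.
rewrite integral_cst //= probability_setT mule1.
apply: (le_trans (barrier_op_exp_le A tau0 lam0)); rewrite lee_fin.
have ip := pow32_gt0 tau0.
rewrite posT // mul1r ler_pM2r ?invr_gt0 // ler_wpM2r ?expR_ge0 //.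
rewrite ler_wpM2l //; first by rewrite mulr_ge0 // invr_ge0 sqr_ge0.
by rewrite ler_piMr ?ltW // -[X in _ < X]expR0 ltr_expR oppr_lt0 mulr_gt0.
Qed.

Lemma CF_le j k : 0 < lam -> 0 < A -> (j <= k <= J)%N ->
  (\int[P]_t ((weight_prod k J t)%:E * (barrier_value j (profile j t) * barrier_value j (profile j t))) <=
   (256 * expR (4 * lam) / lam ^+ 2 * fine_factor j ^+ 2 * expR (- (lam ^+ 2 * g j)) * coarse_factor k)%:E)%E.
Proof.
move=> lam0 A0 jkJ; have /andP[jk kJ] := jkJ; have jJ := leq_trans jk kJ.
set B := 256 * _ / _ * _ * _.
have B0 : 0 <= B.
  rewrite /B; apply: mulr_ge0; last exact: expR_ge0.
  apply: mulr_ge0; last exact: sqr_ge0.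
  apply: divr_ge0; last exact: sqr_ge0.
  by apply: mulr_ge0; [rewrite ler0n | exact: expR_ge0].
have mwr : measurable_fun setT (weight_prod k J : T -> R).
  have mw1 : measurable_fun setT (weight_prod k J : GT (S k) -> R) by apply: weight_prod_smeas => i h; exact: SUle.
  by have /smeas_meas/measurable_EFinP := (measurable_EFinP _ _).2 mw1.
rewrite EFinM; apply: (@le_trans _ _ (B%:E * \int[P]_t ((weight_prod k J t)%:E * (expR (- (3 / 2 * lam * profile j t)))%:E))%E); last first.
  by apply: lee_wpmul2l; [rewrite lee_fin | apply: le_trans (gap_le jkJ) (coarse_le lam0 A0 kJ)].
have mwe : measurable_fun setT (fun t => ((weight_prod k J t)%:E * (expR (- (3 / 2 * lam * profile j t)))%:E)%E).
  by apply: emeasurable_funM; [exact/measurable_EFinP | exact: mexp_profile].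
have my : measurable_fun setT (profile j : T -> R).
  have my1 := profile_smeas (chain_SU ch jJ).
  by have := smeas_meas ((measurable_EFinP _ _).2 my1); move/measurable_EFinP.
have mFF : measurable_fun setT (fun t => barrier_value j (profile j t)) by exact: (measurableT_comp (measurable_barrier_value jJ) my).
rewrite -ge0_integralZl_EFin //; last first.
  by move=> t _; rewrite mule_ge0 // lee_fin ?expR_ge0 // weight_prod_ge0.
apply: ge0_le_integral => //.
- by move=> t _; rewrite !mule_ge0 ?barrier_value_ge0 // lee_fin weight_prod_ge0.
- by apply: emeasurable_funM; [exact/measurable_EFinP | exact: emeasurable_funM].
- exact: emeasurable_funM.
- move=> t _; rewrite [leRHS]muleCA; apply: lee_wpmul2l; first by rewrite lee_fin weight_prod_ge0.
  by rewrite -EFinM; exact: barrier_value2_le.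
Qed.

Lemma measurable_total_weight : measurable_fun setT total_weight.
Proof.
apply: emeasurable_funM; first by apply/measurable_EFinP; exact: measurable_weight_prod.
exact: (measurableT_comp (@measurable_start_window R) (measurable_profile (leq0n J))).
Qed.

(** The weights of the scales between [j] and [k], where two points at distance about [2 ^ j] are
    not decoupled, are at most 1 and are discarded. *)
Lemma total_weight_le j k t : (j <= k <= J)%N ->
  (total_weight t <= (weight_prod k J t)%:E * ((weight_prod 0 j t)%:E * start_window (profile 0 t)))%E.
Proof.
move=> /andP[jk kJ].
have wE0 : weight_prod 0 J t = weight_prod 0 j t * weight_prod j k t * weight_prod k J t.
  by rewrite /weight_prod -!big_cat_nat // ?(leq_trans jk).
rewrite /total_weight wE0 [leRHS]muleA; apply: lee_pmul => //; last 2 first.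
- exact: start_window_ge0.
- rewrite -EFinM lee_fin.
  rewrite mulrAC [leRHS]mulrC; apply: ler_piMr; last exact: weight_prod_le1.
  by rewrite mulr_ge0 ?weight_prod_ge0 // (leq_trans jk).
- by rewrite lee_fin !mulr_ge0 ?weight_prod_ge0 ?(leq_trans jk).
Qed.

End OneChain.

(** * Decoupling two chains *)

Section TwoChains.
Variables (J : nat) (U1 U2 : nat -> F) (S1 S2 : nat -> set F) (g1 g2 : nat -> R).
Hypotheses (ch1 : chain J U1 S1 g1) (ch2 : chain J U2 S2 g2).
Variables (lam1 lam2 A : R) (j k : nat).
Hypothesis jkJ : (j <= k <= J)%N.
Hypothesis H12 : forall i, (i <= j)%N || (k <= i <= J)%N -> S1 j (U2 J - U2 i).
Hypothesis H21 : forall i, (i <= j)%N || (k <= i <= J)%N -> S2 j (U1 J - U1 i).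

(** The larger of [x] and [y] dominates the product, and [p] and [q] are at most 1. This trades the
    joint weight of two points for the weights of one point at a time. *)
Lemma mule_le_sum (p q : R) (x y : \bar R) : 0 <= p <= 1 -> 0 <= q <= 1 -> (0 <= x)%E -> (0 <= y)%E ->
  (p%:E * q%:E * x * y <= p%:E * (x * x) + q%:E * (y * y))%E.
Proof.
have wlog_le (r s : R) (a b : \bar R) : 0 <= r <= 1 -> 0 <= s <= 1 -> (0 <= a)%E -> (0 <= b)%E ->
    (a <= b)%E -> (r%:E * (s%:E * (a * b)) <= s%:E * (b * b))%E.
  move=> /andP[r0 r1] /andP[s0 s1] a0 b0 ab.
  apply: (@le_trans _ _ (1 * (s%:E * (a * b)))%E).
    by apply: lee_wpmul2r; rewrite ?lee_fin // !mule_ge0 ?lee_fin.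
  rewrite mul1e; apply: lee_wpmul2l; first by rewrite lee_fin.
  exact: lee_wpmul2r.
move=> hp hq x0 y0; case: (leP x y) => xy.
  rewrite -!muleA; apply: le_trans (wlog_le p q x y hp hq x0 y0 xy) _.
  by rewrite leeDr // !mule_ge0 ?lee_fin //; case/andP: hp.
rewrite [(p%:E * _)%E in leLHS]muleC -!muleA [(x * y)%E]muleC.
apply: le_trans (wlog_le q p y x hq hp y0 x0 (ltW xy)) _.
by rewrite leeDl // !mule_ge0 ?lee_fin //; case/andP: hq.
Qed.

(** By [H12] all weights of the second point that are kept are measurable for [S1 j], so the fine
    scales of the first point are integrated out first; then [H21] does the same for the second. The
    coarse weights remain correlated and are separated by [mule_le_sum]. *)
Lemma pair_le :
  (\int[P]_t (total_weight J U1 g1 lam1 A t * total_weight J U2 g2 lam2 A t) <=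
   \int[P]_t ((weight_prod J U1 g1 lam1 A k J t)%:E *
      (barrier_value g1 lam1 j (profile J U1 g1 lam1 A j t) * barrier_value g1 lam1 j (profile J U1 g1 lam1 A j t))) +
   \int[P]_t ((weight_prod J U2 g2 lam2 A k J t)%:E *
      (barrier_value g2 lam2 j (profile J U2 g2 lam2 A j t) * barrier_value g2 lam2 j (profile J U2 g2 lam2 A j t))))%E.
Proof.
have /andP[jk kJ] := jkJ; have jJ := leq_trans jk kJ.
set C1 := weight_prod J U1 g1 lam1 A k J; set C2 := weight_prod J U2 g2 lam2 A k J.
set D1 := weight_prod J U1 g1 lam1 A 0 j; set D2 := weight_prod J U2 g2 lam2 A 0 j.
set y1 := profile J U1 g1 lam1 A; set y2 := profile J U2 g2 lam2 A.
set F1 := barrier_value g1 lam1 j; set F2 := barrier_value g2 lam2 j.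
have C10 t : 0 <= C1 t by exact: (weight_prod_ge0 ch1).
have C20 t : 0 <= C2 t by exact: (weight_prod_ge0 ch2).
have D10 t : 0 <= D1 t by exact: (weight_prod_ge0 ch1).
have D20 t : 0 <= D2 t by exact: (weight_prod_ge0 ch2).
have C11 t : C1 t <= 1 by exact: (weight_prod_le1 ch1).
have C21 t : C2 t <= 1 by exact: (weight_prod_le1 ch2).
have F10 x : (0 <= F1 x)%E by exact: (barrier_value_ge0 ch1).
have F20 x : (0 <= F2 x)%E by exact: (barrier_value_ge0 ch2).
pose H1 t := ((C1 t)%:E * (C2 t)%:E * ((D2 t)%:E * start_window (y2 0%N t)))%E.
have H10 t : (0 <= H1 t)%E by rewrite !mule_ge0 ?lee_fin ?start_window_ge0.
have sC1 : smeas (S1 j) (fun t => (C1 t)%:E).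
  apply/measurable_EFinP; apply: weight_prod_smeas => i /andP[ki iJ].
  by apply: (SUle ch1); rewrite (leq_trans jk).
have sC2 : smeas (S1 j) (fun t => (C2 t)%:E).
  by apply/measurable_EFinP; apply: weight_prod_smeas => i h; apply: H12; rewrite h orbT.
have sC1' : smeas (S2 j) (fun t => (C1 t)%:E).
  by apply/measurable_EFinP; apply: weight_prod_smeas => i h; apply: H21; rewrite h orbT.
have sC2' : smeas (S2 j) (fun t => (C2 t)%:E).
  apply/measurable_EFinP; apply: weight_prod_smeas => i /andP[ki iJ].
  by apply: (SUle ch2); rewrite (leq_trans jk).
have sD2 : smeas (S1 j) (fun t => (D2 t)%:E).
  by apply/measurable_EFinP; apply: weight_prod_smeas => i /andP[_ h]; apply: H12; rewrite h.
have sy20 : measurable_fun setT (y2 0%N : GT (S1 j) -> R) by apply: profile_smeas; exact: H12.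
have sH1 : smeas (S1 j) H1.
  apply: emeasurable_funM; first exact: emeasurable_funM.
  apply: emeasurable_funM => //; exact: (measurableT_comp (@measurable_start_window R) sy20).
pose H2 t := ((C1 t)%:E * (C2 t)%:E * F1 (y1 j t))%E.
have H20 t : (0 <= H2 t)%E by rewrite !mule_ge0 ?lee_fin.
have sy1 : measurable_fun setT (y1 j : GT (S2 j) -> R) by apply: profile_smeas; apply: H21; rewrite leqnn.
have sH2 : smeas (S2 j) H2.
  apply: emeasurable_funM; first exact: emeasurable_funM.
  exact: (measurableT_comp (measurable_barrier_value ch1 lam1 jJ) sy1).
have mW1 := measurable_total_weight ch1 lam1 A; have mW2 := measurable_total_weight ch2 lam2 A.
have my1 i : (i <= J)%N -> measurable_fun setT (y1 i) by exact: (measurable_profile ch1).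
have my2 i : (i <= J)%N -> measurable_fun setT (y2 i) by exact: (measurable_profile ch2).
have mD1 : measurable_fun setT (fun t => (D1 t)%:E) by apply/measurable_EFinP; exact: (measurable_weight_prod ch1).
have mf1 : measurable_fun setT (fun t => start_window (y1 0%N t)) by exact: (measurableT_comp (@measurable_start_window R) (my1 _ _)).
have mF1 : measurable_fun setT (fun t => F1 (y1 j t)) by exact: (measurableT_comp (measurable_barrier_value ch1 lam1 jJ) (my1 _ _)).
have mF2 : measurable_fun setT (fun t => F2 (y2 j t)) by exact: (measurableT_comp (measurable_barrier_value ch2 lam2 jJ) (my2 _ _)).
have mC1 := smeas_meas sC1; have mC2 := smeas_meas sC2.
apply: (@le_trans _ _ (\int[P]_t (H1 t * ((D1 t)%:E * start_window (y1 0%N t))))%E).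
  apply: ge0_le_integral => //.
  - by move=> t _; rewrite mule_ge0 ?(total_weight_ge0 ch1) ?(total_weight_ge0 ch2).
  - exact: emeasurable_funM.
  - by apply: emeasurable_funM; [exact: smeas_meas sH1 | exact: emeasurable_funM].
  - move=> t _.
    apply: (le_trans (lee_pmul (total_weight_ge0 ch1 lam1 A t) (total_weight_ge0 ch2 lam2 A t) (total_weight_le ch1 lam1 A t jkJ) (total_weight_le ch2 lam2 A t jkJ))).
    by rewrite /H1 muleACA -[leRHS]muleA [X in (_ <= _ * X)%E]muleC lexx.
rewrite (peel_barrier_value ch1 lam1 A jJ sH1 H10).
rewrite [leLHS](_ : _ = \int[P]_t (H2 t * ((D2 t)%:E * start_window (y2 0%N t))))%E; last first.
  by apply: eq_integral => t _; rewrite /H1 /H2 muleAC.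
have F11 t : (0 <= F1 (y1 j t) * F1 (y1 j t))%E := mule_ge0 (F10 _) (F10 _).
have F22 t : (0 <= F2 (y2 j t) * F2 (y2 j t))%E := mule_ge0 (F20 _) (F20 _).
rewrite (peel_barrier_value ch2 lam2 A jJ sH2 H20) -ge0_integralD //; last 4 first.
- by move=> t _; apply: mule_ge0 (F11 t); rewrite lee_fin C10.
- by apply: emeasurable_funM => //; exact: emeasurable_funM.
- by move=> t _; apply: mule_ge0 (F22 t); rewrite lee_fin C20.
- by apply: emeasurable_funM => //; exact: emeasurable_funM.
apply: ge0_le_integral => //.
- by move=> t _; exact: mule_ge0 (H20 t) (F20 _).
- by apply: emeasurable_funM => //; exact: smeas_meas sH2.
- by apply: emeasurable_funD; apply: emeasurable_funM => //; exact: emeasurable_funM.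
- move=> t _; apply: mule_le_sum; [| |exact: F10|exact: F20].
    by rewrite C10 C11.
  by rewrite C20 C21.
Qed.

End TwoChains.
End Chain.

(** * Elementary inequalities *)

Section Elementary.
Variable R : realType.
Implicit Types (x y a : R) (n j J : nat).

(** Convexity, from the tangent inequality [exp u >= 1 + u] at two points weighted by [th] and
    [1 - th]. *)
Lemma expR_interp (th a : R) : 0 <= th <= 1 -> expR (th * a) <= th * expR a + (1 - th).
Proof.
move=> /andP[th0 th1].
have h1 : expR (th * a) * (1 + (1 - th) * a) <= expR a.
  have -> : expR a = expR (th * a) * expR ((1 - th) * a) by rewrite -expRD; congr expR; ring.
  by rewrite ler_pM2l ?expR_gt0 // expR_ge1Dx.
have h2 : expR (th * a) * (1 - th * a) <= 1.
  rewrite -[leRHS](@expRxMexpNx_1 R (th * a)) ler_pM2l ?expR_gt0 // expR_ge1Dx //.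
have h3 : th * (expR (th * a) * (1 + (1 - th) * a)) <= th * expR a by rewrite ler_wpM2l.
have h4 : (1 - th) * (expR (th * a) * (1 - th * a)) <= 1 - th.
  by rewrite -[leRHS]mulr1 ler_wpM2l //; lra.
have -> : expR (th * a) = th * (expR (th * a) * (1 + (1 - th) * a)) + (1 - th) * (expR (th * a) * (1 - th * a)) by ring.
by rewrite lerD.
Qed.

(** The slope spreads the correction [(3/2) ln J] evenly over the scales; [J ^ (j / J) <= j + 1]
    turns the share of the first [j] scales into a power of [j]. *)
Lemma expR_frac_ln j J : (0 < J)%N -> (j <= J)%N ->
  expR (j%:R / J%:R * ln (J%:R : R)) <= j%:R + 1.
Proof.
move=> J0 jJ; have JR : 0 < (J%:R : R) by rewrite ltr0n.
have th : 0 <= (j%:R / J%:R : R) <= 1.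
  by rewrite divr_ge0 ?ler0n //= ler_pdivrMr // mul1r ler_nat.
apply: le_trans (expR_interp _ th) _; rewrite lnK ?posrE // mulfVK ?gt_eqF //.
by case/andP: th => th0 _; lra.
Qed.

Lemma ln_le_subr1 x : 0 < x -> ln x <= x - 1.
Proof.
move=> x0; have := @le_ln1Dx R (x - 1).
by rewrite (_ : 1 + (x - 1) = x); [apply; lra | ring].
Qed.

Lemma exists_nat_ge x : exists n : nat, x <= n%:R.
Proof.
exists (Num.bound `|x|); apply: le_trans (ler_norm x) _.
by rewrite ltW // archi_boundP.
Qed.

Lemma expR_pow32 x : 0 < x -> expR (3 / 2 * ln x) = pow32 x.
Proof.
move=> x0; have s0 : 0 < Num.sqrt x by rewrite sqrtr_gt0.
have e : ln x = ln (Num.sqrt x) + ln (Num.sqrt x) by rewrite -lnM ?posrE // -expr2 sqr_sqrtr ?ltW.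
rewrite (_ : 3 / 2 * ln x = ln x + ln (Num.sqrt x)); last by rewrite e; field.
by rewrite expRD !lnK ?posrE.
Qed.

(** From the second term on, each term is at most the difference of consecutive values of
    [2 / sqrt n]. *)
Lemma sum_pow32 n : \sum_(0 <= i < n) (pow32 (i.+1%:R : R))^-1 <= 3.
Proof.
suff h : (0 < n)%N -> \sum_(0 <= i < n) (pow32 (i.+1%:R : R))^-1 <= 3 - 2 / Num.sqrt n%:R.
  case: n h => [|n] h; first by rewrite big_geq.
  apply: le_trans (h isT) _; have : 0 <= 2 / Num.sqrt (n.+1%:R : R) by rewrite divr_ge0 // sqrtr_ge0.
  by lra.
elim: n => [//|n IH] _; case: n IH => [_|n IH].
  by rewrite big_nat1 /pow32 sqrtr1 mulr1 invr1; lra.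
rewrite big_nat_recr //=; apply: (le_trans (lerD (IH isT) (lexx _))).
set s := Num.sqrt (n.+1%:R : R); set s' := Num.sqrt (n.+2%:R : R).
have s0 : 0 < s by rewrite sqrtr_gt0.
have s'0 : 0 < s' by rewrite sqrtr_gt0.
have ss' : s <= s' by rewrite ler_wsqrtr // ler_nat.
have e1 : s ^+ 2 = n.+1%:R by rewrite sqr_sqrtr.
have e2 : s' ^+ 2 = n.+2%:R by rewrite sqr_sqrtr.
have e3 : s' ^+ 2 - s ^+ 2 = 1 by rewrite e1 e2 -[n.+2]addn1 natrD; lra.
rewrite /pow32 -/s' -e2; clearbody s s'.
have h : (s' ^+ 2 * s')^-1 <= 2 / s - 2 / s'.
  have -> : 2 / s - 2 / s' = 2 * (s' ^+ 2 - s ^+ 2) / (s * s' * (s + s')).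
    by field; rewrite !gt_eqF // addr_gt0.
  have h2 : 0 < s' ^+ 2 * s' by rewrite mulr_gt0 ?exprn_gt0.
  have h3 : 0 < s * s' * (s + s') by rewrite !mulr_gt0 ?addr_gt0.
  rewrite e3 mulr1 -[leLHS]mul1r ler_pdivrMr // mulrAC ler_pdivlMr // mul1r.
  have : s * s' * (s + s') <= s' * s' * (s' + s').
    have a : s * s' <= s' * s' by rewrite ler_pM2r.
    have b : s + s' <= s' + s' by rewrite lerD2r.
    by apply: ler_pM => //; rewrite ?mulr_ge0 ?addr_ge0 // ltW.
  by rewrite expr2; lra.
by move: h; lra.
Qed.

Lemma ln_lin (eps : R) : 0 < eps -> exists2 K, 0 <= K & forall x, 0 < x -> ln x <= eps * x + K.
Proof.
move=> e0; exists `|- ln eps|; first exact: normr_ge0.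
move=> x x0.
have h : ln (eps * x) <= eps * x.
  by apply: le_trans (ln_le_subr1 (mulr_gt0 e0 x0)) _; rewrite gerBl.
rewrite lnM ?posrE // in h.
by have := ler_norm (- ln eps); lra.
Qed.

Lemma ln_sqrt_le x : 1 <= x -> ln x ^+ 2 <= 4 * x.
Proof.
move=> x1; have x0 : 0 < x by lra.
have s0 : 0 < Num.sqrt x by rewrite sqrtr_gt0.
have e : ln x = ln (Num.sqrt x) + ln (Num.sqrt x) by rewrite -lnM ?posrE // -expr2 sqr_sqrtr ?ltW.
have h : ln (Num.sqrt x) <= Num.sqrt x.
  by apply: le_trans (ln_le_subr1 s0) _; rewrite gerBl.
have -> : 4 * x = (2 * Num.sqrt x) ^+ 2 by rewrite exprMn sqr_sqrtr ?ltW //; ring.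
apply: lerXn2r; rewrite ?nnegrE; [exact: ln_ge0| by rewrite mulr_ge0 // ltW |].
by rewrite e; lra.
Qed.

Lemma pow32_add x y : 0 < x -> 0 < y -> pow32 (x + y) <= 3 * (pow32 x + pow32 y).
Proof.
move=> x0 y0.
wlog xy : x y x0 y0 / x <= y => [h|].
  by case: (leP x y) => xy; [exact: h | rewrite addrC [pow32 x + _]addrC; apply: h => //; exact: ltW].
apply: (@le_trans _ _ (pow32 (2 * y))); first by apply: pow32_le; lra.
rewrite pow32M //; have -> : pow32 2 = 2 * Num.sqrt 2 :> R by [].
have s2 : Num.sqrt 2 <= 3 / 2 :> R.
  rewrite -[leRHS]ger0_norm ?divr_ge0 // -sqrtr_sqr ler_wsqrtr // expr2; lra.
have := pow32_gt0 x0; have py := pow32_gt0 y0.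
have : 2 * Num.sqrt 2 * pow32 y <= 2 * (3 / 2) * pow32 y by rewrite ler_wpM2r ?ler_wpM2l // ltW.
by lra.
Qed.

Lemma sqrD_le x y : (x + y) ^+ 2 <= 2 * x ^+ 2 + 2 * y ^+ 2.
Proof. by have := sqr_ge0 (x - y); rewrite !expr2; lra. Qed.

End Elementary.

Lemma level_coef_ge0 (R : realType) (a b K C : R) J j : 0 <= a -> 0 <= b -> 0 <= C ->
  0 <= 256 * a * b * K ^+ 2 * C / 4 ^+ J / 4 ^+ j.
Proof.
move=> a0 b0 C0; apply: divr_ge0; last exact: exprn_ge0.
apply: divr_ge0; last exact: exprn_ge0.
apply: mulr_ge0 C0; apply: mulr_ge0 (sqr_ge0 K).
by apply: mulr_ge0 b0; apply: mulr_ge0 a0; rewrite ler0n.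
Qed.

(** * Choice of the slope and size of the moments *)

Section Asymptotics.
Variable R : realType.
Notation u := (green_rate R).

(* The exponent [lam ^ 2 * g J / 2] for [lam = slope J (g J)]; the term in [ln J] is the
   price of staying positive. *)
Definition ballot_rate (J : nat) : R := J%:R * ln 4 - 3 / 2 * ln J%:R.
Definition slope (J : nat) (gJ : R) : R := Num.sqrt (2 * ballot_rate J / gJ).

Lemma expR_ballot_rate J : (0 < J)%N -> expR (- ballot_rate J) = pow32 J%:R / 4 ^+ J.
Proof.
move=> J0; rewrite /ballot_rate opprB expRD expR_pow32 ?ltr0n //; congr (_ * _).
by rewrite expRN expRM_natl lnK // posrE.
Qed.

Lemma ln4E : ln 4 = 2 * ln 2 :> R.
Proof. by rewrite (_ : 4 = 2 * 2 :> R) ?lnM ?posrE //; ring. Qed.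

Lemma ln2_bounds : 0 < ln (2 : R) <= 1.
Proof.
rewrite ln_gt0 ?ltr1n //=.
by have := @ln_le_subr1 R 2 (ltr0Sn _ _); lra.
Qed.

Lemma green_rate_le1 : u <= 1.
Proof.
have /andP[l0 l1] := ln2_bounds; have p2 := @pi_ge2 R.
rewrite /green_rate -[leRHS]mulr1 ler_pM ?divr_ge0 ?(ltW l0) ?pi_ge0 //.
by rewrite ler_pdivrMr ?pi_gt0 // mul1r.
Qed.

Lemma ballot_rate_bounds : exists J0 : nat, forall J, (J0 <= J)%N -> J%:R * ln 2 <= ballot_rate J <= J%:R * (2 * ln 2).
Proof.
have /andP[l0 l1] := ln2_bounds.
have e0 : 0 < ln (2 : R) / 3 by rewrite divr_gt0.
have [K K0 hK] := ln_lin e0.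
have [n hn] := exists_nat_ge (3 * K / ln 2); exists n.+1 => J hJ.
have hJ' : 3 * K / ln 2 <= J%:R by apply: le_trans hn _; rewrite ler_nat ltnW.
have J1 : (0 < J)%N by apply: leq_trans hJ.
have JR : 0 < (J%:R : R) by rewrite ltr0n.
rewrite ler_pdivrMr // in hJ'.
have h := hK _ JR.
have lJ : 0 <= ln (J%:R : R) by rewrite ln_ge0 // ler1n.
by rewrite /ballot_rate ln4E; apply/andP; split; lra.
Qed.

Lemma nat_aux1 j M J : (0 < M -> j + 3 + M <= J -> j + 3 < J)%N. Proof. lia. Qed.
Lemma nat_aux2 j M J : (j + 3 + M <= J -> M + 3 <= J - j)%N. Proof. lia. Qed.
Lemma nat_aux3 j M J : (J < j + 3 + M -> J - j <= M + 3)%N. Proof. lia. Qed.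

(* For two points at distance about [2 ^ j] the scales below [j] and above
   [coarse_level J M j] are decoupled; the latter are discarded if fewer than [M] remain. *)
Definition coarse_level (J M j : nat) : nat := if (j + 3 + M <= J)%N then (j + 3)%N else J.

Lemma lev_bounds J M j : (j < J)%N -> (minn (j + 3) J <= coarse_level J M j <= J)%N.
Proof. by rewrite /coarse_level; case: ifP; lia. Qed.

Section FixedChain.
Variables (J : nat) (g : nat -> R).
Hypotheses (g0 : g 0%N = 0) (g1 : 1 <= g 1%N).
Hypothesis g_mono : forall i j, (i <= j <= J)%N -> g i <= g j.
Hypothesis g_lin : forall j, (j <= J)%N -> `|g j - u * j%:R| <= 10.
Hypothesis LJb : J%:R * ln 2 <= ballot_rate J <= J%:R * (2 * ln 2).
Hypothesis uJ : 20 <= u * J%:R.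
Notation lam := (slope J (g J)).

Let u0 : 0 < u := green_rate_gt0 R.
Let u1 : u <= 1 := green_rate_le1.

Lemma g_bounds j : (j <= J)%N -> u * j%:R - 10 <= g j <= u * j%:R + 10.
Proof. by move=> jJ; have := g_lin jJ; rewrite ler_norml; lra. Qed.

Lemma J_gt0 : (0 < J)%N.
Proof. by case: J uJ => [|//]; rewrite mulr0; lra. Qed.

Let JR : 0 < (J%:R : R). Proof. by rewrite ltr0n J_gt0. Qed.

(** The hypothesis [uJ] makes the additive error 10 at most half of [u * J]. *)
Lemma gJ_bounds : u / 2 * J%:R <= g J <= 2 * (u * J%:R).
Proof. by have := g_bounds (leqnn J); move: uJ; lra. Qed.

Lemma gJ_gt0 : 0 < g J.
Proof. by have /andP[h _] := gJ_bounds; move: uJ h; lra. Qed.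

Lemma ballot_rate_gt0 : 0 < ballot_rate J.
Proof.
have /andP[l0 _] := ln2_bounds; case/andP: LJb => h _.
by apply: lt_le_trans h; rewrite mulr_gt0.
Qed.

Lemma lam_sq : lam ^+ 2 = 2 * ballot_rate J / g J.
Proof.
rewrite /slope sqr_sqrtr // ltW // divr_gt0 ?gJ_gt0 // mulr_gt0 // ballot_rate_gt0 //.
Qed.

Lemma lam_ballot_rate : lam ^+ 2 * g J / 2 = ballot_rate J.
Proof. by rewrite lam_sq; field; rewrite gt_eqF // gJ_gt0. Qed.

Lemma u_ln2 : ln 2 = u * (pi / 2).
Proof.
by rewrite /green_rate; have := @pi_gt0 R; move: (pi : R) => p p0; field; rewrite gt_eqF.
Qed.

(** For large [J] the square is close to [2 * pi], as [ln 2 = u * pi / 2]; the crude bounds on [g J]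
    and [ballot_rate J] lose a bounded factor. *)
Lemma lam_sq_bounds : 1 <= lam ^+ 2 <= 16.
Proof.
rewrite lam_sq; have gJ0 := gJ_gt0; have /andP[h1 h2] := gJ_bounds; case/andP: LJb => h3 h4.
have pp := @pi_ge2 R; have p2 : pi / 2 < 2 :> R by have /andP[] := @pihalf_02 R.
have uJ0 : 0 < u * J%:R by rewrite mulr_gt0.
rewrite ler_pdivlMr // ler_pdivrMr // mul1r.
rewrite u_ln2 in h3 h4.
have e1 : u * J%:R * 1 <= u * J%:R * (pi / 2) by rewrite ler_pM2l //; lra.
have e2 : u * J%:R * (pi / 2) <= u * J%:R * 2 by rewrite ler_pM2l // ltW.
have e3 : J%:R * (u * (pi / 2)) = u * J%:R * (pi / 2) by ring.
have e4 : J%:R * (2 * (u * (pi / 2))) = 2 * (u * J%:R * (pi / 2)) by ring.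
by apply/andP; split; move: h1 h2 h3 h4 e1 e2; rewrite e3 e4; lra.
Qed.

Lemma lam_bounds : 1 <= lam <= 4.
Proof.
have /andP[h1 h2] := lam_sq_bounds; have l0 : 0 <= lam by exact: sqrtr_ge0.
apply/andP; split.
  by rewrite -(@ler_pXn2r _ 2) ?nnegrE // expr1n.
by rewrite -(@ler_pXn2r _ 2) ?nnegrE //; rewrite (_ : 4 ^+ 2 = 16) //; ring.
Qed.

Lemma barrier_valueJ : barrier_value g lam J = barrier_op lam (g J) (@start_window R).
Proof. by case: J J_gt0. Qed.

(** The factor [J ^ (3/2)] in [exp (- ballot_rate J)] cancels the decay [(g J) ^ (-3/2)] of the
    kernel. *)
Lemma barrier_valueJ_le : (barrier_value g lam J 2 <= (8 / pow32 (u / 2) / 4 ^+ J)%:E)%E.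
Proof.
have /andP[l1 l4] := lam_bounds; have l0 : 0 <= lam by lra.
rewrite barrier_valueJ; apply: le_trans (barrier_op_start_window_le _ gJ_gt0 l0) _.
rewrite lee_fin lam_ballot_rate expR_ballot_rate ?J_gt0 // posT // mul1r.
have -> : 4 * expR (2 * lam) / pow32 (g J) * (pow32 J%:R / 4 ^+ J) * (2 * expR (- (lam * 2))) =
  8 * (pow32 J%:R / pow32 (g J)) / 4 ^+ J * (expR (2 * lam) * expR (- (2 * lam))).
  by rewrite (mulrC lam 2); ring.
rewrite -expRD subrr expR0 mulr1 ler_pM2r ?invr_gt0 ?exprn_gt0 // ler_pM2l //.
have u2 : 0 < u / 2 by rewrite divr_gt0.
rewrite ler_pdivrMr ?pow32_gt0 ?gJ_gt0 // mulrC ler_pdivlMr ?pow32_gt0 //.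
rewrite mulrC -pow32M ?(ltW u2) //.
by apply: pow32_le; [rewrite mulr_ge0 // ltW | case/andP: gJ_bounds].
Qed.

Lemma barrier_valueJ_ge :
  ((expR (- 4) * (expR (- 1) * (Num.sqrt (2 * pi))^-1 * (4 / 5)) / pow32 (2 * u) / 4 ^+ J)%:E <= barrier_value g lam J 2)%E.
Proof.
have /andP[l1 l4] := lam_bounds; have l0 : 0 <= lam by lra.
have gJ1 : 1 <= g J by have /andP[h _] := gJ_bounds; move: uJ h; lra.
rewrite barrier_valueJ; apply: le_trans (barrier_op_start_window_ge gJ1 l0).
rewrite lee_fin lam_ballot_rate expR_ballot_rate ?J_gt0 //.
set K := expR (- 1) * _ * _.
have K0 : 0 < K by rewrite /K !mulr_gt0 ?expR_gt0 // invr_gt0 sqrtr_gt0 mulr_gt0 // pi_gt0.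
have u2 : 0 < 2 * u by rewrite mulr_gt0.
have pJ := pow32_gt0 JR; have pu := pow32_gt0 u2; have gauss_pdf := pow32_gt0 gJ_gt0.
rewrite [leLHS](_ : _ = K / 4 ^+ J * (expR (- 4) * (pow32 (2 * u))^-1)); last by ring.
rewrite [leRHS](_ : _ = K / 4 ^+ J * (expR (- lam) * (pow32 J%:R / pow32 (g J)))); last by ring.
rewrite ler_pM2l ?divr_gt0 ?exprn_gt0 //.
apply: ler_pM; rewrite ?expR_ge0 ?invr_ge0 ?(ltW pu) //; first by rewrite ler_expR lerN2.
rewrite ler_pdivlMr // mulrC ler_pdivrMr // mulrC -pow32M ?(ltW u2) //.
by apply: pow32_le; [rewrite ltW // gJ_gt0 | case/andP: gJ_bounds => _; rewrite mulrA].
Qed.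

(** For [j >= 1], the bounds [g j >= u * j - 10] and [g j >= 1] give [u * (j + 1) <= 2 * u * j <= 2
    * (g j + 10) <= 22 * g j]. *)
Lemma fine_factor_le j : (j <= J)%N -> 0 <= fine_factor g j <= pow32 (22 / u) / pow32 (j%:R + 1).
Proof.
case: j => [|j] jJ.
  have p1 : pow32 1 = 1 :> R by rewrite /pow32 sqrtr1 mulr1.
  rewrite /fine_factor add0r p1 divr1 ler01 /=; apply: (@le_trans _ _ (pow32 1)); first by rewrite p1.
  have h22 : 1 <= 22 / u by rewrite ler_pdivlMr // mul1r; apply: le_trans u1 _; rewrite ler1n.
  exact: pow32_le ler01 h22.
have h1 : 1 <= g j.+1 by apply: le_trans g1 _; apply: g_mono; rewrite jJ.
have /andP[h2 _] := g_bounds jJ.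
have gj : 0 < g j.+1 by lra.
have j1 : 0 < (j.+1%:R + 1 : R) by rewrite ltr_wpDl.
rewrite /fine_factor invr_ge0 ltW ?pow32_gt0 //=.
rewrite ler_pdivlMr ?pow32_gt0 // mulrC ler_pdivrMr ?pow32_gt0 //.
have u22 : 0 <= 22 / u by rewrite divr_ge0 // ltW.
rewrite -pow32M //; apply: pow32_le; first exact: ltW.
rewrite mulrAC ler_pdivlMr //.
have : u * (j.+1%:R + 1) <= 2 * (u * j.+1%:R).
  have : u * 1 <= u * j.+1%:R by rewrite ler_pM2l // ler1n.
  by rewrite mulrDr; lra.
by rewrite mulrC; lra.
Qed.

(** Linear growth gives [g j >= (j / J) * g J - 20], which costs the factor [exp (16 * 20 / 2)];
    what remains in the exponent is the share [j / J] of [ballot_rate J]. *)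
Lemma expR_lamg j : (j <= J)%N ->
  expR (- (lam ^+ 2 * g j / 2)) <= expR 160 * pow32 (j%:R + 1) / 4 ^+ j.
Proof.
move=> jJ; have gJ0 := gJ_gt0; have /andP[h1 h2] := g_bounds jJ; have /andP[h3 h4] := g_bounds (leqnn J).
have /andP[l1 l16] := lam_sq_bounds.
set a := j%:R / J%:R * ln (J%:R : R).
have key : - (lam ^+ 2 * g j / 2) <= 160 + (3 / 2 * a - j%:R * ln 4).
  have e1 : 3 / 2 * a - j%:R * ln 4 = - (lam ^+ 2 / 2 * (g J * j%:R / J%:R)).
    rewrite (_ : lam ^+ 2 / 2 * (g J * j%:R / J%:R) = (lam ^+ 2 * g J / 2) * (j%:R / J%:R)); last by ring.
    by rewrite lam_ballot_rate /ballot_rate /a; field; rewrite gt_eqF.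
  have e2 : g J * j%:R / J%:R <= g j + 20.
    rewrite ler_pdivrMr //.
    have f1 : g J * j%:R <= (u * J%:R + 10) * j%:R by rewrite ler_wpM2r.
    have f2 : (u * j%:R - 10) * J%:R <= g j * J%:R by rewrite ler_wpM2r // ltW.
    have f3 : (j%:R : R) <= J%:R by rewrite ler_nat.
    by rewrite mulrDl; move: f1 f2; rewrite !mulrDl !mulNr [u * J%:R * _]mulrAC; lra.
  have e3 : lam ^+ 2 / 2 * (g J * j%:R / J%:R) <= lam ^+ 2 / 2 * (g j + 20).
    by rewrite ler_wpM2l // divr_ge0 // sqr_ge0.
  by rewrite e1; move: e3; rewrite mulrDr; lra.
apply: (@le_trans _ _ (expR (160 + (3 / 2 * a - j%:R * ln 4)))); first by rewrite ler_expR.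
have -> : expR (160 + (3 / 2 * a - j%:R * ln 4)) = expR 160 * (expR (3 / 2 * a) / 4 ^+ j).
  rewrite expRD; congr (_ * _); rewrite expRD; congr (_ * _).
  by rewrite expRN expRM_natl lnK // posrE ltr0n.
rewrite -[leRHS]mulrA ler_pM2l ?expR_gt0 // ler_pM2r ?invr_gt0 ?exprn_gt0 //.
have j1 : 0 < (j%:R + 1 : R) by rewrite ltr_wpDl.
rewrite -expR_pow32 // ler_expR ler_pM2l // -ler_expR lnK ?posrE //.
exact: expR_frac_ln J_gt0 jJ.
Qed.

Section Level.
Variables (M j : nat).
Hypothesis uM : 40 <= u * M%:R.
Hypothesis jJ : (j < J)%N.
(** The first term serves the level [j + 3], where [32 * 2 / lam ^ 2 <= 64], [g (j + 3) <= g j + 23]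
    and [184 = 16 * 23 / 2]; the second serves the level [J], where [g J <= g j + M + 23]. *)
Definition coarse_const : R := 64 * expR 184 / pow32 (u / 8) + expR (8 * (M%:R + 23)) * pow32 (M%:R + 3).

Lemma cc_bound : coarse_factor J g lam 2 (coarse_level J M j) <= coarse_const * expR (- ballot_rate J) * expR (lam ^+ 2 * g j / 2) / pow32 (J - j)%:R.
Proof.
have /andP[l1 l16] := lam_sq_bounds.
have Jj0 : 0 < ((J - j)%:R : R) by rewrite ltr0n subn_gt0.
have pJj := pow32_gt0 Jj0.
have u8 : 0 < u / 8 by rewrite divr_gt0.
have pu8 := pow32_gt0 u8.
have M0 : (0 < M)%N by case: M uM => [|//]; rewrite mulr0; lra.
have pM : 0 < pow32 (M%:R + 3 : R) by rewrite pow32_gt0 // ltr_wpDl.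
have A0 : 0 <= 64 * expR 184 / pow32 (u / 8) by apply: divr_ge0; [apply: mulr_ge0; [|exact: expR_ge0] | exact: ltW].
have B0 : 0 <= expR (8 * (M%:R + 23)) * pow32 (M%:R + 3 : R) by apply: mulr_ge0; [exact: expR_ge0 | exact: ltW].
have D0 : 0 <= expR (- ballot_rate J) * expR (lam ^+ 2 * g j / 2) / pow32 (J - j)%:R.
  by rewrite mulr_ge0 ?mulr_ge0 ?expR_ge0 // invr_ge0 ltW.
rewrite [leRHS](_ : _ = coarse_const * (expR (- ballot_rate J) * expR (lam ^+ 2 * g j / 2) / pow32 (J - j)%:R)); last by ring.
rewrite /coarse_const mulrDl /coarse_level; case: leqP => h.
  apply: ler_wpDr; first by rewrite mulr_ge0.
  have jM := nat_aux1 M0 h.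
  rewrite /coarse_factor jM.
  have [/andP[a1 a2] /andP[a3 a4]] := (g_bounds (ltnW jM), g_bounds (leqnn J)).
  have /andP[a5 a6] := g_bounds (ltnW jJ).
  have nJ : (J%:R : R) = j%:R + (J - j)%:R by rewrite -natrD subnKC // ltnW.
  have hM : (M%:R : R) + 3 <= (J - j)%:R by rewrite -natrD ler_nat; exact: nat_aux2.
  rewrite natrD in a1 a2.
  have M1 : (1 : R) <= M%:R by rewrite ler1n.
  (* Since [u * (J - j) >= u * M + 3 * u >= 40 + 3 * u], an eighth of it survives the errors
     [20 + 3 * u]. *)
  have tlow : u / 8 * (J - j)%:R <= g J - g (j + 3)%N.
    have : u * (M%:R + 3) <= u * (J - j)%:R by rewrite ler_pM2l.
    rewrite nJ mulrDr in a3; rewrite mulrDr in a2.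
    by move: uM u1 u0; rewrite mulrDr; lra.
  have gjk : g (j + 3)%N <= g j + 23.
    by move: a2 a5 u1; rewrite mulrDr; lra.
  have tp : 0 < g J - g (j + 3)%N by apply: lt_le_trans tlow; rewrite mulr_gt0.
  have ptp := pow32_gt0 tp.
  have e1 : expR (- (lam ^+ 2 * (g J - g (j + 3)%N) / 2)) <= expR 184 * (expR (- ballot_rate J) * expR (lam ^+ 2 * g j / 2)).
    rewrite -!expRD ler_expR -lam_ballot_rate.
    have : lam ^+ 2 * g (j + 3)%N <= lam ^+ 2 * (g j + 23) by rewrite ler_wpM2l // sqr_ge0.
    by rewrite mulrBr mulrDr; lra.
  have e2 : (pow32 (g J - g (j + 3)%N))^-1 <= (pow32 (u / 8))^-1 * (pow32 (J - j)%:R)^-1.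
    have m0 := mulr_gt0 u8 Jj0.
    rewrite -invfM -pow32M ?(ltW u8) // lef_pV2 ?posrE //; last exact: pow32_gt0.
    by apply: pow32_le => //; exact: ltW.
  have e3 : 32 / lam ^+ 2 * 2 <= 64.
    have : (lam ^+ 2)^-1 <= 1 by rewrite invf_le1 //; lra.
    by lra.
  have e30 : 0 <= 32 / lam ^+ 2 * 2 by rewrite mulr_ge0 // divr_ge0 // sqr_ge0.
  apply: (@le_trans _ _ (64 * (expR 184 * (expR (- ballot_rate J) * expR (lam ^+ 2 * g j / 2))) * ((pow32 (u / 8))^-1 * (pow32 (J - j)%:R)^-1))).
    apply: ler_pM => //; first by rewrite mulr_ge0 ?expR_ge0.
      by rewrite invr_ge0 ltW.
    by apply: ler_pM; rewrite ?expR_ge0.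
  by apply/eqP/eqP; rewrite le_eqVlt; apply/orP; left; apply/eqP; ring.
apply: ler_wpDl; first by rewrite mulr_ge0.
rewrite /coarse_factor ltnn.
have [/andP[a3 a4] /andP[a5 a6]] := (g_bounds (leqnn J), g_bounds (ltnW jJ)).
have nJ : (J%:R : R) = j%:R + (J - j)%:R by rewrite -natrD subnKC // ltnW.
have hM : ((J - j)%:R : R) <= M%:R + 3 by rewrite -natrD ler_nat; exact: nat_aux3.
have gJj : g J <= g j + (M%:R + 23).
  have : u * (J - j)%:R <= 1 * (M%:R + 3) by rewrite ler_pM // ltW.
  by rewrite nJ mulrDr in a4; lra.
have e1 : 1 <= expR (8 * (M%:R + 23)) * (expR (- ballot_rate J) * expR (lam ^+ 2 * g j / 2)).
  rewrite -!expRD -[leLHS]expR0 ler_expR -lam_ballot_rate.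
  have f1 : lam ^+ 2 * g J <= lam ^+ 2 * (g j + (M%:R + 23)) by rewrite ler_wpM2l // sqr_ge0.
  have f2 : lam ^+ 2 * (M%:R + 23) <= 16 * (M%:R + 23) by rewrite ler_wpM2r // addr_ge0.
  by rewrite mulrDr in f1; lra.
have e2 : 1 <= pow32 (M%:R + 3 : R) / pow32 (J - j)%:R.
  by rewrite ler_pdivlMr // mul1r; apply: pow32_le => //; exact: ltW.
rewrite [leRHS](_ : _ = (expR (8 * (M%:R + 23)) * (expR (- ballot_rate J) * expR (lam ^+ 2 * g j / 2))) * (pow32 (M%:R + 3) / pow32 (J - j)%:R)); last by ring.
by rewrite -[leLHS]mulr1 ler_pM.
Qed.

(** The square of [fine_factor] gives [(j + 1) ^ (-3)]. Of the two factors
    [exp (- lam ^ 2 * g j / 2)], one is cancelled by the coarse part and the other gives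
    [(j + 1) ^ (3/2) / 4 ^ j]; the coarse part leaves [J ^ (3/2) / (J - j) ^ (3/2) / 4 ^ J]. As
    [J <= (j + 1) + (J - j)], the powers are summable over [j] uniformly in [J], while [4 ^ j] will
    meet the number of points. *)
Lemma level_bound :
  256 * expR (4 * lam) / lam ^+ 2 * fine_factor g j ^+ 2 * expR (- (lam ^+ 2 * g j)) * coarse_factor J g lam 2 (coarse_level J M j) <=
  (768 * expR 176 * pow32 (22 / u) ^+ 2 * coarse_const) / 4 ^+ J / 4 ^+ j *
    ((pow32 (j%:R + 1))^-1 + (pow32 (J - j)%:R)^-1).
Proof.
have /andP[l1 l16] := lam_sq_bounds; have /andP[_ l4] := lam_bounds.
have cb := cc_bound; have eb := expR_lamg (ltnW jJ); have /andP[b0 bb1] := fine_factor_le (ltnW jJ).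
have j1 : 0 < (j%:R + 1 : R) by rewrite ltr_wpDl.
have Jj0 : 0 < ((J - j)%:R : R) by rewrite ltr0n subn_gt0.
have pj := pow32_gt0 j1; have pJj := pow32_gt0 Jj0.
have C60 : 0 <= coarse_const.
  have u8 : 0 < u / 8 by rewrite divr_gt0.
  apply: addr_ge0.
    by apply: divr_ge0; [apply: mulr_ge0; [|exact: expR_ge0] | rewrite ltW // pow32_gt0].
  by apply: mulr_ge0; [exact: expR_ge0 | rewrite ltW // pow32_gt0 // ltr_wpDl].
rewrite expR_ballot_rate ?J_gt0 // in cb.
have nJ : (J%:R : R) + 1 = (j%:R + 1) + (J - j)%:R by rewrite addrAC -natrD subnKC // ltnW.
have pJ : pow32 (J%:R : R) <= 3 * (pow32 (j%:R + 1) + pow32 (J - j)%:R).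
  apply: le_trans (pow32_add j1 Jj0); rewrite -nJ; apply: pow32_le; first exact: ltW.
  by rewrite lerDl.
have c0 : 0 <= coarse_factor J g lam 2 (coarse_level J M j).
  rewrite /coarse_factor; case: ifP => // h.
  have t0 : 0 <= g J - g (coarse_level J M j) by rewrite subr_ge0 g_mono // leqnn ltnW.
  apply: divr_ge0; last by rewrite mulr_ge0 ?sqrtr_ge0.
  apply: mulr_ge0; last exact: expR_ge0.
  by apply: mulr_ge0 => //; apply: divr_ge0 => //; exact: sqr_ge0.
have e2 : expR (- (lam ^+ 2 * g j)) = expR (- (lam ^+ 2 * g j / 2)) ^+ 2.
  by rewrite -expRM_natl; congr expR; field.
have e3 : expR (- (lam ^+ 2 * g j / 2)) * expR (lam ^+ 2 * g j / 2) = 1.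
  by rewrite -expRD addNr expR0.
have e4 : expR (4 * lam) / lam ^+ 2 <= expR 16.
  rewrite ler_pdivrMr; last by lra.
  apply: (@le_trans _ _ (expR 16)); first by rewrite ler_expR; lra.
  by rewrite ler_peMr ?expR_ge0.
have e5 : expR 176 = expR 16 * expR 160 :> R by rewrite -expRD; congr expR; ring.
rewrite e5; move: (expR 16 : R) (expR 160 : R) (expR_ge0 (16 : R)) (expR_ge0 (160 : R)) e2 e3 eb cb bb1 b0 e4 pJ.
move=> E16 E160 E16_0 E160_0.
set x := expR (- (lam ^+ 2 * g j / 2)); set y := expR (lam ^+ 2 * g j / 2).
have x0 : 0 <= x by exact: expR_ge0.
set p := pow32 (j%:R + 1) in pj *; set q := pow32 (J - j)%:R in pJj *.
set b := fine_factor g j; set c := coarse_factor _ _ _ _ _ in c0 *; set K := pow32 (22 / u); set z := expR (4 * lam) / lam ^+ 2.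
have z0 : 0 <= z by rewrite /z divr_ge0 ?expR_ge0 ?sqr_ge0.
have p0 : 0 <= pow32 J%:R :> R by rewrite ltW // pow32_gt0.
move: (pow32 J%:R) p0 => r r0 e2 e3 eb cb bb1 b0 e4 pJ.
have h1 : b ^+ 2 <= (K / p) ^+ 2 by apply: lerXn2r => //; rewrite nnegrE //; exact: le_trans bb1.
have y0 : 0 <= y by exact: expR_ge0.
have h2 : x ^+ 2 * c <= coarse_const * (r / 4 ^+ J) * (E160 * p / 4 ^+ j) / q.
  apply: (@le_trans _ _ (x ^+ 2 * (coarse_const * (r / 4 ^+ J) * y / q))); first by rewrite ler_wpM2l // sqr_ge0.
  rewrite [leLHS](_ : _ = (coarse_const * (r / 4 ^+ J) / q) * ((x * y) * x)); last by ring.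
  rewrite [leRHS](_ : _ = (coarse_const * (r / 4 ^+ J) / q) * (E160 * p / 4 ^+ j)); last by ring.
  rewrite e3 mul1r ler_wpM2l //.
  by rewrite divr_ge0 ?(ltW pJj) // mulr_ge0 // divr_ge0 // exprn_ge0.
have h3 : z * b ^+ 2 <= E16 * (K / p) ^+ 2 by apply: ler_pM; rewrite ?sqr_ge0.
rewrite [leLHS](_ : _ = 256 * ((z * b ^+ 2) * (x ^+ 2 * c))); last by rewrite e2 /z; ring.
have q4 : 0 < (4 : R) ^+ J * 4 ^+ j by rewrite mulr_gt0 ?exprn_gt0.
have h4 : r / (p * q) <= 3 * (p^-1 + q^-1).
  rewrite (ler_pdivrMr _ _ (mulr_gt0 pj pJj)); apply: le_trans pJ _.
  by rewrite le_eqVlt; apply/orP; left; apply/eqP; field; rewrite !gt_eqF.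
apply: (@le_trans _ _ (256 * ((E16 * (K / p) ^+ 2) * (coarse_const * (r / 4 ^+ J) * (E160 * p / 4 ^+ j) / q)))).
  apply: ler_wpM2l; first by rewrite ler0n.
  apply: ler_pM h3 h2; apply: mulr_ge0 => //; exact: sqr_ge0.
rewrite [leLHS](_ : _ = (256 * E16 * E160 * K ^+ 2 * coarse_const / 4 ^+ J / 4 ^+ j) * (r / (p * q))); last first.
  by field; rewrite !gt_eqF ?exprn_gt0.
rewrite [leRHS](_ : _ = (256 * E16 * E160 * K ^+ 2 * coarse_const / 4 ^+ J / 4 ^+ j) * (3 * (p^-1 + q^-1))); last first.
  by ring.
by apply: (ler_wpM2l (level_coef_ge0 K J j E16_0 E160_0 C60)); exact: h4.
Qed.

End Level.

(** The numerator collects the errors linear in [J] when squares are compared: [8 * c2 ^ 2] from the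
    square of [c2 * ln J], and [40 * ln 2] from the error 10 in [g J]. *)
Definition target_const : R := (8 * c2 R ^+ 2 + 40 * ln 2) / c1 R.

Lemma c1_gt0 : 0 < c1 R.
Proof.
have /andP[l0 _] := ln2_bounds.
by rewrite /c1 !mulr_gt0 // sqrtr_gt0 divr_gt0 // pi_gt0.
Qed.

Lemma c1_sq : c1 R ^+ 2 = 4 * ln 2 * u.
Proof.
rewrite /c1 !exprMn sqr_sqrtr ?divr_ge0 ?pi_ge0 // /green_rate; have := @pi_gt0 R; move: (pi : R) => p p0.
by field; rewrite gt_eqF.
Qed.

Lemma c1_c2 : c1 R * c2 R = 3 / 2 * u.
Proof.
have h : Num.sqrt (2 / pi) ^+ 2 = 2 / pi :> R by rewrite sqr_sqrtr ?divr_ge0 ?pi_ge0.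
transitivity (3 / 2 * ln 2 * Num.sqrt (2 / pi) ^+ 2 : R).
  by rewrite /c1 /c2; move: (Num.sqrt (2 / pi)) => s; field.
by rewrite h /green_rate; ring.
Qed.

(** In the square [2 * ballot_rate J * g J] of the right-hand side, the terms in [J ^ 2] and
    [J * ln J] are those of [(c1 * J - c2 * ln J) ^ 2], because [c1 ^ 2 = 2 * ln 4 * u] and
    [c1 * c2 = (3/2) * u]; the constant absorbs the rest. *)
Lemma target_le : 2 * target_const <= c1 R * J%:R -> c1 R * J%:R - c2 R * ln J%:R - target_const <= lam * g J.
Proof.
move=> hC; set m := c1 R * J%:R - c2 R * ln J%:R - target_const.
have /andP[l0 _] := ln2_bounds; have c10 := c1_gt0.
have lg0 : 0 <= lam * g J by rewrite mulr_ge0 ?sqrtr_ge0 // ltW // gJ_gt0.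
case: (leP m 0) => m0; first exact: le_trans lg0.
rewrite -(@ler_pXn2r _ 2) ?nnegrE //; last exact: ltW.
have -> : (lam * g J) ^+ 2 = 2 * ballot_rate J * g J.
  by rewrite exprMn lam_sq; field; rewrite gt_eqF // gJ_gt0.
have /andP[h1 _] := g_bounds (leqnn J); have L0 := ballot_rate_gt0; case/andP: LJb => _ L2.
have J1 : (1 : R) <= J%:R by rewrite ler1n J_gt0.
have lJ := ln_sqrt_le J1; have lJ0 := ln_ge0 J1.
have C70 : 0 <= target_const by rewrite /target_const divr_ge0 ?(ltW c10) // addr_ge0 ?mulr_ge0 ?sqr_ge0 // ltW.
have eC : c1 R * target_const = 8 * c2 R ^+ 2 + 40 * ln 2 by rewrite /target_const mulrCA mulfV ?mulr1 // gt_eqF.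
have f1 : 2 * ballot_rate J * (u * J%:R - 10) <= 2 * ballot_rate J * g J by rewrite ler_wpM2l // mulr_ge0 // ltW.
apply: le_trans f1; rewrite [leRHS](_ : _ = c1 R ^+ 2 * J%:R ^+ 2 - 2 * (c1 R * c2 R) * J%:R * ln J%:R - 20 * ballot_rate J); last first.
  by rewrite c1_sq c1_c2 /ballot_rate ln4E; field.
rewrite [leLHS](_ : _ = c1 R ^+ 2 * J%:R ^+ 2 - 2 * (c1 R * c2 R) * J%:R * ln J%:R - 2 * (c1 R * target_const) * J%:R + (c2 R * ln J%:R + target_const) ^+ 2); last first.
  by rewrite /m; ring.
have f2 : (c2 R * ln J%:R + target_const) ^+ 2 <= 2 * (c2 R * ln J%:R) ^+ 2 + 2 * target_const ^+ 2.
  exact: sqrD_le.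
have f3 : 2 * (c2 R * ln J%:R) ^+ 2 <= 8 * c2 R ^+ 2 * J%:R.
  by rewrite exprMn; have := ler_wpM2l (sqr_ge0 (c2 R)) lJ; lra.
have f4 : 2 * target_const ^+ 2 <= c1 R * target_const * J%:R.
  by have := ler_wpM2l C70 hC; rewrite expr2; lra.
have f5 : c1 R * target_const * J%:R = 8 * c2 R ^+ 2 * J%:R + 40 * ln 2 * J%:R by rewrite eC; ring.
by move: L2 f2 f3 f4 f5; lra.
Qed.

End FixedChain.

Lemma ltn_add3 i j k J : (i + j + k < J)%N -> [/\ (i <= J)%N, (j <= J)%N & (k <= J)%N].
Proof. by move=> h; split; lia. Qed.

(** All constants precede [J] and [g]: the variances depend on the point, and so does the slope,
    while the bounds must be uniform over the box. *)
Lemma asymptotics : exists (cl C : R) (J0 M : nat), [/\ 0 < cl, 0 <= C, (0 < J0)%N &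
  forall J (g : nat -> R), (J0 <= J)%N -> g 0%N = 0 -> 1 <= g 1%N ->
    (forall i j, (i <= j <= J)%N -> g i <= g j) ->
    (forall j, (j <= J)%N -> `|g j - u * j%:R| <= 10) ->
  exists lam : R,
  [/\ 0 < lam, c1 R * J%:R - c2 R * ln J%:R - C <= lam * g J,
      ((cl / 4 ^+ J)%:E <= barrier_value g lam J 2)%E, (barrier_value g lam J 2 <= (C / 4 ^+ J)%:E)%E &
      forall j, (j < J)%N ->
        256 * expR (4 * lam) / lam ^+ 2 * fine_factor g j ^+ 2 * expR (- (lam ^+ 2 * g j)) * coarse_factor J g lam 2 (coarse_level J M j) <=
        C / 4 ^+ J / 4 ^+ j * ((pow32 (j%:R + 1))^-1 + (pow32 (J - j)%:R)^-1)]].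
Proof.
have u0 := green_rate_gt0 R; have c10 := c1_gt0.
have [J1 hJ1] := ballot_rate_bounds; have [J2 hJ2] := exists_nat_ge (20 / u).
have [J3 hJ3] := exists_nat_ge (2 * target_const / c1 R); have [M hM] := exists_nat_ge (40 / u).
rewrite ler_pdivrMr // mulrC in hM.
pose Ca := 8 / pow32 (u / 2); pose Cb := 768 * expR 176 * pow32 (22 / u) ^+ 2 * coarse_const M.
have u2 : 0 < 2 * u by rewrite mulr_gt0.
have uh : 0 < u / 2 by rewrite divr_gt0.
have Ca0 : 0 <= Ca by rewrite /Ca divr_ge0 // ltW // pow32_gt0.
exists (expR (- 4) * (expR (- 1) * (Num.sqrt (2 * pi))^-1 * (4 / 5)) / pow32 (2 * u)).
exists (`|Ca| + `|Cb| + `|target_const|), (J1 + J2 + J3).+1, M; split => //.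
- apply: divr_gt0; last exact: pow32_gt0.
  by rewrite !mulr_gt0 ?expR_gt0 // invr_gt0 sqrtr_gt0 mulr_gt0 // pi_gt0.
move=> J g hJ g0 g1 gm gl.
have [q1 q2 q3] := ltn_add3 hJ.
have LJb : J%:R * ln 2 <= ballot_rate J <= J%:R * (2 * ln 2) by exact: hJ1.
have uJ : 20 <= u * J%:R.
  rewrite mulrC -ler_pdivrMr //; by apply: le_trans hJ2 _; rewrite ler_nat.
have cJ : 2 * target_const <= c1 R * J%:R.
  by rewrite [c1 R * _]mulrC -(ler_pdivrMr _ _ c10); apply: le_trans hJ3 _; rewrite ler_nat.
have /andP[l1 _] := lam_bounds gl LJb uJ.
exists (slope J (g J)); split.
- by lra.
- have := target_le gl LJb uJ cJ.
  by have := ler_norm target_const; have := normr_ge0 Ca; have := normr_ge0 Cb; lra.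
- exact: barrier_valueJ_ge.
- apply: le_trans (barrier_valueJ_le gl LJb uJ) _; rewrite lee_fin ler_pM2r ?invr_gt0 ?exprn_gt0 //.
  by have := ler_norm Ca; have := normr_ge0 target_const; have := normr_ge0 Cb; rewrite -/Ca; lra.
- move=> j jJ.
  apply: le_trans (level_bound g1 gm gl LJb uJ hM jJ) _.
  have j1 : 0 < (j%:R + 1 : R) by rewrite ltr_wpDl.
  have Jj0 : 0 < ((J - j)%:R : R) by rewrite ltr0n subn_gt0.
  apply: ler_wpM2r; first by rewrite addr_ge0 // invr_ge0 ltW // pow32_gt0.
  rewrite ler_pM2r ?invr_gt0 ?exprn_gt0 // ler_pM2r ?invr_gt0 ?exprn_gt0 //.
  by have := ler_norm Cb; have := normr_ge0 target_const; have := normr_ge0 Ca; rewrite -/Cb; lra.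
Qed.

End Asymptotics.

(** A function is read as the coefficients of a linear functional of the field; [R^o] provides the
    pointwise module structure. *)
Definition lattice_fun (R : realType) : lmodType R := (int * int -> R^o)%type.

Lemma uniq_rect lo n : uniq (rect lo n).
Proof.
apply: allpairs_uniq; rewrite ?iota_uniq // => -[i j] [i' j'] _ _ /= [h1 h2].
by congr pair; lia.
Qed.

Lemma uniq_ball2 x r : uniq (ball2 x r).
Proof. exact: uniq_rect. Qed.

(** * The maximum over one box *)

Section GreenExtra.
Variable R : realType.
Variable a : R.
Hypotheses (a0 : 0 < a) (a1 : a <= 1).
Implicit Types (e : int * int -> R) (x y : int * int).

Definition green_fun (D : seq (int * int)) x : int * int -> R :=
  xget (fun=> 0) [set e | is_green a D x e].

Lemma grnP D x : is_green a D x (green_fun D x).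
Proof. by have [e he] := green_exists D x a0 a1; rewrite /green_fun; case: xgetP => // /(_ e he). Qed.

Lemma green_fun_out D x y : y \notin D -> green_fun D x y = 0.
Proof. by case: (grnP D x) => h _; exact: h. Qed.

Lemma green_fun_in D x y : y \in D -> lap a (green_fun D x) y = kron R x y.
Proof. by case: (grnP D x) => _ h; exact: h. Qed.

Lemma green_fun_ge0 D x y : 0 <= green_fun D x y.
Proof. exact: green_ge0 a0 a1 (grnP D x) y. Qed.

Lemma green_fun_le D D' x y : {subset D <= D'} -> green_fun D x y <= green_fun D' x y.
Proof. by move=> s; have /andP[] := green_sub a0 a1 (grnP D x) (grnP D' x) s y. Qed.

Lemma green_fun_diag D x : x \in D -> 1 <= green_fun D x x.
Proof.
move=> xD; have := green_fun_in x xD; rewrite /lap /kron eqxx => h.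
have : 0 <= a * avg (green_fun D x) x.
  by rewrite mulr_ge0 ?(ltW a0) // avg_ge0 // => y _; exact: green_fun_ge0.
by move: h; rewrite mulr1n; lra.
Qed.

Lemma avg_eq0 (v : int * int -> R) x y : (forall z, 0 <= v z) -> avg v x = 0 -> nbr x y -> v y = 0.
Proof.
move=> v0 h hy; apply/eqP; rewrite eq_le v0 andbT.
have := v0 (x.1 + 1, x.2); have := v0 (x.1 - 1, x.2); have := v0 (x.1, x.2 + 1); have := v0 (x.1, x.2 - 1).
move: h; rewrite /avg; case/or4P: hy => /eqP ->; lra.
Qed.

Lemma harmonic_zero (v : int * int -> R) x y : (forall z, 0 <= v z) -> lap a v x = 0 -> v x = 0 -> nbr x y -> v y = 0.
Proof.
move=> v0; rewrite /lap => h vx; apply: avg_eq0 => //.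
apply/eqP; move: h; rewrite vx sub0r => /eqP; rewrite oppr_eq0 mulf_eq0 => /orP[|//].
by rewrite gt_eqF.
Qed.

(** If the two values agreed, the nonnegative harmonic difference would vanish at [x], hence along
    the horizontal ray up to the first point outside [D]. There [green_fun D' x] would be 0, and
    this zero would travel back to [x], against [green_fun_diag]. Strictness makes the durations
    [g (j + 1) - g j] positive. *)
Lemma green_fun_lt D D' x (r : nat) : {subset D <= D'} ->
  (forall k : nat, (k < r)%N -> (x.1 + k%:Z, x.2) \in D) ->
  (x.1 + r%:Z, x.2) \notin D ->
  (forall k : nat, (k <= r)%N -> (x.1 + k%:Z, x.2) \in D') ->
  green_fun D x x < green_fun D' x x.
Proof.
move=> DD' hD hr hD'; rewrite lt_neqAle green_fun_le // andbT; apply/negP => /eqP heq.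
pose v y := green_fun D' x y - green_fun D x y.
have v0 y : 0 <= v y by rewrite subr_ge0 green_fun_le.
have vx : v x = 0 by rewrite /v heq subrr.
have nb k : nbr (x.1 + k%:Z, x.2) (x.1 + k.+1%:Z, x.2).
  by rewrite /nbr /=; apply/orP; left; apply/eqP; congr pair; lia.
have nb' k : nbr (x.1 + k.+1%:Z, x.2) (x.1 + k%:Z, x.2).
  by rewrite /nbr /=; apply/orP; right; apply/orP; left; apply/eqP; congr pair; lia.
have x0 : (x.1 + 0%N%:Z, x.2) = x by case: (x) => p q /=; rewrite addr0.
have vk k : (k <= r)%N -> v (x.1 + k%:Z, x.2) = 0.
  elim: k => [_|k IH kr]; first by rewrite x0.
  apply: (harmonic_zero v0 _ (IH (ltnW kr)) (nb k)).
  by rewrite lapB (green_fun_in x (hD' k (ltnW kr))) (green_fun_in x (hD k kr)) subrr.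
have er : green_fun D' x (x.1 + r%:Z, x.2) = 0.
  by have := vk r (leqnn r); rewrite /v (green_fun_out x hr) subr0.
have ek k : (k <= r)%N -> green_fun D' x (x.1 + (r - k)%N%:Z, x.2) = 0.
  elim: k => [_|k IH kr]; first by rewrite subn0.
  have h1 : (r - k = (r - k.+1).+1)%N by lia.
  have := IH (ltnW kr); rewrite h1 => h2.
  apply: (harmonic_zero (green_fun_ge0 D' x) _ h2 (nb' _)).
  rewrite green_fun_in; last by apply: hD'; lia.
  by rewrite /kron; case: eqP => // hx; move: (congr1 fst hx) => /=; lia.
have := ek r (leqnn r); rewrite subnn x0 => h.
have xD' : x \in D' by rewrite -x0; exact: hD'.
by have := green_fun_diag xD'; rewrite h; lra.
Qed.

End GreenExtra.

Lemma pow2_split J : (3 <= J)%N -> (2 ^ J.-1 = 2 * 2 ^ (J - 2))%N /\ (2 ^ J = 2 * 2 ^ J.-1)%N.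
Proof. by move=> J3; rewrite -!expnS; split; congr (_ ^ _)%N; lia. Qed.

Lemma ball2_sub x y r s : (`|y.1 - x.1| + r <= s)%N -> (`|y.2 - x.2| + r <= s)%N ->
  {subset ball2 y r <= ball2 x s}.
Proof. by move=> h1 h2 z; rewrite !mem_ball2; lia. Qed.

Lemma ball2_sub_refl x r s : (r <= s)%N -> {subset ball2 x r <= ball2 x s}.
Proof. by move=> rs; apply: ball2_sub; lia. Qed.

Lemma pair_sep_arith (x y z z' : int * int) (i j : nat) : nbr z z' || (z' == z) ->
  (2 * 2 ^ j <= maxn `|y.1 - x.1| `|y.2 - x.2|)%N ->
  (`|z.1 - x.1| < 2 ^ j)%N && (`|z.2 - x.2| < 2 ^ j)%N -> (2 ^ i <= 2 ^ j)%N ->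
  ~ ((`|z'.1 - y.1| < 2 ^ i)%N && (`|z'.2 - y.2| < 2 ^ i)%N).
Proof.
move=> hz' d1 zx ij2 hz; case/orP: hz' => [hn|/eqP hn]; last by move: hz; rewrite hn; lia.
by move: d1 zx hz; case/or4P: hn => /eqP -> /=; lia.
Qed.

(** * The nested boxes around a point *)

Section LatticeChain.
Variable R : realType.
Context d (T : measurableType d) (P : probability T R).
Variables (L : lattice_fun R -> T -> R) (c : lattice_fun R -> lattice_fun R -> R).
Variables (a : R) (In : pred (int * int)).
Hypotheses (a0 : 0 < a) (a1 : a <= 1).

(* The covariance form is the inverse of the Laplacian on the domain [In]. *)
Definition inverts_lap : Prop := forall (D : seq (int * int)) (e : int * int -> R) (f : lattice_fun R),
  uniq D -> {subset D <= In} -> (forall y, y \notin D -> e y = 0) ->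
  c (lap a e) f = \sum_(z <- D) e z * f z.

Hypothesis G : gaussian_space P L c.
Hypothesis HK : inverts_lap.

Variables (J : nat) (z0 : int * int).
Hypothesis J3 : (3 <= J)%N.
Notation D := (ball2 z0 (2 ^ J.-1)).
Hypothesis DIn : {subset D <= In}.
Hypothesis aJ : (1 - a) * 4 ^+ J <= 1.

(** Half the radius of [D], so that the balls of radius up to [2 ^ (J - 2)] around a candidate stay
    in [D]. *)
Definition candidates : seq (int * int) := ball2 z0 (2 ^ (J - 2)).

(** The empty box at [j = 0] starts the variances at 0. From [J] on the box is [D] itself, not
    centred at [x], so that all candidates share the outermost domain. *)
Definition nested_box (x : int * int) (j : nat) : seq (int * int) :=
  if j is j'.+1 then (if (j < J)%N then ball2 x (2 ^ j') else D) else [::].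

Arguments nested_box x j : simpl never.

Lemma nested_box_ge x j : (J <= j)%N -> nested_box x j = D.
Proof. by case: j => [|j] h; [have := leq_trans J3 h | rewrite /nested_box ltnNge h]. Qed.

Lemma nested_box_lt x j : (j.+1 < J)%N -> nested_box x j.+1 = ball2 x (2 ^ j).
Proof. by rewrite /nested_box => ->. Qed.

Lemma nested_box0 x : nested_box x 0 = [::]. Proof. by []. Qed.

Definition box_field x j : lattice_fun R := lap a (green_fun a (nested_box x j) x).
Definition box_variance x j : R := green_fun a (nested_box x j) x x.
Definition vanishing_on x j : set (lattice_fun R) := [set f | forall z, z \in nested_box x j -> f z = 0].

Lemma candidates_sub x : x \in candidates -> {subset ball2 x (2 ^ (J - 2)) <= D}.
Proof.
move=> xX; have [h _] := pow2_split J3; move: xX; rewrite mem_ball2 => xX.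
by apply: ball2_sub; rewrite h; lia.
Qed.

Lemma sub_candidates x : x \in candidates -> {subset D <= ball2 x (2 ^ J)}.
Proof.
move=> xX; have [h h'] := pow2_split J3; move: xX; rewrite mem_ball2 => xX.
by apply: ball2_sub; rewrite h' h; lia.
Qed.

Lemma nested_box_mono x i j : x \in candidates -> (i <= j)%N -> {subset nested_box x i <= nested_box x j}.
Proof.
move=> xX ij; case: i ij => [|i] ij; first by move=> z.
case: j ij => [//|j] ij; rewrite /nested_box.
case: ltnP => hi; case: ltnP => hj //.
- by apply: ball2_sub_refl; rewrite leq_exp2l.
- move=> z zB; apply: (candidates_sub xX); move: z zB; apply: ball2_sub_refl.
  by rewrite leq_exp2l //; lia.
- by have := leq_trans hj (leq_trans hi ij); rewrite ltnn.
Qed.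

Lemma nested_box_in x i : x \in candidates -> {subset nested_box x i <= In}.
Proof.
move=> xX z zB; apply: DIn; have : z \in nested_box x (maxn i J).
  by move: z zB; apply: nested_box_mono => //; lia.
by rewrite nested_box_ge // leq_maxr.
Qed.

Lemma uniq_nested_box x i : uniq (nested_box x i).
Proof. by rewrite /nested_box; case: i => [//|i]; case: ifP => _; exact: uniq_ball2. Qed.

Lemma x_in_nested_box x i : x \in candidates -> (0 < i)%N -> x \in nested_box x i.
Proof.
move=> xX i0; apply: (nested_box_mono xX i0); rewrite /nested_box; have -> : (1 < J)%N by lia.
by rewrite mem_ball2 !subrr.
Qed.

Lemma c_box_field x j f : x \in candidates -> c (box_field x j) f = \sum_(z <- nested_box x j) green_fun a (nested_box x j) x z * f z.
Proof.
move=> xX; apply: HK => //; [exact: uniq_nested_box | exact: nested_box_in |].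
by move=> y; exact: green_fun_out.
Qed.

Lemma box_field_in x j z : z \in nested_box x j -> box_field x j z = kron R x z.
Proof. exact: green_fun_in. Qed.

(** On its own box [box_field x j] is the indicator of [x], so pairing it with the Green function of
    a smaller box evaluates that function at [x]. Orthogonality to [vanishing_on] comes from the
    same formula. *)
Lemma lattice_chain x : x \in candidates -> chain c J (box_field x) (vanishing_on x) (box_variance x).
Proof.
move=> xX; have [_ _ [_ csym] _ _] := G.
split.
- by move=> j z _.
- by move=> i j ij f Sf z zB; apply: Sf; exact: (nested_box_mono xX ij zB).
- move=> i j /andP[ij jJ]; rewrite c_box_field //.
  case: i ij => [|i] ij; first by rewrite nested_box0 big_nil /box_variance nested_box0 green_fun_out.
  rewrite (big_rem x) ?x_in_nested_box //= big_seq big1 => [|z].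
    by rewrite box_field_in ?x_in_nested_box // ?(leq_trans _ ij) // /kron eqxx mulr1 addr0.
  rewrite mem_rem_uniq ?uniq_nested_box // inE => /andP[zx zB].
  by rewrite box_field_in ?(nested_box_mono xX ij zB) // /kron eq_sym (negbTE zx) mulr0.
- move=> j jJ z zB; rewrite /GRing.add /= /GRing.opp /=.
  by rewrite !box_field_in ?(nested_box_mono xX jJ zB) // subrr.
- move=> j f jJ Sf; rewrite csym c_box_field // big_seq big1 // => z zB.
  by rewrite Sf ?mulr0.
- by rewrite /box_variance nested_box0 green_fun_out.
- move=> j jJ; rewrite /box_variance.
  have [hp _] := pow2_split J3.
  case: j jJ => [|j] jJ.
    rewrite nested_box0 [X in X < _]green_fun_out //; apply: lt_le_trans (green_fun_diag a0 a1 (x_in_nested_box xX (ltnSn 0))).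
    by [].
  apply: (@green_fun_lt _ _ a0 a1 _ _ _ (2 ^ j)).
  + exact: nested_box_mono.
  + by move=> k kr; rewrite nested_box_lt // mem_ball2 /= addrAC subrr add0r subrr; lia.
  + by rewrite nested_box_lt // mem_ball2 /= addrAC subrr add0r subrr; lia.
  + move=> k kr; case: (ltnP j.+2 J) => hj.
      by rewrite nested_box_lt // mem_ball2 /= addrAC subrr add0r subrr expnS; have := expn_gt0 2 j; lia.
    have jE : (j = J - 2)%N by lia.
    rewrite nested_box_ge // mem_ball2 /=; move: xX; rewrite /candidates mem_ball2 hp -jE => xX.
    by lia.
Qed.

Lemma box_variance1 x : x \in candidates -> 1 <= box_variance x 1.
Proof. by move=> xX; apply: green_fun_diag => //; exact: x_in_nested_box. Qed.

(** The estimate for balls has error 8. The box of index [j < J] has radius [2 ^ (j - 1)], and [D]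
    lies between the balls of radius [2 ^ (J - 2)] and [2 ^ J] around [x]; these shifts of the index
    cost at most [2 * u <= 2]. *)
Lemma box_variance_lin x j : x \in candidates -> (j <= J)%N -> `|box_variance x j - green_rate R * j%:R| <= 10.
Proof.
move=> xX jJ; have u0 := green_rate_gt0 R; have u1 := green_rate_le1 R.
have p4 k : (k <= J)%N -> (1 - a) * 4 ^+ k <= 1.
  move=> kJ; apply: le_trans aJ; apply: ler_wpM2l; first by rewrite subr_ge0.
  by apply: ler_weXn2l => //; lra.
case: j jJ => [|j] jJ; first by rewrite /box_variance nested_box0 green_fun_out // mulr0 subr0 normr0.
have gb k : (k <= J)%N -> `|green_fun a (ball2 x (2 ^ k)) x x - green_rate R * k%:R| <= 8.
  by move=> kJ; apply: (@green_ball_pow2 R a) => //; [exact: p4 | exact: grnP].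
case: (ltnP j.+1 J) => hj.
  have := gb j (ltnW (ltnW hj)); rewrite /box_variance nested_box_lt // !ler_norml.
  by rewrite -[j.+1]addn1 natrD mulrDr mulr1; lra.
have jE : (j.+1 = J)%N by apply/eqP; rewrite eqn_leq jJ hj.
rewrite jE /box_variance nested_box_ge //.
have h1 := green_fun_le a0 a1 x x (candidates_sub xX); have h2 := green_fun_le a0 a1 x x (sub_candidates xX).
have J2 : (J - 2 <= J)%N by rewrite leq_subr.
have := gb _ J2; have := gb _ (leqnn J).
have -> : ((J - 2)%:R : R) = J%:R - 2 by rewrite natrB //; exact: ltnW.
rewrite !ler_norml mulrBr; lra.
Qed.

Lemma box_field_far (y : int * int) i (z : int * int) : y \in candidates -> z \in D -> (i < J)%N -> z != y ->
  (forall z' : int * int, nbr z z' || (z' == z) -> z' \notin nested_box y i) -> (box_field y J - box_field y i) z = 0.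
Proof.
move=> yX zD iJ zy hz; rewrite /GRing.add /= /GRing.opp /=.
rewrite box_field_in ?nested_box_ge // /kron eq_sym (negbTE zy) sub0r; apply/eqP; rewrite oppr_eq0; apply/eqP.
have e0 z' : nbr z z' || (z' == z) -> green_fun a (nested_box y i) y z' = 0 by move=> h; apply: green_fun_out => //; exact: hz.
by rewrite /box_field /lap /avg !e0 ?addr0 ?mulr0 ?subrr // /nbr !eqxx ?orbT.
Qed.

(** For [i <= j] the box of [x] and its neighbours miss the box of [y], so both functionals of [y]
    vanish on the box of [x]. For [i >= j + 3] the box of [x], of radius [2 ^ (j - 1)] and centred
    within [2 ^ (j + 1)] of [y], lies in the [i]-th box of [y], where the two functionals agree. *)
Lemma pair_sep (x y : int * int) j i : x \in candidates -> y \in candidates -> (j < J)%N ->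
  (2 ^ j <= maxn `|y.1 - x.1| `|y.2 - x.2| < 2 ^ j.+1)%N ->
  (i <= j)%N || (minn (j + 3) J <= i <= J)%N -> vanishing_on x j (box_field y J - box_field y i).
Proof.
move=> xX yX jJ /andP[d1 d2] hi.
suff key (z : int * int) : z \in nested_box x j -> (box_field y J - box_field y i) z = 0 by move=> z; exact: key.
move=> zB.
have chy := lattice_chain yX.
case: (leqP i j) hi => [ij _|ji /= /andP[hi iJ]].
  have zD : z \in D by rewrite -(nested_box_ge x (leqnn J)); apply: (nested_box_mono xX (ltnW jJ) zB).
  case: j jJ d1 d2 zB ij => [|j] jJ d1 d2 zB ij //.
  have zx : (`|z.1 - x.1| < 2 ^ j)%N && (`|z.2 - x.2| < 2 ^ j)%N by move: zB; rewrite nested_box_lt // mem_ball2.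
  rewrite expnS in d1.
  apply: box_field_far => //.
  - by apply: leq_ltn_trans ij jJ.
  - by apply/eqP => zy; move: d1 zx; rewrite zy; lia.
  - move=> z' hz'; case: i ij => [|i] ij //.
    have iJ : (i.+1 < J)%N by apply: leq_ltn_trans ij jJ.
    rewrite nested_box_lt // mem_ball2; apply/negP => hz.
    have ij2 : (2 ^ i <= 2 ^ j)%N by rewrite leq_exp2l.
    exact: (pair_sep_arith hz' d1 zx ij2 hz).
case: (ltnP i J) => iJ'; last first.
  have -> : i = J by apply/eqP; rewrite eqn_leq iJ iJ'.
  by rewrite subrr.
apply: (chain_SU chy iJ).
case: i hi iJ iJ' ji => [|i] hi iJ iJ' ji //.
rewrite nested_box_lt //.
have h3 : (2 ^ j.+2 <= 2 ^ i)%N by rewrite leq_exp2l //; lia.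
have h4 : (2 ^ j <= 2 ^ i)%N by rewrite leq_exp2l.
case: j jJ d1 d2 zB h3 h4 {hi ji} => [|j] jJ d1 d2 zB h3 h4; first by [].
move: zB; rewrite nested_box_lt // !mem_ball2 => zB; rewrite !expnS in d2 h3.
by have := expn_gt0 2 j; lia.
Qed.

End LatticeChain.

Lemma size_ball2 x r : size (ball2 x r) = ((2 * r).-1 ^ 2)%N.
Proof. by rewrite /ball2 /rect size_allpairs !size_iota -mulnn. Qed.

Lemma size_ball2_pow x j : (4 ^ j <= size (ball2 x (2 ^ j)) <= 4 ^ j.+1)%N.
Proof.
rewrite size_ball2 -[4%N]/(2 ^ 2)%N -!expnM !(mulnC 2) !expnM !leq_exp2r // expnS.
by have := expn_gt0 2 j; lia.
Qed.

(** * The Paley-Zygmund inequality *)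

Section PaleyZygmund.
Variable R : realType.
Context d (T : measurableType d) (P : probability T R).

(** Integration of [2 s W <= 1_E + s ^ 2 W ^ 2] with [s = b / C]: the inequality holds on [E]
    because [(1 - s W) ^ 2 >= 0], and off [E] because [W = 0] there. *)
Lemma paley_zygmund (W : T -> R) (E : set T) (b C : R) :
  measurable_fun setT W -> (forall t, 0 <= W t) -> measurable E -> (forall t, 0 < W t -> E t) ->
  0 < b -> 0 < C ->
  (b%:E <= \int[P]_t (W t)%:E)%E -> (\int[P]_t (W t * W t)%:E <= C%:E)%E ->
  ((b ^+ 2 / C)%:E <= P E)%E.
Proof.
move=> mW W0 mE hE b0 C0 h1 h2.
pose s := b / C; have s0 : 0 < s by rewrite divr_gt0.
have key : ((2 * s)%:E * \int[P]_t (W t)%:E <= P E + (s ^+ 2)%:E * \int[P]_t (W t * W t)%:E)%E.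
  have mWE : measurable_fun setT (fun t => (W t)%:E) by exact/measurable_EFinP.
  have mWW : measurable_fun setT (fun t => (W t * W t)%:E).
    by apply/measurable_EFinP; exact: measurable_funM.
  have WW0 t : (0 <= (W t * W t)%:E)%E by rewrite lee_fin mulr_ge0.
  have s2 : 0 <= 2 * s by rewrite mulr_ge0 // ltW.
  have mI : measurable_fun setT (fun t => (\1_E t : R)%:E).
    by apply/measurable_EFinP; exact: measurable_indic.
  have -> : P E = (\int[P]_t (\1_E t : R)%:E)%E.
    by rewrite (integral_indic P measurableT mE) setIT.
  rewrite -!ge0_integralZl_EFin ?sqr_ge0 //; last by move=> t _; rewrite lee_fin.
  rewrite -ge0_integralD //; last 2 first.
  - by move=> t _; rewrite mule_ge0 // lee_fin sqr_ge0.
  - exact: emeasurable_funM.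
  apply: ge0_le_integral => //.
  - by move=> t _; rewrite mule_ge0 // lee_fin.
  - exact: emeasurable_funM.
  - by apply: emeasurable_funD => //; exact: emeasurable_funM.
  - move=> t _; rewrite -!EFinM -EFinD lee_fin.
    case: (ltP 0 (W t)) => w0.
      rewrite indicE mem_set; last exact: hE.
      have := sqr_ge0 (1 - s * W t); rewrite mulr1n expr2 => h.
      by move: h; rewrite !expr2; lra.
    have -> : W t = 0 by apply/eqP; rewrite eq_le w0 W0.
    by rewrite !mulr0 addr0 indicE ler0n.
have f1 : ((2 * s * b)%:E <= (2 * s)%:E * \int[P]_t (W t)%:E)%E.
  by rewrite EFinM; apply: lee_wpmul2l => //; rewrite lee_fin mulr_ge0 // ltW.
have f2 : ((s ^+ 2)%:E * \int[P]_t (W t * W t)%:E <= (s ^+ 2 * C)%:E)%E.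
  by rewrite (EFinM (s ^+ 2)); apply: lee_wpmul2l => //; rewrite lee_fin sqr_ge0.
have := le_trans f1 (le_trans key (leeD2l (P E) f2)).
have <- : (fine (P E))%:E = P E by rewrite fineK // fin_num_measure.
rewrite -EFinD !lee_fin.
have -> : s ^+ 2 * C = b ^+ 2 / C by rewrite /s; field; rewrite gt_eqF.
have -> : 2 * s * b = 2 * (b ^+ 2 / C) by rewrite /s; ring.
by lra.
Qed.

End PaleyZygmund.

Section BlockMax.
Variable R : realType.

Definition block_level (C : R) (J : nat) : R := c1 R * J%:R - c2 R * ln J%:R - C.

Definition block_event d (T : measurableType d) (L : lattice_fun R -> T -> R) (a : R) (J : nat) (z0 : int * int) (m : R) : set T :=
  [set t | exists2 x, x \in candidates J z0 & m <= L (box_field a J z0 x J) t].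

Lemma block_event_measurable d (T : measurableType d) (P : probability T R) (L : lattice_fun R -> T -> R) c a J z0 m :
  gaussian_space P L c -> measurable (block_event L a J z0 m).
Proof.
case=> mL _ _ _ _.
rewrite (_ : block_event _ _ _ _ _ = \bigcup_(x in [set` candidates J z0]) (L (box_field a J z0 x J) @^-1` `[m, +oo[)).
  apply: fin_bigcup_measurable => // x _.
  rewrite -[X in measurable X]setTI; exact: (mL _ measurableT).
apply/seteqP; split => t /=.
  by move=> [x xX h]; exists x => //=; rewrite in_itv /= andbT.
by move=> [x /= xX]; rewrite in_itv /= andbT => h; exists x.
Qed.

Lemma sum_levels (J : nat) : \sum_(j < J) ((pow32 (j%:R + 1 : R))^-1 + (pow32 (J - j)%:R)^-1) <= 6.
Proof.
rewrite big_split /=.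
have h1 : \sum_(j < J) (pow32 (j%:R + 1 : R))^-1 <= 3.
  rewrite -(big_mkord xpredT (fun j => (pow32 (j%:R + 1 : R))^-1)).
  by apply: le_trans (sum_pow32 R J); apply: ler_sum => i _; rewrite -[i.+1]addn1 natrD.
have h2 : \sum_(j < J) (pow32 ((J - j)%:R : R))^-1 <= 3.
  apply: le_trans (sum_pow32 R J); rewrite big_mkord (reindex_inj rev_ord_inj) /=.
  by apply: ler_sum => i _; rewrite subKn.
by lra.
Qed.

Lemma log2_scale (n J : nat) : (0 < n < 2 ^ J)%N -> exists2 j, (j < J)%N & (2 ^ j <= n < 2 ^ j.+1)%N.
Proof.
move=> /andP[n0 nJ]; exists (trunc_log 2 n).
  by rewrite -(ltn_exp2l _ _ (isT : 1 < 2)%N); apply: leq_ltn_trans nJ; exact: trunc_logP.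
by rewrite trunc_logP //= trunc_log_ltn.
Qed.

Lemma maxn_dist_eq0 (x y : int * int) : maxn `|y.1 - x.1| `|y.2 - x.2| = 0%N -> x = y.
Proof. by case: x y => [p q] [p' q'] /= h; congr pair; lia. Qed.

(** * First and second moments of the total weight of a box *)

Section SecondMoment.
Context d (T : measurableType d) (P : probability T R).
Variables (L : lattice_fun R -> T -> R) (c : lattice_fun R -> lattice_fun R -> R).
Variables (a : R) (In : pred (int * int)).
Hypotheses (a0 : 0 < a) (a1 : a <= 1).
Hypothesis G : gaussian_space P L c.
Hypothesis HK : inverts_lap c a In.
Variables (J : nat) (z0 : int * int).
Hypothesis J3 : (3 <= J)%N.
Hypothesis DIn : {subset ball2 z0 (2 ^ J.-1) <= In}.
Hypothesis aJ : (1 - a) * 4 ^+ J <= 1.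
Variables (cl C : R) (M : nat).
Hypotheses (cl0 : 0 < cl) (C0 : 0 <= C).
Variable lam : int * int -> R.
Notation X := (candidates J z0).
Notation U := (box_field a J z0).
Notation g := (box_variance a J z0).
Hypothesis hlam : forall x, x \in X -> 0 < lam x.
Hypothesis hm : forall x, x \in X -> block_level C J <= lam x * g x J.
Hypothesis hlow : forall x, x \in X -> ((cl / 4 ^+ J)%:E <= barrier_value (g x) (lam x) J 2)%E.
Hypothesis hup : forall x, x \in X -> (barrier_value (g x) (lam x) J 2 <= (C / 4 ^+ J)%:E)%E.
Let s (j : nat) : R := (pow32 (j%:R + 1))^-1 + (pow32 (J - j)%:R)^-1.
Hypothesis hlev : forall x j, x \in X -> (j < J)%N ->
  256 * expR (4 * lam x) / lam x ^+ 2 * fine_factor (g x) j ^+ 2 * expR (- (lam x ^+ 2 * g x j)) * coarse_factor J (g x) (lam x) 2 (coarse_level J M j) <=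
  C / 4 ^+ J / 4 ^+ j * s j.

Let W x t : R := weight_prod L J (U x) (g x) (lam x) 2 0 J t * (1 <= profile L J (U x) (g x) (lam x) 2 0 t <= 2)%R%:R.

Let WE x t : total_weight L J (U x) (g x) (lam x) 2 t = (W x t)%:E.
Proof. by rewrite /total_weight start_windowE -EFinM. Qed.

Let chX x : x \in X -> chain c J (U x) (vanishing_on J z0 x) (g x).
Proof. by move=> xX; apply: (lattice_chain a0 a1 G HK). Qed.

Let W0 x t : x \in X -> 0 <= W x t.
Proof. by move=> xX; rewrite mulr_ge0 ?ler0n // (weight_prod_ge0 L (chX xX)). Qed.

Let W1 x t : x \in X -> W x t <= 1.
Proof.
move=> xX; rewrite /W -[leRHS]mulr1 ler_pM ?ler0n ?lern1 ?leq_b1 //.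
  exact: (weight_prod_ge0 L (chX xX)).
exact: (weight_prod_le1 L (chX xX)).
Qed.

Let mW x : x \in X -> measurable_fun setT (W x).
Proof.
move=> xX; apply/measurable_EFinP; have := measurable_total_weight G (chX xX) (lam x) 2.
rewrite (_ : total_weight _ _ _ _ _ _ = EFin \o W x) //; apply/funext => t; exact: WE.
Qed.

Let EW x : x \in X -> (\int[P]_t (W x t)%:E = barrier_value (g x) (lam x) J 2)%E.
Proof.
move=> xX; rewrite -(integral_total_weight G (chX xX) (lam x) 2).
by apply: eq_integral => t _; rewrite WE.
Qed.

Let Q (j : nat) : R := C / 4 ^+ J / 4 ^+ j * s j.

Let s_ge0 (j : nat) : 0 <= s j.
Proof. by rewrite /s addr_ge0 // invr_ge0 mulr_ge0 ?sqrtr_ge0 // addr_ge0. Qed.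

Let Q_ge0 (j : nat) : 0 <= Q j.
Proof. by rewrite /Q mulr_ge0 // divr_ge0 ?exprn_ge0 // divr_ge0 // exprn_ge0. Qed.

Lemma pair_moment (x y : int * int) j : x \in X -> y \in X -> (j < J)%N ->
  (2 ^ j <= maxn `|y.1 - x.1| `|y.2 - x.2| < 2 ^ j.+1)%N ->
  (\int[P]_t (W x t * W y t)%:E <= (2 * Q j)%:E)%E.
Proof.
move=> xX yX jJ hd.
have hd' : (2 ^ j <= maxn `|x.1 - y.1| `|x.2 - y.2| < 2 ^ j.+1)%N.
  by rewrite (distnC x.1) (distnC x.2).
have /andP[k1 k2] := lev_bounds M jJ.
have jk : (j <= coarse_level J M j <= J)%N by rewrite k2 andbT (leq_trans _ k1) // leq_min leq_addr ltnW.
have lx := hlam xX; have ly := hlam yX; have two0 : 0 < 2 :> R by [].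
have H12 i : (i <= j)%N || (coarse_level J M j <= i <= J)%N -> vanishing_on J z0 x j (U y J - U y i).
  move=> hi; apply: (pair_sep a0 a1 G HK J3 DIn aJ xX yX jJ hd).
  by case/orP: hi => [->//|/andP[h1 h2]]; rewrite (leq_trans k1 h1) h2 orbT.
have H21 i : (i <= j)%N || (coarse_level J M j <= i <= J)%N -> vanishing_on J z0 y j (U x J - U x i).
  move=> hi; apply: (pair_sep a0 a1 G HK J3 DIn aJ yX xX jJ hd').
  by case/orP: hi => [->//|/andP[h1 h2]]; rewrite (leq_trans k1 h1) h2 orbT.
have h := pair_le G (chX xX) (chX yX) (lam x) (lam y) 2 jk H12 H21.
have cx := CF_le G (chX xX) lx two0 jk; have cy := CF_le G (chX yX) ly two0 jk.
have -> : (2 * Q j)%:E = ((Q j)%:E + (Q j)%:E)%E by rewrite -EFinD; congr EFin; ring.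
apply: le_trans (leeD (le_trans cx _) (le_trans cy _)); last 2 first.
- by rewrite lee_fin; exact: hlev.
- by rewrite lee_fin; exact: hlev.
by apply: le_trans h; rewrite le_eqVlt; apply/orP; left; apply/eqP; apply: eq_integral => t _; rewrite !WE.
Qed.

(** The scale of the pair is replaced by a sum over all scales with the indicator of a ball, which
    lets the sum over [y] be taken first. *)
Lemma pair_moment_sum (x y : int * int) : x \in X -> y \in X ->
  (\int[P]_t (W x t * W y t)%:E <=
   ((x == y)%:R * (C / 4 ^+ J) + \sum_(j < J) (y \in ball2 x (2 ^ j.+1))%:R * (2 * Q j))%:E)%E.
Proof.
move=> xX yX.
have S0 : 0 <= \sum_(j < J) (y \in ball2 x (2 ^ j.+1))%:R * (2 * Q j).
  by apply: sumr_ge0 => j _; rewrite mulr_ge0 ?mulr_ge0 // Q_ge0.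
have mWW : measurable_fun setT (fun t => (W x t * W y t)%:E).
  by apply/measurable_EFinP; apply: measurable_funM; exact: mW.
case: (eqVneq x y) => [exy|nxy].
  rewrite mul1r -exy; apply: (@le_trans _ _ (\int[P]_t (W x t)%:E)%E).
    apply: ge0_le_integral => //.
    - by move=> t _; rewrite lee_fin mulr_ge0 // W0.
    - by move: mWW; rewrite -exy.
    - by apply/measurable_EFinP; exact: mW.
    - by move=> t _; rewrite lee_fin -[leRHS]mulr1 ler_wpM2l ?W0 ?W1.
  rewrite EW //; apply: le_trans (hup xX) _; rewrite lee_fin lerDl.
  by move: S0; rewrite -exy.
rewrite mul0r add0r.
have hn : (0 < maxn `|y.1 - x.1| `|y.2 - x.2| < 2 ^ J)%N.
  apply/andP; split.
    rewrite lt0n; apply: contra nxy => /eqP h; apply/eqP.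
    exact: maxn_dist_eq0 h.
  have [hp hp'] := pow2_split J3; move: xX yX; rewrite /candidates !mem_ball2 => xX yX.
  by rewrite hp' hp; lia.
have [j jJ hj] := log2_scale hn.
apply: le_trans (pair_moment xX yX jJ hj) _; rewrite lee_fin.
rewrite (bigD1 (Ordinal jJ)) //= -[leLHS]addr0 lerD //.
  rewrite mem_ball2 (_ : _ && _); first by rewrite mul1r.
  by rewrite -gtn_max; case/andP: hj.
by apply: sumr_ge0 => i _; rewrite mulr_ge0 ?mulr_ge0 // Q_ge0.
Qed.

Lemma count_ball (x : int * int) r : \sum_(y <- X) (y \in ball2 x (2 ^ r))%:R <= (4 ^ r.+1)%:R :> R.
Proof.
rewrite -natr_sum ler_nat -big_mkcond sum1_count -size_filter.
apply: (@leq_trans (size (ball2 x (2 ^ r)))); last by case/andP: (size_ball2_pow x r).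
apply: uniq_leq_size; first by rewrite filter_uniq // uniq_ball2.
by move=> y; rewrite mem_filter => /andP[].
Qed.

Definition Wtot t : R := \sum_(x <- X) W x t.

Lemma Wtot_ge0 t : 0 <= Wtot t.
Proof. by rewrite /Wtot big_seq sumr_ge0 // => x xX; exact: W0. Qed.

(** Extended by 0 outside the candidates, so that sign and measurability hold at every point, as the
    integral of a sum requires. *)
Let W' x t := if x \in X then W x t else 0.

Let W'0 x t : 0 <= W' x t.
Proof. by rewrite /W'; case: ifP => // xX; exact: W0. Qed.

Let mW' x : measurable_fun setT (W' x).
Proof. by rewrite /W'; case: (boolP (x \in X)) => // xX; exact: mW. Qed.

Let WtE t : Wtot t = \sum_(x <- X) W' x t.
Proof. by rewrite /Wtot big_seq big_mkcond. Qed.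

Lemma Wtot_meas : measurable_fun setT Wtot.
Proof.
rewrite (_ : Wtot = fun t => \sum_(x <- X) W' x t); last by apply/funext => t; exact: WtE.
exact: measurable_sum.
Qed.

(** There are at least [4 ^ (J - 2)] candidates, whence the 16. *)
Lemma Wtot_first : ((cl / 16)%:E <= \int[P]_t (Wtot t)%:E)%E.
Proof.
have -> : (\int[P]_t (Wtot t)%:E)%E = (\sum_(x <- X) \int[P]_t (W' x t)%:E)%E.
  rewrite -ge0_integral_sum //.
  - by apply: eq_integral => t _; rewrite sumEFin WtE.
  - by move=> x; exact/measurable_EFinP.
  - by move=> x t _; rewrite lee_fin.
apply: (@le_trans _ _ (\sum_(x <- X) (cl / 4 ^+ J)%:E)%E); last first.
  rewrite big_seq [leRHS]big_seq; apply: lee_sum => x xX.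
  by rewrite /W' xX EW //; exact: hlow.
rewrite sumEFin lee_fin big_const_seq count_predT iter_addr_0.
have /andP[hs _] := size_ball2_pow z0 (J - 2).
rewrite -(mulr_natr _ (size X)); apply: (@le_trans _ _ (cl / 4 ^+ J * (4 ^ (J - 2))%:R)).
  have -> : (4 : R) ^+ J = 4 ^+ (J - 2) * 16 by rewrite (_ : 16 = 4 ^+ 2 :> R) -?exprD ?subnK //; [exact: ltnW | ring].
  by rewrite natrX le_eqVlt; apply/orP; left; apply/eqP; field; rewrite expf_neq0.
by rewrite ler_wpM2l ?ler_nat // divr_ge0 ?exprn_ge0 // ltW.
Qed.

(** For each [x], scale [j] has at most [4 ^ (j + 2)] points [y], which contributes
    [32 * (C / 4 ^ J) * s j]; the [s j] add up to at most 6 and the diagonal gives one more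
    [C / 4 ^ J], so [193 = 32 * 6 + 1]. Finally there are at most [4 ^ J] points [x]. *)
Lemma Wtot_second : (\int[P]_t (Wtot t * Wtot t)%:E <= (193 * C)%:E)%E.
Proof.
have -> : (\int[P]_t (Wtot t * Wtot t)%:E)%E = (\sum_(x <- X) \sum_(y <- X) \int[P]_t (W' x t * W' y t)%:E)%E.
  transitivity (\sum_(x <- X) \int[P]_t \sum_(y <- X) (W' x t * W' y t)%:E)%E.
    rewrite -ge0_integral_sum //.
    - by apply: eq_integral => t _; rewrite WtE mulr_suml -sumEFin; apply: eq_bigr => x _; rewrite mulr_sumr sumEFin.
    - move=> x; apply: emeasurable_sum => y; apply/measurable_EFinP; exact: measurable_funM.
    - by move=> x t _; apply: sume_ge0 => y _; rewrite lee_fin mulr_ge0.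
  apply: eq_bigr => x _; rewrite ge0_integral_sum //.
  - by move=> y; apply/measurable_EFinP; exact: measurable_funM.
  - by move=> y t _; rewrite lee_fin mulr_ge0.
pose B (x y : int * int) : R := (x == y)%:R * (C / 4 ^+ J) + \sum_(j < J) (y \in ball2 x (2 ^ j.+1))%:R * (2 * Q j).
apply: (@le_trans _ _ (\sum_(x <- X) \sum_(y <- X) (B x y)%:E)%E).
  rewrite big_seq [leRHS]big_seq; apply: lee_sum => x xX.
  rewrite big_seq [leRHS]big_seq; apply: lee_sum => y yX.
  apply: le_trans (pair_moment_sum xX yX); rewrite le_eqVlt; apply/orP; left; apply/eqP.
  by apply: eq_integral => t _; rewrite /W' xX yX.
have inner x : x \in X -> \sum_(y <- X) B x y <= 193 * C / 4 ^+ J.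
  move=> xX; rewrite /B big_split /=.
  have e1 : \sum_(y <- X) (x == y)%:R * (C / 4 ^+ J) <= C / 4 ^+ J.
    rewrite -mulr_suml -[leRHS]mul1r ler_wpM2r ?divr_ge0 ?exprn_ge0 //.
    rewrite -natr_sum -[leRHS]/(1%:R) ler_nat -big_mkcond sum1_count.
    by rewrite (@eq_count _ _ (pred1 x)) ?count_uniq_mem ?uniq_ball2 ?leq_b1 // => y /=; rewrite eq_sym.
  have e2 : \sum_(y <- X) \sum_(j < J) (y \in ball2 x (2 ^ j.+1))%:R * (2 * Q j) <= 192 * C / 4 ^+ J.
    rewrite exchange_big /=.
    apply: (@le_trans _ _ (\sum_(j < J) 32 * (C / 4 ^+ J) * s j)).
      apply: ler_sum => j _; rewrite -mulr_suml.
      apply: (@le_trans _ _ ((4 ^ j.+2)%:R * (2 * Q j))).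
        by rewrite ler_wpM2r ?count_ball // mulr_ge0 // Q_ge0.
      rewrite /Q natrX !exprS le_eqVlt; apply/orP; left; apply/eqP.
      by field; rewrite !expf_neq0.
    rewrite -mulr_sumr; apply: (@le_trans _ _ (32 * (C / 4 ^+ J) * 6)).
      by rewrite ler_wpM2l ?sum_levels // mulr_ge0 // divr_ge0 ?exprn_ge0.
    by rewrite le_eqVlt; apply/orP; left; apply/eqP; ring.
  apply: le_trans (lerD e1 e2) _.
  by rewrite le_eqVlt; apply/orP; left; apply/eqP; ring.
under eq_bigr do rewrite sumEFin; rewrite sumEFin lee_fin.
apply: (@le_trans _ _ (\sum_(x <- X) 193 * C / 4 ^+ J)).
  by rewrite big_seq [leRHS]big_seq; apply: ler_sum => x; exact: inner.
rewrite big_const_seq count_predT iter_addr_0 -(mulr_natr _ (size X)).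
have hs : (size X <= 4 ^ J)%N.
  by have /andP[_ h] := size_ball2_pow z0 (J - 2); apply: leq_trans h _; rewrite leq_exp2l //; lia.
have k0 : 0 <= 193 * C by apply: mulr_ge0; [rewrite ler0n | exact: C0].
rewrite mulrAC ler_pdivrMr ?exprn_gt0 //; apply: ler_wpM2l => //.
by rewrite -natrX ler_nat.
Qed.

Lemma block_max_prob : (((cl / 16) ^+ 2 / (193 * (C + 1)))%:E <= P (block_event L a J z0 (block_level C J)))%E.
Proof.
apply: (paley_zygmund Wtot_meas Wtot_ge0 (block_event_measurable a J z0 (block_level C J) G)); last 2 first.
- exact: Wtot_first.
- by apply: le_trans Wtot_second _; rewrite lee_fin; lra.
- move=> t Wt.
  have [x xX Wx] : exists2 x, x \in X & 0 < W x t.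
    apply: contrapT => h; move: Wt; rewrite /Wtot big_seq big1 ?ltxx // => x xX.
    by apply/eqP; rewrite eq_le W0 // andbT leNgt; apply/negP => Wx; apply: h; exists x.
  exists x => //; apply: le_trans (hm xX) _.
  move: Wx; rewrite /W; case: (boolP (_ <= _ <= 2)) => [/andP[_ h] _|_]; last by rewrite mulr0 ltxx.
  (* The box of index 0 is empty, so with the value 2 at scale [J] the bound [profile 0 <= 2] reads
     [lam * g J <= L (U J)]. *)
  have U0 : U x 0 = 0 by apply/funext => z; rewrite /box_field nested_box0 /lap /avg !green_fun_out // !addr0 !mulr0 subrr.
  move: h; rewrite /profile U0 (gs_L0 G) (chain_g0 (chX xX)) !subr0; lra.
- by rewrite divr_gt0.
- by apply: mulr_gt0; [rewrite ltr0n | exact: ltr_wpDl C0 ltr01].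
Qed.

End SecondMoment.

(** The field, the killing rate and the box come after the constants, so that one [dl] serves every
    scale of both fields. *)
Lemma block_max : exists (dl C : R) (J0 : nat), [/\ 0 < dl, 0 <= C, (3 <= J0)%N &
  forall d (T : measurableType d) (P : probability T R) (L : lattice_fun R -> T -> R) c (a : R) (In : pred (int * int)) J z0,
  0 < a -> a <= 1 -> gaussian_space P L c -> inverts_lap c a In -> (J0 <= J)%N ->
  {subset ball2 z0 (2 ^ J.-1) <= In} -> (1 - a) * 4 ^+ J <= 1 ->
  (dl%:E <= P (block_event L a J z0 (block_level C J)))%E].
Proof.
have [cl [C [J0 [M [cl0 C0 J00 H]]]]] := asymptotics R.
exists ((cl / 16) ^+ 2 / (193 * (C + 1))), C, (maxn 3 J0); split; [|exact: C0| |].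
- apply: divr_gt0; first by apply: exprn_gt0; apply: divr_gt0 cl0 _; rewrite ltr0n.
  by apply: mulr_gt0; [rewrite ltr0n | exact: ltr_wpDl C0 ltr01].
- by rewrite leq_maxl.
move=> d T P L c a In J z0 a0 a1 G HK; rewrite geq_max => /andP[J3 hJ] DIn aJ.
pose Good (x : int * int) (l : R) := [/\ 0 < l, block_level C J <= l * box_variance a J z0 x J,
   ((cl / 4 ^+ J)%:E <= barrier_value (box_variance a J z0 x) l J 2)%E, (barrier_value (box_variance a J z0 x) l J 2 <= (C / 4 ^+ J)%:E)%E &
   forall j, (j < J)%N -> 256 * expR (4 * l) / l ^+ 2 * fine_factor (box_variance a J z0 x) j ^+ 2 * expR (- (l ^+ 2 * box_variance a J z0 x j)) *
     coarse_factor J (box_variance a J z0 x) l 2 (coarse_level J M j) <= C / 4 ^+ J / 4 ^+ j * ((pow32 (j%:R + 1))^-1 + (pow32 (J - j)%:R)^-1)].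
(* A slope is chosen for each candidate, since its variances depend on its position in [D]. *)
pose lam x := xget 0 (Good x).
have hl (x : int * int) : x \in candidates J z0 -> Good x (lam x).
  move=> xX; have ch := lattice_chain a0 a1 G HK J3 DIn aJ xX.
  apply: xgetPex; apply: H => //.
  - exact: (chain_g0 ch).
  - exact: box_variance1.
  - by move=> i j; exact: (chain_mono ch).
  - by move=> j jJ; apply: box_variance_lin.
apply: (@block_max_prob _ _ _ L c a In a0 a1 G HK J z0 J3 DIn aJ cl C M cl0 C0 lam).
- by move=> x /hl [].
- by move=> x /hl [].
- by move=> x /hl [].
- by move=> x /hl [].
- by move=> x j /hl [_ _ _ _ h]; exact: h.
Qed.

End BlockMax.

(** * Independent boxes at all scales *)

Section GaussExtra.
Variable R : realType.

Lemma gauss_refl (v : R) (h : R -> \bar R) : 0 <= v -> measurable_fun setT h -> (forall x, 0 <= h x)%E ->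
  (\int[gauss v]_x h (- x)%R = \int[gauss v]_x h x)%E.
Proof.
move=> v0 mh h0.
have mhN : measurable_fun setT (fun x : R => h (- x)) by apply: (measurableT_comp mh); exact: measurable_funN.
move: v0; rewrite le_eqVlt => /orP[/eqP <-|v0].
  by rewrite !integral_gauss0 // oppr0.
rewrite (integral_gauss v0 mhN (fun x => h0 (- x))) (integral_gauss v0 mh h0).
rewrite -[RHS](@integral_refl R 0 (fun x => (h x * (gauss_pdf v x)%:E)%E)).
- by apply: eq_integral => x _; rewrite sub0r pgN.
- by apply: emeasurable_funM => //; apply/measurable_EFinP; exact: measurable_gauss_pdf.
- by move=> x; rewrite mule_ge0 // lee_fin gauss_pdf_ge0.
Qed.

Context d (T : measurableType d) (P : probability T R).
Variables (Y : T -> R) (v : R).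
Hypotheses (v0 : 0 <= v) (mY : measurable_fun setT Y).
Hypothesis law : forall h : R -> \bar R, measurable_fun setT h -> (forall x, (0 <= h x)%E) ->
  (\int[P]_t h (Y t) = \int[gauss v]_x h x)%E.

(** The bound [|y| <= exp y + exp (- y)] reduces this to the exponential moments, which are
    explicit. *)
Lemma gauss_law_integrable : P.-integrable setT (EFin \o Y).
Proof.
have m (s : R) : measurable_fun setT (fun t => (expR (s * Y t))%:E).
  by apply/measurable_EFinP; apply: mexp2; exact: measurable_funM.
have fin (s : R) : (\int[P]_t (expR (s * Y t))%:E < +oo)%E.
  have m1 : measurable_fun setT (fun x : R => (expR (s * x))%:E).
    by apply/measurable_EFinP; apply: mexp2; exact: measurable_funM.
  have p1 (x : R) : (0 <= (expR (s * x))%:E)%E by rewrite lee_fin expR_ge0.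
  by rewrite (law m1 p1) integral_gauss_exp // ltry.
apply/integrableP; split; first exact/measurable_EFinP.
apply: (@le_lt_trans _ _ (\int[P]_t ((expR (1 * Y t))%:E + (expR (-1 * Y t))%:E))%E).
  apply: ge0_le_integral => //.
  - by apply: measurableT_comp => //; exact/measurable_EFinP.
  - by apply: emeasurable_funD.
  - move=> t _; rewrite /= -EFinD lee_fin mul1r mulN1r ler_norml.
    have := expR_ge1Dx (Y t); have := expR_ge1Dx (- Y t).
    have := expR_gt0 (Y t); have := expR_gt0 (- Y t); lra.
rewrite ge0_integralD //; try by move=> t _; rewrite lee_fin expR_ge0.
by apply: lte_add_pinfty; exact: fin.
Qed.

Lemma gauss_law_mean0 : (\int[P]_t (Y t)%:E = 0)%E.
Proof.
have mE : measurable_fun setT (EFin : R -> \bar R) by apply/measurable_EFinP; exact: measurable_id.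
have mp := measurable_funepos mE; have mn := measurable_funeneg mE.
have pn : (\int[P]_t ((EFin \o Y)^\+ t) = \int[P]_t ((EFin \o Y)^\- t))%E.
  transitivity (\int[P]_t (EFin^\+%E (Y t)))%E; first by apply: eq_integral => t _; rewrite !funeposE.
  transitivity (\int[P]_t (EFin^\-%E (Y t)))%E; last by apply: eq_integral => t _; rewrite !funenegE.
  apply: (etrans (law mp (funepos_ge0 _))).
  apply: (etrans _ (esym (law mn (funeneg_ge0 _)))).
  apply: (etrans _ (gauss_refl v0 mn (funeneg_ge0 _))); apply: eq_integral => x _.
  by rewrite funeposE funenegE EFinN oppeK.
apply: (etrans (integralE P setT (EFin \o Y))); rewrite pn.
apply: subee; apply: integrable_neg_fin_num => //; exact: gauss_law_integrable.
Qed.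

End GaussExtra.

Section GaussianSpaceMean.
Variable R : realType.
Context d (T : measurableType d) (P : probability T R).
Variables (F : lmodType R) (L : F -> T -> R) (c : F -> F -> R).
Hypothesis G : gaussian_space P L c.

Lemma gs_integrable f : P.-integrable setT (EFin \o L f).
Proof. by have [mL _ _ c0 law] := G; exact: (gauss_law_integrable (c0 f) (mL f) (law f)). Qed.

Lemma gs_mean0 f : (\int[P]_t (L f t)%:E = 0)%E.
Proof. by have [mL _ _ c0 law] := G; exact: (gauss_law_mean0 (c0 f) (mL f) (law f)). Qed.

End GaussianSpaceMean.

Section IndepInt.
Variable R : realType.
Context d (T : measurableType d) (P : probability T R).
Variables (F : lmodType R) (L : F -> T -> R) (c : F -> F -> R).
Hypothesis G : gaussian_space P L c.
Notation GT S := (g_sigma_algebraType (rects L S)).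
Variables (S1 S2 : set F) (A : set T).
Hypotheses (S10 : S1 0) (S20 : S2 0) (S12 : forall f g, S1 f -> S2 g -> c f g = 0).
Hypothesis sA : <<s rects L S1 >> A.

Lemma sigma_meas S B : <<s rects L S >> B -> measurable B.
Proof.
by apply: smallest_sub; [exact: sigma_algebra_measurable | exact: (rects_measurable G)].
Qed.

(** On the sigma-algebra of [S2] the restriction of [P] to [A] is [P] scaled by [P A]; both
    integrals are moved there by a pushforward along the identity. *)
Lemma ge0_indep_int (h : T -> \bar R) : smeas L S2 h -> (forall t, 0 <= h t)%E ->
  (\int[P]_(t in A) h t = P A * \int[P]_t h t)%E.
Proof.
move=> sh h0; have mA := sigma_meas sA; have mh := smeas_meas G sh.
have fA := fin_num_measure P A mA.
pose r : {nonneg R} := NngNum (fine_ge0 (measure_ge0 P A)).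
have m1A : measurable_fun setT (fun t => (\1_A t : R)%:E) by apply/measurable_EFinP; exact: measurable_indic.
have dens : (\int[mrestr P mA]_t h t = \int[P]_t (h t * (\1_A t : R)%:E))%E.
  apply: (ge0_integral_density m1A) => //.
  by move=> B mB; rewrite (integral_indic P mB mA) setIC.
pose m1 : {mfun T >-> GT S2} := HB.pack (mapid L S2) (isMeasurableFun.Build _ _ _ _ _ (@measurable_mapid _ _ _ _ _ _ _ G S2)).
transitivity (\int[mrestr P mA]_t h t)%E.
  rewrite dens integral_mkcond; apply: eq_integral => t _.
  by rewrite patchE indicE; case: ifP => _; rewrite ?mule1 ?mule0.
have p0 (nu : {measure set T -> \bar R}) : (\int[nu]_t h t = \int[pushforward nu m1]_y (h : GT S2 -> \bar R) y)%E.
  apply: (etrans _ (esym (@ge0_integral_pushforward _ _ T (GT S2) R m1 (@measurable_mapid _ _ _ _ _ _ _ G S2) nu setT h measurableT sh (fun y _ => h0 y)))).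
  by [].
rewrite p0 (p0 P).
pose Q1 : {measure set (GT S2) -> \bar R} := mscale r (distribution P m1).
transitivity (\int[Q1]_y (h : GT S2 -> \bar R) y)%E.
  apply: eq_measure_integral => B mB _.
  rewrite /Q1 /= /mscale /distribution /= /pushforward /= /mrestr fineK //.
  rewrite -(gs_indep G S10 S20 S12 sA mB) setIC //.
by rewrite /Q1 ge0_integral_mscale //= fineK.
Qed.

Lemma indep_int (h : T -> R) : smeas L S2 (EFin \o h) -> P.-integrable setT (EFin \o h) ->
  (\int[P]_(t in A) (h t)%:E = P A * \int[P]_t (h t)%:E)%E.
Proof.
move=> sh ih; have mA := sigma_meas sA.
have hp := ge0_indep_int (measurable_funepos sh) (funepos_ge0 _).
have hn := ge0_indep_int (measurable_funeneg sh) (funeneg_ge0 _).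
apply: (etrans (integralE P A (EFin \o h))); rewrite hp hn.
rewrite -[in RHS]/(\int[P]_t ((EFin \o h) t))%E (integralE P setT (EFin \o h)).
have fn := integrable_neg_fin_num measurableT ih.
have fA := fin_num_measure P A mA.
by rewrite -(muleBr fA) // fin_num_adde_defl // fin_numN.
Qed.

End IndepInt.

(** * From a positive probability to an expectation *)

Section Spine.
Variable R : realType.
Context d (T : measurableType d) (P : probability T R).
Variables (L : lattice_fun R -> T -> R) (c : lattice_fun R -> lattice_fun R -> R).
Variables (a : R) (In : pred (int * int)).
Hypotheses (a0 : 0 < a) (a1 : a <= 1).
Hypothesis G : gaussian_space P L c.
Hypothesis HK : inverts_lap c a In.
Notation GT S := (g_sigma_algebraType (rects L S)).

Definition site_fun (x : int * int) : lattice_fun R := kron R x.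

(** The corner is the default value: it is centred and lies outside all the boxes that will be
    tried. *)
Definition max_over (l : seq (int * int)) (t : T) : R :=
  foldr (fun x acc => Num.max (L (site_fun x) t) acc) (L (site_fun (0, 0)) t) l.

Lemma max_over_le l (z : R) t : (forall x, x \in (0, 0) :: l -> L (site_fun x) t <= z) -> max_over l t <= z.
Proof.
elim: l => [|x l IH] h /=; first by apply: h; rewrite inE.
rewrite ge_max h ?inE ?eqxx ?orbT //= IH // => y; rewrite inE => /orP[/eqP ->|yl]; apply: h; rewrite !inE ?eqxx ?yl ?orbT //.
Qed.

Lemma max_over_smeas S l : S (site_fun (0, 0)) -> (forall x, x \in l -> S (site_fun x)) ->
  measurable_fun setT (max_over l : GT S -> R).
Proof.
move=> S0; elim: l => [|x l IH] h /=; first exact: smeas_L.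
apply: measurable_maxr; first by apply: smeas_L; apply: h; rewrite inE eqxx.
by apply: IH => y yl; apply: h; rewrite inE yl orbT.
Qed.

Lemma max_over_meas l : measurable_fun setT (max_over l).
Proof.
have [mL _ _ _ _] := G.
by elim: l => [|x l IH] /=; [exact: mL | exact: measurable_maxr].
Qed.

Lemma max_over_integrable l : P.-integrable setT (EFin \o max_over l).
Proof.
elim: l => [|x l IH]; first exact: (gs_integrable G).
have h := integrableD measurableT (integrable_abse (gs_integrable G (site_fun x))) (integrable_abse IH).
apply: le_integrable h => //; first by apply/measurable_EFinP; exact: max_over_meas.
move=> t _; rewrite /= lee_fin.
rewrite [leRHS]ger0_norm ?addr_ge0 //.
by rewrite /Num.max; case: ifP => _; rewrite ?lerDl ?lerDr normr_ge0.
Qed.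

Variables (D : seq (int * int)) (pt : seq (int * int)) (U : int * int -> lattice_fun R).
Hypothesis uD : uniq D.
Hypothesis DIn : {subset D <= In}.
Hypothesis UE : forall x, U x = lap a (green_fun a D x).
Variable (m : R).

Let S1 : set (lattice_fun R) := [set f | f = 0 \/ exists2 x, x \in pt & f = U x].
Let S2 : set (lattice_fun R) := [set f | forall z, z \in D -> f z = 0].

Let S10 : S1 0. Proof. by left. Qed.
Let S20 : S2 0. Proof. by []. Qed.

Let cU x f : c (U x) f = \sum_(z <- D) green_fun a D x z * f z.
Proof. by rewrite UE; apply: HK => // y; exact: green_fun_out. Qed.

Let S12 f g : S1 f -> S2 g -> c f g = 0.
Proof.
move=> [->|[x xp ->]] Sg; first by rewrite (gs_c0 G).
by rewrite cU big_seq big1 // => z zD; rewrite Sg ?mulr0.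
Qed.

Let S2dZ x : x \notin D -> S2 (site_fun x).
Proof. by move=> xD z zD; rewrite /site_fun /kron; case: eqP xD => // ->; rewrite zD. Qed.

(** On [D] the functional [U x] has the coefficients of the site [x], so the residual vanishes there
    and is orthogonal to every [U y]. *)
Let S2res x : x \in pt -> S2 (site_fun x - U x).
Proof.
move=> xp z zD; rewrite /GRing.add /= /GRing.opp /= UE green_fun_in // subrr //.
Qed.

Definition hits (p : seq (int * int)) : set T := [set t | exists2 x, x \in p & m <= L (U x) t].

Let hit1 x : x \in pt -> <<s rects L S1 >> [set t | m <= L (U x) t].
Proof.
move=> xp; have mL : measurable_fun setT (L (U x) : GT S1 -> measurableTypeR R).
  by apply: smeas_L; right; exists x.
have := mL measurableT `[m, +oo[%classic (measurable_itv _); rewrite setTI.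
congr (<<s _ >> _); apply/seteqP; split => t /=; by rewrite in_itv /= andbT.
Qed.

Let hits_cons x p : hits (x :: p) = [set t | m <= L (U x) t] `|` hits p.
Proof.
apply/seteqP; split => t /=.
  by move=> [y]; rewrite inE => /orP[/eqP ->|yp] h; [left | right; exists y].
by move=> [h|[y yp h]]; [exists x; rewrite ?inE ?eqxx | exists y; rewrite ?inE ?yp ?orbT].
Qed.

Lemma hits_sigma p : {subset p <= pt} -> <<s rects L S1 >> (hits p).
Proof.
elim: p => [|x p IH] h.
  rewrite (_ : hits [::] = set0); last by apply/seteqP; split => t //= -[].
  exact: (@measurable0 _ (GT S1)).
rewrite hits_cons; apply: (@measurableU _ (GT S1)).
  by apply: hit1; apply: h; rewrite inE eqxx.
by apply: IH => y yp; apply: h; rewrite inE yp orbT.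
Qed.

(** The points of [p] are tried in order, and [B] is the event that the previous ones failed. At the
    first success the maximum is at least [m] plus a centred residual independent of the event; if
    all fail, the maximum over [l] is independent of that failure. *)
Lemma select_step l p B : {subset p <= pt} -> (forall x, x \in (0, 0) :: l -> x \notin D) ->
  <<s rects L S1 >> B ->
  (m%:E * P (B `&` hits p) + P (B `\` hits p) * \int[P]_t (max_over l t)%:E <=
   \int[P]_(t in B) (max_over (p ++ l) t)%:E)%E.
Proof.
move=> pp lD; elim: p B pp => [|x p IH] B pp sB.
  rewrite (_ : hits [::] = set0); last by apply/seteqP; split => t //= -[].
  rewrite setI0 measure0 mule0 add0e setD0 /=.
  rewrite -(indep_int G S10 S20 S12 sB) //; last exact: max_over_integrable.
  apply/measurable_EFinP; apply: max_over_smeas; first by apply: S2dZ; apply: lD; rewrite inE.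
  by move=> y yl; apply: S2dZ; apply: lD; rewrite inE yl orbT.
have xp : x \in pt by apply: pp; rewrite inE eqxx.
have pp' : {subset p <= pt} by move=> y yp; apply: pp; rewrite inE yp orbT.
set A := [set t | m <= L (U x) t].
have sA : <<s rects L S1 >> A by exact: hit1.
have sBA : <<s rects L S1 >> (B `&` A) by exact: (@measurableI _ (GT S1)).
have sBD : <<s rects L S1 >> (B `\` A) by exact: (@measurableD _ (GT S1)).
have mBA := sigma_meas G sBA; have mBD := sigma_meas G sBD.
have mH := sigma_meas G (hits_sigma pp').
have IB := IH _ pp' sBD.
have mB := sigma_meas G sB.
have intM q : P.-integrable setT (EFin \o max_over q) by exact: max_over_integrable.
have intS (E : set T) q : measurable E -> P.-integrable E (EFin \o max_over q).
  by move=> mE; apply: (integrableS measurableT mE _ (intM q)).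
have -> : (\int[P]_(t in B) (max_over ((x :: p) ++ l) t)%:E =
   \int[P]_(t in B `&` A) (max_over ((x :: p) ++ l) t)%:E + \int[P]_(t in B `\` A) (max_over ((x :: p) ++ l) t)%:E)%E.
  rewrite -integral_setU //.
  - by rewrite setUIDK.
  - by apply: measurable_funTS; apply/measurable_EFinP; exact: max_over_meas.
  - apply/disj_setPS => t /= [[_ h] [_ h']]; exact: h' h.
(* The residual at [x] is added to the constant [m]: it has integral 0 over the event, and there the
   sum is a lower bound for the field at [x]. *)
have h1 : (m%:E * P (B `&` A) <= \int[P]_(t in B `&` A) (max_over ((x :: p) ++ l) t)%:E)%E.
  have ih : P.-integrable (B `&` A) (EFin \o L (site_fun x - U x)).
    exact: (integrableS measurableT mBA _ (gs_integrable G _)).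
  have ic : P.-integrable (B `&` A) (EFin \o (fun=> m)).
    apply: (integrableS measurableT mBA) => //.
    exact: finite_measure_integrable_cst.
  have e1 : (\int[P]_(t in B `&` A) ((EFin \o (fun=> m)) t + (EFin \o L (site_fun x - U x)) t) = m%:E * P (B `&` A))%E.
    rewrite integralD // integral_cst //.
    rewrite (indep_int G S10 S20 S12 sBA _ (gs_integrable G _)).
      by rewrite (gs_mean0 G) mule0 adde0.
    by apply/measurable_EFinP; apply: smeas_L; exact: S2res.
  rewrite -e1; apply: le_integral => //; [exact: integrableD | exact: intS |].
  move=> t; rewrite inE => -[_ tA] /=; rewrite -EFinD lee_fin le_max; apply/orP; left.
  by rewrite (gs_LB G); move: tA; rewrite /A /=; lra.
have h2 : (\int[P]_(t in B `\` A) (max_over (p ++ l) t)%:E <= \int[P]_(t in B `\` A) (max_over ((x :: p) ++ l) t)%:E)%E.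
  apply: le_integral => //; [exact: intS | exact: intS |].
  by move=> t _; rewrite lee_fin /= le_max lexx orbT.
apply: le_trans (leeD h1 (le_trans IB h2)).
have eD : B `\` hits (x :: p) = B `\` A `\` hits p.
  by rewrite hits_cons; apply/seteqP; split => t /=; tauto.
have eI : B `&` hits (x :: p) = (B `&` A) `|` ((B `\` A) `&` hits p).
  by rewrite hits_cons; apply/seteqP; split => t /=; have [?|?] := pselect (A t); tauto.
have mDH : measurable ((B `\` A) `&` hits p) by exact: measurableI.
rewrite eD eI measureU //; last first.
  by apply/seteqP; split => t //= [[_ h] [[_ h'] _]].
by rewrite muleDr ?fin_num_measure ?ge0_adde_def ?inE // addeA.
Qed.

(* If some point of [pt] is high, the field there minus [U] is centred and independent of
   the choice of the point; otherwise one falls back on [l]. *)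
Lemma block_step l (dl b : R) : (forall x, x \in (0, 0) :: l -> x \notin D) ->
  0 <= dl -> (dl%:E <= P (hits pt))%E -> b <= m -> (b%:E <= \int[P]_t (max_over l t)%:E)%E ->
  ((dl * m + (1 - dl) * b)%:E <= \int[P]_t (max_over (pt ++ l) t)%:E)%E.
Proof.
move=> lD dl0 hdl bm hb.
have sT : <<s rects L S1 >> setT by exact: (@measurableT _ (GT S1)).
have mH := sigma_meas G (hits_sigma (fun _ h => h) : <<s rects L S1 >> (hits pt)).
apply: le_trans (select_step (fun _ h => h) lD sT).
rewrite setTI setTD probability_setC //.
have fH := fin_num_measure P _ mH.
have fM := integrable_fin_num measurableT (max_over_integrable l).
have fM' : (\int[P]_t (max_over l t)%:E)%E \is a fin_num by [].
move: hdl hb; rewrite -(fineK fM') -(fineK fH) !lee_fin => hdl hb.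
have hp1 : fine (P (hits pt)) <= 1 by rewrite -lee_fin fineK // probability_le1.
set p := fine _ in hdl hp1 *; set M := fine _ in hb *.
have h1 : 0 <= (p - dl) * (m - b) by rewrite mulr_ge0 //; lra.
have h2 : 0 <= (1 - p) * (M - b) by rewrite mulr_ge0 //; lra.
by move: h1 h2; rewrite !mulrBl !mulrBr; lra.
Qed.

End Spine.

(** Both coordinates are the midpoint of [2 ^ s] and [2 ^ (s + 1)]; with radius [2 ^ (s - 1)] the
    boxes are disjoint for different [s]. *)
Definition block_center (s : nat) : int * int := ((3 * 2 ^ s.-1)%N%:Z, (3 * 2 ^ s.-1)%N%:Z).

Lemma mem_block_center s (z : int * int) : (0 < s)%N -> z \in ball2 (block_center s) (2 ^ s.-1) ->
  ((2 ^ s)%N%:Z < z.1 < (2 ^ s.+1)%N%:Z) && ((2 ^ s)%N%:Z < z.2 < (2 ^ s.+1)%N%:Z).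
Proof.
case: s => // s _; rewrite mem_ball2 /= !expnS; have := expn_gt0 2 s; lia.
Qed.

Fixpoint spine_points (J0 k : nat) : seq (int * int) :=
  if k is k'.+1 then candidates (J0 + k') (block_center (J0 + k')) ++ spine_points J0 k' else [::].

Lemma candidates_mem s (x : int * int) : (3 <= s)%N -> x \in candidates s (block_center s) -> x \in ball2 (block_center s) (2 ^ s.-1).
Proof. by move=> s3; apply: ball2_sub_refl; rewrite leq_exp2l //; lia. Qed.

Lemma points_bound J0 k (x : int * int) : (3 <= J0)%N -> x \in spine_points J0 k ->
  (0 <= x.1 < (2 ^ (J0 + k))%N%:Z) && (0 <= x.2 < (2 ^ (J0 + k))%N%:Z).
Proof.
move=> J3; elim: k => [//|k IH] /=; rewrite mem_cat => /orP[h|/IH].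
  have s3 : (3 <= J0 + k)%N by rewrite (leq_trans J3) // leq_addr.
  have := mem_block_center (leq_trans _ s3) (candidates_mem s3 h); rewrite addnS => /(_ isT); lia.
by rewrite addnS expnS; lia.
Qed.

Lemma points_out J0 k (x : int * int) : (3 <= J0)%N -> x \in (0, 0) :: spine_points J0 k ->
  x \notin ball2 (block_center (J0 + k)) (2 ^ (J0 + k).-1).
Proof.
move=> J3 h; apply/negP => hx.
have s3 : (0 < J0 + k)%N by lia.
have := mem_block_center s3 hx.
move: h; rewrite inE => /orP[/eqP ->|/(points_bound J3)] /=; lia.
Qed.

Lemma c2_gt0 (R : realType) : 0 < c2 R.
Proof. by rewrite /c2 mulr_gt0 // sqrtr_gt0 divr_gt0 // pi_gt0. Qed.

Lemma block_level_le (R : realType) (C : R) J : 0 <= C -> (1 <= J)%N -> block_level C J <= c1 R * J%:R.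
Proof.
move=> C0 J1; have h : 0 <= ln (J%:R : R) by rewrite ln_ge0 // ler1n.
by have := mulr_ge0 (ltW (c2_gt0 R)) h; rewrite /block_level; lra.
Qed.

Lemma ln_step (R : realType) J : (2 <= J)%N -> 0 <= ln (J.+1%:R : R) - ln (J%:R) <= 1.
Proof.
move=> J2; have J0' : 0 < (J%:R : R) by rewrite ltr0n; lia.
have J1' : 0 < (J.+1%:R : R) by rewrite ltr0n.
have /andP[l0 l1] := ln2_bounds R.
have h1 : ln (J%:R : R) <= ln J.+1%:R by rewrite ler_ln // ler_nat.
have h2 : ln (J.+1%:R : R) <= ln (2 * J%:R).
  by rewrite ler_ln ?posrE ?mulr_gt0 // -natrM ler_nat; lia.
by rewrite lnM ?posrE // in h2; lra.
Qed.

Lemma level_arith J n : (3 <= J)%N -> (J < n)%N ->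
  [/\ (J + (n - J.+1) < n)%N, ((J + (n - J.+1)).-1 = n - 2)%N, (0 < n - 2)%N & (2 <= n)%N].
Proof. by move=> h1 h2; split; lia. Qed.

Lemma coord_lt (p q : int) (k n : nat) : (0 <= p < k%:Z) && (0 <= q < k%:Z) -> (k <= n)%N ->
  (0 <= p < n%:Z) && (0 <= q < n%:Z).
Proof. lia. Qed.

Lemma interior_arith s n (z : int * int) : (s.+1 < n)%N ->
  ((2 ^ s)%N%:Z < z.1 < (2 ^ s.+1)%N%:Z) && ((2 ^ s)%N%:Z < z.2 < (2 ^ s.+1)%N%:Z) ->
  (0 < z.1 < (2 ^ n)%N%:Z - 1) && (0 < z.2 < (2 ^ n)%N%:Z - 1).
Proof.
move=> sn; have : (2 ^ s.+2 <= 2 ^ n)%N by rewrite leq_exp2l.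
by rewrite !expnS; lia.
Qed.

(** * Induction over the scales *)

Section Levels.
Variable R : realType.
Variables (dl C : R) (J0 : nat).
Hypotheses (dl0 : 0 < dl) (C0 : 0 <= C) (J03 : (3 <= J0)%N).
Context d (T : measurableType d) (P : probability T R).
Variables (L : lattice_fun R -> T -> R) (c : lattice_fun R -> lattice_fun R -> R).
Variables (a : R) (In : pred (int * int)) (n : nat).
Hypotheses (a0 : 0 < a) (a1 : a <= 1).
Hypothesis G : gaussian_space P L c.
Hypothesis HK : inverts_lap c a In.
Hypothesis HIn : forall z : int * int,
  (0 < z.1 < (2 ^ n)%N%:Z - 1) && (0 < z.2 < (2 ^ n)%N%:Z - 1) -> In z.
Hypothesis an : (1 - a) * 4 ^+ n <= 1.
Hypothesis HB : forall J z0, (J0 <= J)%N -> {subset ball2 z0 (2 ^ J.-1) <= In} -> (1 - a) * 4 ^+ J <= 1 ->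
  (dl%:E <= P (block_event L a J z0 (block_level C J)))%E.

(** About [1 / dl] scales are lost in mean before a success, each worth at most [c1]. The other
    terms cover the scales below [J0] and a possible decrease of [block_level] from one scale to the
    next, at most [c2]. *)
Definition spine_loss : R := c1 R / dl + c1 R * J0%:R + c2 R.

(** One block step replaces a bound [b] by [dl * m + (1 - dl) * b]. The bound
    [block_level - spine_loss] follows this recursion because the level rises by at most
    [c1 <= dl * spine_loss] per scale. *)
Lemma levels k : (J0 + k < n)%N || (k == 0)%N -> ((block_level C (J0 + k).-1 - spine_loss)%:E <= \int[P]_t (max_over L (spine_points J0 k) t)%:E)%E.
Proof.
have c10 := c1_gt0 R; have c20 := c2_gt0 R.
have dli : 0 < c1 R / dl by rewrite divr_gt0.
elim: k => [_|k IH].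
  rewrite (gs_mean0 G) lee_fin addn0; have J1 : (1 <= J0.-1)%N by lia.
  have := block_level_le C0 J1; have : c1 R * J0.-1%:R <= c1 R * J0%:R by rewrite ler_pM2l // ler_nat leq_pred.
  by rewrite /spine_loss; lra.
rewrite orbF addnS /= => kn.
set s := (J0 + k)%N in kn *.
have s3 : (3 <= s)%N by rewrite (leq_trans J03) // leq_addr.
have {}IH : ((block_level C s.-1 - spine_loss)%:E <= \int[P]_t (max_over L (spine_points J0 k) t)%:E)%E by apply: IH; rewrite (ltnW kn).
have DIn : {subset ball2 (block_center s) (2 ^ s.-1) <= In}.
  move=> z /mem_block_center hz; apply: HIn.
  exact: (interior_arith kn (hz (leq_trans (isT : 0 < 3)%N s3))).
have as_ : (1 - a) * 4 ^+ s <= 1.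
  apply: le_trans an; apply: ler_wpM2l; first by rewrite subr_ge0.
  by apply: ler_weXn2l; [lra | rewrite ltnW // ltnW].
have hdl := HB (leq_addr k J0 : (J0 <= s)%N) DIn as_.
have Pm := block_event_measurable a s (block_center s) (block_level C s) G.
have dl1 : dl <= 1 by rewrite -lee_fin; apply: le_trans hdl (probability_le1 P Pm).
have sS : (s.-1.+1 = s)%N by rewrite prednK // (leq_trans _ s3).
have s2' : (2 <= s.-1)%N by rewrite -ltnS sS.
have /andP[s1 s2] := ln_step R s2'; rewrite sS in s1 s2.
have hm : block_level C s.-1 - spine_loss <= block_level C s.
  rewrite /block_level; have : c2 R * (ln s%:R - ln s.-1%:R) <= c2 R * 1 by rewrite ler_pM2l.
  have : c1 R * s.-1%:R <= c1 R * s%:R by rewrite ler_pM2l // ler_nat leq_pred.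
  have : 0 <= c1 R * J0%:R by rewrite mulr_ge0 // ltW.
  by rewrite /spine_loss; lra.
have out x : x \in (0, 0) :: spine_points J0 k -> x \notin ball2 (block_center s) (2 ^ s.-1) by exact: points_out.
have UE x : box_field a s (block_center s) x s = lap a (green_fun a (ball2 (block_center s) (2 ^ s.-1)) x) by rewrite /box_field nested_box_ge.
have := @block_step R _ T P L c a In a0 a1 G HK (ball2 (block_center s) (2 ^ s.-1)) (candidates s (block_center s)) (fun x => box_field a s (block_center s) x s)
  (uniq_ball2 _ _) DIn UE (block_level C s) (spine_points J0 k) dl (block_level C s.-1 - spine_loss) out (ltW dl0) hdl hm IH.
apply: le_trans; rewrite lee_fin.
have hmm : block_level C s - block_level C s.-1 <= c1 R.
  rewrite /block_level; have : 0 <= c2 R * (ln s%:R - ln s.-1%:R) by rewrite mulr_ge0 // ltW.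
  have -> : (s%:R : R) = s.-1%:R + 1 by rewrite -{1}sS -addn1 natrD.
  by lra.
have KE : c1 R <= dl * spine_loss.
  rewrite /spine_loss !mulrDr mulrCA mulfV ?gt_eqF // mulr1.
  have : 0 <= dl * (c1 R * J0%:R) by apply: mulr_ge0; [exact: ltW | apply: mulr_ge0 => //; exact: ltW].
  have : 0 <= dl * c2 R by rewrite mulr_ge0 // ltW.
  by lra.
have h1 : (1 - dl) * (block_level C s - block_level C s.-1) <= (1 - dl) * c1 R by rewrite ler_wpM2l //; lra.
have h2 : 0 <= dl * c1 R by rewrite mulr_ge0 // ltW.
rewrite [leRHS](_ : _ = (block_level C s - spine_loss) + (dl * spine_loss - (1 - dl) * (block_level C s - block_level C s.-1))); last by ring.
rewrite lerDl subr_ge0; apply: le_trans h1 _; rewrite mulrBl mul1r.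
by move: KE h2; lra.
Qed.

Lemma spine_bound (Z : T -> R) : (1 <= n)%N -> P.-integrable setT (EFin \o Z) ->
  (forall x : int * int, (0 <= x.1 < (2 ^ n)%N%:Z) && (0 <= x.2 < (2 ^ n)%N%:Z) -> forall t, L (site_fun R x) t <= Z t) ->
  ((c1 R * n%:R - c2 R * ln n%:R - (C + spine_loss + c1 R * (J0%:R + 2)))%:E <= \int[P]_t (Z t)%:E)%E.
Proof.
move=> n1 iZ hZ.
have c10 := c1_gt0 R; have c20 := c2_gt0 R.
have lnn : 0 <= ln (n%:R : R) by rewrite ln_ge0 // ler1n.
have K0 : 0 <= spine_loss.
  by apply: addr_ge0; [apply: addr_ge0; [apply: divr_ge0|apply: mulr_ge0 => //]|]; exact: ltW.
have step k : (J0 + k < n)%N || (k == 0)%N ->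
    (\int[P]_t (max_over L (spine_points J0 k) t)%:E <= \int[P]_t (Z t)%:E)%E.
  move=> hk; apply: le_integral => //; first exact: (max_over_integrable G).
  move=> t _; rewrite lee_fin; apply: max_over_le => x; rewrite inE => /orP[/eqP ->|xl].
    by apply: hZ; rewrite /= ltz_nat expn_gt0.
  case/orP: hk => [hk|/eqP hk]; last by move: xl; rewrite hk.
  apply: hZ; apply: coord_lt (points_bound J03 xl) _ => //.
  by rewrite leq_exp2l // ltnW.
case: (ltnP J0 n) => hn.
  (* The last box has [s = n - 2]: then [2 ^ (s + 1) < 2 ^ n - 1], which puts it in the interior. *)
  have [e1 e2 e3 e4] := level_arith J03 hn.
  have hk : (J0 + (n - J0.+1) < n)%N || ((n - J0.+1)%N == 0%N) by rewrite e1.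
  apply: le_trans (step _ hk); apply: le_trans (levels hk); rewrite lee_fin e2.
  have h : c2 R * ln ((n - 2)%N%:R : R) <= c2 R * ln n%:R.
    by rewrite ler_pM2l // ler_ln ?posrE ?ltr0n // ler_nat leq_subr.
  have h2 : c1 R * n%:R = c1 R * (n - 2)%N%:R + 2 * c1 R.
    by rewrite -[in LHS](subnK e4) natrD mulrDr; ring.
  have h3 : 0 <= c1 R * J0%:R by rewrite mulr_ge0 // ltW.
  by rewrite /block_level h2 mulrDr; move: h h3; lra.
(* For [n <= J0] the corner alone, of mean 0, reaches the bound. *)
have hk : (J0 + 0 < n)%N || (0%N == 0%N) by rewrite orbT.
apply: le_trans (step _ hk); rewrite (gs_mean0 G) lee_fin.
have : c1 R * n%:R <= c1 R * J0%:R by rewrite ler_pM2l // ler_nat.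
by have := mulr_ge0 (ltW c20) lnn; move: C0 K0; rewrite mulrDr; lra.
Qed.

End Levels.

(** * Green functions of the random walk *)

Section PathProbability.
Variable R : realType.
Implicit Types (x y z : int * int) (p s : seq (int * int)) (phi : seq (int * int) -> bool).

(** Probability that the first [m + 1] positions of the walk from [x] satisfy [phi]. The recursion
    conditions on the first step, so that summation over [m] gives the Laplace equation of the Green
    functions. *)
Fixpoint path_prob m x phi : R :=
  if m is m'.+1 then avg (fun z => path_prob m' z (fun s => phi (x :: s))) x
  else (phi [:: x])%:R.

Lemma path_prob_ge0 m x phi : 0 <= path_prob m x phi.
Proof.
elim: m x phi => [|m IH] x phi /=; first exact: ler0n.
by rewrite /avg mulr_ge0 ?invr_ge0 // !addr_ge0.
Qed.

Lemma path_prob_compl m x phi : path_prob m x phi + path_prob m x (predC phi) = 1.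
Proof.
elim: m x phi => [|m IH] x phi /=; first by case: (phi _); rewrite ?addr0 ?add0r.
rewrite -avgD /avg; have h z := IH z (fun s => phi (x :: s)).
by rewrite !h; lra.
Qed.

Context d (W : measurableType d) (w : nat -> W -> int * int).
Hypothesis mw : forall m y, measurable (w m @^-1` [set y]).
Variables (nu : {measure set W -> \bar R}) (k : R) (x0 : int * int).
Hypothesis k0 : 0 <= k.
Hypothesis nuT : nu setT = k%:E.
Hypothesis nu_path : forall m (p : nat -> int * int), nu (walk_path w m p) =
  (k * ((p 0%N == x0)%:R * \prod_(i < m) srw_step R (p i) (p i.+1)))%:E.

Definition prefix p : set W := [set u | mkseq (w^~ u) (size p) = p].
Definition event n phi : set W := [set u | phi (mkseq (w^~ u) n)].

Lemma prefixE p : prefix p = \big[setI/setT]_(i < size p) (w i @^-1` [set nth (0, 0) p i]).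
Proof.
rewrite -(bigcap_mkord (size p) (fun i => w i @^-1` [set nth (0, 0) p i])); apply/seteqP; split=> u /= h.
  by move=> i /= ip; rewrite -[in RHS]h nth_mkseq.
apply: (@eq_from_nth _ (0, 0)); rewrite size_mkseq // => i ip.
by rewrite nth_mkseq // h.
Qed.

Lemma measurable_prefix p : measurable (prefix p).
Proof. by rewrite prefixE; apply: bigsetI_measurable => i _; exact: mw. Qed.

(** There are countably many lists of length [n], so the event is a countable union of events fixing
    a path. *)
Lemma measurable_event n phi : measurable (event n phi).
Proof.
have -> : event n phi = \bigcup_(p : seq (int * int))
    (if phi p && (size p == n) then prefix p else set0).
  apply/seteqP; split=> u /= => [h|[p _]].
    by exists (mkseq (w^~ u) n) => //; rewrite h size_mkseq eqxx /prefix /= size_mkseq.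
  by case: ifP => // /andP[h /eqP hn] hp; rewrite /event /= -hn hp.
apply: countable_bigcupT_measurable; first exact: countableP.
by move=> p; case: ifP => // _; exact: measurable_prefix.
Qed.

Lemma in_event n phi u : (u \in event n phi) = phi (mkseq (w^~ u) n).
Proof. by apply/idP/idP; rewrite inE. Qed.

Definition path_weight p : R :=
  (nth (0, 0) p 0 == x0)%:R * \prod_(i < (size p).-1) srw_step R (nth (0, 0) p i) (nth (0, 0) p i.+1).

Lemma nu_prefix p : (0 < size p)%N -> nu (prefix p) = (k * path_weight p)%:E.
Proof.
move=> p0; rewrite -[RHS](nu_path (size p).-1 (nth (0, 0) p)); congr (nu _).
apply/seteqP; split=> u /= h.
  by move=> i ip; rewrite -h nth_mkseq //; lia.
apply: (@eq_from_nth _ (0, 0)); rewrite size_mkseq // => i ip.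
by rewrite nth_mkseq // h //; lia.
Qed.

Lemma path_weight_rcons p y z :
  path_weight (rcons (rcons p y) z) = path_weight (rcons p y) * srw_step R y z.
Proof.
rewrite /path_weight !size_rcons /= big_ord_recr /= mulrA; congr (_ * _ * _).
- by rewrite nth_rcons size_rcons.
- apply: eq_bigr => -[i ip] _ /=.
  by rewrite ![nth _ (rcons (rcons p y) z) _]nth_rcons size_rcons !ltnS (ltnW ip) ip.
- by rewrite !nth_rcons size_rcons ltnSn eqxx !ltnn eqxx.
Qed.

Lemma sum_slices n (s : seq (int * int)) (A : set W) : uniq s -> measurable A ->
  (\sum_(z <- s) nu (A `&` w n @^-1` [set z]) <= nu A)%E.
Proof.
elim: s A => [|z s IH] A /=; first by rewrite big_nil.
move=> /andP[zs us] mA; rewrite big_cons (measureDI nu mA (mw n z)) addeC leeD2r //.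
apply: (@le_trans _ _ (\sum_(y <- s) nu ((A `\` w n @^-1` [set z]) `&` w n @^-1` [set y]))%E);
  last by apply: IH => //; exact: measurableD.
rewrite !big_seq; apply: lee_sum => y ys; rewrite le_measure ?inE //.
- exact: measurableI.
- by apply: measurableI => //; exact: measurableD.
- move=> u [Au /= uy]; split=> //; split=> //= uz.
  by move: zs; rewrite -uz uy ys.
Qed.

Definition nbrs z : seq (int * int) :=
  [:: (z.1 + 1, z.2); (z.1 - 1, z.2); (z.1, z.2 + 1); (z.1, z.2 - 1)].

Lemma uniq_nbrs z : uniq (nbrs z).
Proof. by case: z => a b; rewrite /= !inE /= !xpair_eqE /=; lia. Qed.

Lemma step_nbrs y z : z \in nbrs y -> srw_step R y z = 4^-1.
Proof.
move=> h; rewrite /srw_step ifT //; move: h; case: y => a b; case: z => a' b'.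
by rewrite !inE !xpair_eqE /=; lia.
Qed.

Lemma avg_nbrs (f : int * int -> R) z : avg f z = \sum_(y <- nbrs z) 4^-1 * f y.
Proof. by rewrite /avg /nbrs !big_cons big_nil addr0 !mulrDr !addrA. Qed.

(* Only lower bounds are needed: applied to an event and to its complement they add up to
   the total mass. *)
Lemma nu_event_ge m p z phi :
  ((k * path_weight (rcons p z) * path_prob m z (fun s => phi (p ++ s)))%:E <=
   nu (prefix (rcons p z) `&` event (size p + m).+1 phi))%E.
Proof.
elim: m p z phi => [|m IH] p z phi.
  rewrite /= cats1; have -> : prefix (rcons p z) `&` event (size p + 0).+1 phi =
      if phi (rcons p z) then prefix (rcons p z) else set0.
    apply/seteqP; split=> u; rewrite addn0 /prefix /event /= size_rcons.
      by move=> [h]; rewrite h => ->.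
    by case: ifP => //; rewrite /= ?size_rcons => hp h; rewrite h.
  case: (phi _); first by rewrite mulr1 nu_prefix // size_rcons.
  by rewrite mulr0 measure0.
apply: le_trans (@sum_slices (size p).+1 (nbrs z) _ (uniq_nbrs z)
  (measurableI _ _ (measurable_prefix _) (measurable_event _ _))).
rewrite [path_prob _ _ _]/= avg_nbrs mulr_sumr -sumEFin !big_seq.
apply: lee_sum => y yz; rewrite addnS -addSn -(size_rcons p z).
apply: le_trans (_ : _ <= nu (prefix (rcons (rcons p z) y) `&` event (size (rcons p z) + m).+1 phi))%E _.
  apply: le_trans (IH _ _ _); rewrite path_weight_rcons (step_nbrs yz) !mulrA lee_fin.
  by under [X in path_prob _ _ X]eq_fun do rewrite -cat_rcons.
rewrite le_measure ?inE //.
- by apply: measurableI; [exact: measurable_prefix|exact: measurable_event].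
- apply: measurableI => //; apply: measurableI; [exact: measurable_prefix|exact: measurable_event].
- move=> u [hp he]; move: hp; rewrite /prefix /= size_rcons.
  by rewrite mkseqS => /rcons_inj[h1 h2]; split.
Qed.

(** A measure of total mass [k] takes the place of a probability because the torus field applies
    this to the law of the walk restricted to the event that the clock has not yet rung. *)
Lemma nu_event m phi : nu (event m.+1 phi) = (k * path_prob m x0 phi)%:E.
Proof.
have lb f : ((k * path_prob m x0 f)%:E <= nu (event m.+1 f))%E.
  apply: le_trans (le_measure nu _ _ (@subIsetr _ (prefix [:: x0]) _)); rewrite ?inE.
  - have := nu_event_ge m [::] x0 f; rewrite /path_weight /= eqxx big_ord0 !mulr1 add0n.
    exact.
  - by apply: measurableI; [exact: measurable_prefix|exact: measurable_event].
  - exact: measurable_event.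
have e1 : (nu (event m.+1 phi) + nu (event m.+1 (predC phi)) = k%:E)%E.
  rewrite -nuT (measureDI nu measurableT (measurable_event m.+1 phi)) setTI setTD addeC.
  by congr (nu _ + _)%E; apply/seteqP; split=> u /= /negP.
have f1 : nu (event m.+1 phi) \is a fin_num.
  rewrite ge0_fin_numE //; apply: le_lt_trans (ltry k); rewrite -nuT.
  by apply: le_measure; rewrite ?inE //; exact: measurable_event.
have f2 : nu (event m.+1 (predC phi)) \is a fin_num.
  rewrite ge0_fin_numE //; apply: le_lt_trans (ltry k); rewrite -nuT.
  by apply: le_measure; rewrite ?inE //; exact: measurable_event.
move: e1 (lb phi) (lb (predC phi)).
rewrite -(fineK f1) -(fineK f2) -EFinD !lee_fin => -[e1] h1 h2; congr EFin.
have h3 : k * path_prob m x0 phi + k * path_prob m x0 (predC phi) = k.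
  by rewrite -mulrDr path_prob_compl mulr1.
lra.
Qed.

End PathProbability.

(** * Series and Laplace equations for both Green functions *)

Section GreenSeries.
Variable R : realType.
Implicit Types (x y z : int * int) (s : seq (int * int)) (phi : seq (int * int) -> bool).

Lemma eq_path_prob m x phi psi : (forall z s, phi (z :: s) = psi (z :: s)) ->
  path_prob R m x phi = path_prob R m x psi.
Proof.
elim: m x phi psi => [|m IH] x phi psi h /=; first by rewrite h.
by rewrite /avg !(IH _ (fun s => phi (x :: s)) (fun s => psi (x :: s))).
Qed.

(** The identity is kept in the extended reals: the finiteness of the Green functions only comes
    later, from the Gaussian field that has them as covariance. *)
Lemma nneseries_avg (a : R) (q : nat -> int * int -> R) x : 0 <= a ->
  (forall m z, 0 <= q m z) -> (forall m, q m.+1 x = a * avg (q m) x) ->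
  (\sum_(m <oo) (q m x)%:E = (q 0 x)%:E + (a * 4^-1)%:E *
    (\sum_(m <oo) (q m (x.1 + 1, x.2)%R)%:E + \sum_(m <oo) (q m (x.1 - 1, x.2)%R)%:E
     + \sum_(m <oo) (q m (x.1, x.2 + 1)%R)%:E + \sum_(m <oo) (q m (x.1, x.2 - 1)%R)%:E))%E.
Proof.
move=> a0 q0 qS.
have q0' m z : (0 <= (q m z)%:E)%E by rewrite lee_fin.
rewrite nneseries_recl //; congr (_ + _)%E.
rewrite -(nneseries_addn 1 (f := fun m => (q m x)%:E)) //.
rewrite -!nneseriesD //; try by move=> i _ _; rewrite ?adde_ge0.
rewrite -nneseriesZl; last by move=> i _; rewrite ?adde_ge0.
by apply: eq_eseriesr => i _; rewrite addn1 qS -!EFinD -EFinM mulrA.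
Qed.

Definition killed_at N y s : bool :=
  all (fun z => z \notin box_boundary N) s && (last (0, 0) s == y).
Definition torus_at N y s : bool := torus_eq N (last (0, 0) s) y.

Lemma killed_step N m x y : x \notin box_boundary N ->
  path_prob R m.+1 x (killed_at N y) = avg (fun z => path_prob R m z (killed_at N y)) x.
Proof.
move=> hx; rewrite /= /avg.
have h z : path_prob R m z (fun s => killed_at N y (x :: s)) = path_prob R m z (killed_at N y).
  by apply: eq_path_prob => u s; rewrite /killed_at /= hx.
by rewrite !h.
Qed.

Lemma torus_step N m x y :
  path_prob R m.+1 x (torus_at N y) = avg (fun z => path_prob R m z (torus_at N y)) x.
Proof.
rewrite /= /avg.
have h z : path_prob R m z (fun s => torus_at N y (x :: s)) = path_prob R m z (torus_at N y).
  by apply: eq_path_prob => u s.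
by rewrite !h.
Qed.

Context d (W : measurableType d) (Pw : int * int -> probability W R).
Variable w : nat -> W -> int * int.
Hypothesis srw : forall x, is_srw (Pw x) w x.

Lemma measurable_walk m y : measurable (w m @^-1` [set y]).
Proof. by have [h _] := srw (0, 0); exact: h. Qed.

Lemma hitting_timeP N m u : (m%:R%:E < hitting_time R w N u)%E =
  all (fun z => z \notin box_boundary N) (mkseq (w^~ u) m.+1).
Proof.
apply/idP/idP => [h|/allP h].
  apply/allP => z /mapP[i]; rewrite mem_iota add0n => /andP[_ im] ->.
  apply/negP => hi; move: h; rewrite ltNge => /negP; apply.
  apply: (@le_trans _ _ i%:R%:E); last by rewrite lee_fin ler_nat -ltnS.
  by apply: ereal_inf_lbound; exists i.
apply: (@lt_le_trans _ _ m.+1%:R%:E); first by rewrite lte_fin ltr_nat.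
apply: le_ereal_inf_tmp => _ [i /= hi <-]; rewrite lee_fin ler_nat ltnNge.
apply/negP => im; have := h (w i u) _; rewrite hi => /(_ _)/negP; case=> //.
by apply/mapP; exists i; rewrite // mem_iota.
Qed.

Lemma in_set1_eq x y : (x \in [set y]) = (x == y).
Proof. by apply/idP/eqP; rewrite inE. Qed.

Lemma green_series N x y :
  (green Pw w N x y = \sum_(m <oo) (path_prob R m x (killed_at N y))%:E)%E.
Proof.
rewrite /green.
under eq_integral => u _.
  rewrite eseries_mkcond.
  under eq_eseriesr => m _.
    have -> : (if (m%:R%:E < hitting_time R w N u)%E then (\1_[set y] (w m u))%:E else 0%E) =
      (\1_(event w m.+1 (killed_at N y)) u : R)%:E.
      rewrite hitting_timeP indicE [in RHS]indicE.
      rewrite in_event /killed_at [X in last _ X]mkseqS last_rcons in_set1_eq.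
      by case: (all _ _).
    over.
  over.
rewrite integral_nneseries //; last first.
  move=> m; apply/measurable_EFinP; apply: measurable_indic; exact: measurable_event measurable_walk _ _.
apply: eq_eseriesr => m _.
rewrite integral_indic // ?setIT; last exact: measurable_event measurable_walk _ _.
rewrite (@nu_event _ _ _ _ measurable_walk (Pw x) 1 x) ?mul1r //.
- exact: probability_setT.
- by move=> k p; rewrite mul1r; have [_ h] := srw x; exact: h.
Qed.

Lemma green_eq N x y : x \notin box_boundary N ->
  (green Pw w N x y = (kron R x y)%:E + (1 * 4^-1)%:E *
    (green Pw w N (x.1 + 1, x.2)%R y + green Pw w N (x.1 - 1, x.2)%R y
     + green Pw w N (x.1, x.2 + 1)%R y + green Pw w N (x.1, x.2 - 1)%R y))%E.
Proof.
move=> hx; rewrite !green_series.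
rewrite (@nneseries_avg 1 (fun m z => path_prob R m z (killed_at N y))) //.
- by rewrite /= /killed_at /= hx.
- by move=> m z; exact: path_prob_ge0.
- by move=> m; rewrite mul1r killed_step.
Qed.

Variables (N : nat) (t : {mfun W >-> R}).
Hypothesis N0 : (0 < N)%N.
Hypothesis clock : forall x, is_exp_clock (Pw x) w N t.

Definition survival : R := expR (- (N ^ 2)%:R^-1).

Lemma exponential_tail (r : R) m : 0 < r ->
  exponential_prob r `[m%:R, +oo[ = (expR (- r) ^+ m)%:E.
Proof.
move=> r0; rewrite /exponential_prob integral_mkcond /=.
pose f (u : R) : \bar R := ((fun v : R => (exponential_pdf r v)%:E) \_ `[m%:R, +oo[) u.
have mf : measurable_fun setT f.
  apply/(measurable_restrict _ _ _) => //.
  by apply: measurable_funTS; apply/measurable_EFinP; exact: measurable_exponential_pdf.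
have f0 (u : R) : (0 <= f u)%E.
  by rewrite /f patchE; case: ifP => // _; rewrite lee_fin exponential_pdf_ge0 // ltW.
rewrite -[LHS](integral_shift m%:R mf f0).
transitivity (\int[lebesgue_measure]_x ((expR (- r) ^+ m)%:E * (exponential_pdf r x)%:E))%E.
  apply: eq_integral => x _; rewrite /f patchE mem_setE in_itv /= andbT lerDr.
  have [x0|x0] := leP 0 x; last by rewrite (lt0_exponential_pdf _ x0) // mule0.
  rewrite !exponential_pdfE ?addr_ge0 // -EFinM; congr EFin.
  by rewrite -expRM_natl mulrCA; congr (_ * _); rewrite -expRD; congr expR; lra.
rewrite ge0_integralZl //.
- by rewrite integral_exponential_pdf // mule1.
- by apply/measurable_EFinP; exact: measurable_exponential_pdf.
- by move=> x _; rewrite lee_fin exponential_pdf_ge0 // ltW.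
Qed.

Lemma torus_series x y :
  (torus_green Pw w t N x y = \sum_(m <oo) (survival ^+ m * path_prob R m x (torus_at N y))%:E)%E.
Proof.
rewrite /torus_green.
pose A m : set W := t @^-1` `[m%:R, +oo[.
have mA m : measurable (A m) by rewrite -[A m]setTI; exact: (measurable_funP t).
under eq_integral => u _.
  rewrite eseries_mkcond.
  under eq_eseriesr => m _.
    have -> : (if m%:R <= t u then (\1_[set v | torus_eq N v y] (w m u))%:E else 0%E) =
      (\1_(event w m.+1 (torus_at N y) `&` A m) u : R)%:E.
      rewrite indicE [in RHS]indicE.
      have -> : (u \in event w m.+1 (torus_at N y) `&` A m) =
          torus_eq N (w m u) y && (m%:R <= t u).
        rewrite in_setI in_event /torus_at mkseqS last_rcons; congr andb.
        by apply/idP/idP; rewrite inE /A /= in_itv /= andbT.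
      have -> : (w m u \in [set v | torus_eq N v y]) = torus_eq N (w m u) y.
        by apply/idP/idP; rewrite inE.
      have h (b e : bool) : (if b then (e%:R : R)%:E else 0%E) = (e && b)%:R%:E.
        by case: b e => -[].
      exact: h.
    over.
  over.
rewrite integral_nneseries //; last first.
  move=> m; apply/measurable_EFinP; apply: measurable_indic; apply: measurableI => //.
  exact: measurable_event measurable_walk _ _.
apply: eq_eseriesr => m _.
rewrite integral_indic // ?setIT; last first.
  by apply: measurableI => //; exact: measurable_event measurable_walk _ _.
have [hc1 hc2] := clock x.
have r0 : 0 < (N ^ 2)%:R^-1 :> R by rewrite invr_gt0 ltr0n expn_gt0 N0.
have PA : Pw x (A m) = (survival ^+ m)%:E by rewrite hc1 // exponential_tail.
(* The clock is independent of the walk, so restricting to [m <= t] multiplies every path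
   probability by [survival ^ m]. *)
rewrite -(@nu_event _ _ _ _ measurable_walk (mrestr (Pw x) (mA m)) (survival ^+ m) x) //.
- by rewrite exprn_ge0 // expR_ge0.
- by rewrite -PA; congr (Pw x _); rewrite setTI.
- move=> k p; rewrite EFinM -PA; have [_ h] := srw x; rewrite -h -hc2 //.
  by rewrite /mrestr setIC.
Qed.

Lemma torus_green_eq x y :
  (torus_green Pw w t N x y = (torus_eq N x y)%:R%:E + (survival * 4^-1)%:E *
    (torus_green Pw w t N (x.1 + 1, x.2)%R y + torus_green Pw w t N (x.1 - 1, x.2)%R y
     + torus_green Pw w t N (x.1, x.2 + 1)%R y + torus_green Pw w t N (x.1, x.2 - 1)%R y))%E.
Proof.
rewrite !torus_series.
have a0 : 0 <= survival by exact: expR_ge0.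
rewrite (@nneseries_avg survival (fun m z => survival ^+ m * path_prob R m z (torus_at N y))) //.
- by rewrite expr0 mul1r.
- by move=> m z; rewrite mulr_ge0 ?exprn_ge0 // path_prob_ge0.
- by move=> m; rewrite torus_step exprS -mulrA avgZ.
Qed.

Lemma survival_le : (1 - survival) * (N ^ 2)%:R <= 1.
Proof.
have := expR_ge1Dx (- (N ^ 2)%:R^-1 : R); rewrite -/survival.
have n0 : 0 < (N ^ 2)%:R :> R by rewrite ltr0n expn_gt0 N0.
move=> h; rewrite -ler_pdivlMr // mul1r; lra.
Qed.

End GreenSeries.

(** * Variance of the Gaussian law *)

Section SecondMoment.
Variable R : realType.
Notation mu := (@lebesgue_measure R).

Lemma measurable_sqr : measurable_fun setT (fun x : R => (x ^+ 2)%:E).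
Proof. by apply/measurable_EFinP; exact: measurable_funX. Qed.

(* The variance of [gauss v] is read off from [expR u >= 1 + u] with [u = s * x ^ 2] and
   [s -> 0] from both sides. *)
Lemma gauss_exp_sqr (v r : R) : 0 < v -> 0 < r ->
  (\int[gauss v]_x (expR ((1 - r ^+ 2) / (2 * v) * x ^+ 2))%:E = (r^-1)%:E)%E.
Proof.
move=> v0 r0.
have me : measurable_fun setT (fun x : R => (expR ((1 - r ^+ 2) / (2 * v) * x ^+ 2))%:E).
  apply/measurable_EFinP; apply: (measurableT_comp (@measurable_expR R)).
  by apply: measurable_funM => //; exact: measurable_funX.
rewrite integral_gauss //.
have v'0 : 0 < v / r ^+ 2 by rewrite divr_gt0 // exprn_gt0.
transitivity (\int[mu]_x ((r^-1)%:E * (gauss_pdf (v / r ^+ 2) (x - 0))%:E))%E.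
  apply: eq_integral => x _; rewrite subr0 -!EFinM; congr EFin.
  rewrite /gauss_pdf mulrCA -expRD [RHS]mulrA; congr (_ * expR _).
    rewrite -invfM; congr (_^-1); rewrite -{1}(ger0_norm (ltW r0)) -sqrtr_sqr.
    by rewrite -sqrtrM ?sqr_ge0 //; congr Num.sqrt; field; rewrite gt_eqF.
  by field; rewrite !gt_eqF.
rewrite ge0_integralZl_EFin ?integral_gauss_pdf ?mule1 ?invr_ge0 ?ltW //.
- by move=> x _; rewrite lee_fin gauss_pdf_ge0.
- apply/measurable_EFinP; apply: (measurableT_comp (measurable_gauss_pdf _)); exact: measurable_funB.
Qed.

Lemma gauss_sqr_le (v r : R) : 0 < v -> 0 < r ->
  ((1 + (1 - r ^+ 2) / (2 * v) * fine (\int[gauss v]_x (x ^+ 2)%:E)) <= r^-1 )%R /\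
  (\int[gauss v]_x (x ^+ 2)%:E)%E \is a fin_num.
Proof.
move=> v0 r0.
have ms := measurable_sqr.
have me (s : R) : measurable_fun setT (fun x : R => (expR (s * x ^+ 2))%:E).
  apply/measurable_EFinP; apply: (measurableT_comp (@measurable_expR R)).
  by apply: measurable_funM => //; exact: measurable_funX.
have fin : (\int[gauss v]_x (x ^+ 2)%:E)%E \is a fin_num.
  rewrite ge0_fin_numE; last by apply: integral_ge0 => x _; rewrite lee_fin sqr_ge0.
  pose s : R := (1 - 2^-1 ^+ 2) / (2 * v).
  have s0 : 0 < s by rewrite divr_gt0 // ?mulr_gt0 //; lra.
  apply: (@le_lt_trans _ _ (\int[gauss v]_x ((s^-1)%:E * (expR (s * x ^+ 2))%:E))%E).
    apply: ge0_le_integral => //.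
    - by move=> x _; rewrite lee_fin sqr_ge0.
    - by apply: emeasurable_funM => //; exact: me.
    - move=> x _; rewrite -EFinM lee_fin mulrC ler_pdivlMr // mulrC.
      by have := expR_ge1Dx (s * x ^+ 2); lra.
  rewrite ge0_integralZl_EFin //; last by rewrite invr_ge0 ltW.
    by rewrite gauss_exp_sqr // -EFinM ltry.
  exact: me.
split => //; set s := (1 - r ^+ 2) / (2 * v).
have i2 : (gauss v).-integrable setT (fun x : R => (x ^+ 2)%:E).
  apply/integrableP; split => //.
  under eq_integral do rewrite gee0_abs ?lee_fin ?sqr_ge0 //.
  by rewrite ltey_eq fin.
have i1 : (gauss v).-integrable setT (fun x : R => (1 : R)%:E).
  exact: finite_measure_integrable_cst.
have ie : (gauss v).-integrable setT (fun x : R => (expR (s * x ^+ 2))%:E).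
  apply/integrableP; split; first exact: me.
  under eq_integral do rewrite gee0_abs ?lee_fin ?expR_ge0 //.
  by rewrite gauss_exp_sqr // ltry.
have isz : (gauss v).-integrable setT (fun x : R => s%:E * (x ^+ 2)%:E)%E by exact: integrableZl.
rewrite -lee_fin -(gauss_exp_sqr v0 r0) -/s EFinD EFinM fineK //.
rewrite -(integralZl measurableT i2).
have -> : 1%:E = (\int[gauss v]_x (1 : R)%:E)%E.
  by rewrite integral_cst //= probability_setT mule1.
rewrite -(integralD measurableT i1 isz).
apply: le_integral => //; first exact: integrableD.
by move=> x _; rewrite -EFinM -EFinD lee_fin; exact: expR_ge1Dx.
Qed.

Lemma gauss_sqr (v : R) : 0 <= v -> (\int[gauss v]_x (x ^+ 2)%:E = v%:E)%E.
Proof.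
rewrite le_eqVlt => /orP[/eqP <-|v0].
  rewrite integral_gauss0 ?expr0n //; first exact: measurable_sqr.
  by move=> x; rewrite lee_fin sqr_ge0.
have [_ fin] := gauss_sqr_le v0 ltr01.
rewrite -(fineK fin); congr EFin; set M := fine _.
have M0 : 0 <= M by rewrite fine_ge0 // integral_ge0 // => x _; rewrite lee_fin sqr_ge0.
have key (r : R) : 0 < r -> (1 - r ^+ 2) * M <= 2 * v * (r^-1 - 1).
  move=> r0; have [h _] := gauss_sqr_le v0 r0; move: h; rewrite -/M => h.
  have -> : (1 - r ^+ 2) * M = 2 * v * ((1 - r ^+ 2) / (2 * v) * M) by field; rewrite gt_eqF.
  by rewrite ler_pM2l ?mulr_gt0 //; lra.
apply/eqP; rewrite eq_le; apply/andP; split; rewrite leNgt; apply/negP => h.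
  (* At [r = 1 - e], [key] reads [2 M - 3 e M + e ^ 2 M <= 2 v]; with [3 e M = M - v] this
     contradicts [v < M]. *)
  pose e : R := (M - v) / (3 * M).
  have Mp : 0 < M by lra.
  have e0 : 0 < e by rewrite divr_gt0 ?mulr_gt0 //; lra.
  have e1 : e <= 3^-1 by rewrite ler_pdivrMr ?mulr_gt0 //; lra.
  have eM : e * M = (M - v) / 3 by rewrite /e; field; rewrite gt_eqF.
  have re : 0 < 1 - e by lra.
  have := key (1 - e) re.
  have -> : 2 * v * ((1 - e)^-1 - 1) = 2 * v * e / (1 - e) by field; rewrite gt_eqF.
  rewrite ler_pdivlMr //.
  have -> : (1 - (1 - e) ^+ 2) * M * (1 - e) = e * ((2 - e) * (1 - e) * M) by ring.
  rewrite [leRHS]mulrC ler_pM2l //.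
  have -> : (2 - e) * (1 - e) * M = 2 * M - 3 * (e * M) + e ^+ 2 * M by ring.
  have := mulr_ge0 (sqr_ge0 e) M0.
  by rewrite eM; lra.
(* At [r = 1 + e], [key] gives [2 v <= (2 + e) (1 + e) M <= 2 M + 4 e v], and [4 e v = v - M]
   contradicts [M < v]. *)
pose e : R := (v - M) / (4 * v).
have e0 : 0 < e by rewrite divr_gt0 ?mulr_gt0 //; lra.
have e1 : e <= 1 by rewrite ler_pdivrMr ?mulr_gt0 //; lra.
have ev : e * v = (v - M) / 4 by rewrite /e; field; rewrite gt_eqF.
have re : 0 < 1 + e by lra.
have := key (1 + e) re.
have -> : 2 * v * ((1 + e)^-1 - 1) = (- (2 * v * e)) / (1 + e) by field; rewrite gt_eqF.
rewrite ler_pdivlMr //.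
have -> : (1 - (1 + e) ^+ 2) * M * (1 + e) = - (e * ((2 + e) * (1 + e) * M)) by ring.
rewrite lerN2 [leLHS]mulrC ler_pM2l //.
have e2 : e ^+ 2 <= e by rewrite expr2 ler_piMl // ltW.
have : (2 + e) * (1 + e) * M <= (2 + 4 * e) * M.
  rewrite ler_wpM2r //.
  have -> : (2 + e) * (1 + e) = 2 + 3 * e + e ^+ 2 by ring.
  lra.
have : e * M <= e * v by rewrite ler_pM2l // ltW.
have -> : (2 + 4 * e) * M = 2 * M + 4 * (e * M) by ring.
by rewrite ev; lra.
Qed.

End SecondMoment.

(** * A Gaussian field as a Gaussian space *)

Section GaussianField.
Context (R : realType) d (T : measurableType d) (P : probability T R).

Lemma gaussian_law_shift (X : T -> R) : measurable_fun setT X -> gaussian_law P X ->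
  exists m v : R, 0 <= v /\
   forall h : R -> \bar R, measurable_fun setT h -> (forall x, (0 <= h x)%E) ->
     (\int[P]_t h (X t - m)%R = \int[gauss v]_x h x)%E.
Proof.
move=> mX [m [s hs]]; exists m, (s ^+ 2); split; first exact: sqr_ge0.
move=> h mh h0.
have mhm : measurable_fun setT (fun x : R => h (x - m)).
  by apply: (measurableT_comp mh); exact: measurable_funB.
have mX1 : measurable_fun setT (X : T -> measurableTypeR R) by exact: mX.
pose RX : {mfun T >-> measurableTypeR R} := HB.pack (X : T -> measurableTypeR R) (isMeasurableFun.Build _ _ _ _ _ mX1).
have h1 := @ge0_integral_distribution _ _ T (measurableTypeR R) R P RX (fun x : R => h (x - m)) mhm (fun x => h0 _).
rewrite -[LHS]h1.
pose nu : probability (measurableTypeR R) R :=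
  if s == 0 then (@dirac _ (measurableTypeR R) m R : probability (measurableTypeR R) R)
  else normal_prob m s.
transitivity (\int[nu]_x h (x - m)%R)%E.
  apply: eq_measure_integral => A mA _.
  by rewrite /= /distribution /pushforward hs // /nu; case: ifP.
have [s0|s0] := eqVneq s 0.
  rewrite /nu s0 eqxx expr0n /= integral_gauss0 //.
  by rewrite integral_dirac // diracT mul1e subrr.
have v0 : 0 < s ^+ 2 by rewrite exprn_even_gt0.
rewrite /nu (negPf s0).
rewrite (@ge0_integral_density _ (measurableTypeR R) R lebesgue_measure (normal_prob m s)
  (fun x => (normal_pdf m s x)%:E)) //; last 2 first.
- by apply/measurable_EFinP; exact: measurable_normal_pdf.
- by move=> x; rewrite lee_fin normal_pdf_ge0.
rewrite integral_gauss // -[RHS](integral_shift (- m)).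
- apply: eq_integral => x _; congr (_ * _%:E)%E.
  (* The parameter [s] may be negative; the density depends on its absolute value only. *)
  have -> : normal_pdf m s = normal_pdf m `|s|.
    apply/funext => y; rewrite !normal_pdfE ?normr_eq0 //.
    by rewrite /normal_peak /normal_fun real_normK ?num_real.
  by rewrite -sqrtr_sqr pgE.
- by apply: emeasurable_funM => //; apply/measurable_EFinP; exact: measurable_gauss_pdf.
- by move=> x; rewrite mule_ge0 // lee_fin gauss_pdf_ge0.
Qed.

Variables (I : finType) (K : I -> I -> \bar R) (X : I -> {RV P >-> R}).
Hypothesis GX : centered_gaussian_field K X.
Implicit Types (a : I -> R).

Definition lincomb a (t : T) : R := \sum_i a i * X i t.

Lemma measurable_lincomb a : measurable_fun setT (lincomb a).
Proof. by apply: measurable_sum => i; exact: measurable_funM. Qed.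

Lemma lincomb1 i t : lincomb (fun j => (j == i)%:R) t = X i t.
Proof.
rewrite /lincomb (bigD1 i) //= eqxx mul1r big1 ?addr0 // => j /negPf ->.
by rewrite mul0r.
Qed.

Lemma lincomb_integrable a : P.-integrable setT (EFin \o lincomb a).
Proof.
have [gl _ _] := GX.
have [m [v [v0 law]]] := gaussian_law_shift (measurable_lincomb a) (gl a).
have mY : measurable_fun setT (fun t => lincomb a t - m).
  by apply: measurable_funB => //; exact: measurable_lincomb.
have iY := gauss_law_integrable v0 mY law.
have im : P.-integrable setT (fun t : T => m%:E) by exact: finite_measure_integrable_cst.
apply: eq_integrable (integrableD measurableT iY im) => // t _ /=.
by rewrite -EFinD subrK.
Qed.

Lemma field_integrable i : P.-integrable setT (fun t => (X i t)%:E).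
Proof.
by apply: eq_integrable (lincomb_integrable (fun j => (j == i)%:R)) => // t _ /=; rewrite lincomb1.
Qed.

Lemma lincomb_mean a : (\int[P]_t (lincomb a t)%:E = 0)%E.
Proof.
have [_ E0 _] := GX.
have i1 i : P.-integrable setT (fun t => (a i)%:E * (X i t)%:E)%E.
  by apply: integrableZl => //; exact: field_integrable.
transitivity (\int[P]_t \sum_(i : I) ((a i)%:E * (X i t)%:E))%E.
  by apply: eq_integral => t _; rewrite /lincomb -sumEFin.
rewrite integral_sum // big1 // => i _.
rewrite integralZl //; last exact: field_integrable.
by have := E0 i; rewrite unlock => ->; rewrite mule0.
Qed.

Lemma lincomb_law a : exists v : R, 0 <= v /\
   forall h : R -> \bar R, measurable_fun setT h -> (forall x, (0 <= h x)%E) ->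
     (\int[P]_t h (lincomb a t) = \int[gauss v]_x h x)%E.
Proof.
have [gl _ _] := GX.
have [m [v [v0 law]]] := gaussian_law_shift (measurable_lincomb a) (gl a).
have mY : measurable_fun setT (fun t => lincomb a t - m).
  by apply: measurable_funB => //; exact: measurable_lincomb.
have iY := gauss_law_integrable v0 mY law.
have im : P.-integrable setT (fun t : T => m%:E) by exact: finite_measure_integrable_cst.
have m0 : m = 0.
  have : (\int[P]_t (lincomb a t)%:E = \int[P]_t ((lincomb a t - m)%:E + m%:E))%E.
    by apply: eq_integral => t _; rewrite -EFinD subrK.
  rewrite lincomb_mean (integralD measurableT iY im) (gauss_law_mean0 v0 mY law) add0e.
  by rewrite integral_cst //= probability_setT mule1 => -[].
exists v; split => // h mh h0; rewrite -law //.
by apply: eq_integral => t _; rewrite m0 subr0.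
Qed.

Lemma lincomb_sqr_integrable a : P.-integrable setT (fun t => (lincomb a t ^+ 2)%:E).
Proof.
have [v [v0 law]] := lincomb_law a.
apply/integrableP; split.
  by apply/measurable_EFinP; apply: measurable_funX; exact: measurable_lincomb.
under eq_integral do rewrite gee0_abs ?lee_fin ?sqr_ge0 //.
rewrite (law (fun x : R => (x ^+ 2)%:E)) ?gauss_sqr ?ltry //; first exact: measurable_sqr.
by move=> x; rewrite lee_fin sqr_ge0.
Qed.

Lemma field_sqr_integrable i : P.-integrable setT (fun t => (X i t ^+ 2)%:E).
Proof.
by apply: eq_integrable (lincomb_sqr_integrable (fun j => (j == i)%:R)) => // t _ /=; rewrite lincomb1.
Qed.

Lemma field_prod_integrable i j : P.-integrable setT (fun t => (X i t * X j t)%:E).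
Proof.
apply: le_integrable (integrableD measurableT (field_sqr_integrable i) (field_sqr_integrable j)) => //.
  by apply/measurable_EFinP; exact: measurable_funM.
move=> t _; rewrite /= lee_fin [leRHS]ger0_norm ?addr_ge0 ?sqr_ge0 // ler_norml.
have := sqr_ge0 (X i t + X j t); have := sqr_ge0 (X i t - X j t).
have := sqr_ge0 (X i t); have := sqr_ge0 (X j t).
by move: (X i t) (X j t) => x y h1 h2 h3 h4; apply/andP; split; nra.
Qed.

Lemma field_cov i j : (\int[P]_t (X i t * X j t)%:E = K i j)%E.
Proof.
have [_ E0 cov] := GX; rewrite -cov unlock !E0 /= unlock.
by apply: eq_integral => t _; congr EFin; rewrite -[LHS]/(X i t * X j t) -{1}[X i t]subr0 -{1}[X j t]subr0.
Qed.

Lemma field_cov_fin i j : K i j \is a fin_num.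
Proof. by rewrite -field_cov; apply: integrable_fin_num => //; exact: field_prod_integrable. Qed.

Lemma field_covC i j : K i j = K j i.
Proof. by rewrite -!field_cov; apply: eq_integral => t _; rewrite mulrC. Qed.

(** The hypothesis [gaussian_law] leaves the variance unspecified; it is read off from the second
    moment, which is the quadratic form of the covariances on one side and [v] by [gauss_sqr] on the
    other. *)
Lemma lincomb_law_cov a (h : R -> \bar R) : measurable_fun setT h -> (forall x, (0 <= h x)%E) ->
  (\int[P]_t h (lincomb a t) =
   \int[gauss (\sum_i \sum_j a i * fine (K i j) * a j)]_x h x)%E /\
  0 <= \sum_i \sum_j a i * fine (K i j) * a j.
Proof.
move=> mh h0; have [v [v0 law]] := lincomb_law a.
suff -> : \sum_i \sum_j a i * fine (K i j) * a j = v by split => //; exact: law.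
apply: EFin_inj; rewrite -(gauss_sqr v0) -(law (fun x : R => (x ^+ 2)%:E)); last 2 first.
- exact: measurable_sqr.
- by move=> x; rewrite lee_fin sqr_ge0.
have i1 i j : P.-integrable setT (fun t => (a i * a j)%:E * (X i t * X j t)%:E)%E.
  by apply: integrableZl => //; exact: field_prod_integrable.
transitivity (\int[P]_t \sum_i \sum_j ((a i * a j)%:E * (X i t * X j t)%:E))%E; last first.
  apply: eq_integral => t _; rewrite expr2 [X in (X * _)%R]/lincomb mulr_suml -sumEFin.
  apply: eq_bigr => i _; rewrite /lincomb mulr_sumr -sumEFin.
  by apply: eq_bigr => j _; rewrite -EFinM mulrACA.
rewrite integral_sum //; last by move=> i; exact: integrable_sum.
rewrite -sumEFin; apply: eq_bigr => i _.
rewrite integral_sum // -sumEFin; apply: eq_bigr => j _.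
rewrite integralZl //; last exact: field_prod_integrable.
by rewrite field_cov -{2}(fineK (field_cov_fin i j)) -EFinM mulrAC.
Qed.

Variable site : I -> int * int.
Definition field_L (f : lattice_fun R) (t : T) : R := lincomb (fun i => f (site i)) t.
Definition field_c (f g : lattice_fun R) : R := \sum_i \sum_j f (site i) * fine (K i j) * g (site j).

Lemma field_gaussian_space : gaussian_space P field_L field_c.
Proof.
split.
- by move=> f; exact: measurable_lincomb.
- move=> a f g t; rewrite /field_L /lincomb mulr_sumr -big_split /=.
  by apply: eq_bigr => i _; rewrite mulrA -mulrDl.
- split=> [a f g h|f g]; rewrite /field_c.
    rewrite mulr_sumr -big_split /=; apply: eq_bigr => i _.
    rewrite mulr_sumr -big_split /=; apply: eq_bigr => j _.
    by rewrite !mulrA -!mulrDl.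
  rewrite exchange_big /=; apply: eq_bigr => i _; apply: eq_bigr => j _.
  by rewrite (field_covC j i) mulrAC [RHS]mulrAC (mulrC (f _)).
- move=> f; have [] := @lincomb_law_cov (fun i => f (site i)) (fun=> 0%E) => //.
- by move=> f h mh h0; have [] := @lincomb_law_cov (fun i => f (site i)) h mh h0.
Qed.

End GaussianField.

Definition inside (N : nat) : pred (int * int) :=
  fun z => (0 < z.1 < N%:Z - 1) && (0 < z.2 < N%:Z - 1).

Lemma interior_nbrs N z : box_interior N z ->
  [/\ box N z, z \notin box_boundary N &
   [/\ box N (z.1 + 1, z.2), box N (z.1 - 1, z.2), box N (z.1, z.2 + 1) & box N (z.1, z.2 - 1)]].
Proof.
case: z => x y /= h; have h' := h; rewrite /box_interior /= in h'.
split; [by rewrite /box /=; lia| |by rewrite /box /=; split; lia].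
by apply/negP; rewrite inE => -[].
Qed.

Lemma dvdz_small (u m : int) : - m < u < m -> (m %| u)%Z -> u = 0.
Proof.
move=> hu /dvdzP[q hq]; have [q0|q0] := eqVneq q 0; first by rewrite hq q0 mul0r.
have : (1 <= q) || (q <= -1) by lia.
by case/orP; nia.
Qed.

(** The coordinates of an interior point differ from those of a point of the box by less than [N],
    so a multiple of [N] must be 0. *)
Lemma torus_eq_interior N x y : box_interior N x -> box N y -> torus_eq N x y = (x == y).
Proof.
move=> hx hy; apply/idP/eqP => [|->]; last by rewrite /torus_eq !subrr !dvdz0.
move: hx hy; rewrite /torus_eq /box_interior /box /=.
case: x => x1 x2; case: y => y1 y2 /= hx hy /andP[h1 h2].
have e1 : x1 - y1 = 0 by apply: dvdz_small h1; lia.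
have e2 : x2 - y2 = 0 by apply: dvdz_small h2; lia.
by congr pair; lia.
Qed.

(** * Inverting the Laplacian on the sites of the box *)

Section SiteSums.
Variables (R : realType) (N : nat).
Implicit Types (F k : int * int -> R) (z : int * int).

Lemma site_sum1 F z : box N z -> \sum_(i : 'I_N * 'I_N) (site i == z)%:R * F (site i) = F z.
Proof.
rewrite -(range_site N) => -[i _ <-].
rewrite (bigD1 i) //= eqxx mul1r big1 ?addr0 // => j ji.
by rewrite (inj_eq (@site_inj N)) (negPf ji) mul0r.
Qed.

Lemma lap_kron (a : R) z x : lap a (kron R z) x =
  (x == z)%:R - a * (4^-1 * ((x == (z.1 + 1, z.2))%:R + (x == (z.1 - 1, z.2))%:R
    + (x == (z.1, z.2 + 1))%:R + (x == (z.1, z.2 - 1))%:R)).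
Proof.
rewrite /lap /avg /kron; case: z => p q; case: x => p' q' /=.
have -> : ((p, q) == (p' + 1, q')) = ((p', q') == (p - 1, q)) by rewrite !xpair_eqE; lia.
have -> : ((p, q) == (p' - 1, q')) = ((p', q') == (p + 1, q)) by rewrite !xpair_eqE; lia.
have -> : ((p, q) == (p', q' + 1)) = ((p', q') == (p, q - 1)) by rewrite !xpair_eqE; lia.
have -> : ((p, q) == (p', q' - 1)) = ((p', q') == (p, q + 1)) by rewrite !xpair_eqE; lia.
by rewrite [(p, q) == _]eq_sym; congr (_ - _ * (_ * _)); ring.
Qed.

Lemma site_sum_lap_kron (a : R) k z : box_interior N z ->
  \sum_(i : 'I_N * 'I_N) lap a (kron R z) (site i) * k (site i) = lap a k z.
Proof.
move=> /interior_nbrs[hz _ [h1 h2 h3 h4]].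
under eq_bigr do rewrite lap_kron mulrBl -!mulrA !mulrDl.
rewrite sumrB -!mulr_sumr !big_split /=.
by rewrite (site_sum1 _ hz) (site_sum1 _ h1) (site_sum1 _ h2) (site_sum1 _ h3) (site_sum1 _ h4).
Qed.

Lemma site_sum_lap (a : R) k (D : seq (int * int)) (e : int * int -> R) :
  uniq D -> {subset D <= inside N} -> (forall y, y \notin D -> e y = 0) ->
  \sum_(i : 'I_N * 'I_N) lap a e (site i) * k (site i) = \sum_(z <- D) e z * lap a k z.
Proof.
move=> uD DI e0.
have eE : e = fun y => \sum_(z <- D) e z * kron R z y.
  apply/funext => y; have [yD|yD] := boolP (y \in D).
    rewrite (bigD1_seq y) //= /kron eqxx mulr1 big1 ?addr0 // => z /negPf ->.
    by rewrite mulr0.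
  rewrite e0 // big_seq big1 // => z zD; rewrite /kron.
  by have [zy|] := eqVneq z y; [rewrite -zy zD in yD | rewrite mulr0].
rewrite {1}eE; under eq_bigr do rewrite lap_sum mulr_suml.
rewrite exchange_big /= !big_seq; apply: eq_bigr => z zD.
rewrite -(site_sum_lap_kron a k (DI z zD)) mulr_sumr.
by apply: eq_bigr => i _; rewrite lapZ mulrA.
Qed.

Variables (a : R) (k : int * int -> int * int -> R).
Hypothesis hk : forall x y, box_interior N x -> box N y -> lap a (k^~ y) x = kron R x y.

(** Moved onto the kernel, the Laplacian becomes the Kronecker symbol on [D], and only the values of
    [e] there remain. *)
Lemma inverts_lap_site :
  inverts_lap (fun f g : lattice_fun R => \sum_(i : 'I_N * 'I_N) \sum_(j : 'I_N * 'I_N)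
     f (site i) * k (site i) (site j) * g (site j)) a (inside N).
Proof.
move=> D e f uD DI e0; rewrite exchange_big /=.
have bs (j : 'I_N * 'I_N) : box N (site j) by rewrite -range_site; exists j.
transitivity (\sum_(j : 'I_N * 'I_N) e (site j) * f (site j)).
  apply: eq_bigr => j _; rewrite -mulr_suml (site_sum_lap a (k^~ (site j)) uD DI e0); congr (_ * _).
  rewrite big_seq (eq_bigr (fun z => e z * kron R z (site j))) -?big_seq; last first.
    by move=> z zD; rewrite hk //; exact: DI.
  have [yD|yD] := boolP (site j \in D).
    rewrite (bigD1_seq (site j)) //= /kron eqxx mulr1 big1 ?addr0 // => z /negPf ->.
    by rewrite mulr0.
  rewrite e0 // big_seq big1 // => z zD; rewrite /kron.
  by have [zy|] := eqVneq z (site j); [rewrite -zy zD in yD | rewrite mulr0].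
rewrite -(big_map (@site N) xpredT (fun z => e z * f z)) /=.
rewrite (bigID (mem D)) /= [X in _ + X]big1 ?addr0; last by move=> z /e0 ->; rewrite mul0r.
rewrite -big_filter; apply: perm_big; apply: uniq_perm => //.
  by rewrite filter_uniq // map_inj_uniq ?index_enum_uniq //; exact: site_inj.
move=> z; rewrite mem_filter; have [zD|//] := boolP (z \in D) => /=.
have [hz _ _] := interior_nbrs (DI z zD).
by move: hz; rewrite -range_site => -[i _ <-]; rewrite map_f ?mem_index_enum.
Qed.

End SiteSums.

Lemma max_over_ge (R : realType) d (T : measurableType d) (L : lattice_fun R -> T -> R) l x t :
  x \in l -> L (site_fun R x) t <= max_over L l t.
Proof.
elim: l => // y l IH; rewrite inE /= le_max => /orP[/eqP ->|/IH ->]; last exact: orbT.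
by rewrite lexx.
Qed.

(** * The bound for any covariance solving the Laplace equation in the interior *)

Section Conclusion.
Variable R : realType.
Variables (dl C : R) (J0 : nat).
Hypotheses (dl0 : 0 < dl) (C0 : 0 <= C) (J03 : (3 <= J0)%N).
Hypothesis HB : forall d (T : measurableType d) (P : probability T R) (L : lattice_fun R -> T -> R)
  (c : lattice_fun R -> lattice_fun R -> R) (a : R) (In : pred (int * int)) (J : nat) (z0 : int * int),
  0 < a -> a <= 1 -> gaussian_space P L c -> inverts_lap c a In -> (J0 <= J)%N ->
  {subset ball2 z0 (2 ^ J.-1) <= In} -> (1 - a) * 4 ^+ J <= 1 ->
  (dl%:E <= P (block_event L a J z0 (block_level C J)))%E.
Variables (n : nat) (a : R).
Hypotheses (n0 : (1 <= n)%N) (a0 : 0 < a) (a1 : a <= 1) (an : (1 - a) * 4 ^+ n <= 1).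
Let N := (2 ^ n)%N.
Variable Gr : int * int -> int * int -> \bar R.
Hypothesis Gr_eq : forall x y : int * int, box_interior N x -> box N y ->
  (Gr x y = (kron R x y)%:E + (a * 4^-1)%:E *
    (Gr (x.1 + 1, x.2)%R y + Gr (x.1 - 1, x.2)%R y
     + Gr (x.1, x.2 + 1)%R y + Gr (x.1, x.2 - 1)%R y))%E.
Context d (T : measurableType d) (P : probability T R) (X : 'I_N * 'I_N -> {RV P >-> R}).
Hypothesis GX : centered_gaussian_field (fun i j => Gr (site i) (site j)) X.

(** The values are covariances of square-integrable variables; this is where the series of visits is
    seen to converge. *)
Lemma Gr_fin x y : box N x -> box N y -> Gr x y \is a fin_num.
Proof.
by rewrite -range_site => -[i _ <-] [j _ <-]; exact: (field_cov_fin GX).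
Qed.

Lemma Gr_lap x y : box_interior N x -> box N y -> lap a (fun z => fine (Gr z y)) x = kron R x y.
Proof.
move=> hx hy; have [nested_box _ [h1 h2 h3 h4]] := interior_nbrs hx.
have := Gr_eq hx hy.
rewrite -(fineK (Gr_fin nested_box hy)) -(fineK (Gr_fin h1 hy)) -(fineK (Gr_fin h2 hy)).
rewrite -(fineK (Gr_fin h3 hy)) -(fineK (Gr_fin h4 hy)) => -[h].
by rewrite /lap /avg h mulrA addrK.
Qed.

Notation L := (field_L X (@site N)).

Lemma L_site i t : L (site_fun R (site i)) t = X i t.
Proof.
rewrite -(lincomb1 X i t) /field_L; congr lincomb; apply/funext => j.
by rewrite /site_fun /kron (inj_eq (@site_inj N)) eq_sym.
Qed.

Lemma expected_max_bound :
  ((c1 R * n%:R - c2 R * ln n%:R - (C + spine_loss dl J0 + c1 R * (J0%:R + 2)))%:E <= 'E_P[field_max X])%E.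
Proof.
have N0 : (0 < N)%N by rewrite expn_gt0.
pose i0 : 'I_N * 'I_N := (Ordinal N0, Ordinal N0).
have G := field_gaussian_space GX (@site N).
have HK : inverts_lap (field_c (fun i j => Gr (site i) (site j)) (@site N)) a (inside N).
  exact: (inverts_lap_site Gr_lap).
have HIn (z : int * int) : (0 < z.1 < (2 ^ n)%N%:Z - 1) && (0 < z.2 < (2 ^ n)%N%:Z - 1) -> inside N z by [].
have maxE : field_max X = max_over L (map (@site N) (enum [set: 'I_N * 'I_N]%SET)).
  apply/funext => t; have [i -> hi] := field_max_attained X i0 t.
  apply/eqP; rewrite eq_le; apply/andP; split.
    rewrite -L_site; apply: max_over_ge; apply: map_f; by rewrite mem_enum inE.
  apply: max_over_le => x; rewrite inE => /orP[/eqP ->|/mapP[j _ ->]]; last by rewrite L_site.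
  by rewrite -[(0, 0)]/(site i0) L_site.
rewrite unlock; apply: (spine_bound dl0 C0 J03 a0 a1 G HK HIn an) => //.
- by move=> J z0 hJ hs haJ; exact: (HB a0 a1 G HK hJ hs haJ).
- by rewrite maxE; exact: (max_over_integrable G).
- move=> x hx t; have : box N x by move: hx; rewrite /box /=; lia.
  rewrite -range_site => -[i _ <-]; rewrite L_site.
  by have [j -> hj] := field_max_attained X i0 t.
Qed.

End Conclusion.

Theorem proposition5p1 (R : realType) :
  exists C : R,
  forall (n : nat), (1 <= n)%N ->
  forall (d : measure_display) (W : measurableType d)
    (Pw : int * int -> probability W R) (w : nat -> W -> int * int),
  (forall x : int * int, is_srw (Pw x) w x) ->
  forall (d' : measure_display) (T : measurableType d') (P : probability T R),
  (forall X : 'I_(2 ^ n) * 'I_(2 ^ n) -> {RV P >-> R},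
     is_gff Pw w X ->
     ((c1 R * n%:R - c2 R * ln n%:R - C)%:E <= 'E_P[field_max X])%E)
  /\
  (forall (t : {mfun W >-> R}) (Y : 'I_(2 ^ n) * 'I_(2 ^ n) -> {RV P >-> R}),
     (forall x : int * int, is_exp_clock (Pw x) w (2 ^ n) t) ->
     is_tgff Pw w t Y ->
     ((c1 R * n%:R - c2 R * ln n%:R - C)%:E <= 'E_P[field_max Y])%E).
Proof.
have [dl [C [J0 [dl0 C0 J03 HB]]]] := block_max R.
exists (C + spine_loss dl J0 + c1 R * (J0%:R + 2)) => n n1 d W Pw w srw d' T P; split=> [X|t Y clock] GX.
  (* The walk is not killed inside the box, so [a = 1] and [(1 - a) * 4 ^ n] is 0. *)
  apply: (@expected_max_bound _ _ _ _ dl0 C0 J03 HB n 1 _ _ _ _ (green Pw w (2 ^ n))) => //; rewrite ?subrr ?mul0r //.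
  - move=> x y /interior_nbrs[_ hx _] _; exact: green_eq.
have N0 : (0 < 2 ^ n)%N by rewrite expn_gt0.
apply: (@expected_max_bound _ _ _ _ dl0 C0 J03 HB n (survival R (2 ^ n)) _ _ _ _ (torus_green Pw w t (2 ^ n))) => //.
- exact: expR_gt0.
- by rewrite /survival -[leRHS]expR0 ler_expR oppr_le0 invr_ge0.
(* The killing rate satisfies [(1 - a) * N ^ 2 <= 1], and [N ^ 2 = 4 ^ n] for [N = 2 ^ n]. *)
- by have := @survival_le R _ N0; rewrite -expnM mulnC expnM natrX.
- move=> x y hx hy; rewrite (torus_green_eq srw N0 clock); congr (_%:E + _)%E.
  by rewrite /kron torus_eq_interior.
Qed.
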